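(* Let $\widetilde M$ be a complete, simply connected visibility Riemannian manifold with no conjugate points, and let $\Gamma$ be a non-elementary discrete subgroup of $\mathrm{Iso}(\widetilde M)$. Let $\{\mu_q\}_{q\in\widetilde M}$ be the Patterson--Sullivan measure and let $p\in\widetilde M$ be arbitrary. Then there is $R_0=R_0(p)>0$ such that for every $r\ge R_0$ there is $C=C(r)>1$ with $$\frac1C\le\frac{\mu_p(\mathrm{pr}_p(B(\alpha p,r)))}{e^{-\delta_\Gamma d(p,\alpha p)}}\le C\qquad\text{for all }\alpha\in\Gamma.$$
   Context: All geodesics have unit speed; $d$ is the Riemannian distance; $B(q,r)$ is the open ball. No conjugate points: no geodesic carries a non-trivial Jacobi field vanishing at two distinct parameters. For $p\in\widetilde M$, $\measuredangle_p(x,y)$ is the angle at $p$ between the geodesics from $p$ to $x$ and to $y$. $\widetilde M$ satisfies the visibility axiom (is a visibility manifold) if for all $p\in\widetilde M$, $\epsilon>0$ there is $R=R(p,\epsilon)>0$ such that every geodesic (segment) $c:[a,b]\to\widetilde M$ ($a,b$ possibly infinite) with $d(p,c)\ge R$ satisfies $\measuredangle_p(c(a),c(b))\le\epsilon$. Geodesics $c_1,c_2$ are positively asymptotic if $d(c_1(t),c_2(t))$ is bounded for $t\ge0$; the ideal boundary $\widetilde M(\infty)$ is the set of asymptote classes and $c(+\infty)$ is the class of $c$. For $p\in\widetilde M$ and $x\in\widetilde M\cup\widetilde M(\infty)$, $x\ne p$, $c_{p,x}$ is the unique geodesic with $c_{p,x}(0)=p$ going to $x$ (with $c_{p,x}(+\infty)=x$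 if $x\in\widetilde M(\infty)$). The cone topology on $\widetilde M\cup\widetilde M(\infty)$ is generated by the open sets of $\widetilde M$ and the truncated cones $\{x:\measuredangle(c_{p,x}'(0),v)<\epsilon,\ d(p,x)>r\}$, $v\in T^1_p\widetilde M$. Isometries act on $\widetilde M(\infty)$ by $\alpha(c(+\infty))=(\alpha\circ c)(+\infty)$. The shadow of $B(q,r)$ from $p$ is $\mathrm{pr}_p(B(q,r))=\{c_{p,z}(+\infty): z\in B(q,r),\ z\neq p\}\subset\widetilde M(\infty)$. $L(\Gamma)=\overline{\Gamma(p)}\cap\widetilde M(\infty)$ (independent of $p$); $\Gamma$ is non-elementary if $\#L(\Gamma)=\infty$. Busemann function: $\beta_\xi(p,x)=\lim_{t\to\infty}(d(p,c_{x,\xi}(t))-t)$. Patterson--Sullivan measure. $P(s,p,q)=\sum_{\alpha\in\Gamma}e^{-s\,d(p,\alpha q)}$, $\delta_\Gamma=\inf\{s\ge0:P(s,p,q)<\infty\}$ (independent of $p,q$; understood finite). An $r$-dimensional conformal density is a family of finite Borel measures $\{\mu_p\}_{p\in\widetilde M}$ on $\widetilde M(\infty)$ with $\mathrm{supp}\,\mu_p\subset L(\Gamma)$, $\frac{d\mu_p}{d\mu_q}(\xi)=e^{-r\beta_\xi(p,q)}$ almost everywhere, and $\mu_{\alpha p}(\alpha A)=\mu_p(A)$ for all Borel $A$, $\alpha\in\Gamma$. Let $h:\mathbb R^+\to\mathbb R^+$ be Patterson's non-decreasing function (for every $\epsilon>0$ there is $r_0$ with $h(r+t)\le e^{\epsilon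 t}h(r)$ for $r\ge r_0$, $t\ge0$) such that $\widetilde P(s,p,q)=\sum_\alpha h(d(p,\alpha q))e^{-s\,d(p,\alpha q)}$ has critical exponent $\delta_\Gamma$ and diverges at $\delta_\Gamma$ ($h\equiv1$ if $P$ already diverges at $\delta_\Gamma$). Fix $q$; a Patterson--Sullivan measure is a $\delta_\Gamma$-dimensional conformal density $\{\mu_p\}$ obtained as weak-$*$ limits (on the compact space $\widetilde M\cup\widetilde M(\infty)$) $\mu_p=\lim_n\mu_{p,q,s_n}$ for a sequence $s_n\downarrow\delta_\Gamma$, where $\mu_{p,q,s}=\widetilde P(s,q,q)^{-1}\sum_\alpha h(d(p,\alpha q))e^{-s\,d(p,\alpha q)}\delta_{\alpha q}$ ($\delta_{\alpha q}$ the Dirac mass). *)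

(* Defs.v *)
From HB Require Import structures.
From mathcomp Require Import all_boot all_order all_algebra.
From mathcomp Require Import all_classical all_reals all_analysis.

Set Implicit Arguments.
Unset Strict Implicit.
Unset Printing Implicit Defensive.

Import Order.TTheory GRing.Theory Num.Theory.
Import numFieldNormedType.Exports.

Local Open Scope classical_set_scope.
Local Open Scope ring_scope.

Section euclidean.
Context {R : realType} {n : nat}.

Definition partial (a : 'I_n) (f : 'rV[R]_n -> R) : 'rV[R]_n -> R :=
  fun x => 'D_(delta_mx 0 a : 'rV[R]_n) f x.

(* C^oo on the open set U: every iterated partial derivative, of every order,
   is (Frechet) differentiable on U. *)
Definition smooth_on (U : set 'rV[R]_n) (f : 'rV[R]_n -> R) : Prop :=
  forall (s : seq 'I_n) x, U x -> differentiable (foldr partial f s) x.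

End euclidean.

(* A (second countable, Hausdorff) smooth n-manifold given by a smooth atlas
   (chart i, with domain chart_dom i and inverse chart_inv i), together with a
   smooth Riemannian metric given in each chart by its Gram matrix.  Vectors are
   rows: the differential of f at x sends v to v *m 'J f x. *)
Record riemannian_manifold (R : realType) (n : nat) := RiemannianManifold {
  carrier :> ptopologicalType;
  chart_index : Type;
  chart_dom : chart_index -> set carrier;
  chart : chart_index -> carrier -> 'rV[R]_n;
  chart_inv : chart_index -> 'rV[R]_n -> carrier;
  chart_at : carrier -> chart_index;
  gram : chart_index -> 'rV[R]_n -> 'M[R]_n;
  manifold_hausdorff : hausdorff_space carrier;
  manifold_second_countable : @second_countable carrier;
  chart_dom_open : forall i, open (chart_dom i);
  chart_image_open : forall i, open (chart i @` chart_dom i);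
  chart_invK : forall i p, chart_dom i p -> chart_inv i (chart i p) = p;
  chart_continuous : forall i p, chart_dom i p -> {for p, continuous (chart i)};
  chart_inv_continuous : forall i x,
    (chart i @` chart_dom i) x -> {for x, continuous (chart_inv i)};
  chart_atP : forall p, chart_dom (chart_at p) p;
  transition_smooth : forall i j k,
    smooth_on (chart i @` (chart_dom i `&` chart_dom j))
              (fun x => chart j (chart_inv i x) 0 k);
  gram_sym : forall i x, (chart i @` chart_dom i) x -> (gram i x)^T = gram i x;
  gram_pos : forall i x, (chart i @` chart_dom i) x ->
    forall v : 'rV[R]_n, v != 0 -> 0 < (v *m gram i x *m v^T) 0 0;
  gram_smooth : forall i a b,
    smooth_on (chart i @` chart_dom i) (fun x => gram i x a b);
  gram_transition : forall i j x,
    (chart i @` (chart_dom i `&` chart_dom j)) x ->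
    let J := 'J (chart j \o chart_inv i) x in
    gram i x = J *m gram j (chart j (chart_inv i x)) *m J^T
}.

Section riemannian.
Context {R : realType} {n : nat} (M : riemannian_manifold R n).
Implicit Types (p q x y : M) (c : R -> M) (i j : chart_index M).

(* T_p M is identified with 'rV_n through the chart [chart_at p]. *)
Definition inner p (u v : 'rV[R]_n) : R :=
  (u *m gram (chart_at p) (chart (chart_at p) p) *m v^T) 0 0.

Definition tnorm p (v : 'rV[R]_n) : R := Num.sqrt (inner p v v).

Definition tangle p (u v : 'rV[R]_n) : R :=
  acos (inner p u v / (tnorm p u * tnorm p v)).

Definition coord i c (k : 'I_n) : R -> R := fun t => chart i (c t) 0 k.

Definition velocity_in i c (t : R) : 'rV[R]_n := \row_k derive1 (coord i c k) t.

Definition velocity c (t : R) : 'rV[R]_n := velocity_in (chart_at (c t)) c t.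

Definition speed c (t : R) : R := tnorm (c t) (velocity c t).

(* C^1 on a neighbourhood of each point of [a, b]; a C^1 curve on the closed
   interval always extends in this way. *)
Definition C1_on (a b : R) c : Prop :=
  forall t, a <= t <= b -> {for t, continuous c} /\
    forall i, chart_dom i (c t) -> forall k,
      (\forall s \near t, derivable (coord i c k) s 1) /\
      {for t, continuous (derive1 (coord i c k))}.

(* [piecewise_C1 x y l]: a piecewise C^1 curve of length l goes from x to y. *)
Inductive piecewise_C1 : M -> M -> R -> Prop :=
| Pw_nil x : piecewise_C1 x x 0
| Pw_cons c (a b : R) y l : a <= b -> C1_on a b c -> piecewise_C1 (c b) y l ->
    piecewise_C1 (c a) y
      (Rintegral (@lebesgue_measure R) `[a, b] (speed c) + l).

Definition rdist x y : R := inf [set l | piecewise_C1 x y l].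

Definition rball x (r : R) : set M := [set y | rdist x y < r].

Definition rcomplete : Prop :=
  forall u : nat -> M,
    (forall e, 0 < e -> exists N, forall k l,
      (N <= k)%N -> (N <= l)%N -> rdist (u k) (u l) < e) ->
    exists x, rdist (u m) x @[m --> \oo] --> (0 : R).

Definition simply_connected : Prop :=
  (forall x y, exists c : R -> M,
     [/\ {within `[0, 1], continuous c}, c 0 = x & c 1 = y]) /\
  (forall c : R -> M, {within `[0, 1], continuous c} -> c 0 = c 1 ->
     exists H : R * R -> M,
       [/\ {within `[0, 1] `*` `[0, 1], continuous H},
           forall t, 0 <= t <= 1 -> H (0, t) = c t,
           forall t, 0 <= t <= 1 -> H (1, t) = c 0 &
           forall s, 0 <= s <= 1 -> H (s, 0) = c 0 /\ H (s, 1) = c 0]).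

(* Gamma^k_{ab} in the chart i, at coordinates x. *)
Definition christoffel i (k a b : 'I_n) (x : 'rV[R]_n) : R :=
  2^-1 * \sum_l invmx (gram i x) k l *
    (partial a (fun z => gram i z b l) x + partial b (fun z => gram i z a l) x
     - partial l (fun z => gram i z a b) x).

(* The coefficient along the l-th coordinate field of R(d_a, d_b) d_c, where
   R(X, Y) Z = D_X D_Y Z - D_Y D_X Z - D_[X,Y] Z. *)
Definition curvature i (l c a b : 'I_n) (x : 'rV[R]_n) : R :=
  partial a (christoffel i l b c) x - partial b (christoffel i l a c) x
  + \sum_m (christoffel i l a m x * christoffel i m b c x
            - christoffel i l b m x * christoffel i m a c x).

(* Vector fields along c are given by their components in all the charts:
   V i t is meaningful when c t is in the domain of the chart i. *)
Definition field_along c (V : chart_index M -> R -> 'rV[R]_n) : Prop :=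
  forall i j t, chart_dom i (c t) -> chart_dom j (c t) ->
    V j t = V i t *m 'J (chart j \o chart_inv i) (chart i (c t)).

Definition covariant_derivative c (V : chart_index M -> R -> 'rV[R]_n) :
    chart_index M -> R -> 'rV[R]_n :=
  fun i t => \row_k (derive1 (fun s => V i s 0 k) t +
    \sum_a \sum_b christoffel i k a b (chart i (c t)) *
      velocity_in i c t 0 a * V i t 0 b).

Definition derivable_field c (V : chart_index M -> R -> 'rV[R]_n) : Prop :=
  forall i t, chart_dom i (c t) -> forall k, derivable (fun s => V i s 0 k) t 1.

(* Unit speed geodesics, defined on the whole line. *)
Definition geodesic c : Prop :=
  [/\ continuous c,
      forall i t, chart_dom i (c t) -> forall k, derivable (coord i c k) t 1,
      derivable_field c (fun i => velocity_in i c),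
      forall i t, chart_dom i (c t) ->
        covariant_derivative c (fun j => velocity_in j c) i t = 0 &
      forall t, speed c t = 1].

Definition jacobi_field c (V : chart_index M -> R -> 'rV[R]_n) : Prop :=
  [/\ field_along c V, derivable_field c V,
      derivable_field c (covariant_derivative c V) &
      forall i t, chart_dom i (c t) -> forall l,
        covariant_derivative c (covariant_derivative c V) i t 0 l +
        \sum_a \sum_b \sum_d curvature i l d a b (chart i (c t)) *
          V i t 0 a * velocity_in i c t 0 b * velocity_in i c t 0 d = 0].

Definition no_conjugate_points : Prop :=
  forall c V (s t : R), geodesic c -> jacobi_field c V -> s != t ->
    V (chart_at (c s)) s = 0 -> V (chart_at (c t)) t = 0 ->
    forall i u, chart_dom i (c u) -> V i u = 0.

Definition asymptotic c c' : Prop :=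
  exists K, forall t, 0 <= t -> rdist (c t) (c' t) <= K.

(* c(+oo) is the class of c: a point xi at infinity is the set [sval xi] of
   the geodesics c such that c(+oo) = xi. *)
Definition ideal_boundary : Type :=
  {A : set (R -> M) | exists2 c, geodesic c &
     A = [set c' | geodesic c' /\ asymptotic c c']}.

Definition compactification : Type := (M + ideal_boundary)%type.

Definition ideal_points : set compactification := range inr.

Definition goes_to c (x : compactification) : Prop :=
  match x with
  | inl y => exists2 t : R, 0 < t & c t = y
  | inr xi => sval xi c
  end.

(* c_{p,x}; [xget] selects it, its existence and uniqueness being consequences of
   completeness, simple connectedness, no conjugate points and visibility. *)
Definition ray p (x : compactification) : R -> M :=
  xget (fun=> p) [set c | [/\ geodesic c, c 0 = p & goes_to c x]].

Definition direction p (x : compactification) : 'rV[R]_n :=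
  velocity_in (chart_at p) (ray p x) 0.

Definition angle p (x y : compactification) : R :=
  tangle p (direction p x) (direction p y).

Definition truncated_cone p (v : 'rV[R]_n) (e r : R) : set compactification :=
  [set x | tangle p (direction p x) v < e /\
           match x with inl y => r < rdist p y | inr _ => True end].

Definition cone_subbase : set (set compactification) :=
  [set A | (exists2 U : set M, open U & A = inl @` U) \/
    exists p v e r, [/\ inner p v v = 1, 0 < e, 0 < r
                      & A = truncated_cone p v e r]].

HB.instance Definition _ := gen_eqMixin compactification.
HB.instance Definition _ := gen_choiceMixin compactification.
HB.instance Definition _ := isPointed.Build compactification (inl point).
HB.instance Definition _ :=
  isSubBaseTopological.Build compactification cone_subbase id.

Definition borel_compactification := g_sigma_algebraType (@open compactification).

(* [endpoint c a x]: x = c(a), where a may be infinite. *)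
Definition endpoint c (a : \bar R) (x : compactification) : Prop :=
  match a with
  | EFin t => x = inl (c t)
  | +oo%E => exists2 xi : ideal_boundary, x = inr xi & sval xi c
  | -oo%E => exists2 xi : ideal_boundary,
               x = inr xi & sval xi (fun t => c (- t))
  end.

Definition visibility : Prop :=
  forall p (e : R), 0 < e -> exists2 r : R, 0 < r &
    forall c (a b : \bar R) (x y : compactification), geodesic c -> (a < b)%E ->
      (forall t, (a <= t%:E <= b)%E -> r <= rdist p (c t)) ->
      endpoint c a x -> endpoint c b y ->
      angle p x y <= e.

Definition busemann (xi : ideal_boundary) p x : R :=
  lim ((rdist p (ray x (inr xi) t) - t) @[t --> +oo]).

(* pr_p(A) *)
Definition shadow p (A : set M) : set compactification :=
  [set x | exists z (xi : ideal_boundary),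
     [/\ A z, z <> p, sval xi (ray p (inl z)) & x = inr xi]].

Definition riemannian_isometry (f : M -> M) : Prop :=
  [/\ bijective f, continuous f,
      forall i j k,
        smooth_on (chart i @` (chart_dom i `&` f @^-1` chart_dom j))
                  (fun z => chart j (f (chart_inv i z)) 0 k) &
      forall i j (z : 'rV[R]_n),
        (chart i @` (chart_dom i `&` f @^-1` chart_dom j)) z ->
        let J := 'J (chart j \o f \o chart_inv i) z in
        gram i z = J *m gram j (chart j (f (chart_inv i z))) *m J^T].

Definition discrete_isometry_group (Gamma : set (M -> M)) : Prop :=
  [/\ forall f, Gamma f -> riemannian_isometry f,
      Gamma idfun,
      forall f g, Gamma f -> Gamma g -> Gamma (f \o g),
      forall f, Gamma f -> exists2 g, Gamma g & cancel f g /\ cancel g f &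
      forall f, Gamma f ->
        \forall g \near (f : {compact-open, M -> M}), Gamma g -> g = f].

(* The image of a set of the compactification under an isometry of M, with
   alpha(c(+oo)) = (alpha \o c)(+oo) *)
Definition translate (f : M -> M) (A : set compactification) :
    set compactification :=
  [set y | exists2 x, A x &
    match x, y with
    | inl x0, inl y0 => y0 = f x0
    | inr xi, inr eta => exists2 c, sval xi c & sval eta (f \o c)
    | _, _ => False
    end].

Definition limit_set (Gamma : set (M -> M)) p : set compactification :=
  closure [set (inl (f p) : compactification) | f in Gamma] `&` ideal_points.

Definition non_elementary (Gamma : set (M -> M)) p : Prop :=
  infinite_set (limit_set Gamma p).

(* \sum_(alpha in Gamma) h(d(p, alpha q)) e^{-s d(p, alpha q)} *)
Definition weighted_poincare (h : R -> R) (Gamma : set (M -> M)) (s : R) p q :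
    \bar R :=
  (\esum_(f in Gamma) (h (rdist p (f q)) * expR (- s * rdist p (f q)))%:E)%E.

Definition weighted_exponent (h : R -> R) (Gamma : set (M -> M)) p q : \bar R :=
  ereal_inf [set s%:E | s in
    [set s : R | 0 <= s /\ (weighted_poincare h Gamma s p q < +oo)%E]].

Definition poincare : set (M -> M) -> R -> M -> M -> \bar R :=
  weighted_poincare (fun=> 1).

(* delta_Gamma, computed at the points p, q; +oo when no series converges *)
Definition critical_exponent : set (M -> M) -> M -> M -> \bar R :=
  weighted_exponent (fun=> 1).

Definition patterson_function (Gamma : set (M -> M)) q (h : R -> R) : Prop :=
  let delta := critical_exponent Gamma q q in
  [/\ forall t, 0 <= t -> 0 <= h t,
      forall t u, 0 <= t -> t <= u -> h t <= h u,
      forall e, 0 < e -> exists2 r0, 0 <= r0 &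
        forall r t, r0 <= r -> 0 <= t -> h (r + t) <= expR (e * t) * h r,
      forall x y, weighted_exponent h Gamma x y = delta /\
                  weighted_poincare h Gamma (fine delta) x y = +oo%E &
      poincare Gamma (fine delta) q q = +oo%E -> forall t, 0 <= t -> h t = 1].

End riemannian.

Arguments ideal_points {R n} M _.

Section patterson_sullivan.
Context {R : realType} {n : nat} (M : riemannian_manifold R n).
Local Notation X := (borel_compactification M).
Implicit Types (mu : M -> {finite_measure set X -> \bar R}).

Definition measure_support (m : set X -> \bar R) : set (compactification M) :=
  [set x | forall U : set (compactification M), open U -> U x -> (0 < m U)%E].

(* The finite Borel measures on the ideal boundary are regarded as the finite
   Borel measures on the compactification for which M is negligible. *)
Definition conformal_density (Gamma : set (M -> M)) q (r : R) mu : Prop :=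
  [/\ forall p, mu p (~` ideal_points M) = 0%E,
      forall p, measure_support (mu p) `<=` limit_set Gamma q,
      forall p x, mu p `<< mu x /\
        {ae mu x, forall z : X, forall xi : ideal_boundary M, z = inr xi ->
          Radon_Nikodym (charge_of_finite_measure (mu p)) (mu x) z
          = (expR (- r * busemann xi p x))%:E} &
      forall p f (A : set X), Gamma f -> measurable A -> A `<=` ideal_points M ->
        mu (f p) (translate f A) = mu p A].

(* mu_{p,q,s}; as a set function it is a measure as soon as h >= 0 on [0, +oo[. *)
Definition orbit_measure (h : R -> R) (Gamma : set (M -> M)) (s : R) p q
    (A : set X) : \bar R :=
  (((fine (weighted_poincare h Gamma s q q))^-1)%:E *
   \esum_(f in Gamma) ((h (rdist p (f q)) * expR (- s * rdist p (f q)))%:E *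
      dirac (inl (f q) : X) A))%E.

Definition patterson_sullivan (Gamma : set (M -> M)) q (h : R -> R) mu : Prop :=
  let delta := fine (critical_exponent Gamma q q) in
  conformal_density Gamma q delta mu /\
  exists s : nat -> R,
    [/\ nonincreasing_seq s, forall k, delta < s k, s @ \oo --> delta &
        forall p (f : compactification M -> R), continuous f ->
          (\int[orbit_measure h Gamma (s k) p q]_z (f z)%:E)%E @[k --> \oo]
            --> (\int[mu p]_z (f z)%:E)%E].

End patterson_sullivan.

(* Main.v *)
(* Without conjugate points the exponential map at [p] is a local diffeomorphism. By the
   Gauss lemma it lifts curves without shortening them, so it is a covering, hence a
   bijection, and geodesics minimize the distance.

   Put x = alpha^-1 p. By equivariance, mu_p(pr_p B(alpha p, r)) = mu_x(S) with
   S = pr_x B(p, r). On S the densities of mu_x and mu_p differ from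
   e^(- delta d(p, x)) by a factor at most e^(2 delta r), so only a lower bound of mu_p(S)
   uniform in x is missing. By visibility the complement of S is a cap seen from [p] under a
   small angle, so without such a bound mu_p is concentrated at one point xi. Then Gamma
   fixes xi and delta * beta_xi(q, f q) = 0 for f in Gamma. If delta > 0 this fails for f q far
   from q in another limit direction. If delta = 0, two elements of Gamma pushing towards
   two other limit points embed the orbit away from xi disjointly into itself, and the
   Poincare series would be at least twice itself, up to a factor tending to 1 with s. *)
Require Import Defs.
From HB Require Import structures.
From mathcomp Require Import all_boot all_order all_algebra.
From mathcomp Require Import all_classical all_reals all_analysis.
From mathcomp Require Import ring lra.

Set Implicit Arguments.
Unset Strict Implicit.
Unset Printing Implicit Defensive.

Import Order.TTheory GRing.Theory Num.Theory.
Import numFieldNormedType.Exports.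
Local Open Scope classical_set_scope.
Local Open Scope ring_scope.

(** * Epsilon-delta forms of limits and derivatives; row vectors with the maximum norm *)

Section normed.
Context {R : realType}.

(** Derivatives in the initial velocity are taken in the strict sense, with both points varying.
    Strict differentiability with invertible derivative at a single vector already gives injectivity
    and surjectivity nearby, so the inverse branches of the exponential map appear as continuous
    sections and are differentiated along curves alone.

    A ray is selected by choice, with a constant curve as default, so rays to boundary points have
    to be produced. Visibility does it: a missing ray would have direction 0 and make the angle
    [pi / 2] with everything, also far along a geodesic of the class, where angles are small.

    Small angles are handled as chords of unit vectors, which obey a triangle inequality.

    The weak limits enter through the test function 1: it shows that [mu q] has mass at least 1, and
    mutual absolute continuity passes positivity to every [mu p].

    The factor [e^(2 delta r)] has this origin: a ray from [x] that enters the ball of radius [r]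
    about [p] does so at a time at least [d(p, x) - r], which puts [beta_xi(p, x)] within [2 r] of
    [- d(p, x)]. *)

Lemma nearN_P (V : normedModType R) (x : V) (P : set V) :
  nbhs x P <-> exists2 d : R, 0 < d & forall y, `|y - x| < d -> P y.
Proof.
split.
  move=> /nbhs_normP[d /= d0 H]; exists d => // y yx; apply: H.
  by rewrite /= distrC.
move=> [d d0 H]; apply/nbhs_normP; exists d => //= y yx; apply: H.
by rewrite distrC.
Qed.

Lemma contP (V W : normedModType R) (f : V -> W) (x : V) :
  {for x, continuous f} <-> forall e : R, 0 < e -> exists2 d : R, 0 < d &
     forall y, `|y - x| < d -> `|f y - f x| <= e.
Proof.
split.
  move=> /cvgrPdist_le H e e0; have /nearN_P[d d0 K] := H e e0.
  by exists d => // y /K; rewrite distrC.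
move=> H; apply/cvgrPdist_le => e e0; have [d d0 K] := H e e0.
by apply/nearN_P; exists d => // y /K; rewrite distrC.
Qed.

(** With the non-strict bound [e * |s - t|] the point [s = t] need not be excluded, so the punctured
    neighbourhood disappears and a derivative is literally a case of [fd] below. *)
Lemma derP (W : normedModType R) (f : R -> W) (t : R) (d : W) :
  is_derive t (1 : R) f d <-> forall e : R, 0 < e -> exists2 r : R, 0 < r &
     forall s, `|s - t| < r -> `|f s - f t - (s - t) *: d| <= e * `|s - t|.
Proof.
split.
  move=> [ex dv] e e0.
  have /cvgrPdist_le /(_ e e0) : (h^-1 *: ((f \o shift t) (h *: (1 : R)) - f t)
     @[h --> 0^']) --> d by rewrite -dv; exact: ex.
  rewrite /dnbhs /within /= => /nearN_P[r r0 H]; exists r => // s sr.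
  have [->|st] := eqVneq s t; first by rewrite !subrr scale0r subr0 !normr0 mulr0.
  have st0 : s - t != 0 by rewrite subr_eq0.
  have := H (s - t); rewrite subr0 => /(_ sr st0) /=.
  rewrite /shift /= [(s - t) *: 1]mulr1 subrK => H1.
  rewrite -(ler_pM2l (_ : 0 < `|s - t|)) ?normr_gt0// in H1.
  rewrite mulrC; apply: le_trans H1; rewrite -normrZ scalerBr scalerA mulfV//.
  by rewrite scale1r distrC.
move=> H.
suff C : h^-1 *: ((f \o shift t) (h *: (1 : R)) - f t) @[h --> 0^'] --> d.
  split; last by rewrite /derive; exact: (cvg_lim _ C).
  by rewrite /derivable; apply/cvg_ex; exists d.
apply/cvgrPdist_le => e e0; have [r r0 K] := H e e0.
rewrite /dnbhs /within /=; apply/nearN_P; exists r => // h; rewrite subr0 => hr h0.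
rewrite /shift /= [h *: 1]mulr1.
have := K (h + t); rewrite addrK => /(_ hr) H1.
have hp : 0 < `|h| by rewrite normr_gt0.
rewrite -(ler_pM2l hp) mulrC; rewrite [X in X <= _]mulrC -normrZ scalerBr scalerA mulfV//.
by rewrite scale1r distrC mulrC.
Qed.

Lemma der_cont (W : normedModType R) (f : R -> W) (t : R) (d : W) :
  is_derive t (1 : R) f d -> {for t, continuous f}.
Proof.
move=> /derP H; apply/contP => e e0.
have [r r0 K] := H 1 ltr01.
have M0 : 0 < 1 + `|d| by rewrite ltr_pwDl.
exists (Num.min r (e / (1 + `|d|))); first by rewrite lt_min r0 divr_gt0.
move=> s; rewrite lt_min => /andP[sr se].
rewrite -(subrK ((s - t) *: d) (f s - f t)) (le_trans (ler_normD _ _))//.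
rewrite normrZ (le_trans (lerD (K _ sr) (lexx _)))//.
rewrite mulrC -mulrDr.
by rewrite -ler_pdivlMr// ltW.
Qed.

Lemma derE (f : R -> R) (t d : R) : is_derive t (1 : R) f d -> derive1 f t = d.
Proof. by move=> H; rewrite derive1E; exact: derive_val. Qed.

Lemma derivable_der (f : R -> R) (t : R) :
  derivable f t 1 -> is_derive t (1 : R) f (derive1 f t).
Proof. by move=> H; rewrite derive1E; exact: derivableP. Qed.

Lemma der_near (W : normedModType R) (f g : R -> W) t d :
  (\forall s \near t, f s = g s) -> is_derive t (1 : R) f d ->
  is_derive t (1 : R) g d.
Proof.
move=> /nearN_P[r r0 fg] /derP H; apply/derP => e /H[r' r'0 K].
exists (Num.min r r'); first by rewrite lt_min r0.
move=> s; rewrite lt_min => /andP[sr sr'].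
by rewrite -!fg ?subrr ?normr0//; apply: K.
Qed.

Lemma rv_le m (x : 'rV[R]_m) (e : R) : 0 <= e ->
  (forall k, `|x 0 k| <= e) -> `|x| <= e.
Proof.
move=> e0 H; rewrite /Num.norm /= mx_normrE.
by apply: bigmax_le => // -[i j] _ /=; rewrite (ord1 i).
Qed.

Lemma rv_ge m (x : 'rV[R]_m) k : `|x 0 k| <= `|x|.
Proof.
rewrite /Num.norm /= mx_normrE.
by rewrite (bigD1 (ord0, k))//= le_max lexx.
Qed.

Lemma der_rvP m (f : R -> 'rV[R]_m) (t : R) (d : 'rV[R]_m) :
  is_derive t (1 : R) f d <->
  forall k, is_derive t (1 : R) (fun s => f s 0 k) (d 0 k).
Proof.
split=> [/derP H k|H].
  apply/derP => e /H[r r0 K]; exists r => // s sr.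
  apply: le_trans (K s sr); rewrite (le_trans _ (rv_ge _ k))//.
  by rewrite !mxE.
apply/derP => e e0.
have {}H k : exists r : R, 0 < r /\ forall s, `|s - t| < r ->
    `|f s 0 k - f t 0 k - (s - t) * d 0 k| <= e * `|s - t|.
  by have /derP/(_ e e0)[r r0 K] := H k; exists r.
have {H} [r H] := choice H.
exists (\big[Num.min/1]_k r k).
  by apply: lt_bigmin => // k _; case: (H k).
move=> s sr; apply: rv_le => [|k]; first by rewrite mulr_ge0// ltW.
rewrite !mxE; apply: (H k).2; apply: lt_le_trans sr _.
exact: bigmin_le.
Qed.

Lemma cont_rvP (V : normedModType R) m (f : V -> 'rV[R]_m) (t : V) :
  {for t, continuous f} <-> forall k, {for t, continuous (fun s => f s 0 k)}.
Proof.
split=> [/contP H k|H].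
  apply/contP => e /H[r r0 K]; exists r => // s sr.
  apply: le_trans (K s sr); rewrite (le_trans _ (rv_ge _ k))//.
  by rewrite !mxE.
apply/contP => e e0.
have {}H k : exists r : R, 0 < r /\ forall s, `|s - t| < r ->
    `|f s 0 k - f t 0 k| <= e.
  by have /contP/(_ e e0)[r r0 K] := H k; exists r.
have {H} [r H] := choice H.
exists (\big[Num.min/1]_k r k).
  by apply: lt_bigmin => // k _; case: (H k).
move=> s sr; apply: rv_le => [|k]; first by rewrite ltW.
rewrite !mxE; apply: (H k).2; apply: lt_le_trans sr _.
exact: bigmin_le.
Qed.

Definition dot m (u v : 'rV[R]_m) : R := \sum_a u 0 a * v 0 a.

Lemma dotDl m (u v w : 'rV[R]_m) : dot (u + v) w = dot u w + dot v w.
Proof. by rewrite /dot -big_split; apply: eq_bigr => a _; rewrite mxE mulrDl. Qed.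
Lemma dotZl m a (u v : 'rV[R]_m) : dot (a *: u) v = a * dot u v.
Proof. by rewrite /dot mulr_sumr; apply: eq_bigr => k _; rewrite mxE mulrA. Qed.
Lemma dotC m (u v : 'rV[R]_m) : dot u v = dot v u.
Proof. by apply: eq_bigr => a _; rewrite mulrC. Qed.
Lemma dotNl m (u v : 'rV[R]_m) : dot (- u) v = - dot u v.
Proof. by rewrite -scaleN1r dotZl mulN1r. Qed.
Lemma dotBl m (u v w : 'rV[R]_m) : dot (u - v) w = dot u w - dot v w.
Proof. by rewrite dotDl dotNl. Qed.
Lemma dotDr m (u v w : 'rV[R]_m) : dot u (v + w) = dot u v + dot u w.
Proof. by rewrite dotC dotDl !(dotC _ u). Qed.
Lemma dotZr m a (u v : 'rV[R]_m) : dot u (a *: v) = a * dot u v.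
Proof. by rewrite dotC dotZl dotC. Qed.
Lemma dot0l m (u : 'rV[R]_m) : dot 0 u = 0.
Proof. by rewrite -(scale0r 0) dotZl mul0r. Qed.
Lemma dot0r m (u : 'rV[R]_m) : dot u 0 = 0.
Proof. by rewrite dotC dot0l. Qed.
Lemma dot_delta m a (u : 'rV[R]_m) : dot (delta_mx 0 a) u = u 0 a.
Proof.
rewrite /dot (bigD1 a)//= big1 ?addr0 ?mxE ?eqxx ?mul1r// => b ba.
by rewrite mxE eqxx (negbTE ba) mul0r.
Qed.

(** Row vectors carry the maximum norm, hence the factor [m]. *)
Lemma dot_le m (u v : 'rV[R]_m) : `|dot u v| <= m%:R * `|v| * `|u|.
Proof.
apply: le_trans (ler_norm_sum _ _ _) _.
apply: (@le_trans _ _ (\sum_(i < m) `|v| * `|u|)); last first.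
  by rewrite sumr_const card_ord -mulrA mulr_natl.
by apply: ler_sum => i _; rewrite normrM mulrC ler_pM// rv_ge.
Qed.

End normed.

(** * Frechet derivatives and functions of class C^k *)

Lemma addr_sub6 (V : zmodType) (a b c d e f : V) :
  a + b - (c + d) - (e + f) = (a - c - e) + (b - d - f).
Proof. by rewrite (opprD c) (opprD e) [LHS](AC (2*2*2) ((1*3*5)*(2*4*6)))%AC. Qed.

Section frechet.
Context {R : realType}.

(** The candidate [L] is an arbitrary function: additivity and a Lipschitz bound are asked for in
    the lemmas that use them, and no bundled linear map has to be built. *)
Definition fd (V W : normedModType R) (f : V -> W) (x : V) (L : V -> W) :=
  forall e : R, 0 < e -> exists2 d : R, 0 < d &
    forall y, `|y - x| < d -> `|f y - f x - L (y - x)| <= e * `|y - x|.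

Lemma der_fd (W : normedModType R) (f : R -> W) t d :
  is_derive t (1 : R) f d <-> fd f t (fun h => h *: d).
Proof. exact: derP. Qed.

Lemma fd_lip (V W : normedModType R) (f : V -> W) x L C :
  fd f x L -> (forall h, `|L h| <= C * `|h|) ->
  exists2 d : R, 0 < d & forall y, `|y - x| < d -> `|f y - f x| <= (1 + C) * `|y - x|.
Proof.
move=> H LC; have [d d0 K] := H 1 ltr01; exists d => // y /K yd.
rewrite -(subrK (L (y - x)) (f y - f x)) (le_trans (ler_normD _ _))//.
by rewrite mulrDl lerD.
Qed.

Lemma lip_cont (V W : normedModType R) (f : V -> W) x C :
  (exists2 d : R, 0 < d & forall y, `|y - x| < d -> `|f y - f x| <= C * `|y - x|) ->
  {for x, continuous f}.
Proof.
move=> [d d0 H]; apply/contP => e e0.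
have C0 : 0 < `|C| + 1 by rewrite ltr_wpDl.
exists (Num.min d (e / (`|C| + 1))); first by rewrite lt_min d0 divr_gt0.
move=> y; rewrite lt_min => /andP[yd ye].
apply: le_trans (H _ yd) _; apply: le_trans (_ : (`|C| + 1) * `|y - x| <= _).
  by rewrite ler_wpM2r// (le_trans (ler_norm _))// lerDl.
by rewrite mulrC -ler_pdivlMr// ltW.
Qed.

Lemma fd_comp (U V W : normedModType R) (f : U -> V) (g : V -> W) x L L' C C' :
  fd f x L -> fd g (f x) L' -> (forall h, `|L h| <= C * `|h|) ->
  (forall h, `|L' h| <= C' * `|h|) -> (forall u v, L' (u - v) = L' u - L' v) ->
  fd (g \o f) x (L' \o L).
Proof.
move=> Hf Hg LC LC' L'B e e0.
have [d1 d10 K1] := fd_lip Hf LC.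
set A := `|1 + C| + 1; have A0 : 0 < A by rewrite /A ltr_wpDl.
set B := `|C'| + 1; have B0 : 0 < B by rewrite /B ltr_wpDl.
have [d2 d20 K2] := Hg (e / 2 / A) (divr_gt0 (divr_gt0 e0 (ltr0n _ 2)) A0).
have [d3 d30 K3] := Hf (e / 2 / B) (divr_gt0 (divr_gt0 e0 (ltr0n _ 2)) B0).
exists (Num.min d1 (Num.min (d2 / A) d3)).
  by rewrite !lt_min d10 d30 divr_gt0.
move=> y; rewrite !lt_min => /and3P[yd1 yd2 yd3] /=.
have yA : `|f y - f x| <= A * `|y - x|.
  apply: le_trans (K1 _ yd1) _; rewrite ler_wpM2r// (le_trans (ler_norm _))//.
  by rewrite lerDl.
have yd2' : `|f y - f x| < d2.
  by apply: le_lt_trans yA _; rewrite mulrC -ltr_pdivlMr.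
have {}K2 := K2 _ yd2'.
have {}K3 := K3 _ yd3.
rewrite -(subrK (L' (f y - f x)) (g (f y) - g (f x))) -addrA -L'B.
apply: le_trans (ler_normD _ _) _.
have -> : e * `|y - x| = e / 2 / A * (A * `|y - x|) + B * (e / 2 / B * `|y - x|).
  by field; rewrite !gt_eqF.
apply: lerD.
  by apply: le_trans K2 _; rewrite ler_wpM2l// ltW// !divr_gt0.
apply: le_trans (LC' _) _; apply: le_trans (ler_wpM2l (ltW B0) K3).
by rewrite ler_wpM2r// (le_trans (ler_norm _))// lerDl.
Qed.

Lemma fd_rvP (V : normedModType R) m (f : V -> 'rV[R]_m) x (L : V -> 'rV[R]_m) :
  fd f x L <-> forall k, fd (fun y => f y 0 k) x (fun h => L h 0 k).
Proof.
split=> [H k e /H[r r0 K]|H e e0].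
  exists r => // s sr.
  apply: le_trans (K s sr); rewrite (le_trans _ (rv_ge _ k))//.
  by rewrite !mxE.
have {}H k : exists r : R, 0 < r /\ forall y, `|y - x| < r ->
    `|f y 0 k - f x 0 k - L (y - x) 0 k| <= e * `|y - x|.
  by have /(_ e e0)[r r0 K] := H k; exists r.
have {H} [r H] := choice H.
exists (\big[Num.min/1]_k r k).
  by apply: lt_bigmin => // k _; case: (H k).
move=> s sr; apply: rv_le => [|k]; first by rewrite mulr_ge0// ltW.
rewrite !mxE; apply: (H k).2; apply: lt_le_trans sr _.
exact: bigmin_le.
Qed.

Lemma fd_eq (V W : normedModType R) (f : V -> W) x L L' :
  fd f x L -> L =1 L' -> fd f x L'.
Proof. by move=> H E e /H[d d0 K]; exists d => // y /K; rewrite E. Qed.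

Lemma fd_near (V W : normedModType R) (f g : V -> W) x L :
  (\forall y \near x, f y = g y) -> fd f x L -> fd g x L.
Proof.
move=> /nearN_P[r r0 fg] H e /H[r' r'0 K].
exists (Num.min r r'); first by rewrite lt_min r0.
move=> s; rewrite lt_min => /andP[sr sr'].
by rewrite -!fg ?subrr ?normr0//; apply: K.
Qed.

Lemma fdD (V W : normedModType R) (f g : V -> W) x L L' :
  fd f x L -> fd g x L' -> fd (fun y => f y + g y) x (fun h => L h + L' h).
Proof.
move=> Hf Hg e e0; have e2 : 0 < e / 2 by rewrite divr_gt0.
have [d d0 K] := Hf _ e2; have [d' d'0 K'] := Hg _ e2.
exists (Num.min d d'); first by rewrite lt_min d0.
move=> y; rewrite lt_min => /andP[/K yd /K' yd'].
have -> : f y + g y - (f x + g x) - (L (y - x) + L' (y - x)) =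
  (f y - f x - L (y - x)) + (g y - g x - L' (y - x)).
  exact: addr_sub6.
by rewrite (splitr e) mulrDl (le_trans (ler_normD _ _))// lerD.
Qed.

Lemma fdM (V : normedModType R) (f g : V -> R) x L L' C C' :
  fd f x L -> fd g x L' -> (forall h, `|L h| <= C * `|h|) ->
  (forall h, `|L' h| <= C' * `|h|) ->
  fd (fun y => f y * g y) x (fun h => f x * L' h + g x * L h).
Proof.
move=> Hf Hg LC LC' e e0.
have [d1 d10 K1] := fd_lip Hf LC; have [d2 d20 K2] := fd_lip Hg LC'.
have e3 : 0 < e / 3 by rewrite divr_gt0.
have P (a : R) : 0 < `|a| + 1 by rewrite ltr_wpDl.
have [d3 d30 K3] := Hf _ (divr_gt0 e3 (P (g x))).
have [d4 d40 K4] := Hg _ (divr_gt0 e3 (P (f x))).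
set D := `|(1 + C) * (1 + C')| + 1; have D0 : 0 < D by exact: P.
exists (Num.min (Num.min d1 d2) (Num.min (Num.min d3 d4) (e / 3 / D))).
  by rewrite !lt_min d10 d20 d30 d40 /= divr_gt0.
move=> y; rewrite !lt_min => /andP[/andP[/K1 y1 /K2 y2]] /andP[/andP[/K3 y3 /K4 y4] y5].
have -> : f y * g y - f x * g x - (f x * L' (y - x) + g x * L (y - x)) =
  f x * (g y - g x - L' (y - x)) + g x * (f y - f x - L (y - x))
   + (f y - f x) * (g y - g x) by ring.
have -> : e * `|y - x| = e / 3 * `|y - x| + e / 3 * `|y - x| + e / 3 * `|y - x|.
  by field.
apply: le_trans (ler_normD _ _) _; apply: lerD; last first.
  rewrite normrM; apply: le_trans (ler_pM _ _ y1 y2) _ => //.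
  have -> : (1 + C) * `|y - x| * ((1 + C') * `|y - x|) =
     ((1 + C) * (1 + C') * `|y - x|) * `|y - x| by ring.
  apply: ler_wpM2r => //; apply: le_trans (_ : D * `|y - x| <= _).
    by rewrite ler_wpM2r// (le_trans (ler_norm _))// lerDl.
  by rewrite mulrC -ler_pdivlMr// ltW.
apply: le_trans (ler_normD _ _) _; apply: lerD; rewrite normrM.
  apply: le_trans (_ : (`|f x| + 1) * (e / 3 / (`|f x| + 1) * `|y - x|) <= _).
    by apply: ler_pM => //; rewrite lerDl.
  by rewrite mulrA [X in X * _]mulrC divfK ?gt_eqF.
apply: le_trans (_ : (`|g x| + 1) * (e / 3 / (`|g x| + 1) * `|y - x|) <= _).
  by apply: ler_pM => //; rewrite lerDl.
by rewrite mulrA [X in X * _]mulrC divfK ?gt_eqF.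
Qed.

Lemma fdV (V : normedModType R) (f : V -> R) x L C : f x != 0 ->
  fd f x L -> (forall h, `|L h| <= C * `|h|) ->
  fd (fun y => (f y)^-1) x (fun h => - (f x)^-2 * L h).
Proof.
move=> fx0 Hf LC.
have Hg : fd (fun z : R => z^-1) (f x) (fun h => - (f x)^-2 * h).
  have : fd (fun z : R => z^-1) (f x) (fun h : R => h *: (- (f x)^-2 : R)).
    have D := @is_deriveV _ id (f x) 1 1 fx0 (is_derive_id _ _).
    apply/der_fd/derP => e e0; have /derP/(_ e e0)[r r0 K] := D.
    by exists r => // s sr; move: (K s sr); rewrite /= [_ *: (1 : R)]mulr1.
  by move=> /fd_eq; apply => h; rewrite [LHS]mulrC.
have := fd_comp Hf Hg LC (C' := `|(f x)^-2|).
move/(_ _ _); apply => h.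
  by rewrite normrM normrN.
by move=> v; rewrite mulrBr.
Qed.

End frechet.

Section ck.
Context {R : realType}.

Definition has_grad m (f : 'rV[R]_m -> R) (x g : 'rV[R]_m) :=
  fd f x (fun h => dot h g).

Lemma dot_lip m (g : 'rV[R]_m) h : `|dot h g| <= m%:R * `|g| * `|h|.
Proof. exact: dot_le. Qed.

Lemma hg_cont m (f : 'rV[R]_m -> R) x g : has_grad f x g -> {for x, continuous f}.
Proof. by move=> H; apply: lip_cont (fd_lip H (dot_lip g)). Qed.

Lemma hg_cst m (c : R) (x : 'rV[R]_m) : has_grad (fun=> c) x 0.
Proof.
move=> e e0; exists 1 => // y _.
by rewrite dot0r !subrr normr0 mulr_ge0// ltW.
Qed.

Lemma hg_coord m k (x : 'rV[R]_m) : has_grad (fun y => y 0 k) x (delta_mx 0 k).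
Proof.
move=> e e0; exists 1 => // y _.
by rewrite dotC dot_delta !mxE subrr normr0 mulr_ge0// ltW.
Qed.

Lemma hgD m (f g : 'rV[R]_m -> R) x u v :
  has_grad f x u -> has_grad g x v -> has_grad (fun y => f y + g y) x (u + v).
Proof. by move=> /fdD H /H K; apply: fd_eq K _ => h /=; rewrite dotDr. Qed.

Lemma hgM m (f g : 'rV[R]_m -> R) x u v :
  has_grad f x u -> has_grad g x v ->
  has_grad (fun y => f y * g y) x (f x *: v + g x *: u).
Proof.
move=> H1 H2; apply: fd_eq (fdM H1 H2 (dot_lip u) (dot_lip v)) _ => h /=.
by rewrite dotDr !dotZr.
Qed.

Lemma hgV m (f : 'rV[R]_m -> R) x u : f x != 0 ->
  has_grad f x u -> has_grad (fun y => (f y)^-1) x (- (f x)^-2 *: u).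
Proof.
move=> f0 H1; apply: fd_eq (fdV f0 H1 (dot_lip u)) _ => h /=.
by rewrite dotZr.
Qed.

Lemma dotBl_lin m (g : 'rV[R]_m) u v : dot (u - v) g = dot u g - dot v g.
Proof. exact: dotBl. Qed.

Lemma hg_comp m p (f : 'rV[R]_m -> R) (psi : 'rV[R]_p -> 'rV[R]_m) x u
    (G : 'I_m -> 'rV[R]_p) :
  has_grad f (psi x) u -> (forall k, has_grad (fun y => psi y 0 k) x (G k)) ->
  has_grad (f \o psi) x (\sum_k u 0 k *: G k).
Proof.
move=> Hf Hpsi.
have Hp : fd psi x (fun h => \row_k dot h (G k)).
  apply/fd_rvP => k; apply: fd_eq (Hpsi k) _ => h; by rewrite mxE.
have LC h : `|\row_k dot h (G k)| <= (\sum_k p%:R * `|G k|) * `|h|.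
  apply: rv_le => [|k].
    by rewrite mulr_ge0// sumr_ge0// => k _; rewrite mulr_ge0.
  rewrite mxE (le_trans (dot_lip _ _))// ler_wpM2r//.
  rewrite (bigD1 k)//= lerDl sumr_ge0// => j _; by rewrite mulr_ge0.
apply: fd_eq (fd_comp Hp Hf LC (dot_lip u) (dotBl_lin u)) _ => h /=.
have -> : dot (\row_k dot h (G k)) u = \sum_k dot h (G k) * u 0 k.
  by apply: eq_bigr => k _; rewrite mxE.
have -> : dot h (\sum_k u 0 k *: G k) = \sum_k dot h (u 0 k *: G k).
  by apply: (big_morph (dot h)) => [a b|]; rewrite ?dotDr ?dot0r.
by apply: eq_bigr => k _; rewrite dotZr mulrC.
Qed.

Lemma der_comp m (f : 'rV[R]_m -> R) (c : R -> 'rV[R]_m) t u v :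
  has_grad f (c t) u -> is_derive t (1 : R) c v ->
  is_derive t (1 : R) (f \o c) (dot v u).
Proof.
move=> Hf /der_fd Hc; apply/der_fd.
apply: fd_eq (fd_comp Hc Hf (C := `|v|) _ (dot_lip u) (dotBl_lin u)) _ => h /=.
  by rewrite normrZ mulrC.
by rewrite dotZl.
Qed.

Lemma hg_partial m (f : 'rV[R]_m -> R) x u a : has_grad f x u -> partial a f x = u 0 a.
Proof.
move=> Hf; rewrite /partial.
have Hc : is_derive (0 : R) (1 : R) (fun s => s *: (delta_mx 0 a : 'rV[R]_m) + x) (delta_mx 0 a).
  apply/der_fd => e e0; exists 1 => // y _.
  by rewrite scale0r add0r addrK subr0 subrr normr0 mulr_ge0// ltW.
have := @der_comp _ f (fun s => s *: (delta_mx 0 a : 'rV[R]_m) + x) 0 u (delta_mx 0 a).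
rewrite scale0r add0r dot_delta => /(_ Hf Hc) H.
have <- := derive_val (is_derive := H).
rewrite /derive.
suff -> : (fun h : R => h^-1 *: ((f \o shift x) (h *: (delta_mx 0 a : 'rV[R]_m)) - f x)) =
  (fun h : R => h^-1 *: (((f \o (fun s : R => s *: (delta_mx 0 a : 'rV[R]_m) + x)) \o shift 0) (h *: (1 : R)) -
     (f \o (fun s : R => s *: (delta_mx 0 a : 'rV[R]_m) + x)) 0)) by [].
apply/funext => h /=.
by rewrite scale0r add0r addr0 [h%:A]mulr1.
Qed.

Lemma diff_has_grad m (f : 'rV[R]_m -> R) x :
  differentiable f x -> has_grad f x (\row_a partial a f x).
Proof.
move=> df; have /diff_locallyP[_ /eqaddoP H] := df.
move=> e e0; have /nearN_P[d d0 K] := H e e0.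
exists d => // y yd; have := K (y - x); rewrite subr0 => /(_ yd) /=.
rewrite /cst /= !fctE /= /shift /= subrK opprD addrA.
suff -> : 'd f x (y - x) = dot (y - x) (\row_a partial a f x) by [].
rewrite {1}(row_sum_delta (y - x)) linear_sum /dot; apply: eq_bigr => a _.
by rewrite linearZ /= !mxE /partial deriveE.
Qed.

(** Class C^N, with the gradient field quantified existentially: each closure property is one
    induction that exhibits the gradient. [ck_hg] identifies it with the partial derivatives
    afterwards. *)
Fixpoint ck N m (U : set 'rV[R]_m) (f : 'rV[R]_m -> R) : Prop :=
  match N with
  | 0 => forall x, U x -> {for x, continuous f}
  | S N' => exists g : 'rV[R]_m -> 'rV[R]_m, (forall x, U x -> has_grad f x (g x)) /\
             forall a, ck N' U (fun x => g x 0 a)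
  end.

Lemma ckSP N m U (f : 'rV[R]_m -> R) : ck N.+1 U f <->
  exists g : 'rV[R]_m -> 'rV[R]_m, (forall x, U x -> has_grad f x (g x)) /\
             forall a, ck N U (fun x => g x 0 a).
Proof. by []. Qed.

Lemma ck_cont N m U (f : 'rV[R]_m -> R) x : ck N U f -> U x -> {for x, continuous f}.
Proof.
case: N => [|N] H Ux; first exact: H.
by have [g [H1 _]] := H; exact: hg_cont (H1 _ Ux).
Qed.

Lemma ckW N m U (f : 'rV[R]_m -> R) : ck N.+1 U f -> ck N U f.
Proof.
elim: N f => [|N IH] f H; first by move=> x; exact: ck_cont H.
by have [g [H1 H2]] := H; exists g; split => // a; exact: IH.
Qed.

Lemma ck_sub N m (U V : set 'rV[R]_m) f : V `<=` U -> ck N U f -> ck N V f.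
Proof.
move=> VU; elim: N f => [|N IH] f /= H; first by move=> x /VU; exact: H.
have [g [H1 H2]] := H; exists g; split => [x /VU|a]; [exact: H1|exact: IH].
Qed.

Lemma ck_eq N m (U : set 'rV[R]_m) f g : open U -> (forall x, U x -> f x = g x) ->
  ck N U f -> ck N U g.
Proof.
move=> oU fg; have fgn x : U x -> \forall y \near x, f y = g y.
  by move=> Ux; apply: filterS fg _; exact: open_nbhs_nbhs.
case: N => [|N] /= H.
  move=> x Ux; have := H x Ux => /contP cf; apply/contP => e /cf[d d0 K].
  have /nearN_P[r r0 L] := fgn x Ux.
  exists (Num.min d r); first by rewrite lt_min d0.
  by move=> y; rewrite lt_min => /andP[yd yr]; rewrite -!L ?subrr ?normr0//; exact: K.
have [G [H1 H2]] := H; exists G; split => // x Ux.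
exact: fd_near (fgn x Ux) (H1 x Ux).
Qed.

Lemma ck_cst N m (U : set 'rV[R]_m) c : ck N U (fun=> c).
Proof.
elim: N c => [|N IH] c /=; first by move=> x _; exact: hg_cont (hg_cst c x).
exists (fun=> 0); split=> [x _|a]; first exact: hg_cst.
by under eq_fun do rewrite mxE; exact: IH.
Qed.

Lemma ck_coord N m (U : set 'rV[R]_m) k : ck N U (fun x => x 0 k).
Proof.
case: N => [|N] /=; first by move=> x _; exact: hg_cont (hg_coord k x).
exists (fun=> delta_mx 0 k); split=> [x _|a]; first exact: hg_coord.
exact: ck_cst.
Qed.

Lemma ckD N m (U : set 'rV[R]_m) f g : ck N U f -> ck N U g -> ck N U (fun x => f x + g x).
Proof.
elim: N f g => [|N IH] f g /=; first by move=> Hf Hg x Ux; exact: (cvgD (Hf x Ux) (Hg x Ux)).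
move=> [u [Hu cu]] [v [Hv cv]]; exists (fun x => u x + v x); split => [x Ux|a].
  by apply: hgD; [exact: Hu|exact: Hv].
by under eq_fun do rewrite mxE; exact: IH.
Qed.

Lemma ckM N m (U : set 'rV[R]_m) f g : ck N U f -> ck N U g -> ck N U (fun x => f x * g x).
Proof.
elim: N f g => [|N IH] f g; first by move=> Hf Hg x Ux; exact: (cvgM (Hf x Ux) (Hg x Ux)).
move=> cf cg; have /ckSP[u [Hu cu]] := cf; have /ckSP[v [Hv cv]] := cg.
exists (fun x => f x *: v x + g x *: u x); split => [x Ux|a].
  by apply: hgM; [exact: Hu|exact: Hv].
under eq_fun do rewrite !mxE.
by apply: ckD; apply: IH => //; exact: ckW.
Qed.

Lemma ckN N m (U : set 'rV[R]_m) f : ck N U f -> ck N U (fun x => - f x).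
Proof.
move=> H; have := ckM (ck_cst N U (-1)) H.
by under eq_fun do rewrite mulN1r.
Qed.

Lemma ckB N m (U : set 'rV[R]_m) f g : ck N U f -> ck N U g -> ck N U (fun x => f x - g x).
Proof. by move=> Hf Hg; apply: ckD => //; exact: ckN. Qed.

Lemma ck_sum N m (U : set 'rV[R]_m) (I : finType) (P : pred I) (f : I -> 'rV[R]_m -> R) :
  (forall i, ck N U (f i)) -> ck N U (fun x => \sum_(i | P i) f i x).
Proof.
move=> H; suff: forall s : seq I, ck N U (fun x => \sum_(i <- s | P i) f i x) by [].
elim=> [|i s IH]; first by under eq_fun do rewrite big_nil; exact: ck_cst.
have -> : (fun x => \sum_(j <- i :: s | P j) f j x) =
  (fun x => if P i then f i x + \sum_(j <- s | P j) f j x else \sum_(j <- s | P j) f j x).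
  by apply/funext => x; rewrite big_cons.
by case: (P i); [exact: (ckD (H i) IH)|exact: IH].
Qed.

Lemma ck_prod N m (U : set 'rV[R]_m) (I : finType) (P : pred I) (f : I -> 'rV[R]_m -> R) :
  (forall i, ck N U (f i)) -> ck N U (fun x => \prod_(i | P i) f i x).
Proof.
move=> H; suff: forall s : seq I, ck N U (fun x => \prod_(i <- s | P i) f i x) by [].
elim=> [|i s IH]; first by under eq_fun do rewrite big_nil; exact: ck_cst.
have -> : (fun x => \prod_(j <- i :: s | P j) f j x) =
  (fun x => if P i then f i x * \prod_(j <- s | P j) f j x else \prod_(j <- s | P j) f j x).
  by apply/funext => x; rewrite big_cons.
by case: (P i); [exact: (ckM (H i) IH)|exact: IH].
Qed.

Lemma ckV N m (U : set 'rV[R]_m) f : (forall x, U x -> f x != 0) ->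
  ck N U f -> ck N U (fun x => (f x)^-1).
Proof.
move=> f0; elim: N => [|N IH] cf.
  by move=> x Ux; exact: (cvgV (f0 x Ux) (cf x Ux)).
have /ckSP[u [Hu cu]] := cf; exists (fun x => - (f x)^-2 *: u x); split => [x Ux|a].
  by apply: hgV; [exact: f0|exact: Hu].
under eq_fun do rewrite !mxE.
apply: ckM; last exact: cu.
apply: (@ckN N m U (fun x => (f x)^-2)).
under eq_fun do rewrite -exprVn expr2.
by apply: (@ckM N m U (fun x => (f x)^-1) (fun x => (f x)^-1)); apply: IH; exact: ckW.
Qed.

Lemma ck_comp N m p (U : set 'rV[R]_p) (V : set 'rV[R]_m) f (psi : 'rV[R]_p -> 'rV[R]_m) :
  (forall x, U x -> V (psi x)) -> ck N V f -> (forall k, ck N U (fun x => psi x 0 k)) ->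
  ck N U (fun x => f (psi x)).
Proof.
move=> UV; elim: N f => [|N IH] f cf cpsi.
  move=> x Ux; apply: continuous_comp; last by apply: cf; exact: UV.
  by apply/cont_rvP => k; exact: cpsi.
have /ckSP[u [Hu cu]] := cf.
have [G HG] := choice cpsi.
exists (fun x => \sum_k u (psi x) 0 k *: G k x); split => [x Ux|a].
  apply: hg_comp; first by apply: Hu; exact: UV.
  by move=> k; apply: (HG k).1.
have -> : (fun x => (\sum_k u (psi x) 0 k *: G k x) 0 a) =
          (fun x => \sum_k u (psi x) 0 k * G k x 0 a).
  by apply/funext => x; rewrite summxE; apply: eq_bigr => k _; rewrite mxE.
apply: ck_sum => k; apply: ckM; last exact: (HG k).2.
by apply: (IH (fun y => u y 0 k)); [exact: cu|move=> j; exact: ckW].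
Qed.

Lemma smooth_ck N m (U : set 'rV[R]_m) f : smooth_on U f -> ck N U f.
Proof.
elim: N f => [|N IH] f sf.
  by move=> x Ux; exact: hg_cont (diff_has_grad (sf [::] x Ux)).
exists (fun x => \row_a partial a f x); split => [x Ux|a].
  exact: (diff_has_grad (sf [::] x Ux)).
under eq_fun do rewrite mxE; apply: IH => s x Ux.
(* The derivative taken first is the innermost one, that is, the last element of the sequence. *)
by have := sf (rcons s a) x Ux; rewrite foldr_rcons.
Qed.

Lemma ck_hg N m (U : set 'rV[R]_m) f x : ck N.+1 U f -> U x ->
  has_grad f x (\row_a partial a f x).
Proof.
move=> [g [H _]] Ux; suff -> : \row_a partial a f x = g x by exact: H.
by apply/rowP => a; rewrite mxE; exact: hg_partial (H x Ux).
Qed.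

Lemma ck_partial N m (U : set 'rV[R]_m) f a : open U -> ck N.+1 U f -> ck N U (partial a f).
Proof.
move=> oU [g [H cg]]; apply: ck_eq (cg a) => // x Ux.
by rewrite (hg_partial _ (H x Ux)).
Qed.

Lemma ck_det N m (U : set 'rV[R]_m) k (A : 'rV[R]_m -> 'M[R]_k) :
  (forall a b, ck N U (fun x => A x a b)) -> ck N U (fun x => \det (A x)).
Proof.
move=> H; apply: ck_sum => s; apply: ckM; first exact: ck_cst.
by apply: ck_prod => i; exact: H.
Qed.

Lemma ck_inv N m (U : set 'rV[R]_m) k (A : 'rV[R]_m -> 'M[R]_k) : open U ->
  (forall x, U x -> A x \in unitmx) ->
  (forall a b, ck N U (fun x => A x a b)) ->
  forall a b, ck N U (fun x => invmx (A x) a b).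
Proof.
move=> oU Au H a b.
apply: (@ck_eq _ _ _ (fun x => (\det (A x))^-1 * cofactor (A x) b a)) => // [x Ux|].
  by rewrite /invmx Au// !mxE.
apply: ckM; first apply: ckV; last 1 first.
- rewrite /cofactor; apply: ckM; first exact: ck_cst.
  by apply: ck_det => c d; under eq_fun do rewrite !mxE; exact: H.
- by move=> x /Au; rewrite unitmxE unitfE.
- exact: ck_det.
Qed.

End ck.

(** * Mean value estimates, quadratic remainders, and truncation *)

Section estimates.
Context {R : realType}.
Implicit Types (a b s t r e B K C : R).

Lemma mvt_scalar (f df : R -> R) a b B : a <= b ->
  (forall s, a <= s <= b -> is_derive s (1 : R) f (df s)) ->
  (forall s, a <= s <= b -> `|df s| <= B) -> `|f b - f a| <= B * (b - a).
Proof.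
move=> ab df_ dfB.
have [c cab ->] : exists2 c, c \in `[a, b]%R & f b - f a = df c * (b - a).
  apply: MVT_segment => // [x xab|].
    by apply: df_; move: xab; rewrite in_itv /= => /andP[/ltW -> /ltW ->].
  apply: continuous_in_subspaceT => x /set_mem; rewrite /= in_itv /= => xab.
  exact: der_cont (df_ _ xab).
rewrite normrM (ger0_norm (_ : 0 <= b - a)) ?subr_ge0// ler_wpM2r ?subr_ge0//.
by apply: dfB; move: cab; rewrite in_itv.
Qed.

Lemma mvt_rv m (f df : R -> 'rV[R]_m) a b B :
  (forall s, a <= s <= b -> is_derive s (1 : R) f (df s)) ->
  (forall s, a <= s <= b -> `|df s| <= B) ->
  forall s t, a <= s <= b -> a <= t <= b -> `|f s - f t| <= B * `|s - t|.
Proof.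
move=> df_ dfB s t.
wlog st : s t / s <= t.
  move=> H sab tab; have [st|/ltW ts] := leP s t; first exact: H.
  by rewrite distrC [`|s - t|]distrC; exact: H.
move=> /andP[as_ sb] /andP[at_ tb].
have B0 : 0 <= B by rewrite (le_trans (normr_ge0 (df s)))// dfB// as_ sb.
rewrite distrC (distrC s) (ger0_norm (_ : 0 <= t - s)) ?subr_ge0//.
apply: rv_le => [|k]; first by rewrite mulr_ge0// subr_ge0.
rewrite !mxE; apply: (@mvt_scalar (fun s => f s 0 k) (fun s => df s 0 k)) => // u /andP[su ut].
  by apply: (proj1 (der_rvP _ _ _) (df_ u _)); rewrite (le_trans as_ su) (le_trans ut tb).
by rewrite (le_trans (rv_ge _ _))// dfB// (le_trans as_ su) (le_trans ut tb).
Qed.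

Lemma der_segment m (x y : 'rV[R]_m) (t : R) :
  is_derive t (1 : R) (fun s : R => x + s *: (y - x)) (y - x).
Proof.
apply/der_fd => e e0; exists 1 => // s _.
by rewrite [x + _]addrC addrKA -scalerBl subrr normr0 mulr_ge0// ltW.
Qed.

Lemma ball_segment m (z x y : 'rV[R]_m) (t r : R) : 0 <= t <= 1 ->
  `|x - z| < r -> `|y - z| < r -> `|x + t *: (y - x) - z| < r.
Proof.
move=> /andP[t0 t1] xr yr.
have -> : x + t *: (y - x) - z = (1 - t) *: (x - z) + t *: (y - z).
  by apply/rowP => k; rewrite !mxE; ring.
apply: le_lt_trans (ler_normD _ _) _; rewrite !normrZ !ger0_norm ?subr_ge0//.
have [->|tn0] := eqVneq t 0; first by rewrite subr0 mul1r mul0r addr0.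
have tp : 0 < t by rewrite lt_neqAle eq_sym tn0.
apply: le_lt_trans (_ : (1 - t) * r + t * `|y - z| < _).
  by rewrite lerD2r ler_wpM2l ?subr_ge0// ltW.
have {2}-> : r = (1 - t) * r + t * r by ring.
by rewrite ltrD2l ltr_pM2l.
Qed.

(** The convention is that of row vectors multiplied from the left; [fd_jacobian] below identifies
    this matrix with ['J]. *)
Definition jac m p (F : 'rV[R]_m -> 'rV[R]_p) (z : 'rV[R]_m) : 'M[R]_(m, p) :=
  \matrix_(a, k) partial a (fun x => F x 0 k) z.

Definition ckv N m p (U : set 'rV[R]_m) (F : 'rV[R]_m -> 'rV[R]_p) :=
  forall k, ck N U (fun x => F x 0 k).

Lemma mx_entry_le p k (A : 'M[R]_(p, k)) i j : `|A i j| <= `|A|.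
Proof. by rewrite /Num.norm /= mx_normrE (bigD1 (i, j))//= le_max lexx. Qed.

Lemma mx_le p k (A : 'M[R]_(p, k)) e : 0 <= e -> (forall i j, `|A i j| <= e) -> `|A| <= e.
Proof.
move=> e0 H; rewrite /Num.norm /= mx_normrE.
by apply: bigmax_le => // -[i j] _ /=.
Qed.

Lemma mulmx_le m p (u : 'rV[R]_m) (A : 'M[R]_(m, p)) : `|u *m A| <= m%:R * `|A| * `|u|.
Proof.
apply: rv_le => [|k]; first by rewrite !mulr_ge0.
rewrite mxE (le_trans (ler_norm_sum _ _ _))//.
apply: (@le_trans _ _ (\sum_(i < m) `|A| * `|u|)).
  by apply: ler_sum => i _; rewrite normrM mulrC ler_pM// ?rv_ge ?mx_entry_le.
by rewrite sumr_const card_ord -mulrA mulr_natl.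
Qed.

Lemma fd_jac m p (U : set 'rV[R]_m) N (F : 'rV[R]_m -> 'rV[R]_p) x :
  ckv N.+1 U F -> U x -> fd F x (fun h => h *m jac F x).
Proof.
move=> cF Ux; apply/fd_rvP => k; apply: fd_eq (ck_hg (cF k) Ux) _ => h.
by rewrite /dot mxE; apply: eq_bigr => a _; rewrite !mxE.
Qed.

Lemma der_jac m p (U : set 'rV[R]_m) N (F : 'rV[R]_m -> 'rV[R]_p) (c : R -> 'rV[R]_m) t v :
  ckv N.+1 U F -> U (c t) -> is_derive t (1 : R) c v ->
  is_derive t (1 : R) (fun s => F (c s)) (v *m jac F (c t)).
Proof.
move=> cF Ux cv; apply/der_rvP => k.
have := der_comp (ck_hg (cF k) Ux) cv.
rewrite /dot mxE; under [X in _ -> is_derive _ _ _ X]eq_bigr do rewrite mxE.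
by under [X in is_derive _ _ _ X -> _]eq_bigr do rewrite mxE.
Qed.

Lemma jac_near_bound m p (U : set 'rV[R]_m) (F : 'rV[R]_m -> 'rV[R]_p) z :
  open U -> ckv 1 U F -> U z ->
  exists r K : R, [/\ 0 < r, 0 < K, (forall x, `|x - z| < r -> U x) &
    forall x, `|x - z| < r -> `|jac F x| <= K].
Proof.
move=> oU cF Uz.
have /nearN_P[r0 r00 Ur0] : nbhs z U by exact: open_nbhs_nbhs.
have H (ak : 'I_m * 'I_p) : exists r : R, 0 < r /\ forall x, `|x - z| < r ->
    `|partial ak.1 (fun x => F x 0 ak.2) x - partial ak.1 (fun x => F x 0 ak.2) z| <= 1.
  have /contP/(_ 1 ltr01)[r ? ?] := ck_cont (ck_partial ak.1 oU (cF ak.2)) Uz.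
  by exists r.
have {H} [r H] := choice H.
exists (Num.min r0 (\big[Num.min/1]_k r k)), (`|jac F z| + 1); split.
- by rewrite lt_min r00; apply: lt_bigmin => // k _; case: (H k).
- by rewrite ltr_wpDl.
- by move=> x; rewrite lt_min => /andP[/Ur0].
- move=> x; rewrite lt_min => /andP[_ xr].
  apply: mx_le => [|a k]; first by rewrite addr_ge0.
  have xr' : `|x - z| < r (a, k) by apply: lt_le_trans xr _; exact: bigmin_le.
  have := (H (a, k)).2 x xr' => /= {}H.
  rewrite -(subrK (jac F z a k) (jac F x a k)) (le_trans (ler_normD _ _))//.
  by rewrite addrC lerD// ?mx_entry_le// !mxE.
Qed.

Lemma jac_lip_on m p (U : set 'rV[R]_m) (F : 'rV[R]_m -> 'rV[R]_p) z r K :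
  ckv 1 U F -> (forall x, `|x - z| < r -> U x) ->
  (forall x, `|x - z| < r -> `|jac F x| <= K) ->
  forall x y, `|x - z| < r -> `|y - z| < r -> `|F x - F y| <= m%:R * K * `|x - y|.
Proof.
move=> cF rU rK x y xr yr.
have D s : 0 <= s <= 1 -> is_derive s (1 : R) (fun s => F (y + s *: (x - y)))
    ((x - y) *m jac F (y + s *: (x - y))).
  move=> s01; have := @der_jac _ _ U 0 F (fun s => y + s *: (x - y)) s (x - y) cF.
  by apply; [apply: rU; exact: ball_segment|exact: der_segment].
have := mvt_rv D (B := m%:R * K * `|x - y|).
move=> /(_ _ 1 0); rewrite !scale1r !scale0r addr0 subrKC subr0 normr1 mulr1.
apply; rewrite ?lexx ?ler01// => s s01; apply: le_trans (mulmx_le _ _) _.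
by rewrite ler_wpM2r// ler_wpM2l// rK//; exact: ball_segment.
Qed.

Lemma near_lip m p (U : set 'rV[R]_m) (F : 'rV[R]_m -> 'rV[R]_p) z :
  open U -> ckv 1 U F -> U z ->
  exists r K : R, [/\ 0 < r, 0 < K, (forall x, `|x - z| < r -> U x) &
    forall x y, `|x - z| < r -> `|y - z| < r -> `|F x - F y| <= K * `|x - y|].
Proof.
move=> oU cF Uz; have [r [K [r0 K0 rU rK]]] := jac_near_bound oU cF Uz.
exists r, (m%:R * K + 1); split => //; first by rewrite ltr_wpDl// mulr_ge0// ltW.
move=> x y xr yr; apply: le_trans (jac_lip_on cF rU rK xr yr) _.
by rewrite ler_wpM2r// lerDl.
Qed.

(** Mean value inequality for [F] minus its linear part at [w], along the segment from [y] to [x].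
    The base point [w] is free near [z]: in [local_flow] it moves along a trajectory while [x] and
    [y] move along neighbouring ones. *)
Lemma near_quad m p (U : set 'rV[R]_m) (F : 'rV[R]_m -> 'rV[R]_p) z :
  open U -> ckv 2 U F -> U z ->
  exists r K : R, [/\ 0 < r, 0 < K, (forall x, `|x - z| < r -> U x),
    (forall x, `|x - z| < r -> `|jac F x| <= K) &
    forall w x y, `|w - z| < r -> `|x - z| < r -> `|y - z| < r ->
      `|F x - F y - (x - y) *m jac F w| <= K * (`|x - w| + `|y - w|) * `|x - y|].
Proof.
move=> oU cF Uz.
have cF1 : ckv 1 U F by move=> k; exact: ckW.
have [r0 [K0 [r00 K00 rU0 rK0]]] := jac_near_bound oU cF1 Uz.
have H (k : 'I_p) : exists rK : R * R, [/\ 0 < rK.1, 0 < rK.2 &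
   forall x y, `|x - z| < rK.1 -> `|y - z| < rK.1 ->
   `|(\row_a partial a (fun x => F x 0 k) x) - \row_a partial a (fun x => F x 0 k) y|
      <= rK.2 * `|x - y|].
  have [] := @near_lip m m U (fun x => \row_a partial a (fun x => F x 0 k) x) z oU _ Uz.
    by move=> a; under eq_fun do rewrite mxE; exact: ck_partial.
  by move=> r [K [? ? ? ?]]; exists (r, K).
have {H} [rK H] := choice H.
pose r := Num.min r0 (\big[Num.min/1]_k (rK k).1).
pose C := \sum_k (rK k).2.
have C0 : 0 <= C by rewrite sumr_ge0// => k _; case: (H k) => _ /ltW.
exists r, (K0 + m%:R * C); split.
- by rewrite lt_min r00; apply: lt_bigmin => // k _; case: (H k).
- by rewrite ltr_pwDl// mulr_ge0.
- by move=> x; rewrite lt_min => /andP[/rU0].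
- move=> x; rewrite lt_min => /andP[/rK0 + _] => /le_trans; apply.
  by rewrite lerDl mulr_ge0.
move=> w x y wr xr yr.
have rr0 u : `|u - z| < r -> `|u - z| < r0 by rewrite lt_min => /andP[].
have rrk k u : `|u - z| < r -> `|u - z| < (rK k).1.
  rewrite lt_min => /andP[_ /lt_le_trans]; apply; exact: bigmin_le.
have D s : 0 <= s <= 1 -> is_derive s (1 : R)
    (fun s => F (y + s *: (x - y)) - s *: ((x - y) *m jac F w))
    ((x - y) *m (jac F (y + s *: (x - y)) - jac F w)).
  move=> s01; rewrite mulmxBr; apply: is_deriveB.
    have := @der_jac _ _ U 0 F (fun s => y + s *: (x - y)) s (x - y) cF1.
    by apply; [apply/rU0/rr0; exact: ball_segment|exact: der_segment].
  by apply/der_fd => e e0; exists 1 => // t _; rewrite -!scalerBl subrr scale0r normr0 mulr_ge0// ltW.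
have := mvt_rv D (B := (K0 + m%:R * C) * (`|x - w| + `|y - w|) * `|x - y|).
move=> /(_ _ 1 0); rewrite !scale1r !scale0r addr0 subrKC !subr0 normr1 mulr1.
rewrite addrAC; apply; rewrite ?lexx ?ler01// => s s01; apply: le_trans (mulmx_le _ _) _.
rewrite ler_wpM2r//.
apply: (@le_trans _ _ (m%:R * C * (`|x - w| + `|y - w|))); last first.
  by rewrite ler_wpM2r ?addr_ge0// lerDr ltW.
rewrite -mulrA ler_wpM2l//; apply: mx_le => [|a k]; first by rewrite mulr_ge0 ?addr_ge0.
have := (H k); set u := y + _ => -[_ K1 /(_ u w)].
have ur : `|u - z| < r by exact: ball_segment.
move=> /(_ (rrk k u ur) (rrk k w wr)) H1.
have -> : (jac F u - jac F w) a k = ((\row_a partial a (fun x => F x 0 k) u) - \row_a partial a (fun x => F x 0 k) w) 0 a.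
  by rewrite !mxE.
apply: le_trans (rv_ge _ a) _; apply: le_trans H1 _; apply: ler_pM => //; first exact: ltW.
  rewrite /C (bigD1 k)//= lerDl sumr_ge0// => j _; by case: (H j) => _ /ltW.
have -> : u - w = (1 - s) *: (y - w) + s *: (x - w).
  by apply/rowP => j; rewrite !mxE; ring.
move: s01 => /andP[s0 s1].
rewrite addrC (le_trans (ler_normD _ _))// !normrZ !ger0_norm ?subr_ge0//.
by rewrite lerD// ler_piMl// lerBlDr lerDl.
Qed.

(** The retraction of the line onto the interval of radius [r] around [a]. It turns data given on an
    interval or a cube into data given everywhere, with the same Lipschitz constant. *)
Definition clamp1 (a r t : R) : R := Num.max (a - r) (Num.min (a + r) t).

Lemma clamp1_id a r t : `|t - a| <= r -> clamp1 a r t = t.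
Proof.
rewrite ler_norml => /andP[h1 h2]; rewrite /clamp1 min_r ?max_r//; lra.
Qed.

Lemma clamp1_cases a r t : 0 <= r ->
  [\/ clamp1 a r t = t /\ a - r <= t <= a + r, clamp1 a r t = a - r /\ t < a - r |
      clamp1 a r t = a + r /\ a + r < t].
Proof.
move=> r0; have [h|h] := ltP (a + r) t.
  by apply: Or33; rewrite /clamp1 min_l ?ltW// max_r//; lra.
rewrite /clamp1 min_r//; have [h'|h'] := ltP t (a - r).
  by apply: Or32.
by apply: Or31.
Qed.

Lemma clamp1_in a r t : 0 <= r -> `|clamp1 a r t - a| <= r.
Proof.
move=> r0; rewrite ler_norml; case: (clamp1_cases a t r0) => [[-> ?]|[-> ?]|[-> ?]]; lra.
Qed.

Lemma clamp1_lip a r s t : 0 <= r -> `|clamp1 a r s - clamp1 a r t| <= `|s - t|.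
Proof.
move=> r0; wlog st : s t / s <= t.
  by move=> H; have [/H//|/ltW/H] := leP s t; rewrite distrC (distrC s).
rewrite distrC (distrC s) (ger0_norm (_ : 0 <= t - s)) ?subr_ge0//.
rewrite ler_norml; case: (clamp1_cases a t r0) => [[-> ?]|[-> ?]|[-> ?]];
  case: (clamp1_cases a s r0) => [[-> ?]|[-> ?]|[-> ?]]; lra.
Qed.

Definition clamp m (z : 'rV[R]_m) r (x : 'rV[R]_m) : 'rV[R]_m :=
  \row_k clamp1 (z 0 k) r (x 0 k).

Lemma clamp_id m (z x : 'rV[R]_m) r : `|x - z| <= r -> clamp z r x = x.
Proof.
move=> h; apply/rowP => k; rewrite mxE clamp1_id//.
by apply: le_trans h; have := rv_ge (x - z) k; rewrite !mxE.
Qed.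

Lemma clamp_in m (z x : 'rV[R]_m) r : 0 <= r -> `|clamp z r x - z| <= r.
Proof. by move=> r0; apply: rv_le => // k; rewrite !mxE clamp1_in. Qed.

Lemma clamp_lip m (z x y : 'rV[R]_m) r : 0 <= r -> `|clamp z r x - clamp z r y| <= `|x - y|.
Proof.
move=> r0; apply: rv_le => // k; rewrite !mxE (le_trans (clamp1_lip _ _ _ r0))//.
by have := rv_ge (x - y) k; rewrite !mxE.
Qed.

Lemma clamp1_cont a r (t : R) : 0 <= r -> {for t, continuous (clamp1 a r)}.
Proof.
move=> r0; apply: (@lip_cont _ _ _ _ _ 1); exists 1 => // s _.
by rewrite mul1r clamp1_lip.
Qed.

End estimates.

(** * Ordinary differential equations *)

Section ode.
Context {R : realType}.
Implicit Types (a b s t r e B K C T M : R).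

(** The sequences [u k - 2 M / 2^k] and [u k + 2 M / 2^k] are monotone and squeeze the limit, the
    supremum of the lower one. The rate is explicit, hence uniform in any parameter, and stands in
    for convergence in a space of functions. *)
Lemma geo_cvg1 (u : nat -> R) M : 0 <= M ->
  (forall k, `|u k.+1 - u k| <= M * 2^-1 ^+ k) ->
  exists l, forall k, `|u k - l| <= 2 * M * 2^-1 ^+ k.
Proof.
move=> M0 H; pose v k := u k - 2 * M * 2^-1 ^+ k; pose w k := u k + 2 * M * 2^-1 ^+ k.
have h0 k : 0 <= M * 2^-1 ^+ k by rewrite mulr_ge0// exprn_ge0.
have vS k : v k <= v k.+1.
  have := H k; rewrite ler_norml => /andP[h1 h2]; rewrite /v exprS.
  have -> : 2 * M * (2^-1 * 2^-1 ^+ k) = M * 2^-1 ^+ k by field.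
  lra.
have wS k : w k.+1 <= w k.
  have := H k; rewrite ler_norml => /andP[h1 h2]; rewrite /w exprS.
  have -> : 2 * M * (2^-1 * 2^-1 ^+ k) = M * 2^-1 ^+ k by field.
  lra.
have vm : {homo v : i j / (i <= j)%N >-> i <= j} by apply: homo_leq => //; exact: le_trans.
have wm i j : (i <= j)%N -> w j <= w i.
  move=> ij; have : {homo (fun i => - w i) : i j / (i <= j)%N >-> i <= j}.
    by apply: homo_leq => //; [exact: le_trans|move=> k; rewrite lerN2].
  by move=> /(_ _ _ ij); rewrite lerN2.
have vw i j : v i <= w j.
  apply: le_trans (vm _ (maxn i j) (leq_maxl _ _)) _.
  apply: le_trans (wm _ (maxn i j) (leq_maxr _ _)).
  by rewrite /v /w lerD2l; have := h0 (maxn i j); lra.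
have ub k : ubound (range v) (w k) by move=> _ [i _ <-]; exact: vw.
exists (sup (range v)) => k; rewrite ler_norml; apply/andP; split.
  have : sup (range v) <= w k by apply: ge_sup; [exists (v 0%N), 0%N|exact: ub].
  by rewrite /w; lra.
have : v k <= sup (range v).
  by apply: ub_le_sup; [exists (w 0%N); exact: ub|exists k].
by rewrite /v; lra.
Qed.

Lemma geo_cvg m (u : nat -> 'rV[R]_m) M : 0 <= M ->
  (forall k, `|u k.+1 - u k| <= M * 2^-1 ^+ k) ->
  exists l, forall k, `|u k - l| <= 2 * M * 2^-1 ^+ k.
Proof.
move=> M0 H.
have /choice[l Hl] : forall i : 'I_m, exists l, forall k, `|u k 0 i - l| <= 2 * M * 2^-1 ^+ k.
  move=> i; apply: geo_cvg1 => // k; apply: le_trans (H k).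
  by have := rv_ge (u k.+1 - u k) i; rewrite !mxE.
exists (\row_i l i) => k; apply: rv_le => [|i].
  by rewrite !mulr_ge0// exprn_ge0.
by rewrite !mxE.
Qed.

Lemma half_pow_small M e : 0 < e -> exists k : nat, M * 2^-1 ^+ k < e.
Proof.
move=> e0; have [k Hk] : exists k : nat, `|M| / e < k%:R.
  by exists (Num.trunc (`|M| / e)).+1; rewrite truncnS_gt.
exists k; apply: le_lt_trans (_ : `|M| * 2^-1 ^+ k < _).
  by rewrite ler_wpM2r ?exprn_ge0// ler_norm.
rewrite exprVn ltr_pdivrMr ?exprn_gt0// mulrC -ltr_pdivrMr//.
by apply: lt_le_trans Hk _; rewrite -natrX ler_nat ltnW// ltn_expl.
Qed.

Lemma antideriv1 (f : R -> R) T x0 : 0 < T -> (forall t, {for t, continuous f}) ->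
  exists2 G : R -> R, G 0 = x0 & forall t, `|t| <= T -> is_derive t (1 : R) G (f t).
Proof.
move=> T0 cf.
(* Starting the integral at [- T - 1] makes every point of [[- T, T]] interior. *)
pose F x := Rintegral (@lebesgue_measure R) `[(- T - 1), x] f.
have D t : `|t| <= T -> is_derive t (1 : R) F (f t).
  rewrite ler_norml => /andP[t1 t2].
  have tu : t < T + 1 by lra.
  have [] := @continuous_FTC1_closed R f (- T - 1) t (T + 1) tu.
  - apply: continuous_compact_integrable; first exact: segment_compact.
    by apply: continuous_subspaceT => x; exact: cf.
  - lra.
  - exact: cf.
  by move=> d1 d2; split; [exact: d1|rewrite -derive1E; exact: d2].
exists (fun x => F x - F 0 + x0); first by rewrite subrr add0r.
move=> t /D /der_fd H; apply/der_fd => e /H[r r0 K]; exists r => // s /K.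
have -> : F s - F 0 + x0 - (F t - F 0 + x0) = F s - F t by ring.
by [].
Qed.

Lemma antideriv m (f : R -> 'rV[R]_m) T x0 : 0 < T ->
  (forall t, `|t| <= T -> {for t, continuous f}) ->
  exists2 G : R -> 'rV[R]_m, G 0 = x0 & forall t, `|t| <= T -> is_derive t (1 : R) G (f t).
Proof.
move=> T0 cf.
have H (k : 'I_m) : exists G : R -> R, G 0 = x0 0 k /\
   forall t, `|t| <= T -> is_derive t (1 : R) G (f (clamp1 0 T t) 0 k).
  have [|G G0 GD] := @antideriv1 (fun t => f (clamp1 0 T t) 0 k) T (x0 0 k) T0.
    move=> t; have : {for t, continuous (fun t => f (clamp1 0 T t))}.
      apply: continuous_comp; first exact: clamp1_cont (ltW T0).
      by apply: cf; have := clamp1_in 0 t (ltW T0); rewrite subr0.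
    by move/cont_rvP; apply.
  by exists G.
have [G HG] := choice H.
exists (fun t => \row_k G k t); first by apply/rowP => k; rewrite mxE (HG k).1.
move=> t tT; apply/der_rvP => k; under eq_fun do rewrite mxE.
by have := (HG k).2 t tT; rewrite clamp1_id// subr0.
Qed.

Lemma mvt0 m (f df : R -> 'rV[R]_m) T B : 0 <= T ->
  (forall s, `|s| <= T -> is_derive s (1 : R) f (df s)) ->
  (forall s, `|s| <= T -> `|df s| <= B) ->
  forall s t, `|s| <= T -> `|t| <= T -> `|f s - f t| <= B * `|s - t|.
Proof.
move=> T0 H1 H2 s t; rewrite !ler_norml.
by apply: mvt_rv => [u|u]; rewrite -ler_norml; [exact: H1|exact: H2].
Qed.

(** One integration step halves uniform distances on [[- T, T]], because [T * K <= 1/2]. The second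
    condition on [F] is what allows the integration: the right-hand side along a continuous curve is
    continuous. *)
Lemma picard m (F : R -> 'rV[R]_m -> 'rV[R]_m) K T x0 : 0 < T -> 0 <= K -> T * K <= 2^-1 ->
  (forall t x y, `|t| <= T -> `|F t x - F t y| <= K * `|x - y|) ->
  (forall Y : R -> 'rV[R]_m, (forall t, `|t| <= T -> {for t, continuous Y}) ->
     forall t, `|t| <= T -> {for t, continuous (fun s => F s (Y s))}) ->
  exists2 X : R -> 'rV[R]_m, X 0 = x0 &
    forall t, `|t| <= T -> is_derive t (1 : R) X (F t (X t)).
Proof.
move=> T0 K0 TK HL HC.
pose good (Y : R -> 'rV[R]_m) := forall t, `|t| <= T -> {for t, continuous Y}.
(* The integration step as a function on all curves; it is specified on those that are continuous at
   every point of the closed interval. *)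
have /choice[S HS] : forall Y : R -> 'rV[R]_m, exists Z : R -> 'rV[R]_m,
    good Y -> [/\ good Z, Z 0 = x0 & forall t, `|t| <= T -> is_derive t (1 : R) Z (F t (Y t))].
  move=> Y; have [gY|ngY] := pselect (good Y); last by exists Y.
  have [Z Z0 ZD] := antideriv x0 T0 (HC Y gY); exists Z => _; split => //.
  by move=> t /ZD; exact: der_cont.
pose X k := iter k S (cst x0).
have gX k : good (X k).
  elim: k => [|k IH]; first by move=> t _; exact: cst_continuous.
  by have [] := HS _ IH.
have X0 k : X k 0 = x0 by case: k => [//|k]; have [] := HS _ (gX k).
have XD k t : `|t| <= T -> is_derive t (1 : R) (X k.+1) (F t (X k t)).
  by have [_ _] := HS _ (gX k); apply.
have z0 : `|0 : R| <= T by rewrite normr0 ltW.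
have [M M0 HM] : exists2 M, 0 <= M & forall t, `|t| <= T -> `|X 1 t - X 0 t| <= M.
  have [||c cT Hc] := @EVT_max R (fun t => `|X 1 t - X 0 t|) (- T) T; first by lra.
    apply: continuous_in_subspaceT => t /set_mem; rewrite /= in_itv /= -ler_norml => tT.
    apply: continuous_comp; last exact: norm_continuous.
    exact: (cvgB (gX 1 t tT) (gX 0 t tT)).
  exists `|X 1 c - X 0 c| => // t tT; apply: Hc.
  by rewrite in_itv /= -ler_norml.
have stepk (Y Y' : R -> 'rV[R]_m) k : good Y -> good Y' -> 
    (forall t, `|t| <= T -> `|Y t - Y' t| <= k) ->
    forall t, `|t| <= T -> `|S Y t - S Y' t| <= k / 2.
  move=> gY gY' H t tT; have k0 : 0 <= k by apply: le_trans (H 0 z0).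
  have [_ Z0 ZD] := HS _ gY; have [_ Z0' ZD'] := HS _ gY'.
  have := @mvt0 m (fun t => S Y t - S Y' t) (fun t => F t (Y t) - F t (Y' t)) T (K * k) (ltW T0).
  move=> /(_ _ _ t 0 tT z0); rewrite Z0 Z0' subrr !subr0 => H'.
  apply: le_trans (H' _ _) _.
  - by move=> s sT; apply: is_deriveB; [exact: ZD|exact: ZD'].
  - by move=> s sT; rewrite (le_trans (HL _ _ _ sT))// ler_wpM2l// H.
  apply: (@le_trans _ _ (K * k * T)); first by rewrite ler_wpM2l// mulr_ge0.
  have -> : K * k * T = k * (T * K) by ring.
  by rewrite ler_wpM2l.
have Xstep k : forall t, `|t| <= T -> `|X k.+1 t - X k t| <= M * 2^-1 ^+ k.
  elim: k => [|k IH] t tT; first by rewrite expr0 mulr1 HM.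
  by have := stepk _ _ _ (gX k.+1) (gX k) IH t tT; rewrite exprSr mulrA.
have /choice[l Hl] : forall t, exists l, `|t| <= T -> forall k, `|X k t - l| <= 2 * M * 2^-1 ^+ k.
  move=> t; have [tT|ntT] := boolP (`|t| <= T); last by exists 0.
  by have [l Hl] := geo_cvg M0 (fun k => Xstep k t tT); exists l.
(* Clamping the argument makes the limit continuous from both sides at the end points, as [good]
   demands. *)
pose L t := l (clamp1 0 T t).
have cT t : `|clamp1 0 T t| <= T by have := clamp1_in 0 t (ltW T0); rewrite subr0.
have gL : good L.
  move=> t tT; apply/contP => e e0.
  have e3 : 0 < e / 3 by rewrite divr_gt0.
  have [k Hk] := half_pow_small (2 * M) e3.
  have : {for t, continuous (fun s => X k (clamp1 0 T s))}.
    by apply: continuous_comp; [exact: clamp1_cont (ltW T0)|exact: gX].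
  move=> /contP/(_ _ e3)[d d0 Hd]; exists d => // s /Hd sd.
  have -> : L s - L t = - (X k (clamp1 0 T s) - L s) + (X k (clamp1 0 T t) - L t)
      + (X k (clamp1 0 T s) - X k (clamp1 0 T t)).
    by apply/rowP => j; rewrite !mxE; ring.
  have -> : e = e / 3 + e / 3 + e / 3 by field.
  apply: le_trans (ler_normD _ _) _; apply: lerD => //.
  apply: le_trans (ler_normD _ _) _; rewrite normrN; apply: lerD.
    by apply: le_trans (Hl _ (cT s) k) _; exact: ltW.
  by apply: le_trans (Hl _ (cT t) k) _; exact: ltW.
have lE t : `|t| <= T -> L t = l t by move=> tT; rewrite /L clamp1_id// subr0.
have [gSL SL0 SLD] := HS _ gL.
have SLE t : `|t| <= T -> S L t = L t.
  move=> tT; apply/eqP; rewrite -subr_eq0 -normr_eq0; apply/eqP/le_anti.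
  rewrite normr_ge0 andbT leNgt; apply/negP => pos.
  have [k Hk] := half_pow_small (4 * M) pos.
  have H1 : `|S L t - X k.+1 t| <= 2 * M * 2^-1 ^+ k / 2.
    apply: stepk => // s sT; rewrite distrC lE//; exact: Hl.
  have H2 : `|X k.+1 t - L t| <= 2 * M * 2^-1 ^+ k.+1 by rewrite lE//; exact: Hl.
  have := le_trans (ler_normD _ _) (lerD H1 H2); rewrite subrKA exprS => H3.
  have P : 0 <= M * 2^-1 ^+ k by rewrite mulr_ge0// exprn_ge0.
  have Q : 2 * M * 2^-1 ^+ k / 2 + 2 * M * (2^-1 * 2^-1 ^+ k) = 2 * (M * 2^-1 ^+ k) by field.
  have Q' : 4 * M * 2^-1 ^+ k = 4 * (M * 2^-1 ^+ k) by ring.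
  rewrite Q in H3; rewrite Q' in Hk; lra.
(* [S L] agrees with [L] on the interval, but being an antiderivative it has two-sided derivatives
   at the end points as well. *)
exists (S L); first exact: SL0.
by move=> t tT; rewrite SLE//; exact: SLD.
Qed.

(** At a maximum [c] of the norm, the mean value inequality gives
    [|u c| <= |u 0| + T * (K * |u c| + e)], and [T * K <= 1/2] absorbs the middle term. Intervals
    this short are all that is used, and no exponential appears. *)
Lemma gronwall m (u du : R -> 'rV[R]_m) K T e : 0 <= T -> 0 <= K -> T * K <= 2^-1 ->
  (forall t, `|t| <= T -> is_derive t (1 : R) u (du t)) ->
  (forall t, `|t| <= T -> `|du t| <= K * `|u t| + e) ->
  forall t, `|t| <= T -> `|u t| <= 2 * (`|u 0| + T * e).
Proof.
move=> T0 K0 TK uD Hu.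
have [||c cT Hc] := @EVT_max R (fun t => `|u t|) (- T) T; first by lra.
  apply: continuous_in_subspaceT => t /set_mem; rewrite /= in_itv /= -ler_norml => tT.
  apply: continuous_comp; last exact: norm_continuous.
  exact: der_cont (uD t tT).
rewrite in_itv /= -ler_norml in cT.
have {}Hc t : `|t| <= T -> `|u t| <= `|u c| by move=> tT; apply: Hc; rewrite in_itv /= -ler_norml.
have z0 : `|0 : R| <= T by rewrite normr0.
have := @mvt0 m u du T (K * `|u c| + e) T0 uD.
move=> /(_ _ c 0 cT z0); rewrite subr0 => H.
have {}H : `|u c - u 0| <= (K * `|u c| + e) * `|c|.
  by apply: H => s sT; apply: le_trans (Hu s sT) _; rewrite lerD2r ler_wpM2l// Hc.
have B0 : 0 <= K * `|u c| + e by apply: le_trans (Hu c cT).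
have H1 : `|u c| <= `|u 0| + T * K * `|u c| + T * e.
  rewrite -{1}(subrK (u 0) (u c)) (le_trans (ler_normD _ _))// addrC -addrA lerD2l.
  apply: le_trans H _; apply: (@le_trans _ _ ((K * `|u c| + e) * T)).
    by rewrite ler_wpM2l.
  by rewrite mulrDl [T * K]mulrC [T * e]mulrC mulrAC.
have H2 : T * K * `|u c| <= 2^-1 * `|u c| by rewrite ler_wpM2r.
by move=> t /Hc H3; apply: le_trans H3 _; lra.
Qed.

End ode.

(** * Local flows: uniqueness and strict differentiability in the initial value *)

Section flow.
Context {R : realType}.
Implicit Types (a b s t r e d B K C T M L : R).

(** Induction along an interval: the supremum of the times up to which [P] holds cannot lie before
    [b]. The continuation of geodesics, of lifts and of differentiability goes through it. *)
Lemma real_ind (P : R -> Prop) a b : P a ->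
  (forall t, a <= t -> t < b -> (forall s, a <= s -> s <= t -> P s) ->
     exists2 e, 0 < e & forall s, t < s -> s < t + e -> s <= b -> P s) ->
  (forall t, a < t -> t <= b -> (forall s, a <= s -> s < t -> P s) -> P t) ->
  forall t, a <= t -> t <= b -> P t.
Proof.
move=> Pa Hr Hl t at_ tb.
pose S := [set u | a <= u /\ u <= b /\ forall s, a <= s -> s <= u -> P s].
have ab : a <= b by exact: le_trans at_ tb.
have Sa : S a.
  by split=> //; split=> // s as_ sa; have -> : s = a by apply: le_anti; rewrite sa.
have ubS : ubound S b by move=> u [_ [ub _]].
have acS : a <= sup S by apply: ub_le_sup => //; exists b.
have cbS : sup S <= b by apply: ge_sup => //; exists a.
have below s : a <= s -> s < sup S -> P s.
  move=> as_ sc; have [||u [au [ub Hu]] su] := @sup_adherent _ S (sup S - s).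
  - by rewrite subr_gt0.
  - by split; [exists a|exists b].
  by apply: Hu => //; rewrite opprB addrC subrK in su; exact: ltW.
have Pc : P (sup S).
  move: acS; rewrite le_eqVlt => /predU1P[<-//|ac]; exact: Hl.
have upto s : a <= s -> s <= sup S -> P s.
  by move=> as_; rewrite le_eqVlt => /predU1P[->//|]; exact: below.
move: cbS; rewrite le_eqVlt => /predU1P[cb|cb]; first by apply: upto => //; rewrite cb.
have [e e0 He] := Hr _ acS cb upto.
have : S (Num.min b (sup S + e / 2)).
  split; first by rewrite le_min ab /= (le_trans acS)// lerDl divr_ge0 ?ltW.
  split; first by rewrite ge_min lexx.
  move=> s as_; rewrite le_min => /andP[sb se].
  have [sc|cs] := leP s (sup S); first exact: upto.
  by apply: He => //; apply: le_lt_trans se _; rewrite ltrD2l ltr_pdivrMr// ltr_pMr ?ltr1n.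
move=> /(ub_le_sup (ex_intro _ b ubS)); rewrite leNgt lt_min cb /= ltrDl.
by rewrite divr_gt0.
Qed.

Lemma der_shift (W : normedModType R) (x : R -> W) t0 t v :
  is_derive (t0 + t) (1 : R) x v -> is_derive t (1 : R) (fun s => x (t0 + s)) v.
Proof.
move=> /der_fd H; apply/der_fd => e /H[d d0 K]; exists d => // s sd.
have := K (t0 + s); have -> : t0 + s - (t0 + t) = s - t by rewrite opprD addrACA subrr add0r.
exact.
Qed.

Lemma der_sum (W : normedModType R) (I : finType) (f : I -> R -> W) (df : I -> W) t :
  (forall i, is_derive t (1 : R) (f i) (df i)) ->
  is_derive t (1 : R) (fun s => \sum_i f i s) (\sum_i df i).
Proof.
move=> H; suff: forall l : seq I, is_derive t (1 : R) (fun s => \sum_(i <- l) f i s) (\sum_(i <- l) df i) by [].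
elim=> [|i l IH].
  by under eq_fun do rewrite big_nil; rewrite big_nil; exact: is_derive_cst.
by under eq_fun do rewrite big_cons; rewrite big_cons; apply: is_deriveD.
Qed.

Lemma cont_sum (V W : normedModType R) (I : finType) (f : I -> V -> W) (t : V) :
  (forall i, {for t, continuous (f i)}) -> {for t, continuous (fun v => \sum_i f i v)}.
Proof.
move=> H; suff: forall l : seq I, {for t, continuous (fun v => \sum_(i <- l) f i v)} by [].
elim=> [|i l IH].
  have -> : (fun v => \sum_(i <- [::]) f i v) = cst 0 by apply/funext => v; rewrite big_nil.
  exact: cst_continuous.
have -> : (fun v => \sum_(j <- i :: l) f j v) = fun v => f i v + \sum_(j <- l) f j v.
  by apply/funext => v; rewrite big_cons.
exact: (cvgD (H i) IH).
Qed.

Lemma ode_unique_near m (U : set 'rV[R]_m) (F : 'rV[R]_m -> 'rV[R]_m)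
    (x y : R -> 'rV[R]_m) t0 :
  open U -> ckv 1 U F -> U (x t0) -> x t0 = y t0 ->
  (\forall s \near t0, is_derive s (1 : R) x (F (x s))) ->
  (\forall s \near t0, is_derive s (1 : R) y (F (y s))) ->
  \forall s \near t0, x s = y s.
Proof.
move=> oU cF Ux xy /nearN_P[r1 r10 Dx] /nearN_P[r2 r20 Dy].
have [r [K [r0 K0 rU rK]]] := near_lip oU cF Ux.
have near_ball (z : R -> 'rV[R]_m) rz : 0 < rz -> z t0 = x t0 -> (forall s, `|s - t0| < rz -> is_derive s (1 : R) z (F (z s))) ->
   exists2 d, 0 < d & forall s, `|s - t0| < d -> `|z s - x t0| < r.
  move=> rz0 z0 Dz; have : {for t0, continuous z} by apply: der_cont (Dz _ _); rewrite subrr normr0.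
  move=> /contP/(_ (r / 2) (divr_gt0 r0 (ltr0n _ 2)))[d d0 H]; exists d => // s /H.
  by rewrite z0 => /le_lt_trans; apply; rewrite ltr_pdivrMr// ltr_pMr ?ltr1n.
have [d1 d10 H1] := near_ball x r1 r10 erefl Dx.
have [d2 d20 H2] := near_ball y r2 r20 (esym xy) Dy.
pose T := Num.min (Num.min (Num.min r1 r2) (Num.min d1 d2) / 2) (2^-1 / K).
have T0 : 0 < T by rewrite !lt_min !divr_gt0// !lt_min r10 r20 d10.
have TK : T * K <= 2^-1 by rewrite -ler_pdivlMr// ge_min lexx orbT.
have TT s : `|s| <= T -> [/\ `|t0 + s - t0| < r1, `|t0 + s - t0| < r2, `|t0 + s - t0| < d1 & `|t0 + s - t0| < d2].
  move=> sT; have : `|t0 + s - t0| < Num.min (Num.min r1 r2) (Num.min d1 d2).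
    rewrite addrAC subrr add0r; apply: le_lt_trans sT _.
    apply: le_lt_trans (_ : _ <= Num.min (Num.min r1 r2) (Num.min d1 d2) / 2) _; first by rewrite ge_min lexx.
    by rewrite ltr_pdivrMr// ltr_pMr ?ltr1n// !lt_min r10 r20 d10.
  by rewrite !lt_min => /andP[/andP[-> ->] /andP[-> ->]].
have G := @gronwall R m (fun s => x (t0 + s) - y (t0 + s)) (fun s => F (x (t0 + s)) - F (y (t0 + s))) K T 0 (ltW T0) (ltW K0) TK.
apply/nearN_P; exists T => // s sT; have := G _ _ (s - t0) (ltW sT).
rewrite addr0 xy subrr normr0 mulr0 add0r mulr0 subrKC => G'.
apply/eqP; rewrite -subr_eq0 -normr_le0; apply: G' => u uT; have [h1 h2 h3 h4] := TT u uT.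
  by apply: is_deriveB; apply: der_shift; [exact: Dx|exact: Dy].
by rewrite addr0; apply: rK; [exact: H1|exact: H2].
Qed.

(** Strict differentiability: [y] and [z] both vary. With an invertible [A] it gives local
    injectivity and surjectivity from information at the single point [x]. *)
Definition sdiff m p (f : 'rV[R]_m -> 'rV[R]_p) x (A : 'M[R]_(m, p)) :=
  forall e, 0 < e -> exists2 d, 0 < d & forall y z, `|y - x| < d -> `|z - x| < d ->
    `|f y - f z - (y - z) *m A| <= e * `|y - z|.

(** [A y] solves the variational equation along the trajectory of [y]. The difference between
    [Phi t x - Phi t x'] and its linearisation satisfies the same linear equation up to an error
    that [near_quad] bounds, and Gronwall's inequality then makes it small; hence the class C^2. *)
Lemma local_flow m (U : set 'rV[R]_m) (F : 'rV[R]_m -> 'rV[R]_m) (x0 : 'rV[R]_m) :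
  open U -> ckv 2 U F -> U x0 ->
  exists (T r L : R) (Phi : R -> 'rV[R]_m -> 'rV[R]_m) (A : 'rV[R]_m -> R -> 'M[R]_m),
  [/\ 0 < T, 0 < r, 0 < L &
  [/\ forall x, `|x - x0| < r -> Phi 0 x = x /\ forall t, `|t| <= T ->
         U (Phi t x) /\ is_derive t (1 : R) (Phi^~ x) (F (Phi t x)),
      forall t s x y, `|t| <= T -> `|s| <= T -> `|x - x0| < r -> `|y - x0| < r ->
         `|Phi t x - Phi s y| <= L * (`|t - s| + `|x - y|),
      forall y, `|y - x0| < r -> A y 0 = 1%:M /\ forall t, `|t| <= T -> forall w : 'rV[R]_m,
         is_derive t (1 : R) (fun t => w *m A y t) (w *m A y t *m jac F (Phi t y)) &
      forall y, `|y - x0| < r -> forall t, `|t| <= T -> sdiff (Phi t) y (A y t)]].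
Proof.
move=> oU cF Ux0.
have cF1 : ckv 1 U F by move=> k; exact: ckW.
have [r1 [K0 [r10 K00 rU rJ rQ]]] := near_quad oU cF Ux0.
pose K := m%:R * K0; have KK : 0 <= K by rewrite mulr_ge0// ltW.
have rL := jac_lip_on cF1 rU rJ.
pose rho := r1 / 2; have rho0 : 0 < rho by rewrite divr_gt0.
have rhor : rho < r1 by rewrite /rho ltr_pdivrMr// ltr_pMr ?ltr1n.
have x00 : `|x0 - x0| < r1 by rewrite subrr normr0.
pose B := `|F x0| + K * rho + 1.
have B0 : 0 < B by rewrite ltr_wpDl// addr_ge0// mulr_ge0// ltW.
have FB x : `|x - x0| <= rho -> `|F x| <= B.
  move=> xr; have := rL x x0 (le_lt_trans xr rhor) x00.
  move=> H; rewrite -(subrK (F x0) (F x)) (le_trans (ler_normD _ _))//.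
  rewrite addrC /B -addrA lerD2l (le_trans H)// -/K.
  by apply: ler_wpDr => //; rewrite ler_wpM2l.
(* The first bound makes Picard's iteration contract. The second keeps trajectories starting within
   [rho / 2] of [x0] inside the ball of radius [rho], where the truncated field is [F]. *)
pose T := Num.min (2^-1 / (K + 1)) (rho / 2 / B).
have K10 : 0 < K + 1 by rewrite ltr_wpDl.
have T0 : 0 < T by rewrite lt_min !divr_gt0.
have TK : T * K <= 2^-1.
  apply: (@le_trans _ _ (T * (K + 1))); first by rewrite ler_pM2l// lerDl.
  by rewrite -ler_pdivlMr// ge_min lexx.
have TB : T * B <= rho / 2 by rewrite -ler_pdivlMr// ge_min lexx orbT.
have z0 : `|0 : R| <= T by rewrite normr0 ltW.
pose Ft x := F (clamp x0 rho x).
have Ftlip x y : `|Ft x - Ft y| <= K * `|x - y|.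
  apply: le_trans (rL _ _ _ _) _; rewrite ?(le_lt_trans (clamp_in _ _ (ltW rho0)))//.
  by rewrite -/K ler_wpM2l// clamp_lip// ltW.
have FtB x : `|Ft x| <= B by apply: FB; exact: clamp_in (ltW rho0).
have FtC x : {for x, continuous Ft}.
  by apply: (@lip_cont _ _ _ _ _ K); exists 1 => // y _.
have /choice[X HX] : forall x, exists X : R -> 'rV[R]_m, X 0 = x /\
    forall t, `|t| <= T -> is_derive t (1 : R) X (Ft (X t)).
  move=> x; have [||X X0 XD] := @picard R m (fun _ => Ft) K T x T0 KK TK.
  - by move=> *; exact: Ftlip.
  - by move=> Y HY t tT; apply: continuous_comp; [exact: HY|exact: FtC].
  by exists X.
pose Phi t x := X x t.
have Phit s t x : `|s| <= T -> `|t| <= T -> `|Phi t x - Phi s x| <= B * `|t - s|.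
  by move=> sT tT; apply: (mvt0 (ltW T0) (HX x).2).
have Phiin t x : `|t| <= T -> `|x - x0| < rho / 2 -> `|Phi t x - x0| <= rho.
  move=> tT xr; have := Phit 0 t x z0 tT; rewrite subr0 {2}/Phi (HX x).1 => H.
  rewrite -(subrKA x) (le_trans (ler_normD _ _))// (splitr rho) lerD//; last exact: ltW.
  by apply: le_trans H _; apply: le_trans TB; rewrite mulrC ler_pM2r.
have PhiD t x : `|t| <= T -> `|x - x0| < rho / 2 ->
    is_derive t (1 : R) (Phi^~ x) (F (Phi t x)).
  by move=> tT xr; have := (HX x).2 t tT; rewrite /Ft clamp_id//; exact: Phiin.
have Phix t x y : `|t| <= T -> `|Phi t x - Phi t y| <= 2 * `|x - y|.
  move=> tT; have := @gronwall R m (fun t => Phi t x - Phi t y) (fun t => Ft (Phi t x) - Ft (Phi t y)) K T 0 (ltW T0) KK TK.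
  rewrite /Phi (HX x).1 (HX y).1 => /(_ _ _ t tT); rewrite mulr0 addr0; apply => s sT.
    by apply: is_deriveB; [exact: (HX x).2|exact: (HX y).2].
  by rewrite addr0.
have x0r : `|x0 - x0| < rho / 2 by rewrite subrr normr0 divr_gt0.
have UPhi t x : `|t| <= T -> `|x - x0| < rho / 2 -> U (Phi t x).
  by move=> tT xr; apply: rU; apply: le_lt_trans rhor; exact: Phiin.
have /choice[A HA] : forall y0, exists A : R -> 'M[R]_m, `|y0 - x0| < rho / 2 ->
  [/\ A 0 = 1%:M, forall t, `|t| <= T -> forall w : 'rV[R]_m,
         is_derive t (1 : R) (fun t => w *m A t) (w *m A t *m jac F (Phi t y0)) &
      forall t, `|t| <= T -> sdiff (Phi t) y0 (A t)].
  move=> y0; have [y0r|ny0r] := boolP (`|y0 - x0| < rho / 2); last by exists (fun=> 0).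
  have /choice[xi Hxi] : forall a : 'I_m, exists X : R -> 'rV[R]_m, X 0 = delta_mx 0 a /\
      forall t, `|t| <= T -> is_derive t (1 : R) X (X t *m jac F (Phi t y0)).
    move=> a; have [||X' X0 XD] := @picard R m (fun t xi => xi *m jac F (Phi t y0)) K T (delta_mx 0 a) T0 KK TK.
    - move=> t x y tT; rewrite -mulmxBl (le_trans (mulmx_le _ _))// ler_wpM2r//.
      by rewrite ler_wpM2l// rJ// (le_lt_trans (Phiin _ _ tT y0r)).
    - move=> Y HY t tT; apply/cont_rvP => k.
      have -> : (fun s => (Y s *m jac F (Phi s y0)) 0 k) =
         (fun s => \sum_i Y s 0 i * jac F (Phi s y0) i k) by apply/funext => s; rewrite mxE.
      apply: cont_sum => i.
      have c1 : {for t, continuous (fun s => Y s 0 i)} by move: (HY t tT) => /cont_rvP.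
      suff c2 : {for t, continuous (fun s => jac F (Phi s y0) i k)} by exact: (cvgM c1 c2).
      have -> : (fun s => jac F (Phi s y0) i k) = partial i (fun x => F x 0 k) \o Phi^~ y0.
        by apply/funext => s; rewrite mxE.
      apply: (@continuous_comp _ _ _ (Phi^~ y0) (partial i (fun x => F x 0 k))).
        exact: der_cont (PhiD _ _ tT y0r).
      by apply: ck_cont (ck_partial i oU (cF1 k)) _; exact: UPhi.
    by exists X'.
  pose A t : 'M[R]_m := \matrix_(a, k) xi a t 0 k.
  have AE (w : 'rV[R]_m) t : w *m A t = \sum_a w 0 a *: xi a t.
    by apply/rowP => k; rewrite mxE summxE; apply: eq_bigr => a _; rewrite !mxE.
  have AD t : `|t| <= T -> forall w : 'rV[R]_m,
     is_derive t (1 : R) (fun t => w *m A t) (w *m A t *m jac F (Phi t y0)).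
    move=> tT w; rewrite AE mulmx_suml; under eq_fun do rewrite AE.
    apply: der_sum => a; rewrite -scalemxAl.
    have /der_fd H := (Hxi a).2 t tT; apply/der_fd.
    have := @fd_comp R _ _ _ _ (fun v => w 0 a *: v) t _ (fun v => w 0 a *: v) `|xi a t *m jac F (Phi t y0)| `|w 0 a| H.
    move=> H'; apply: fd_eq (H' _ _ _ _) _.
    - by move=> e e0; exists 1 => // y _; rewrite -!scalerBr subrr scaler0 normr0 mulr_ge0// ltW.
    - by move=> h; rewrite normrZ mulrC.
    - by move=> h; rewrite normrZ.
    - by move=> u v; rewrite scalerBr.
    - by move=> h /=; rewrite !scalerA mulrC.
  have A0 : A 0 = 1%:M.
    by apply/matrixP => a k; rewrite !mxE (Hxi a).1 !mxE eqxx /= eq_sym.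
  exists A => _; split => //.
  move=> t tT e e0.
  pose C := 2 * (T * (K0 * 2 * 2)) + 1.
  have C0 : 0 < C by rewrite ltr_wpDl// !mulr_ge0// ltW.
  exists (Num.min (rho / 2 - `|y0 - x0|) (e / C / 2)).
    by rewrite lt_min subr_gt0 y0r !divr_gt0.
  move=> x y; rewrite !lt_min => /andP[xr0 xe] /andP[yr0 ye].
  have inb z : `|z - y0| < rho / 2 - `|y0 - x0| -> `|z - x0| < rho / 2.
    by move=> zr; rewrite -(subrKA y0) (le_lt_trans (ler_normD _ _))// -ltrBrDr.
  have xr := inb _ xr0; have yr := inb _ yr0.
  pose E := K0 * (2 * (`|x - y0| + `|y - y0|)) * (2 * `|x - y|).
  have := @gronwall R m (fun t => Phi t x - Phi t y - (x - y) *m A t)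
     (fun t => F (Phi t x) - F (Phi t y) - (x - y) *m A t *m jac F (Phi t y0)) K T E (ltW T0) KK TK.
  move=> /(_ _ _ t tT) H.
  apply: le_trans (H _ _) _ => [s sT|s sT|].
  - by apply: is_deriveB; [apply: is_deriveB; exact: PhiD|exact: AD].
  - have -> : F (Phi s x) - F (Phi s y) - (x - y) *m A s *m jac F (Phi s y0) =
      (Phi s x - Phi s y - (x - y) *m A s) *m jac F (Phi s y0) +
      (F (Phi s x) - F (Phi s y) - (Phi s x - Phi s y) *m jac F (Phi s y0)).
      set p := Phi s x - Phi s y; set w := (x - y) *m A s.
      by rewrite (mulmxBl p w) [RHS]addrC addrA subrK.
    apply: le_trans (ler_normD _ _) _; apply: lerD.
      apply: le_trans (mulmx_le _ _) _; rewrite ler_wpM2r// ler_wpM2l// rJ//.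
      exact: le_lt_trans (Phiin _ _ sT y0r) rhor.
    have in1 z : `|z - x0| < rho / 2 -> `|Phi s z - x0| < r1.
      by move=> zr; exact: le_lt_trans (Phiin _ _ sT zr) rhor.
    apply: le_trans (rQ _ _ _ (in1 _ y0r) (in1 _ xr) (in1 _ yr)) _.
    apply: ler_pM => //; first by rewrite mulr_ge0 ?addr_ge0// ltW.
      by rewrite ler_pM2l// mulrDr; apply: lerD; exact: Phix.
    exact: Phix.
  rewrite /Phi (HX x).1 (HX y).1 A0 mulmx1 subrr normr0 add0r /E.
  apply: (@le_trans _ _ (C * (`|x - y0| + `|y - y0|) * `|x - y|)).
    have -> : 2 * (T * (K0 * (2 * (`|x - y0| + `|y - y0|)) * (2 * `|x - y|))) =
      2 * (T * (K0 * 2 * 2)) * (`|x - y0| + `|y - y0|) * `|x - y| by ring.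
    by rewrite ler_wpM2r// ler_wpM2r ?addr_ge0// lerDl.
  rewrite ler_wpM2r// mulrC -ler_pdivlMr//.
  by rewrite [leRHS]splitr; apply/ltW/ltrD.
exists T, (rho / 2), (B + 2), Phi, A; split; rewrite ?divr_gt0//; first by rewrite addr_gt0.
split.
- move=> x xr; split; first exact: (HX x).1.
  by move=> t tT; split; [exact: UPhi|exact: PhiD].
- move=> t s x y tT sT xr yr.
  rewrite -(subrKA (Phi s x)) (le_trans (ler_normD _ _))// mulrDr.
  apply: lerD.
    by apply: le_trans (Phit _ _ _ sT tT) _; rewrite ler_wpM2r// lerDl.
  by apply: le_trans (Phix _ _ _ sT) _; rewrite ler_wpM2r// lerDr ltW.
- by move=> y /HA[].
- by move=> y /HA[].
Qed.

End flow.

(** * Christoffel symbols *)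

Section christoffel_calculus.
Context {R : realType}.
Implicit Types (a b s t r e d B K C T M L : R).

Definition derm m p (A : R -> 'M[R]_(m, p)) t (A' : 'M[R]_(m, p)) :=
  forall i j, is_derive t (1 : R) (fun s => A s i j) (A' i j).

Lemma derm_row m (A : R -> 'rV[R]_m) t A' : derm A t A' <-> is_derive t (1 : R) A A'.
Proof.
split=> [H|/der_rvP H i j]; last by rewrite (ord1 i); exact: H.
by apply/der_rvP => k; exact: H.
Qed.

Lemma derm_mul m p k (A : R -> 'M[R]_(m, p)) (B : R -> 'M[R]_(p, k)) t A' (B' : 'M[R]_(p, k)) :
  derm A t A' -> derm B t B' ->
  derm (fun s => A s *m B s) t (A' *m B t + A t *m B').
Proof.
move=> HA HB i j; rewrite !mxE -big_split /=.
have -> : (fun s => (A s *m B s) i j) = (fun s => \sum_l A s i l * B s l j).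
  by apply/funext => s; rewrite mxE.
apply: der_sum => l; have := is_deriveM (HA i l) (HB l j).
by move/is_derive_eq; apply; rewrite /GRing.scale /= addrC [B t l j * _]mulrC.
Qed.

Lemma derm_tr m p (A : R -> 'M[R]_(m, p)) t A' : derm A t A' -> derm (fun s => (A s)^T) t A'^T.
Proof.
move=> H i j; rewrite mxE; have -> : (fun s => (A s)^T i j) = fun s => A s j i.
  by apply/funext => s; rewrite mxE.
exact: H.
Qed.

Lemma derm_cst m p (A : 'M[R]_(m, p)) t : derm (fun=> A) t 0.
Proof. by move=> i j; rewrite mxE; exact: is_derive_cst. Qed.

Lemma derm_near m p (A B : R -> 'M[R]_(m, p)) t A' :
  (\forall s \near t, A s = B s) -> derm A t A' -> derm B t A'.
Proof.
move=> AB H i j; apply: der_near (H i j).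
by apply: filterS AB => s ->.
Qed.

Lemma derm_unique m p (A : R -> 'M[R]_(m, p)) t A1 A2 : derm A t A1 -> derm A t A2 -> A1 = A2.
Proof.
move=> H1 H2; apply/matrixP => i j.
by rewrite -(derE (H1 i j)) (derE (H2 i j)).
Qed.

(** Directional derivative of a matrix-valued map at [x] along [w]. *)
Definition dmat m p k (A : 'rV[R]_m -> 'M[R]_(p, k)) (x w : 'rV[R]_m) : 'M[R]_(p, k) :=
  \matrix_(i, j) \sum_l w 0 l * partial l (fun z => A z i j) x.

Definition ckm N m p k (U : set 'rV[R]_m) (A : 'rV[R]_m -> 'M[R]_(p, k)) :=
  forall i j, ck N U (fun x => A x i j).

Lemma derm_dmat N m p k (U : set 'rV[R]_m) (A : 'rV[R]_m -> 'M[R]_(p, k)) (c : R -> 'rV[R]_m) t v :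
  ckm N.+1 U A -> U (c t) -> is_derive t (1 : R) c v ->
  derm (fun s => A (c s)) t (dmat A (c t) v).
Proof.
move=> cA Uc cv i j; have := der_comp (ck_hg (cA i j) Uc) cv.
rewrite /dot mxE; under [X in is_derive _ _ _ X -> _]eq_bigr do rewrite mxE.
by [].
Qed.

Lemma partial_ext m (f g : 'rV[R]_m -> R) (a : 'I_m) x N (U : set 'rV[R]_m) : open U ->
  ck N.+1 U f -> U x -> (forall z, U z -> f z = g z) -> partial a f x = partial a g x.
Proof.
move=> oU cf Ux fg; have cg : ck N.+1 U g by apply: ck_eq cf.
have Hf := ck_hg cf Ux; rewrite (hg_partial _ Hf); apply/esym/hg_partial.
apply: fd_near Hf; apply: filterS fg _; exact: open_nbhs_nbhs.
Qed.

(** The second difference [D h u v] is symmetric in its two directions. The mean value theorem along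
    [v], combined with the differentiability of [partial l f] at [x], shows that it equals [h^2]
    times either mixed derivative up to [o(h^2)]. *)
Lemma schwarz m (U : set 'rV[R]_m) (f : 'rV[R]_m -> R) x (i j : 'I_m) :
  open U -> ck 2 U f -> U x -> partial i (partial j f) x = partial j (partial i f) x.
Proof.
move=> oU cf Ux.
pose ei : 'rV[R]_m := delta_mx 0 i; pose ej : 'rV[R]_m := delta_mx 0 j.
have n1 (k : 'I_m) : `|(delta_mx 0 k : 'rV[R]_m)| <= 1.
  by apply: rv_le => // l; rewrite mxE eqxx /=; case: eqP => _; rewrite ?normr1 ?normr0.
have /nearN_P[r r0 rU] : nbhs x U by exact: open_nbhs_nbhs.
(* second difference along the directions ei, ej *)
pose D h (u v : 'rV[R]_m) := f (x + h *: u + h *: v) - f (x + h *: v) - (f (x + h *: u) - f x).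
have key (k l : 'I_m) e : 0 < e -> exists2 d, 0 < d & forall h, 0 < h -> h < d ->
    `|D h (delta_mx 0 k) (delta_mx 0 l) - h ^+ 2 * partial k (partial l f) x| <= e * h ^+ 2.
  move=> e0; have [d d0 K] := ck_hg (ck_partial l oU cf) Ux (divr_gt0 e0 (ltr0n _ 4)).
  exists (Num.min d r / 2); first by rewrite divr_gt0// lt_min d0.
  move=> h h0 hd; pose u : 'rV[R]_m := delta_mx 0 k; pose v : 'rV[R]_m := delta_mx 0 l.
  pose phi s := f (x + h *: u + s *: (h *: v)) - f (x + s *: (h *: v)).
  have cf1 : ck 1 U f by exact: ckW.
  have near c s : 0 <= c <= 1 -> 0 <= s <= 1 ->
      `|x + c *: (h *: u) + s *: (h *: v) - x| <= 2 * h /\ `|x + c *: (h *: u) + s *: (h *: v) - x| < Num.min d r.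
    move=> /andP[c0 c1] /andP[s0 s1].
    have H : `|x + c *: (h *: u) + s *: (h *: v) - x| <= 2 * h.
      have -> : x + c *: (h *: u) + s *: (h *: v) - x = c *: (h *: u) + s *: (h *: v).
        by apply/rowP => q; rewrite !mxE; ring.
      apply: le_trans (ler_normD _ _) _; rewrite !normrZ !(ger0_norm (ltW h0)) !ger0_norm//.
      have h1 : c * (h * `|u|) <= h.
        rewrite -[leRHS]mul1r ler_pM ?mulr_ge0 ?(ltW h0)//.
        by rewrite ler_piMr ?(ltW h0)// /u n1.
      have h2 : s * (h * `|v|) <= h by rewrite -[leRHS]mul1r ler_pM ?mulr_ge0 ?(ltW h0)// ler_piMr ?(ltW h0)// /v n1.
      lra.
    split => //; apply: le_lt_trans H _; rewrite mulrC -ltr_pdivlMr//.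
  have nU c s : 0 <= c <= 1 -> 0 <= s <= 1 -> U (x + c *: (h *: u) + s *: (h *: v)).
    by move=> c01 s01; apply: rU; have [_] := near c s c01 s01; rewrite lt_min => /andP[].
  pose g z := partial l f z.
  have Dphi s : 0 <= s <= 1 -> is_derive s (1 : R) (fun s => phi s - s * (h ^+ 2 * partial k (partial l f) x))
     (h * (g (x + h *: u + s *: (h *: v)) - g (x + s *: (h *: v))) - h ^+ 2 * partial k (partial l f) x).
    move=> s01.
    have L (y : 'rV[R]_m) : U (y + s *: (h *: v)) -> is_derive s (1 : R) (fun s => f (y + s *: (h *: v))) (h * g (y + s *: (h *: v))).
      move=> Uy; have := @der_comp R _ f (fun s => y + s *: (h *: v)) s _ (h *: v) (ck_hg cf1 Uy).
      have Hd : is_derive s (1 : R) (fun s => y + s *: (h *: v)) (h *: v).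
        by have := der_segment y (y + h *: v) s; rewrite addrAC subrr add0r.
      by move=> /(_ Hd) /is_derive_eq; apply; rewrite dotZl dot_delta mxE.
    apply: is_deriveB; first rewrite mulrBr; first apply: is_deriveB.
    - by apply: L; have := nU 1 s; rewrite scale1r; apply => //; rewrite ler01 lexx.
    - by apply: L; have := nU 0 s; rewrite scale0r addr0; apply => //; rewrite lexx ler01.
    - by apply/der_fd => e' e'0; exists 1 => // z _; rewrite /GRing.scale /= -!mulrBl subrr mul0r normr0 mulr_ge0// ltW.
  have := @mvt_scalar R _ _ 0 1 (e * h ^+ 2) ler01 Dphi.
  rewrite /phi !scale1r !scale0r !addr0 mul0r subr0 mul1r.
  rewrite (_ : _ - _ - (_ - _) = D h u v - h ^+ 2 * partial k (partial l f) x); last first.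
    by rewrite /D; ring.
  rewrite subr0 mulr1; apply => s s01.
  have i1 : 0 <= (1 : R) <= 1 by rewrite ler01 lexx.
  have i0 : 0 <= (0 : R) <= 1 by rewrite ler01 lexx.
  have [n1a n1b] := near 1 s i1 s01.
  have {}n1b : `|x + h *: u + s *: (h *: v) - x| < d by move: n1b; rewrite scale1r lt_min => /andP[].
  have [n2a n2b] := near 0 s i0 s01.
  have {}n2b : `|x + s *: (h *: v) - x| < d by move: n2b; rewrite scale0r addr0 lt_min => /andP[].
  rewrite scale1r in n1a; rewrite scale0r addr0 in n2a.
  have {}K1 := K _ n1b; have {}K2 := K _ n2b.
  have E : dot (x + h *: u + s *: (h *: v) - x) (\row_c partial c (partial l f) x)
     - dot (x + s *: (h *: v) - x) (\row_c partial c (partial l f) x) = h * partial k (partial l f) x.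
    rewrite -dotBl (_ : _ - _ = h *: u) ?dotZl ?dot_delta ?mxE//.
    by apply/rowP => c; rewrite !mxE; ring.
  set A := g (x + h *: u + s *: (h *: v)); set A' := g (x + s *: (h *: v)).
  rewrite (_ : h * (A - A') - h ^+ 2 * partial k (partial l f) x =
    h * ((A - partial l f x - dot (x + h *: u + s *: (h *: v) - x) (\row_c partial c (partial l f) x))
       - (A' - partial l f x - dot (x + s *: (h *: v) - x) (\row_c partial c (partial l f) x)))); last first.
    by rewrite expr2 -mulrA -E; ring.
  rewrite normrM (gtr0_norm h0) expr2 mulrCA ler_pM2l//.
  apply: le_trans (ler_normB _ _) _.
  apply: le_trans (lerD K1 K2) _.
  have e3 : 0 <= e / 4 by rewrite divr_ge0// ltW.
  apply: le_trans (lerD (ler_wpM2l e3 n1a) (ler_wpM2l e3 n2a)) _.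
  by have -> : e / 4 * (2 * h) + e / 4 * (2 * h) = e * h by field.
suff H e : 0 < e -> `|partial i (partial j f) x - partial j (partial i f) x| <= e.
  apply/eqP; rewrite -subr_eq0 -normr_le0; apply/ler_addgt0Pl => e /H; by rewrite addr0.
move=> e0; have e2 : 0 < e / 2 by rewrite divr_gt0.
have [d1 d10 K1] := key i j _ e2; have [d2 d20 K2] := key j i _ e2.
pose h := Num.min d1 d2 / 2.
have h0 : 0 < h by rewrite divr_gt0// lt_min d10.
have hd : h < Num.min d1 d2 by rewrite ltr_pdivrMr// ltr_pMr ?ltr1n// lt_min d10.
have /andP[hd1 hd2] : (h < d1) && (h < d2) by rewrite -lt_min.
have Dsym : D h ei ej = D h ej ei by rewrite /D (addrAC x); ring.
have h20 : 0 < h ^+ 2 by rewrite exprn_gt0.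
rewrite -(ler_pM2l h20) -{1}(gtr0_norm h20) -normrM.
rewrite (_ : h ^+ 2 * _ = (D h ej ei - h ^+ 2 * partial j (partial i f) x) - (D h ei ej - h ^+ 2 * partial i (partial j f) x)); last first.
  rewrite Dsym; move: (D h ej ei) (partial i (partial j f) x) (partial j (partial i f) x) => P Q S.
  by ring.
apply: le_trans (ler_normB _ _) _; apply: le_trans (lerD (K2 h h0 hd2) (K1 h h0 hd1)) _.
by rewrite -mulrDl -splitr mulrC.
Qed.

(** [christoffel] for an arbitrary matrix function [g], detached from the manifold so that two
    coordinate expressions of one metric can be compared. *)
Definition chr n (g : 'rV[R]_n -> 'M[R]_n) (k a b : 'I_n) (x : 'rV[R]_n) : R :=
  2^-1 * \sum_l invmx (g x) k l *
    (partial a (fun z => g z b l) x + partial b (fun z => g z a l) x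
     - partial l (fun z => g z a b) x).

(** The Christoffel symbols as a bilinear map: the geodesic equation reads
    [x'' = - gam g x x' x']. *)
Definition gam n (g : 'rV[R]_n -> 'M[R]_n) (x v w : 'rV[R]_n) : 'rV[R]_n :=
  \row_k \sum_a \sum_b chr g k a b x * v 0 a * w 0 b.

Lemma gam_scale n (g : 'rV[R]_n -> 'M[R]_n) x v w a b :
  gam g x (a *: v) (b *: w) = (a * b) *: gam g x v w.
Proof.
apply/rowP => k; rewrite !mxE mulr_sumr; apply: eq_bigr => c _.
by rewrite mulr_sumr; apply: eq_bigr => d _; rewrite !mxE; ring.
Qed.

Lemma chr_lower n (g : 'rV[R]_n -> 'M[R]_n) x (a b l : 'I_n) :
  g x \in unitmx -> (g x)^T = g x ->
  \sum_k chr g k a b x * g x k l = 2^-1 * (partial a (fun z => g z b l) x + partial b (fun z => g z a l) x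
     - partial l (fun z => g z a b) x).
Proof.
move=> gu gs; pose X := \row_l (partial a (fun z => g z b l) x + partial b (fun z => g z a l) x
     - partial l (fun z => g z a b) x).
have E : (X *m (invmx (g x))^T *m g x) 0 l = X 0 l.
  by rewrite trmx_inv gs mulmxKV.
rewrite mxE in E; rewrite -[X in _ = _ * X](_ : X 0 l = _); last by rewrite mxE.
rewrite -E mulr_sumr; apply: eq_bigr => k _; rewrite /chr -mulrA; congr (_ * _).
rewrite mxE mulr_suml mulr_suml; apply: eq_bigr => c _; rewrite !mxE; ring.
Qed.

(** Paired with [u] through the metric, the Christoffel term contains derivatives of [g] alone and
    the inverse matrix is gone. The change of charts and the energy identities are computed in this
    form. *)
Lemma gam_lower n (g : 'rV[R]_n -> 'M[R]_n) x v u :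
  g x \in unitmx -> (g x)^T = g x ->
  (gam g x v v *m g x *m u^T) = v *m dmat g x v *m u^T - 2^-1 *: (v *m dmat g x u *m v^T).
Proof.
move=> gu gs; apply/matrixP => i j; rewrite !mxE (ord1 i) (ord1 j).
have -> : \sum_l (gam g x v v *m g x) 0 l * u^T l 0 =
  \sum_l \sum_a \sum_b 2^-1 * (partial a (fun z => g z b l) x + partial b (fun z => g z a l) x
     - partial l (fun z => g z a b) x) * v 0 a * v 0 b * u 0 l.
  apply: eq_bigr => l _; rewrite !mxE mulr_suml.
  under eq_bigr do rewrite mxE mulr_suml mulr_suml.
  rewrite exchange_big /=; apply: eq_bigr => a _.
  under eq_bigr do rewrite mulr_suml mulr_suml.
  rewrite exchange_big /=; apply: eq_bigr => b _.
  rewrite -(chr_lower a b l gu gs) !mulr_suml; apply: eq_bigr => k _; ring.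
have -> : \sum_l (v *m dmat g x v) 0 l * u^T l 0 =
  \sum_l \sum_a \sum_b partial a (fun z => g z b l) x * v 0 a * v 0 b * u 0 l.
  apply: eq_bigr => l _; rewrite !mxE mulr_suml exchange_big /=.
  apply: eq_bigr => b _; rewrite mxE mulr_sumr mulr_suml; apply: eq_bigr => a _; ring.
have -> : 2^-1 * \sum_l (v *m dmat g x u) 0 l * v^T l 0 =
  \sum_l \sum_a \sum_b 2^-1 * partial l (fun z => g z a b) x * v 0 a * v 0 b * u 0 l.
  rewrite mulr_sumr.
  under eq_bigr => b _.
    rewrite !mxE mulr_suml mulr_sumr.
    under eq_bigr => a _ do rewrite mxE mulr_sumr mulr_suml mulr_sumr.
    over.
  rewrite exchange_big /= [RHS]exchange_big /=; apply: eq_bigr => a _.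
  rewrite [RHS]exchange_big /=; apply: eq_bigr => b _; apply: eq_bigr => l _; ring.
rewrite -sumrN -big_split; apply: eq_bigr => l _ /=.
have sw : \sum_a \sum_b 2^-1 * partial b (fun z => g z a l) x * v 0 a * v 0 b * u 0 l =
   \sum_a \sum_b 2^-1 * partial a (fun z => g z b l) x * v 0 a * v 0 b * u 0 l.
  by rewrite exchange_big /=; apply: eq_bigr => a _; apply: eq_bigr => b _; ring.
transitivity (\sum_a \sum_b 2^-1 * partial a (fun z => g z b l) x * v 0 a * v 0 b * u 0 l +
  \sum_a \sum_b 2^-1 * partial b (fun z => g z a l) x * v 0 a * v 0 b * u 0 l -
  \sum_a \sum_b 2^-1 * partial l (fun z => g z a b) x * v 0 a * v 0 b * u 0 l).
  rewrite -sumrN -!big_split; apply: eq_bigr => a _ /=.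
  by rewrite -sumrN -!big_split; apply: eq_bigr => b _ /=; ring.
rewrite sw; congr (_ - _); rewrite -big_split; apply: eq_bigr => a _ /=.
by rewrite -big_split; apply: eq_bigr => b _ /=; field.
Qed.

Lemma half_cancel (A B C P : 'M[R]_1) :
  A + B + P - 2^-1 *: (P + C + P) = A + (B - 2^-1 *: C).
Proof. by apply/matrixP => i j; rewrite !mxE; field. Qed.

(* Change of coordinates for the geodesic equation: the second derivatives of
   the transition psi cancel by Schwarz. *)
Lemma gam_trans n (W : set 'rV[R]_n) (g h : 'rV[R]_n -> 'M[R]_n) (psi : 'rV[R]_n -> 'rV[R]_n) x v
    (V : set 'rV[R]_n) :
  open W -> W x -> ckv 2 W psi -> ckm 1 W g -> ckm 1 V h -> (forall z, W z -> V (psi z)) ->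
  (forall z, W z -> g z = jac psi z *m h (psi z) *m (jac psi z)^T) ->
  g x \in unitmx -> (g x)^T = g x -> h (psi x) \in unitmx -> (h (psi x))^T = h (psi x) ->
  gam g x v v *m jac psi x = gam h (psi x) (v *m jac psi x) (v *m jac psi x) + v *m dmat (jac psi) x v.
Proof.
move=> oW Wx cpsi cg ch WV gh gu gs hu hs.
have cpsi1 : ckv 1 W psi by move=> k; exact: ckW.
have cJ : ckm 1 W (jac psi).
  by move=> i j; apply: ck_eq (ck_partial i oW (cpsi j)) => // z _; rewrite mxE.
pose J := jac psi x; pose D w := dmat (jac psi) x w; pose H w := dmat h (psi x) (w *m J).
have Dsym u w : u *m D w = w *m D u.
  apply/rowP => k; rewrite !mxE.
  under eq_bigr do rewrite mxE mulr_sumr; rewrite exchange_big /=.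
  apply: eq_bigr => l _; rewrite mxE mulr_sumr; apply: eq_bigr => c _.
  rewrite mulrCA; congr (_ * (_ * _)).
  have E (a : 'I_n) : (fun z => jac psi z a k) = partial a (fun z => psi z 0 k).
    by apply/funext => z; rewrite mxE.
  by rewrite (E l) (E c); exact: (schwarz l c oW (cpsi k) Wx).
have gder w : dmat g x w = D w *m h (psi x) *m J^T + J *m H w *m J^T + J *m h (psi x) *m (D w)^T.
  pose c s := x + s *: w.
  have c0 : c 0 = x by rewrite /c scale0r addr0.
  have cd : is_derive (0 : R) (1 : R) c w.
    by have := der_segment x (x + w) 0; rewrite addrAC subrr add0r.
  have Wc : W (c 0) by rewrite c0.
  have H1 := derm_dmat cg Wc cd.
  have H2 := derm_dmat cJ Wc cd.
  have Hp : is_derive (0 : R) (1 : R) (fun s => psi (c s)) (w *m jac psi (c 0)) by exact: der_jac cpsi1 Wc cd.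
  have H3 := derm_dmat (c := fun s => psi (c s)) ch (WV _ Wc) Hp.
  have H4 := derm_mul (derm_mul H2 H3) (derm_tr H2).
  rewrite c0 in H1 H2 H3 H4; rewrite -/J mulmxDl in H4; apply: derm_unique H1 _.
  apply: derm_near H4; have : \forall s \near (0 : R), W (c s).
    have : nbhs (c 0) W by apply: open_nbhs_nbhs.
    exact: (der_cont cd).
  by apply: filterS => s Ws; rewrite gh.
have Hd (u : 'rV[R]_n) : gam g x v v *m g x *m u^T =
   (v *m D v + gam h (psi x) (v *m J) (v *m J)) *m (h (psi x) *m J^T) *m u^T.
  rewrite (gam_lower v u gu gs).
  have -> : (v *m D v + gam h (psi x) (v *m J) (v *m J)) *m (h (psi x) *m J^T) *m u^T =
    v *m D v *m h (psi x) *m (u *m J)^T + gam h (psi x) (v *m J) (v *m J) *m h (psi x) *m (u *m J)^T.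
    by rewrite trmx_mul !mulmxDl !mulmxA.
  have T w : v *m dmat g x w *m (u : 'rV[R]_n)^T = v *m D w *m h (psi x) *m (u *m J)^T +
     v *m J *m H w *m (u *m J)^T + v *m J *m h (psi x) *m (u *m D w)^T.
    by rewrite gder !(mulmxDr, mulmxDl) !trmx_mul !mulmxA.
  have T' w : v *m dmat g x w *m v^T = v *m D w *m h (psi x) *m (v *m J)^T +
     v *m J *m H w *m (v *m J)^T + v *m J *m h (psi x) *m (v *m D w)^T.
    by rewrite gder !(mulmxDr, mulmxDl) !trmx_mul !mulmxA.
  have Es : v *m D u *m h (psi x) *m (v *m J)^T = v *m J *m h (psi x) *m (v *m D u)^T.
    transitivity ((v *m D u *m h (psi x) *m (v *m J)^T)^T).
      by apply/matrixP => i j; rewrite !ord1 [RHS]mxE.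
    by rewrite !trmx_mul !trmxK hs !mulmxA.
  rewrite gam_lower// T T' Es (Dsym u v); exact: half_cancel.
have : gam g x v v *m g x = (v *m D v + gam h (psi x) (v *m J) (v *m J)) *m (h (psi x) *m J^T).
  apply/rowP => l; have := Hd (delta_mx 0 l).
  rewrite trmx_delta -!colE => /matrixP/(_ 0 0); by rewrite !mxE.
rewrite gh// -/J -!mulmxA mulmxA.
have Ju : J \in unitmx.
  by move: gu; rewrite gh// -/J !unitmx_mul => /andP[/andP[]].
move=> /(congr1 (mulmx^~ (invmx J^T))); rewrite !mulmxA !mulmxK ?unitmx_tr//.
by move=> /(congr1 (mulmx^~ (invmx (h (psi x))))); rewrite !mulmxK// addrC.
Qed.

End christoffel_calculus.

(** * The geodesic spray and the first variation of energy *)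

Section spray.
Context {R : realType} {n : nat}.
Implicit Types (s t r e d K C T M L : R).

Lemma fd_jacobian m p (f : 'rV[R]_m -> 'rV[R]_p) x (A : 'M[R]_(m, p)) :
  fd f x (fun h => h *m A) -> 'J f x = A.
Proof.
move=> H.
have C : continuous (mulmxr A : 'rV[R]_m -> 'rV[R]_p).
  move=> y; apply: (@lip_cont _ _ _ _ _ (m%:R * `|A|)); exists 1 => // z _ /=.
  by rewrite -mulmxBl; exact: mulmx_le.
have E : f \o shift x = cst (f x) + (mulmxr A : 'rV[R]_m -> 'rV[R]_p) +o_ 0 id.
  apply/eqaddoP => e e0; have [d d0 K] := H e e0; apply/nearN_P; exists d => // h.
  rewrite subr0 => hd; have := K (h + x); rewrite addrK => /(_ hd).
  by rewrite !fctE /= /shift /= opprD addrA.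
by rewrite /jacobian (diff_unique C E); apply/row_matrixP => i; rewrite rowE mul_rV_lin1 rowE.
Qed.

(** The geodesic equation as a first order system; a state is a row consisting of position and
    velocity. *)
Definition spray (g : 'rV[R]_n -> 'M[R]_n) (s : 'rV[R]_(n + n)) : 'rV[R]_(n + n) :=
  row_mx (rsubmx s) (- gam g (lsubmx s) (rsubmx s) (rsubmx s)).

Definition sdom (U : set 'rV[R]_n) : set 'rV[R]_(n + n) := [set s | U (lsubmx s)].

Record metric_on (U : set 'rV[R]_n) (g : 'rV[R]_n -> 'M[R]_n) : Prop := MetricOn {
  metric_open : open U;
  metric_ck : forall N, ckm N U g;
  metric_sym : forall x, U x -> (g x)^T = g x;
  metric_pos : forall x, U x -> forall v : 'rV[R]_n, v != 0 -> 0 < (v *m g x *m v^T) 0 0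
}.

Lemma metric_unit U g x : metric_on U g -> U x -> g x \in unitmx.
Proof.
move=> mg Ux; rewrite -row_free_unit -kermx_eq0; apply/eqP/row_matrixP => i.
rewrite row0; apply/eqP; case: eqVneq => // k0.
have := metric_pos mg Ux k0; rewrite -[row i _ *m _]row_mul mulmx_ker row0 mul0mx mxE.
by rewrite ltxx.
Qed.

Lemma lsubmx_lip m p (u w : 'rV[R]_(m + p)) : `|lsubmx u - lsubmx w| <= `|u - w|.
Proof.
apply: rv_le => // k; rewrite !mxE.
by have := rv_ge (u - w) (lshift p k); rewrite !mxE.
Qed.

Lemma split_ind m p (P : 'I_(m + p) -> Prop) :
  (forall j, P (lshift p j)) -> (forall j, P (rshift m j)) -> forall k, P k.
Proof.
move=> Hl Hr k; case: (splitP k) => j kj.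
  by have -> : k = lshift p j by exact: val_inj.
by have -> : k = rshift m j by exact: val_inj.
Qed.

Lemma lsubmx_cont m p (u : 'rV[R]_(m + p)) :
  {for u, continuous (lsubmx : 'rV[R]_(m + p) -> 'rV[R]_m)}.
Proof.
by apply: (@lip_cont _ _ _ _ _ 1); exists 1 => // y _; rewrite mul1r lsubmx_lip.
Qed.

Lemma sdom_open U : open U -> open (sdom U).
Proof. by move=> oU; apply: open_comp => // x _; exact: lsubmx_cont. Qed.

Lemma ck_chr U g N k a b : metric_on U g -> ck N U (chr g k a b).
Proof.
move=> mg; apply: ckM; first exact: ck_cst.
apply: (ck_sum xpredT) => l; apply: ckM.
  by apply: ck_inv (metric_open mg) (fun x Ux => metric_unit mg Ux) (metric_ck mg N) k l.
by apply: ckB; [apply: ckD|]; apply: ck_partial (metric_open mg) (metric_ck mg N.+1 _ _).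
Qed.

Lemma spray_lE g (s : 'rV[R]_(n + n)) k : spray g s 0 (lshift n k) = s 0 (rshift n k).
Proof. by rewrite /spray row_mxEl mxE. Qed.

Lemma spray_rE g (s : 'rV[R]_(n + n)) k : spray g s 0 (rshift n k) =
  - \sum_a \sum_b chr g k a b (lsubmx s) * s 0 (rshift n a) * s 0 (rshift n b).
Proof.
rewrite /spray row_mxEr !mxE; congr (- _); apply: eq_bigr => a _; apply: eq_bigr => b _.
by rewrite !mxE.
Qed.

Lemma ck_spray U g N : metric_on U g -> ckv N (sdom U) (spray g).
Proof.
move=> mg; apply: split_ind => j.
  have -> : (fun x => spray g x 0 (lshift n j)) = fun x => x 0 (rshift n j).
    by apply/funext => s; exact: spray_lE.
  exact: ck_coord.
have -> : (fun x => spray g x 0 (rshift n j)) = fun s : 'rV[R]_(n + n) => - \sum_a \sum_b chr g j a b (lsubmx s) * s 0 (rshift n a) * s 0 (rshift n b).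
  by apply/funext => s; exact: spray_rE.
apply: ckN; apply: (ck_sum xpredT) => a; apply: (ck_sum xpredT) => b.
apply: ckM; last exact: ck_coord.
apply: ckM; last exact: ck_coord.
apply: (@ck_comp R N n (n + n) (sdom U) U (chr g j a b) (fun s : 'rV[R]_(n + n) => lsubmx s)); [by []|exact: ck_chr|].
move=> l; have -> : (fun x : 'rV[R]_(n + n) => lsubmx x 0 l) = fun x => x 0 (lshift n l).
  by apply/funext => s; rewrite mxE.
exact: ck_coord.
Qed.

Lemma der_row_mx m p (f : R -> 'rV[R]_m) (h : R -> 'rV[R]_p) t f' h' :
  is_derive t (1 : R) f f' -> is_derive t (1 : R) h h' ->
  is_derive t (1 : R) (fun s => row_mx (f s) (h s)) (row_mx f' h').
Proof.
move=> /der_rvP Hf /der_rvP Hh; apply/der_rvP; apply: split_ind => j.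
  by rewrite row_mxEl; under eq_fun do rewrite row_mxEl; exact: Hf.
by rewrite row_mxEr; under eq_fun do rewrite row_mxEr; exact: Hh.
Qed.

Lemma der_lsubmx m p (f : R -> 'rV[R]_(m + p)) t f' :
  is_derive t (1 : R) f f' -> is_derive t (1 : R) (fun s => lsubmx (f s)) (lsubmx f').
Proof.
move=> /der_rvP Hf; apply/der_rvP => k.
by rewrite mxE; under eq_fun do rewrite mxE; exact: Hf.
Qed.

Lemma der_rsubmx m p (f : R -> 'rV[R]_(m + p)) t f' :
  is_derive t (1 : R) f f' -> is_derive t (1 : R) (fun s => rsubmx (f s)) (rsubmx f').
Proof.
move=> /der_rvP Hf; apply/der_rvP => k.
by rewrite mxE; under eq_fun do rewrite mxE; exact: Hf.
Qed.

Lemma dmat_sym (U : set 'rV[R]_n) g x w : metric_on U g -> U x -> (dmat g x w)^T = dmat g x w.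
Proof.
move=> mg Ux; apply/matrixP => i j; rewrite !mxE; apply: eq_bigr => l _; congr (_ * _).
apply: (@partial_ext _ _ _ _ _ _ 0 U) => //; [exact: metric_open mg|exact: metric_ck mg _ _ _|].
by move=> z Uz; rewrite -{1}(metric_sym mg Uz) mxE.
Qed.

(* Along a geodesic, d/dt <V, x'> = <V', x'> + (1/2) d_V g (x', x'); this is half the
   derivative of the squared speed in the direction (V, V'). *)
Lemma first_variation (U : set 'rV[R]_n) g (x v V : R -> 'rV[R]_n) t V' :
  metric_on U g -> U (x t) ->
  is_derive t (1 : R) x (v t) -> is_derive t (1 : R) v (- gam g (x t) (v t) (v t)) ->
  is_derive t (1 : R) V V' ->
  is_derive t (1 : R) (fun s => (V s *m g (x s) *m (v s)^T) 0 0)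
    ((V' *m g (x t) *m (v t)^T + 2^-1 *: (v t *m dmat g (x t) (V t) *m (v t)^T)) 0 0).
Proof.
move=> mg Ux Dx Dv DV; have gu := metric_unit mg Ux; have gs := metric_sym mg Ux.
have H1 := derm_dmat (metric_ck mg 1) Ux Dx.
have H2 := derm_mul (derm_mul (proj2 (derm_row _ _ _) DV) H1) (derm_tr (proj2 (derm_row _ _ _) Dv)).
have := H2 0 0; move/is_derive_eq; apply; congr (_ 0 0).
rewrite [X in X + _]mulmxDl.
have -> : V t *m g (x t) *m (- gam g (x t) (v t) (v t))^T = - (gam g (x t) (v t) (v t) *m g (x t) *m (V t)^T).
  transitivity (- ((gam g (x t) (v t) (v t) *m g (x t) *m (V t)^T)^T)).
    by rewrite !trmx_mul trmxK gs linearN /= mulmxN mulmxA.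
  by congr (- _); apply/matrixP => i j; rewrite !ord1 [LHS]mxE.
rewrite gam_lower// opprB.
have -> : V t *m dmat g (x t) (v t) *m (v t)^T = v t *m dmat g (x t) (v t) *m (V t)^T.
  transitivity ((v t *m dmat g (x t) (v t) *m (V t)^T)^T).
    by rewrite !trmx_mul !trmxK (dmat_sym _ mg Ux) mulmxA.
  by apply/matrixP => i j; rewrite !ord1 [LHS]mxE.
by rewrite -addrA subrKC.
Qed.

Lemma energy_cst (U : set 'rV[R]_n) g (x v : R -> 'rV[R]_n) t :
  metric_on U g -> U (x t) ->
  is_derive t (1 : R) x (v t) -> is_derive t (1 : R) v (- gam g (x t) (v t) (v t)) ->
  is_derive t (1 : R) (fun s => (v s *m g (x s) *m (v s)^T) 0 0) 0.
Proof.
move=> mg Ux Dx Dv; have := first_variation mg Ux Dx Dv Dv.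
move/is_derive_eq; apply.
rewrite mulNmx mulNmx gam_lower ?(metric_unit mg)// ?(metric_sym mg)// !mxE.
by field.
Qed.

End spray.

(** * Curves and geodesics in charts *)

Section manifold.
Context {R : realType} {n : nat} {M : riemannian_manifold R n}.
Implicit Types (s t r e d K C T L : R) (p q x y : M) (c : R -> M) (i j : chart_index M).

Definition cdom i : set 'rV[R]_n := chart i @` chart_dom i.

Lemma cdom_chart i p : chart_dom i p -> cdom i (chart i p).
Proof. by exists p. Qed.

Lemma chart_invD i z : cdom i z -> chart_dom i (chart_inv i z).
Proof. by move=> [p Dp <-]; rewrite chart_invK. Qed.

Lemma chartK i z : cdom i z -> chart i (chart_inv i z) = z.
Proof. by move=> [p Dp <-]; rewrite chart_invK. Qed.

Lemma metric_chart i : metric_on (cdom i) (gram i).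
Proof.
split.
- exact: chart_image_open.
- by move=> N a b; apply: smooth_ck; exact: gram_smooth.
- by move=> x; exact: gram_sym.
- by move=> x Ux v; exact: gram_pos.
Qed.

(** An isometry without the bijectivity. The identity is one, and its coordinate expressions are the
    transition maps, so a single family of lemmas serves both changes of charts and isometries. *)
Definition local_isom (f : M -> M) : Prop :=
  [/\ continuous f,
      forall i j k,
        smooth_on (chart i @` (chart_dom i `&` f @^-1` chart_dom j))
                  (fun z => chart j (f (chart_inv i z)) 0 k) &
      forall i j (z : 'rV[R]_n),
        (chart i @` (chart_dom i `&` f @^-1` chart_dom j)) z ->
        let J := 'J (chart j \o f \o chart_inv i) z in
        gram i z = J *m gram j (chart j (f (chart_inv i z))) *m J^T].

Lemma isometry_local f : riemannian_isometry f -> local_isom f.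
Proof. by case. Qed.

Lemma id_local : local_isom id.
Proof.
split; first by move=> x; exact: cvg_id.
  by move=> i j k; exact: transition_smooth.
by move=> i j z; exact: gram_transition.
Qed.

Definition trans (f : M -> M) i j (z : 'rV[R]_n) : 'rV[R]_n := chart j (f (chart_inv i z)).

Definition tdom (f : M -> M) i j : set 'rV[R]_n :=
  chart i @` (chart_dom i `&` f @^-1` chart_dom j).

Lemma tdomP f i j z : tdom f i j z <-> cdom i z /\ chart_dom j (f (chart_inv i z)).
Proof.
split=> [[p [Di Dj] <-]|[Cz Dj]].
  by split; [exists p|rewrite chart_invK].
exists (chart_inv i z); last exact: chartK.
by split => //; exact: chart_invD.
Qed.

Lemma tdom_open f i j : continuous f -> open (tdom f i j).
Proof.
move=> cf; rewrite openE => z /tdomP[Cz Dj]; rewrite /interior.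
have N1 : nbhs z (cdom i) by apply: open_nbhs_nbhs; split => //; exact: chart_image_open.
have N2 : nbhs z (chart_inv i @^-1` (f @^-1` chart_dom j)).
  apply: (chart_inv_continuous Cz); apply: cf; apply: open_nbhs_nbhs; split => //.
  exact: chart_dom_open.
by apply: filterS2 N1 N2 => w Cw Dw; apply/tdomP.
Qed.

Lemma ck_trans f i j N : local_isom f -> ckv N (tdom f i j) (trans f i j).
Proof. by move=> [_ H _] k; apply: smooth_ck; exact: H. Qed.

Lemma gram_trans f i j z : local_isom f -> tdom f i j z ->
  gram i z = jac (trans f i j) z *m gram j (trans f i j z) *m (jac (trans f i j) z)^T.
Proof.
move=> If Tz; have [_ _ H] := If; rewrite (H i j z Tz) /=.
suff -> : 'J (chart j \o f \o chart_inv i) z = jac (trans f i j) z by [].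
by apply: fd_jacobian; apply: fd_jac (ck_trans i j 1 If) Tz.
Qed.

Lemma velocityE i c t k : velocity_in i c t 0 k = derive1 (Defs.coord i c k) t.
Proof. by rewrite mxE. Qed.

Lemma der_chart i c t : (forall k, derivable (Defs.coord i c k) t 1) <->
  is_derive t (1 : R) (fun s => chart i (c s)) (velocity_in i c t).
Proof.
split=> [H|/der_rvP H k].
  by apply/der_rvP => k; rewrite velocityE; exact: (derivable_der (H k)).
exact: (ex_derive (is_derive := H k)).
Qed.

Lemma velocity_der i c t v : is_derive t (1 : R) (fun s => chart i (c s)) v ->
  velocity_in i c t = v.
Proof. by move=> /der_rvP H; apply/rowP => k; rewrite mxE; exact: derE (H k). Qed.

Lemma near_dom i c t : {for t, continuous c} -> chart_dom i (c t) ->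
  \forall s \near t, chart_dom i (c s).
Proof. by move=> cc D; apply: cc; apply: open_nbhs_nbhs; split => //; exact: chart_dom_open. Qed.

Lemma cont_chart i c t : (\forall s \near t, chart_dom i (c s)) ->
  {for t, continuous (fun s => chart i (c s))} -> {for t, continuous c}.
Proof.
move=> D cc; have Dt := nbhs_singleton D.
have H : {for t, continuous (chart_inv i \o (fun s => chart i (c s)))}.
  by apply: continuous_comp => //; apply: chart_inv_continuous; exact: cdom_chart.
move=> A; rewrite -(chart_invK Dt) => /H; apply: filterS2 D => s Ds /=.
by rewrite /= chart_invK.
Qed.

Lemma cont_coord i c t : {for t, continuous c} -> chart_dom i (c t) ->
  {for t, continuous (fun s => chart i (c s))}.
Proof. by move=> cc D; apply: continuous_comp => //; exact: chart_continuous. Qed.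

Lemma velocity_trans f i j c t : local_isom f -> {for t, continuous c} ->
  chart_dom i (c t) -> chart_dom j (f (c t)) ->
  is_derive t (1 : R) (fun s => chart i (c s)) (velocity_in i c t) ->
  is_derive t (1 : R) (fun s => chart j (f (c s)))
    (velocity_in i c t *m jac (trans f i j) (chart i (c t))).
Proof.
move=> If cc Di Dj D.
have T : tdom f i j (chart i (c t)) by exists (c t).
have H := der_jac (ck_trans i j 1 If) T D.
apply: der_near H; apply: filterS (near_dom cc Di) => s Ds.
by rewrite /trans chart_invK.
Qed.

Definition sqn i (z w : 'rV[R]_n) : R := (w *m gram i z *m w^T) 0 0.

Lemma sqn_trans f i j z w : local_isom f -> tdom f i j z ->
  sqn i z w = sqn j (trans f i j z) (w *m jac (trans f i j) z).
Proof.
by move=> If Tz; rewrite /sqn (gram_trans If Tz) trmx_mul !mulmxA.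
Qed.

Lemma sqn_ge0 i z w : cdom i z -> 0 <= sqn i z w.
Proof.
move=> Cz; have [->|w0] := eqVneq w 0; first by rewrite /sqn !mul0mx mxE.
exact: ltW (gram_pos Cz w0).
Qed.

Lemma speedE i c t : {for t, continuous c} -> chart_dom i (c t) ->
  is_derive t (1 : R) (fun s => chart i (c s)) (velocity_in i c t) ->
  speed c t = Num.sqrt (sqn i (chart i (c t)) (velocity_in i c t)).
Proof.
move=> cc Di D; rewrite /speed /tnorm /inner.
set k := chart_at (c t); have Dk : chart_dom k (c t) by exact: chart_atP.
have T : tdom id i k (chart i (c t)) by exists (c t).
rewrite (sqn_trans _ id_local T) /trans chart_invK//.
have := velocity_trans id_local cc Di Dk D => /velocity_der.
by rewrite /velocity -/k => <-.
Qed.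

Lemma speed_isom f c t : local_isom f -> {for t, continuous c} ->
  (exists2 i, chart_dom i (c t) & is_derive t (1 : R) (fun s => chart i (c s)) (velocity_in i c t)) ->
  speed (f \o c) t = speed c t.
Proof.
move=> If cc [i Di D]; have [cf _ _] := If.
set k := chart_at (f (c t)); have Dk : chart_dom k (f (c t)) by exact: chart_atP.
have T : tdom f i k (chart i (c t)) by exists (c t).
have D' := velocity_trans If cc Di Dk D.
have V := velocity_der (c := f \o c) D'.
have cfc : {for t, continuous (f \o c)} by apply: continuous_comp => //; exact: cf.
have D2 : is_derive t (1 : R) (fun s => chart k ((f \o c) s)) (velocity_in k (f \o c) t) by rewrite V.
rewrite (speedE cc Di D) (sqn_trans _ If T) (speedE cfc Dk D2).
by rewrite V /trans chart_invK.
Qed.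

Definition lift i c t : 'rV[R]_(n + n) := row_mx (chart i (c t)) (velocity_in i c t).

(** Imposed on a neighbourhood of [t], so that it is an open condition in [t] and velocities can be
    differentiated or transported to another chart there. *)
Definition ageod_in i c t := \forall s \near t,
  chart_dom i (c s) /\ is_derive s (1 : R) (lift i c) (spray (gram i) (lift i c s)).

(* [c] solves the geodesic equation near [t], with any constant speed. *)
Definition ageod_at c t := forall i, chart_dom i (c t) -> ageod_in i c t.

Lemma lift_der i c t : is_derive t (1 : R) (lift i c) (spray (gram i) (lift i c t)) ->
  is_derive t (1 : R) (fun s => chart i (c s)) (velocity_in i c t) /\
  is_derive t (1 : R) (velocity_in i c)
     (- gam (gram i) (chart i (c t)) (velocity_in i c t) (velocity_in i c t)).
Proof.
move=> D; split.
  have := der_lsubmx D; rewrite /spray /lift row_mxKl row_mxKr.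
  rewrite row_mxKl; move/is_derive_eq => /(_ _ erefl).
  by have -> : (fun s => lsubmx (row_mx (chart i (c s)) (velocity_in i c s))) = fun s => chart i (c s)
    by apply/funext => s; rewrite row_mxKl.
have := der_rsubmx D; rewrite /spray /lift !row_mxKr row_mxKl.
by have -> : (fun s => rsubmx (row_mx (chart i (c s)) (velocity_in i c s))) = velocity_in i c
    by apply/funext => s; rewrite row_mxKr.
Qed.

Lemma ageod_in_cont i c t : ageod_in i c t -> {for t, continuous c}.
Proof.
move=> H; apply: (@cont_chart i); first by apply: filterS H => s [].
have [_ D] := nbhs_singleton H.
exact: der_cont (lift_der D).1.
Qed.

(** In the chart [j] the curve is [psi x] with velocity [x' Dpsi(x)], where [psi] is the coordinate
    expression of [f]. Differentiating the velocity once more and inserting [gam_trans] gives the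
    equation for [gram j]. *)
Lemma ageod_in_isom f i j c t : local_isom f -> ageod_in i c t ->
  chart_dom j (f (c t)) -> ageod_in j (f \o c) t.
Proof.
move=> If G Dj; have [cf _ _] := If; have cc := ageod_in_cont G.
have N : nbhs t [set s | chart_dom j (f (c s))].
  have : {for t, continuous (f \o c)} by apply: continuous_comp => //; exact: cf.
  by move=> H; apply: near_dom H Dj.
pose A := [set s | (chart_dom i (c s) /\ is_derive s (1 : R) (lift i c) (spray (gram i) (lift i c s)))
   /\ chart_dom j (f (c s))].
have NA : nbhs t A by apply: filterS2 G N.
(* Nested interiors: the lift is identified around [s], and that identification itself rests on a
   neighbourhood of each nearby time. *)
apply: filterS (nbhs_interior (nbhs_interior NA)) => s As.
have liftE u : nbhs u A -> lift j (f \o c) u =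
   row_mx (trans f i j (chart i (c u))) (velocity_in i c u *m jac (trans f i j) (chart i (c u))).
  move=> Au; have [[Di Du] Dju] := nbhs_singleton Au.
  have ccu : {for u, continuous c}.
    by apply: (@ageod_in_cont i); apply: filterS Au => w [].
  rewrite /lift /trans /= chart_invK//; congr row_mx.
  exact: velocity_der (velocity_trans If ccu Di Dju (lift_der Du).1).
have As1 := nbhs_singleton As.
have [[Di Ds] Djs] := nbhs_singleton As1.
split; first exact: Djs.
rewrite (liftE s As1).
have T : tdom f i j (chart i (c s)) by exists (c s).
have [D1 D2] := lift_der Ds.
apply: (@der_near _ _ (fun u => row_mx (trans f i j (chart i (c u))) (velocity_in i c u *m jac (trans f i j) (chart i (c u))))).
  by apply: filterS As => u Au; rewrite liftE.
have oT := @tdom_open f i j cf.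
have cT N := ck_trans i j N If.
have cJ : ckm 1 (tdom f i j) (jac (trans f i j)).
  by move=> a b; apply: ck_eq (ck_partial a oT (cT 2 b)) => // z _; rewrite mxE.
rewrite /spray row_mxKl row_mxKr; apply: der_row_mx; first exact: der_jac (cT 1) T D1.
apply/derm_row; have := derm_mul (proj2 (derm_row _ _ _) D2) (derm_dmat cJ T D1).
suff -> : - gam (gram i) (chart i (c s)) (velocity_in i c s) (velocity_in i c s) *m jac (trans f i j) (chart i (c s))
  + velocity_in i c s *m dmat (jac (trans f i j)) (chart i (c s)) (velocity_in i c s) =
  - gam (gram j) (trans f i j (chart i (c s))) (velocity_in i c s *m jac (trans f i j) (chart i (c s)))
      (velocity_in i c s *m jac (trans f i j) (chart i (c s))) by [].
have mi := metric_chart i; have mj := metric_chart j.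
have Ci : cdom i (chart i (c s)) by exists (c s).
have Cj z : tdom f i j z -> cdom j (trans f i j z).
  by move=> /tdomP[_ ?]; exact: cdom_chart.
have := @gam_trans R n (tdom f i j) (gram i) (gram j) (trans f i j) (chart i (c s)) (velocity_in i c s) (cdom j) oT T (cT 2).
rewrite mulNmx => -> //.
- by rewrite opprD subrK.
- by move=> a b; apply: ck_sub (metric_ck mi 1 a b) => z /tdomP[].
- exact: metric_ck mj 1.
- by move=> z Tz; exact: gram_trans.
- exact: metric_unit mi Ci.
- exact: (metric_sym mi Ci).
- exact: metric_unit mj (Cj _ T).
- exact: (metric_sym mj (Cj _ T)).
Qed.

Lemma ageod_inW i c t : ageod_in i c t -> ageod_at c t.
Proof. by move=> G j Dj; exact: (ageod_in_isom id_local G Dj). Qed.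

Lemma ageod_isom f c t : local_isom f -> ageod_at c t -> ageod_at (f \o c) t.
Proof.
move=> If G; have Di := chart_atP (c t); have Dj := chart_atP (f (c t)).
exact: ageod_inW (ageod_in_isom If (G _ Di) Dj).
Qed.

Lemma ageod_cont c t : ageod_at c t -> {for t, continuous c}.
Proof. by move=> /(_ _ (chart_atP (c t))); exact: ageod_in_cont. Qed.

Lemma ageod_der i c t : ageod_at c t -> chart_dom i (c t) ->
  is_derive t (1 : R) (fun s => chart i (c s)) (velocity_in i c t).
Proof. by move=> G /G /nbhs_singleton[_ /lift_der[]]. Qed.

Lemma ageod_sqn i c t : ageod_at c t -> chart_dom i (c t) ->
  is_derive t (1 : R) (fun s => sqn i (chart i (c s)) (velocity_in i c s)) 0.
Proof.
move=> G Di; have [_ D] := nbhs_singleton (G i Di); have [D1 D2] := lift_der D.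
exact: energy_cst (metric_chart i) (cdom_chart Di) D1 D2.
Qed.

Lemma ageod_near c t : ageod_at c t -> \forall s \near t, ageod_at c s.
Proof.
move=> /(_ _ (chart_atP (c t))) /nbhs_interior; apply: filterS => s H.
exact: ageod_inW H.
Qed.

Lemma ageod_speed_der c t : ageod_at c t -> is_derive t (1 : R) (fun s => speed c s ^+ 2) 0.
Proof.
move=> G; have Di := chart_atP (c t); apply: der_near (ageod_sqn G Di).
have N := near_dom (ageod_cont G) Di.
apply: filterS2 N (ageod_near G) => s Ds Gs.
rewrite (speedE (ageod_cont Gs) Ds (ageod_der Gs Ds)) sqr_sqrtr//.
by apply: sqn_ge0; exact: cdom_chart.
Qed.

Lemma ageod_speed c a b : a <= b -> (forall t, a <= t <= b -> ageod_at c t) -> speed c a = speed c b.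
Proof.
move=> ab G; have : `|speed c b ^+ 2 - speed c a ^+ 2| <= 0 * (b - a).
  apply: (@mvt_scalar R (fun s => speed c s ^+ 2) (fun=> 0)) => // s; last by rewrite normr0.
  by move=> H; exact: ageod_speed_der (G s H).
rewrite mul0r normr_le0 subr_eq0 => H.
have S t : 0 <= speed c t by exact: sqrtr_ge0.
by apply/esym/eqP; rewrite -(eqrXn2 (n := 2)).
Qed.

Lemma geodesicP c : geodesic c <-> (forall t, ageod_at c t) /\ forall t, speed c t = 1.
Proof.
split.
  move=> [cc dc dv cov sp]; split => // t i Di.
  have N := near_dom (cc t) Di.
  apply: filterS N => s Ds; split => //.
  have D1 := proj1 (der_chart i c s) (dc i s Ds).
  rewrite /spray row_mxKl row_mxKr; apply: der_row_mx => //.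
  apply/der_rvP => k; apply: is_derive_eq (derivable_der (dv i s Ds k)) _.
  have := cov i s Ds => /rowP/(_ k); rewrite !mxE => /eqP; rewrite addr_eq0 => /eqP ->.
  by congr (- _).
move=> [G sp]; split => //.
- by move=> t; exact: ageod_cont.
- by move=> i t Di; apply/der_chart; exact: ageod_der.
- move=> i t Di k; have [_ /lift_der[_ /der_rvP H]] := nbhs_singleton (G t i Di).
  exact: (ex_derive (is_derive := H k)).
- move=> i t Di; have [_ /lift_der[_ /der_rvP H]] := nbhs_singleton (G t i Di).
  apply/rowP => k; rewrite !mxE (derE (H k)) !mxE addrC; apply/eqP; rewrite subr_eq0; apply/eqP.
  by [].
Qed.

End manifold.

(** * Local existence and uniqueness of geodesics *)

Section local_geodesics.
Context {R : realType} {n : nat} {M : riemannian_manifold R n}.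
Implicit Types (a b s t u r e d K T L : R) (p q x y : M) (c : R -> M) (i j : chart_index M).

Lemma der_affine (W : normedModType R) (f : R -> W) a b t v :
  is_derive (a * t + b) (1 : R) f v -> is_derive t (1 : R) (fun s => f (a * s + b)) (a *: v).
Proof.
move=> /der_fd H; have Ha : fd (fun s : R => a * s + b) t (fun h => a * h).
  move=> e e0; exists 1 => // y _.
  rewrite (_ : _ - _ - _ = 0) ?normr0 ?mulr_ge0// ?ltW//; ring.
apply/der_fd; have := fd_comp Ha H (C := `|a|) (C' := `|v|).
move=> /(_ _ _ _) K; apply: fd_eq (K _ _ _) _.
- by move=> h; rewrite normrM.
- by move=> h; rewrite normrZ mulrC.
- by move=> x y; rewrite scalerBl.
- by move=> h /=; rewrite scalerA mulrC.
Qed.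

Lemma ageod_affine c a b t : ageod_at c (a * t + b) -> ageod_at (fun s => c (a * s + b)) t.
Proof.
move=> G i Di; have Gi := G i Di.
pose A := [set u | chart_dom i (c u) /\ is_derive u (1 : R) (lift i c) (spray (gram i) (lift i c u))].
have [d d0 Hd] := proj1 (nearN_P _ _) Gi.
have NA : \forall s \near t, A (a * s + b).
  have a1 : 0 < `|a| + 1 by rewrite ltr_wpDl.
  apply/nearN_P; exists (d / (`|a| + 1)); first by rewrite divr_gt0.
  move=> y; rewrite ltr_pdivlMr// => yd; apply: Hd.
  rewrite (_ : _ - _ = a * (y - t)); last by ring.
  rewrite normrM; apply: le_lt_trans yd; rewrite mulrC ler_wpM2l// lerDl//.
have vE s : A (a * s + b) -> velocity_in i (fun s => c (a * s + b)) s = a *: velocity_in i c (a * s + b).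
  move=> [D /lift_der[D1 _]]; apply: velocity_der.
  exact: (der_affine (f := fun s => chart i (c s)) D1).
apply: filterS (nbhs_interior NA) => s As.
have [D Ds] := nbhs_singleton As; split; first exact: D.
rewrite {2}/lift (vE s (conj D Ds)) /spray row_mxKl row_mxKr gam_scale.
have [D1 D2] := lift_der Ds.
apply: (@der_near _ _ (fun s => row_mx (chart i (c (a * s + b))) (a *: velocity_in i c (a * s + b)))).
  by apply: filterS As => u Au; rewrite /lift (vE u Au).
apply: der_row_mx; first exact: (der_affine (f := fun s => chart i (c s)) D1).
have D3 := der_affine D2; apply: is_derive_eq (@is_deriveZ _ _ _ _ a _ _ _ D3) _.
by rewrite !scalerN scalerA.
Qed.

Definition same_jet c c' t := c t = c' t /\ velocity c t = velocity c' t.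

Lemma lift_same i c c' t : ageod_at c t -> ageod_at c' t -> chart_dom i (c t) ->
  same_jet c c' t -> lift i c t = lift i c' t.
Proof.
move=> G G' Di [cc vv].
have Dk := chart_atP (c t); rewrite /lift cc; congr row_mx.
have T := velocity_trans id_local (ageod_cont G) Dk Di (ageod_der G Dk).
have Dk' : chart_dom (chart_at (c t)) (c' t) by rewrite -cc.
have Di' : chart_dom i (c' t) by rewrite -cc.
have T' := velocity_trans id_local (ageod_cont G') Dk' Di' (ageod_der G' Dk').
rewrite (velocity_der T) (velocity_der T') -cc; congr (_ *m _).
by move: vv; rewrite /velocity -cc.
Qed.

Lemma same_lift i c c' t : ageod_at c t -> ageod_at c' t -> chart_dom i (c t) ->
  chart_dom i (c' t) -> lift i c t = lift i c' t -> same_jet c c' t.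
Proof.
move=> G G' Di Di' /eq_row_mx[xx vv].
have cc : c t = c' t by rewrite -(chart_invK Di) xx chart_invK.
split => //; rewrite /velocity -cc.
have Dk := chart_atP (c t).
have Dk' : chart_dom (chart_at (c t)) (c' t) by rewrite -cc.
have T := velocity_trans id_local (ageod_cont G) Di Dk (ageod_der G Di).
have T' := velocity_trans id_local (ageod_cont G') Di' Dk' (ageod_der G' Di').
by rewrite (velocity_der T) (velocity_der T') xx vv.
Qed.

Lemma same_jet_near c c' t : ageod_at c t -> ageod_at c' t -> same_jet c c' t ->
  \forall s \near t, same_jet c c' s.
Proof.
move=> G G' J; have Di := chart_atP (c t); set i := chart_at (c t) in Di.
have Di' : chart_dom i (c' t) by rewrite -J.1.
have Gi := G i Di; have Gi' := G' i Di'.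
have := @ode_unique_near R _ (sdom (cdom i)) (spray (gram i)) (lift i c) (lift i c') t.
move=> /(_ (sdom_open (metric_open (metric_chart i))) (ck_spray 1 (metric_chart i)) _ (lift_same G G' Di J)) H.
have {}H : \forall s \near t, lift i c s = lift i c' s.
  apply: H.
  - by rewrite /sdom /= /lift row_mxKl; exact: cdom_chart.
  - by apply: filterS Gi => s [].
  - by apply: filterS Gi' => s [].
apply: filterS2 (filterI H (filterI Gi Gi')) (filterI (ageod_near G) (ageod_near G')) => s.
by move=> [E [[D _] [D' _]]] [g g']; exact: same_lift E.
Qed.

(* Both jets are limits from the left. *)
Lemma same_jet_left c c' t a : a < t -> ageod_at c t -> ageod_at c' t ->
  (forall s, a <= s -> s < t -> same_jet c c' s) -> same_jet c c' t.
Proof.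
move=> at_ G G' H.
have haus := @manifold_hausdorff _ _ M.
have cc : c t = c' t.
  apply: haus => A B NA NB.
  have NA' : nbhs t (c @^-1` A) := ageod_cont G NA.
  have NB' : nbhs t (c' @^-1` B) := ageod_cont G' NB.
  have NAB : \forall s \near t, A (c s) /\ B (c' s) by exact: filterI.
  have [d d0 Hd] := proj1 (nearN_P _ _) NAB.
  have tt : `|Num.max a (t - d / 2) - t| < d /\ a <= Num.max a (t - d / 2) /\ Num.max a (t - d / 2) < t.
    split; last by rewrite le_max lexx gt_max at_ ltrBlDr ltrDl divr_gt0.
    by rewrite ltr_norml; case: (leP a (t - d / 2)) => ?; apply/andP; split; lra.
  have [h1 [h2 h3]] := tt; have [hA hB] := Hd _ h1.
  by exists (c (Num.max a (t - d / 2))); split => //; rewrite (H _ h2 h3).1.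
have Di := chart_atP (c t); set i := chart_at (c t) in Di.
have Di' : chart_dom i (c' t) by rewrite -cc.
apply: (@same_lift i) => //.
have [_ Dl] := nbhs_singleton (G i Di); have [_ Dl'] := nbhs_singleton (G' i Di').
apply/eqP; rewrite -subr_eq0 -normr_le0; apply/ler_addgt0Pl => e e0; rewrite addr0.
have e2 : 0 < e / 2 by rewrite divr_gt0.
have /contP/(_ _ e2)[d1 d10 H1] := der_cont Dl.
have /contP/(_ _ e2)[d2 d20 H2] := der_cont Dl'.
have N : \forall s \near t, chart_dom i (c s) /\ ageod_at c s /\ ageod_at c' s.
  exact: filterI (near_dom (ageod_cont G) Di) (filterI (ageod_near G) (ageod_near G')).
have [d3 d30 H3] := proj1 (nearN_P _ _) N.
pose d := Num.min d1 (Num.min d2 d3); have d0 : 0 < d by rewrite !lt_min d10 d20.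
pose s := Num.max a (t - d / 2).
have st : `|s - t| < d.
  by rewrite ltr_norml /s; case: (leP a (t - d / 2)) => ?; apply/andP; split; lra.
have [h2 h3] : a <= s /\ s < t by rewrite /s le_max lexx gt_max at_ ltrBlDr ltrDl divr_gt0.
move: st; rewrite !lt_min => /and3P[/H1 s1 /H2 s2 /H3[Ds [Gs Gs']]].
rewrite (splitr e); have E := lift_same Gs Gs' Ds (H s h2 h3).
rewrite -(subrKA (lift i c s)) (le_trans (ler_normD _ _))//.
by apply: lerD; [rewrite distrC; exact: s1|rewrite E; exact: s2].
Qed.

Lemma geo_unique c c' a b : (forall t, a <= t -> t <= b -> ageod_at c t /\ ageod_at c' t) ->
  same_jet c c' a -> forall t, a <= t -> t <= b -> same_jet c c' t.
Proof.
move=> G Ja; apply: real_ind => // t at_ tb H.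
  have [g g'] := G t at_ (ltW tb); have := same_jet_near g g' (H t at_ (lexx t)).
  move=> /nearN_P[d d0 Hd]; exists d => // s ts sd _; apply: Hd.
  by rewrite ger0_norm ?subr_ge0 ?ltW// ltrBlDl.
have [g g'] := G t (ltW at_) tb; exact: (same_jet_left at_ g g').
Qed.

Lemma velocity_affine c a b t : ageod_at c (a * t + b) ->
  velocity (fun s => c (a * s + b)) t = a *: velocity c (a * t + b).
Proof.
move=> G; rewrite /velocity; apply: velocity_der.
apply: (der_affine (f := fun s => chart (chart_at (c (a * t + b))) (c s))).
exact: ageod_der G (chart_atP _).
Qed.

Lemma same_jet_affine c c' a b t : ageod_at c (a * t + b) -> ageod_at c' (a * t + b) ->
  same_jet c c' (a * t + b) -> same_jet (fun s => c (a * s + b)) (fun s => c' (a * s + b)) t.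
Proof. by move=> G G' [cc vv]; split => //; rewrite !velocity_affine// vv. Qed.

Lemma geo_unique_all c c' t0 : (forall t, ageod_at c t) -> (forall t, ageod_at c' t) ->
  same_jet c c' t0 -> c = c'.
Proof.
move=> G G' J; apply/funext => t; have [t0t|/ltW tt0] := leP t0 t.
  by have [] := geo_unique (b := t) (fun s _ _ => conj (G s) (G' s)) J t0t (lexx t).
(* Time reversal, written as an affine change of parameter so that [ageod_affine] applies. *)
pose o c s := c (-1 * s + 0) : M.
have Jo : same_jet (o c) (o c') (- t0).
  by apply: same_jet_affine; rewrite mulN1r opprK addr0.
have Go f : (forall t, ageod_at f t) -> forall t, ageod_at (o f) t.
  by move=> Gf s; apply: ageod_affine.
have tt : - t0 <= - t by rewrite lerN2.
have [] := geo_unique (b := - t) (fun s _ _ => conj (Go _ G s) (Go _ G' s)) Jo tt (lexx _).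
by rewrite /o mulN1r opprK addr0.
Qed.

(** The flow box of the spray read back on the manifold: its states are lifts of geodesics. Times
    satisfy [|t| < T] strictly, because a lift contains a derivative and the flow has to be known on
    both sides of [t]. *)
Lemma geo_local i (s0 : 'rV[R]_(n + n)) : cdom (M := M) i (lsubmx s0) ->
  exists (T r L : R) (Phi : R -> 'rV[R]_(n + n) -> 'rV[R]_(n + n)) (A : 'rV[R]_(n + n) -> R -> 'M[R]_(n + n)),
  [/\ 0 < T, 0 < r, 0 < L &
  [/\ forall s : 'rV[R]_(n + n), `|s - s0| < r -> Phi 0 s = s /\ forall t, `|t| < T ->
        [/\ cdom (M := M) i (lsubmx (Phi t s)),
            ageod_at (fun t => chart_inv (r := M) i (lsubmx (Phi t s))) t &
            lift i (fun t => chart_inv (r := M) i (lsubmx (Phi t s))) t = Phi t s],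
      forall t t' (s s' : 'rV[R]_(n + n)), `|t| < T -> `|t'| < T -> `|s - s0| < r -> `|s' - s0| < r ->
         `|Phi t s - Phi t' s'| <= L * (`|t - t'| + `|s - s'|),
      forall s : 'rV[R]_(n + n), `|s - s0| < r -> A s 0 = 1%:M /\ forall t, `|t| < T -> forall w : 'rV[R]_(n + n),
         is_derive t (1 : R) (fun t => w *m A s t) (w *m A s t *m jac (spray (gram (r := M) i)) (Phi t s)) &
      forall s : 'rV[R]_(n + n), `|s - s0| < r -> forall t, `|t| < T -> sdiff (Phi t) s (A s t)]].
Proof.
move=> C0; have [T [r [L [Phi [A [T0 r0 L0 [H1 H2 H3 H4]]]]]]] :=
  local_flow (sdom_open (metric_open (metric_chart i))) (ck_spray 2 (metric_chart i)) C0.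
exists T, r, L, Phi, A; split => //; split.
- move=> s sr; have [P0 HP] := H1 s sr; split => // t tT.
  set c := (fun t => chart_inv i (lsubmx (Phi t s))).
  have D u : `|u| <= T -> cdom i (lsubmx (Phi u s)) by move=> /HP[].
  have cE u : `|u| <= T -> chart i (c u) = lsubmx (Phi u s) by move=> /D /chartK.
  have near_le u : `|u| < T -> \forall u' \near u, `|u'| <= T.
    move=> uT; apply/nearN_P; exists (T - `|u|); first by rewrite subr_gt0.
    move=> y yu; rewrite -(subrK u y) (le_trans (ler_normD _ _))// -lerBrDr ltW//.
  have lE u : `|u| < T -> lift i c u = Phi u s.
    move=> uT; rewrite /lift -[RHS]hsubmxK cE; last exact: ltW.
    congr row_mx; apply: velocity_der.
    have := der_lsubmx (HP u (ltW uT)).2; rewrite {1}/spray row_mxKl.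
    by apply: der_near; apply: filterS (near_le u uT) => u' /cE ->.
  split; [exact: D (ltW tT)| |exact: lE].
  apply: (@ageod_inW _ _ _ i); rewrite /ageod_in.
  have : \forall u \near t, `|u| < T.
    apply/nearN_P; exists (T - `|t|); first by rewrite subr_gt0.
    move=> y yu; rewrite -(subrK t y) (le_lt_trans (ler_normD _ _))// -ltrBrDr//.
  move=> /nbhs_interior; apply: filterS => u Hu; have uT := nbhs_singleton Hu.
  split; first by apply: chart_invD; exact: D (ltW uT).
  rewrite (lE u uT); have := (HP u (ltW uT)).2; apply: der_near.
  by apply: filterS Hu => u' /lE ->.
- by move=> t t' s s' tT tT'; apply: H2; exact: ltW.
- by move=> s /H3[h1 h2]; split => // t /ltW; exact: h2.
- by move=> s /H4 h t /ltW; exact: h.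
Qed.

End local_geodesics.

(** * C^1 curves, their length, and comparison of the metric with coordinates *)

Section curves.
Context {R : realType} {n : nat} {M : riemannian_manifold R n}.
Implicit Types (a b s t u r e d K T L l : R) (p q x y : M) (c : R -> M) (i j : chart_index M).

Definition C1_at c t := {for t, continuous c} /\
    forall i, chart_dom i (c t) -> forall k,
      (\forall s \near t, derivable (Defs.coord i c k) s 1) /\
      {for t, continuous (derive1 (Defs.coord i c k))}.

Lemma cont_mulmx (V : normedModType R) (m l k : nat) (A : V -> 'M[R]_(m, l)) (B : V -> 'M[R]_(l, k)) (v : V) :
  (forall (i : 'I_m) (j : 'I_l), {for v, continuous (fun u : V => A u i j)}) ->
  (forall (i : 'I_l) (j : 'I_k), {for v, continuous (fun u : V => B u i j)}) ->
  forall (i : 'I_m) (j : 'I_k), {for v, continuous (fun u : V => (A u *m B u) i j)}.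
Proof.
move=> HA HB i j.
have -> : (fun u : V => (A u *m B u) i j) = (fun u : V => \sum_h A u i h * B u h j).
  by apply/funext => u; rewrite mxE.
by apply: cont_sum => h; exact: (cvgM (HA i h) (HB h j)).
Qed.

Lemma cont_near (V W : topologicalType) (f g : V -> W) (t : V) :
  (\forall s \near t, f s = g s) -> {for t, continuous f} -> {for t, continuous g}.
Proof.
move=> fg cf A; rewrite -(nbhs_singleton fg) => /cf; apply: filterS2 fg => s E /=.
by rewrite /= E.
Qed.

Lemma C1_at_chart i c (v : R -> 'rV[R]_n) t :
  (\forall s \near t, chart_dom i (c s) /\ is_derive s (1 : R) (fun u => chart i (c u)) (v s)) ->
  {for t, continuous v} -> C1_at c t.
Proof.
move=> N cv.
have N1 := nbhs_interior N.
have cc s : nbhs s [set s | chart_dom i (c s) /\ is_derive s (1 : R) (fun u => chart i (c u)) (v s)] ->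
    {for s, continuous c}.
  move=> H; apply: (@cont_chart _ _ _ i); first by apply: filterS H => u [].
  by have [_ D] := nbhs_singleton H; exact: der_cont D.
split; first exact: cc N.
move=> j Dj k.
have Nj : \forall s \near t, chart_dom j (c s) by exact: near_dom (cc _ N) Dj.
pose w s := v s *m jac (trans id i j) (chart i (c s)).
have D : \forall s \near t, is_derive s (1 : R) (fun u => chart j (c u)) (w s).
  apply: filterS2 N1 Nj => s Ns Djs; have [Di Ds] := nbhs_singleton Ns.
  have vE := velocity_der Ds; rewrite /w -vE.
  by apply: (velocity_trans id_local) => //; [exact: cc|rewrite vE].
split.
  apply: filterS D => s /der_rvP/(_ k) Dk.
  exact: (ex_derive (is_derive := Dk)).
apply: (@cont_near _ _ (fun s => w s 0 k)).
  by apply: filterS D => s /der_rvP/(_ k) /derE.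
have [Di Dt] := nbhs_singleton N.
apply: cont_mulmx => [a b|a b].
  by rewrite (ord1 a); move: cv => /cont_rvP; exact.
have -> : (fun s => jac (trans id i j) (chart i (c s)) a b) =
   partial a (fun z => trans id i j z 0 b) \o (fun s => chart i (c s)).
  by apply/funext => s; rewrite mxE.
apply: continuous_comp; first exact: der_cont Dt.
have Tt : tdom id i j (chart i (c t)) by exists (c t).
have [cid _ _] := @id_local _ _ M.
exact: ck_cont (ck_partial a (@tdom_open _ _ M id i j cid) (ck_trans i j 1 id_local b)) Tt.
Qed.

Lemma C1_at_data i c t : C1_at c t -> chart_dom i (c t) ->
  (\forall s \near t, [/\ chart_dom i (c s), {for s, continuous c} &
     is_derive s (1 : R) (fun u => chart i (c u)) (velocity_in i c s)]) /\
  {for t, continuous (velocity_in i c)}.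
Proof.
move=> [cc H] Di; have {}H := H i Di.
have N : \forall s \near t, forall k, derivable (Defs.coord i c k) s 1.
  have H1 k : exists r, 0 < r /\ forall s, `|s - t| < r -> derivable (Defs.coord i c k) s 1.
    by have [r r0 Hr] := proj1 (nearN_P _ _) (H k).1; exists r.
  have [r Hr] := choice H1; apply/nearN_P; exists (\big[Num.min/1]_k r k).
    by apply: lt_bigmin => // k _; case: (Hr k).
  move=> s sr k; apply: (Hr k).2; apply: lt_le_trans sr _; exact: bigmin_le.
split.
  apply: filterS2 (nbhs_interior (near_dom cc Di)) N => s Ds dk.
  have D := proj1 (der_chart i c s) dk.
  split => //; first exact: nbhs_singleton Ds.
  by apply: (@cont_chart _ _ _ i) => //; exact: der_cont D.
apply/cont_rvP => k; apply: cont_near (H k).2.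
by apply: filterE => s; rewrite mxE.
Qed.

Lemma sqn_cont i (z w : R -> 'rV[R]_n) t : cdom (M := M) i (z t) ->
  {for t, continuous z} -> {for t, continuous w} ->
  {for t, continuous (fun s => sqn (M := M) i (z s) (w s))}.
Proof.
move=> Cz cz cw; apply: cont_mulmx => [a b|a b].
  apply: cont_mulmx => [a' b'|a' b'].
    by rewrite (ord1 a'); move: cw => /cont_rvP; exact.
  apply: (@continuous_comp _ _ _ z (fun z => gram i z a' b')) => //.
  exact: ck_cont (metric_ck (metric_chart i) 0 a' b') Cz.
have -> : (fun s => (w s)^T a b) = fun s => w s 0 a.
  by apply/funext => s; rewrite mxE (ord1 b).
by move: cw => /cont_rvP; exact.
Qed.

Lemma speed_cont c t : C1_at c t -> {for t, continuous (speed c)}.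
Proof.
move=> H; have Di := chart_atP (c t); have [N cv] := C1_at_data H Di.
apply: (@cont_near _ _ (fun s => Num.sqrt (sqn (chart_at (c t)) (chart (chart_at (c t)) (c s)) (velocity_in (chart_at (c t)) c s)))).
  by apply: filterS N => s [Ds cs dds]; rewrite (speedE cs Ds dds).
apply: (@continuous_comp _ _ _ _ Num.sqrt); last exact: sqrt_continuous.
apply: sqn_cont => //; first exact: cdom_chart.
by have [_ _ D] := nbhs_singleton N; exact: der_cont D.
Qed.

Lemma C1_onP a b c : C1_on a b c <-> forall t, a <= t <= b -> C1_at c t.
Proof. by []. Qed.

Lemma ageod_C1 c t : ageod_at c t -> C1_at c t.
Proof.
move=> G; have Di := chart_atP (c t).
apply: (@C1_at_chart (chart_at (c t)) c (velocity_in (chart_at (c t)) c)).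
  by apply: filterS (G _ Di) => s [Ds /lift_der[D1 _]].
have [_ /lift_der[_ D2]] := nbhs_singleton (G _ Di); exact: der_cont D2.
Qed.

Lemma speed_ge0 c t : 0 <= speed c t.
Proof. exact: sqrtr_ge0. Qed.

Lemma integral_antideriv (f G : R -> R) a b : a <= b ->
  (forall t, a <= t <= b -> {for t, continuous f}) ->
  (forall t, a <= t <= b -> is_derive t (1 : R) G (f t)) ->
  Rintegral (@lebesgue_measure R) `[a, b] f = G b - G a.
Proof.
rewrite le_eqVlt => /predU1P[<-|ab] cf DG.
  by rewrite set_itv1 Rintegral_set1 subrr.
rewrite /Rintegral (@continuous_FTC2 _ f G a b)//.
- apply: continuous_in_subspaceT => t /set_mem; rewrite /= in_itv /=; exact: cf.
- split.
  + move=> t; rewrite in_itv /= => /andP[/ltW at_ /ltW tb].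
    have D : is_derive t (1 : R) G (f t) by apply: DG; rewrite at_ tb.
    exact: (ex_derive (is_derive := D)).
  + apply: cvg_at_right_filter; apply: (der_cont (DG a _)); by rewrite lexx ltW.
  + apply: cvg_at_left_filter; apply: (der_cont (DG b _)); by rewrite lexx ltW.
- move=> t; rewrite in_itv /= => /andP[/ltW at_ /ltW tb].
  by apply: derE; apply: DG; rewrite at_ tb.
Qed.

(** The speed is controlled at the points of [[a, b]]. Composed with the clamp it becomes continuous
    everywhere, and an antiderivative of the composite serves on the interval. Lengths are handled
    through [G] from here on. *)
Lemma curve_length a b c : a <= b -> (forall t, a <= t <= b -> C1_at c t) ->
  exists2 G : R -> R, forall t, a <= t <= b -> is_derive t (1 : R) G (speed c t) &
    Rintegral (@lebesgue_measure R) `[a, b] (speed c) = G b - G a.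
Proof.
move=> ab HC; pose m := (a + b) / 2; pose rr := (b - a) / 2.
have rr0 : 0 <= rr by rewrite divr_ge0// subr_ge0.
have inab t : `|t - m| <= rr <-> a <= t <= b.
  by rewrite ler_norml /m /rr; split=> /andP[h1 h2]; apply/andP; split; lra.
pose T := `|m| + rr + 1; have T0 : 0 < T by rewrite ltr_wpDl// addr_ge0.
have cf t : {for t, continuous (fun s => speed c (clamp1 m rr s))}.
  apply: continuous_comp; first exact: clamp1_cont.
  by apply/speed_cont/HC/inab; exact: clamp1_in.
have [G G0 DG] := antideriv1 0 T0 cf.
have DG' t : a <= t <= b -> is_derive t (1 : R) G (speed c t).
  move=> /inab tm; rewrite -{2}(clamp1_id tm); apply: DG.
  rewrite -(subrK m t) (le_trans (ler_normD _ _))// /T; lra.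
exists G; first exact: DG'.
apply: (integral_antideriv ab _ DG') => t tab; exact/speed_cont/HC.
Qed.

Lemma cauchy_schwarz i z (u w : 'rV[R]_n) : cdom (M := M) i z ->
  ((u *m gram (r := M) i z *m w^T) 0 0) ^+ 2 <= sqn (M := M) i z u * sqn (M := M) i z w.
Proof.
move=> Cz; set B := (u *m _ *m _) 0 0.
have [w0|w0] := eqVneq w 0.
  by rewrite /B /sqn w0 !trmx0 !mulmx0 !mxE mulr0 expr0n.
have C0 : 0 < sqn i z w by exact: gram_pos.
have E a : sqn i z (u + a *: w) = sqn i z u + 2 * a * B + a ^+ 2 * sqn i z w.
  have S : (w *m gram i z *m u^T) 0 0 = B.
    have -> : w *m gram i z *m u^T = (u *m gram i z *m w^T)^T.
      by rewrite !trmx_mul trmxK (gram_sym Cz) mulmxA.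
    by rewrite mxE.
  rewrite /sqn linearD linearZ /= !(mulmxDl, mulmxDr) -!scalemxAl -!scalemxAr.
  move: S; rewrite /B; set X := u *m _ *m u^T; set Y := w *m _ *m u^T.
  set Z := u *m _ *m w^T; set W := w *m _ *m w^T; rewrite !mxE => ->; ring.
have := sqn_ge0 (u + (- B / sqn i z w) *: w) Cz; rewrite E.
have -> : sqn i z u + 2 * (- B / sqn i z w) * B + (- B / sqn i z w) ^+ 2 * sqn i z w =
   (sqn i z u * sqn i z w - B ^+ 2) / sqn i z w by field; rewrite gt_eqF.
by rewrite pmulr_lge0 ?invr_gt0// subr_ge0.
Qed.

(** The upper bound comes from a local bound of the Gram matrix, the lower one from a bound of its
    inverse: [w] is recovered from [w g], whose entries are inner products with coordinate vectors
    and obey Cauchy-Schwarz. *)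
Lemma sqn_equiv i z0 : cdom (M := M) i z0 -> exists r K : R,
  [/\ 0 < r, 0 < K & forall z, `|z - z0| < r -> cdom (M := M) i z /\
     forall w : 'rV[R]_n, `|w| <= K * Num.sqrt (sqn (M := M) i z w) /\
        Num.sqrt (sqn (M := M) i z w) <= K * `|w|].
Proof.
move=> Cz0; have mi := metric_chart i; have oi := metric_open mi.
have [r1 r10 H1] : exists2 r, 0 < r & forall z, `|z - z0| < r -> cdom i z.
  have N : nbhs z0 (cdom i) by exact: open_nbhs_nbhs.
  by have [r r0 H] := proj1 (nearN_P _ _) N; exists r.
have bnd (A : 'rV[R]_n -> 'M[R]_n) : ckm 0 (cdom i) A ->
   exists r K : R, [/\ 0 < r, 0 < K & forall z, `|z - z0| < r -> `|A z| <= K].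
  move=> cA.
  have H (ab : 'I_n * 'I_n) : exists r, 0 < r /\ forall z, `|z - z0| < r -> `|A z ab.1 ab.2 - A z0 ab.1 ab.2| <= 1.
    by have /contP/(_ 1 ltr01)[r r0 Hr] := cA ab.1 ab.2 z0 Cz0; exists r.
  have [r Hr] := choice H; exists (\big[Num.min/1]_k r k), (`|A z0| + 1); split.
  - by apply: lt_bigmin => // k _; case: (Hr k).
  - by rewrite ltr_wpDl.
  - move=> z zr; apply: mx_le => [|a b]; first by rewrite addr_ge0.
    have zr' : `|z - z0| < r (a, b) by apply: lt_le_trans zr _; exact: bigmin_le.
    have {}Hr := (Hr (a, b)).2 z zr'.
    rewrite -(subrK (A z0 a b) (A z a b)) (le_trans (ler_normD _ _))// addrC lerD//.
    exact: mx_entry_le.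
have [r2 [K2 [r20 K20 H2]]] := bnd _ (metric_ck mi 0).
have [r3 [K3 [r30 K30 H3]]] := bnd _ (ck_inv oi (fun (z : 'rV[R]_n) Ux => metric_unit mi Ux) (metric_ck mi 0)).
pose K := n%:R * K3 * (K2 + 1) + n%:R * n%:R * K2 + 1.
have Ka : 0 <= n%:R * K3 * (K2 + 1) by rewrite !mulr_ge0 ?addr_ge0// ltW.
have Kb : 0 <= n%:R * n%:R * K2 by rewrite !mulr_ge0// ltW.
have K1 : 1 <= K by rewrite /K lerDr addr_ge0.
exists (Num.min r1 (Num.min r2 r3)), K; split.
- by rewrite !lt_min r10 r20.
- exact: lt_le_trans K1.
move=> z; rewrite !lt_min => /and3P[/H1 Cz /H2 gz /H3 iz]; split => // w.
have S0 := sqn_ge0 w Cz.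
split.
  have wE : w = (w *m gram i z) *m invmx (gram i z) by rewrite mulmxK// (metric_unit mi).
  rewrite {1}wE; apply: le_trans (mulmx_le _ _) _.
  have wg : `|w *m gram i z| <= (K2 + 1) * Num.sqrt (sqn i z w).
    apply: rv_le => [|k]; first by rewrite mulr_ge0 ?sqrtr_ge0// addr_ge0// ltW.
    have := cauchy_schwarz w (delta_mx 0 k) Cz.
    have -> : (w *m gram i z *m (delta_mx 0 k : 'rV[R]_n)^T) 0 0 = (w *m gram i z) 0 k.
      by rewrite trmx_delta -colE mxE.
    have -> : sqn i z (delta_mx 0 k) = gram i z k k.
      by rewrite /sqn trmx_delta -colE -rowE !mxE.
    move=> H; rewrite -(ler_sqrt _ (mulr_ge0 S0 (_ : 0 <= gram i z k k))) in H; last first.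
      have := sqn_ge0 (delta_mx 0 k) Cz; by rewrite /sqn trmx_delta -colE -rowE !mxE.
    rewrite sqrtr_sqr sqrtrM// in H; apply: le_trans H _; rewrite mulrC.
    apply: ler_wpM2r; first exact: sqrtr_ge0.
    have gk : gram i z k k <= K2 by apply: le_trans (ler_norm _) _; apply: le_trans (mx_entry_le _ k k) _.
    have K21 : 0 <= K2 + 1 by rewrite addr_ge0// ltW.
    rewrite -(ger0_norm K21) -sqrtr_sqr ler_sqrt ?sqr_ge0//.
    apply: le_trans gk _; have K2' := ltW K20; rewrite sqrrD1; have := sqr_ge0 K2; lra.
  apply: le_trans (ler_wpM2l _ wg) _; first by rewrite mulr_ge0.
  rewrite mulrA; apply: ler_wpM2r; first exact: sqrtr_ge0.
  apply: (@le_trans _ _ (n%:R * K3 * (K2 + 1))); last by rewrite /K -addrA lerDl addr_ge0.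
  apply: ler_wpM2r; first by rewrite addr_ge0// ltW.
  by apply: ler_wpM2l.
have Sle : sqn i z w <= n%:R * n%:R * K2 * `|w| ^+ 2.
  rewrite /sqn -{2}[w]trmxK -[_ *m _ *m _^T]trmxK.
  apply: le_trans (ler_norm _) _.
  have -> : ((w *m gram i z *m (w^T^T)^T)^T^T) 0 0 = dot (w *m gram i z) w.
    by rewrite !trmxK mxE; apply: eq_bigr => l _; rewrite !mxE.
  apply: le_trans (dot_le _ _) _; apply: le_trans (ler_wpM2l _ (mulmx_le _ _)) _.
    by rewrite mulr_ge0.
  have -> : n%:R * `|w| * (n%:R * `|gram i z| * `|w|) = n%:R * n%:R * `|gram i z| * `|w| ^+ 2 by ring.
  by rewrite ler_wpM2r ?sqr_ge0// ler_wpM2l ?mulr_ge0.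
have Kw : 0 <= K * `|w| by rewrite mulr_ge0// (le_trans ler01 K1).
rewrite -(ger0_norm Kw) -sqrtr_sqr ler_sqrt ?sqr_ge0//.
apply: le_trans Sle _; rewrite exprMn ler_wpM2r ?sqr_ge0//.
apply: (@le_trans _ _ K); first by rewrite /K; lra.
by rewrite expr2 ler_peMr// (le_trans ler01 K1).
Qed.

End curves.

(** * The Riemannian distance *)

Section distance.
Context {R : realType} {n : nat} {M : riemannian_manifold R n}.
Implicit Types (a b s t u r e d K T L l : R) (p q x y : M) (c : R -> M) (i j : chart_index M).

Lemma left_point a t d : a < t -> 0 < d -> exists s, [/\ a <= s, s < t & `|s - t| < d].
Proof.
move=> at_ d0; exists (Num.max a (t - d / 2)); split.
- by rewrite le_max lexx.
- by rewrite gt_max at_ ltrBlDr ltrDl divr_gt0.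
- by rewrite ltr_norml; case: (leP a (t - d / 2)) => ?; apply/andP; split; lra.
Qed.

Lemma nondecr_antideriv (G f : R -> R) a b :
  (forall t, a <= t <= b -> is_derive t (1 : R) G (f t)) ->
  (forall t, a <= t <= b -> 0 <= f t) ->
  forall s t, a <= s -> s <= t -> t <= b -> G s <= G t.
Proof.
move=> DG f0 s t as_ st tb.
have [u uin E] : exists2 u, u \in `[s, t]%R & G t - G s = f u * (t - s).
  apply: MVT_segment => // [u uin|].
    by apply: DG; move: uin; rewrite in_itv /= => /andP[/ltW h1 /ltW h2]; apply/andP; split; lra.
  apply: continuous_in_subspaceT => u /set_mem; rewrite /= in_itv /= => /andP[h1 h2].
  by apply: (der_cont (DG u _)); apply/andP; split; lra.
rewrite -subr_ge0 E mulr_ge0 ?subr_ge0//; apply: f0.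
by move: uin; rewrite in_itv /= => /andP[h1 h2]; apply/andP; split; lra.
Qed.

Lemma closed_ball_image i (z0 : 'rV[R]_n) r : (forall z : 'rV[R]_n, `|z - z0| <= r -> cdom (M := M) i z) ->
  0 <= r -> closed (chart_inv (r := M) i @` [set z | `|z - z0| <= r]).
Proof.
move=> HC r0; apply: compact_closed; first exact: manifold_hausdorff.
apply: continuous_compact.
  by apply: continuous_in_subspaceT => z /set_mem /HC Cz; exact: chart_inv_continuous.
have -> : [set z | `|z - z0| <= r] = [set z : 'rV[R]_n | forall k, `[z0 0 k - r, z0 0 k + r]%classic (z 0 k)].
  apply/seteqP; split=> z /= H.
    move=> k; have := le_trans (rv_ge _ k) H; rewrite !mxE ler_norml in_itv /=.
    by move=> /andP[h1 h2]; apply/andP; split; lra.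
  apply: rv_le => // k; have := H k; rewrite !mxE ler_norml in_itv /=.
  by move=> /andP[h1 h2]; apply/andP; split; lra.
apply: (@rV_compact _ _ (fun k => `[z0 0 k - r, z0 0 k + r]%classic)) => k.
exact: segment_compact.
Qed.

(** Leaving a coordinate ball costs length. The continuity induction carries the slack
    [e * (t - a)], which absorbs the first order errors in position and length. At limit times the
    curve is still in the chart, since the image of a closed coordinate ball is compact, hence
    closed in [M]. *)
Lemma displacement i (z0 : 'rV[R]_n) r K rho a b c (G : R -> R) : 0 < K -> 0 <= rho ->
  (forall z, `|z - z0| < r -> cdom (M := M) i z /\
     forall w : 'rV[R]_n, `|w| <= K * Num.sqrt (sqn (M := M) i z w)) ->
  a <= b -> (forall t, a <= t <= b -> C1_at c t) ->
  (forall t, a <= t <= b -> is_derive t (1 : R) G (speed c t)) ->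
  chart_dom i (c a) -> `|chart i (c a) - z0| <= rho -> rho + K * (G b - G a) < r ->
  chart_dom i (c b) /\ `|chart i (c b) - z0| <= rho + K * (G b - G a).
Proof.
move=> K0 rho0 Hr ab HC DG Da Ba Br.
have Gm := nondecr_antideriv DG (fun t _ => speed_ge0 c t).
suff H e : 0 < e -> rho + K * (G b - G a) + e * (b - a) < r ->
    chart_dom i (c b) /\ `|chart i (c b) - z0| <= rho + K * (G b - G a) + e * (b - a).
  pose e0 := (r - (rho + K * (G b - G a))) / (b - a + 1).
  have ba1 : 0 < b - a + 1 by lra.
  have e00 : 0 < e0 by rewrite divr_gt0// subr_gt0.
  have He e : 0 < e -> e <= e0 -> rho + K * (G b - G a) + e * (b - a) < r.
    move=> ep ee; rewrite -ltrBrDl; apply: (@lt_le_trans _ _ (e * (b - a + 1))).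
      by rewrite ltr_pM2l//; lra.
    by rewrite -ler_pdivlMr.
  split; first by have [] := H e0 e00 (He _ e00 (lexx _)).
  apply/ler_addgt0Pl => e ep.
  pose e' := Num.min e0 (e / (b - a + 1)).
  have e'0 : 0 < e' by rewrite lt_min e00 divr_gt0.
  have e'e0 : e' <= e0 by rewrite ge_min lexx.
  have [_] := H e' e'0 (He _ e'0 e'e0).
  move=> /le_trans; apply; rewrite addrC lerD2r.
  apply: (@le_trans _ _ (e' * (b - a + 1))); first by rewrite ler_pM2l//; lra.
  by rewrite -ler_pdivlMr// ge_min lexx orbT.
move=> ep Hb.
pose B t := rho + K * (G t - G a) + e * (t - a).
have Bm s t : a <= s -> s <= t -> t <= b -> B s <= B t.
  move=> as_ st tb; have H1 := Gm s t as_ st tb.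
  have H2 : K * (G s - G a) <= K * (G t - G a) by rewrite ler_pM2l//; lra.
  have H3 : e * (s - a) <= e * (t - a) by rewrite ler_pM2l//; lra.
  by rewrite /B; lra.
have Br' t : a <= t -> t <= b -> B t < r.
  by move=> at_ tb; apply: le_lt_trans Hb; apply: (Bm t b) => //.
suff P : forall t, a <= t -> t <= b -> chart_dom i (c t) /\ `|chart i (c t) - z0| <= B t.
  exact: P.
apply: real_ind; first by rewrite /B !subrr !mulr0 !addr0.
- move=> t at_ tb /(_ t at_ (lexx t))[Dt Bt].
  have tab : a <= t <= b by rewrite at_ ltW.
  have [N _] := C1_at_data (HC t tab) Dt.
  have [_ ct Dx] := nbhs_singleton N.
  have e2 : 0 < e / 2 by rewrite divr_gt0.
  have [d1 d10 H1] := proj1 (derP _ _ _) Dx _ e2.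
  have [d2 d20 H2] := proj1 (derP _ _ _) (DG t tab) _ (divr_gt0 e2 K0).
  have [d3 d30 H3] := proj1 (nearN_P _ _) N.
  exists (Num.min d1 (Num.min d2 d3)); first by rewrite !lt_min d10 d20.
  move=> s ts sd sb.
  have : `|s - t| < Num.min d1 (Num.min d2 d3) by rewrite gtr0_norm ?subr_gt0// ltrBlDl.
  rewrite !lt_min => /and3P[/H1 h1 /H2 h2 /H3[Ds _ _]]; split => //.
  rewrite gtr0_norm ?subr_gt0// in h1 h2.
  set v := velocity_in i c t in h1; set sp := speed c t in h2.
  have vK : `|v| <= K * sp.
    rewrite /sp (speedE ct Dt Dx); apply: (Hr _ _).2; apply: le_lt_trans Bt _.
    by apply: Br' => //; exact: ltW.
  have h3 : `|chart i (c s) - z0| <= `|chart i (c t) - z0| + (s - t) * `|v| + e / 2 * (s - t).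
    have -> : chart i (c s) - z0 = (chart i (c t) - z0) + (s - t) *: v + (chart i (c s) - chart i (c t) - (s - t) *: v).
      by apply/rowP => k; rewrite !mxE; ring.
    apply: le_trans (ler_normD _ _) _; apply: lerD; last exact: h1.
    apply: le_trans (ler_normD _ _) _; rewrite normrZ gtr0_norm// subr_gt0//.
  have h4 : (s - t) * sp <= G s - G t + e / 2 / K * (s - t).
    move: h2; rewrite ler_norml => /andP[h2 _]; rewrite /GRing.scale /= in h2; lra.
  have h5 : (s - t) * `|v| <= K * (G s - G t) + e / 2 * (s - t).
    apply: (@le_trans _ _ (K * ((s - t) * sp))).
      by rewrite mulrCA ler_wpM2l// subr_ge0 ltW.
    apply: le_trans (ler_wpM2l (ltW K0) h4) _.
    by rewrite mulrDr mulrA mulrCA mulfV ?gt_eqF// mulr1.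
  apply: le_trans h3 _; move: Bt h5; rewrite /B; lra.
move=> t at_ tb Hs.
have tab : a <= t <= b by rewrite ltW.
have [ct _] := HC t tab.
have rb0 : 0 <= B b.
  by apply: le_trans (Bm a b (lexx a) ab (lexx b)); rewrite /B !subrr !mulr0 !addr0.
have Cl := @closed_ball_image i z0 (B b) (fun z zB => (Hr z (le_lt_trans zB Hb)).1) rb0.
have Dt : chart_dom i (c t).
  suff [z zB <-] : (chart_inv i @` [set z | `|z - z0| <= B b]) (c t).
    by apply: chart_invD; apply: (Hr z _).1; exact: le_lt_trans zB Hb.
  apply: Cl => A /ct NA; have [d d0 Hd] := proj1 (nearN_P _ _) NA.
  have [s [as_ st sd]] := left_point at_ d0.
  exists (c s); split; last exact: Hd.
  have [Ds Bs] := Hs s as_ st; exists (chart i (c s)); last exact: chart_invK.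
  by apply: le_trans Bs _; apply: Bm => //; lra.
split => //; apply/ler_addgt0Pl => e' e'0.
have [d d0 Hd] := proj1 (contP _ _) (cont_coord ct Dt) _ e'0.
have [s [as_ st sd]] := left_point at_ d0.
have [Ds Bs] := Hs s as_ st.
rewrite -(subrKA (chart i (c s))) (le_trans (ler_normD _ _))//; apply: lerD.
  by rewrite distrC; exact: Hd.
by apply: le_trans Bs _; apply: Bm => //; exact: ltW.
Qed.

Lemma pw_displacement i (z0 : 'rV[R]_n) r K x y l : 0 < K ->
  (forall z, `|z - z0| < r -> cdom (M := M) i z /\
     forall w : 'rV[R]_n, `|w| <= K * Num.sqrt (sqn (M := M) i z w)) ->
  piecewise_C1 x y l -> 0 <= l /\ forall rho, 0 <= rho -> chart_dom i x ->
  `|chart i x - z0| <= rho -> rho + K * l < r ->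
  chart_dom i y /\ `|chart i y - z0| <= rho + K * l.
Proof.
move=> K0 Hr; elim=> [{}x|c a b {}y {}l ab /C1_onP HC _ [l0 IH]].
  by split=> // rho _ Dx Bx _; rewrite mulr0 addr0.
have [G DG ->] := curve_length ab HC.
have Gab : 0 <= G b - G a.
  by rewrite subr_ge0; apply: (nondecr_antideriv DG (fun t _ => speed_ge0 c t)).
split; first exact: addr_ge0.
move=> rho rho0 Da Ba; rewrite mulrDr addrA => Br.
have Kl : 0 <= K * l by rewrite mulr_ge0// ltW.
have KG : 0 <= K * (G b - G a) by rewrite mulr_ge0// ltW.
have Br' : rho + K * (G b - G a) < r by lra.
have [Db Bb] := displacement K0 rho0 Hr ab HC DG Da Ba Br'.
by apply: IH => //; lra.
Qed.

Lemma pw_ge0 x y l : piecewise_C1 x y l -> 0 <= l.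
Proof.
elim=> [//|c a b {}y {}l ab /C1_onP HC _ l0].
have [G DG ->] := curve_length ab HC; apply: addr_ge0 => //.
by rewrite subr_ge0; apply: (nondecr_antideriv DG (fun t _ => speed_ge0 c t)).
Qed.

Lemma pw_cat x y z l l' : piecewise_C1 x y l -> piecewise_C1 y z l' -> piecewise_C1 x z (l + l').
Proof.
elim=> [{}x|c a b {}y {}l ab HC _ IH] H; first by rewrite add0r.
by rewrite -addrA; apply: Pw_cons => //; exact: IH.
Qed.

Lemma pw_curve c a b : a <= b -> (forall t, a <= t <= b -> C1_at c t) ->
  piecewise_C1 (c a) (c b) (Rintegral (@lebesgue_measure R) `[a, b] (speed c)).
Proof.
by move=> ab HC; rewrite -[Rintegral _ _ _]addr0; apply: Pw_cons => //; exact: Pw_nil.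
Qed.

Lemma pw_ageod c a b : a <= b -> (forall t, a <= t <= b -> ageod_at c t) ->
  piecewise_C1 (c a) (c b) (speed c a * (b - a)).
Proof.
move=> ab G; have := pw_curve ab (fun t H => ageod_C1 (G t H)).
have D t : a <= t <= b -> is_derive t (1 : R) (fun s => speed c a * s) (speed c t).
  move=> /andP[at_ tb]; have -> : speed c t = speed c a.
    apply/esym/ageod_speed => // s /andP[as_ st]; apply: G; rewrite as_ /=.
    exact: le_trans tb.
  apply/derP => e e0; exists 1 => // s _.
  rewrite (_ : _ - _ - _ = 0) ?normr0 ?mulr_ge0// ?ltW// /GRing.scale /=; ring.
have cs t : a <= t <= b -> {for t, continuous (speed c)}.
  by move=> tab; apply/speed_cont/ageod_C1/G.
by rewrite (integral_antideriv ab cs D) -mulrBr.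
Qed.

Lemma chart_segment i (z0 : 'rV[R]_n) : cdom (M := M) i z0 ->
  exists r K : R, [/\ 0 < r, 0 < K, forall z, `|z - z0| < r -> cdom (M := M) i z &
  forall z z', `|z - z0| < r -> `|z' - z0| < r ->
    (forall t, 0 <= t <= 1 -> C1_at (fun t => chart_inv (r := M) i (z + t *: (z' - z))) t) /\
    exists2 l, l <= K * `|z' - z| & piecewise_C1 (chart_inv (r := M) i z) (chart_inv i z') l].
Proof.
move=> Cz0; have [r [K [r0 K0 Hr]]] := sqn_equiv Cz0.
exists r, K; split => // [z /Hr[]//|z z' zr zr'].
set c := fun t => chart_inv i (z + t *: (z' - z)).
have inr t : 0 <= t <= 1 -> `|z + t *: (z' - z) - z0| < r by move=> t01; exact: ball_segment.
have N t : 0 <= t <= 1 -> \forall s \near t, cdom i (z + s *: (z' - z)).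
  move=> t01.
  have cc : {for t, continuous (fun s : R => z + s *: (z' - z))} by exact: der_cont (der_segment z z' t).
  have NN : nbhs (z + t *: (z' - z)) (cdom i).
    apply: open_nbhs_nbhs; split; first exact: chart_image_open.
    by have [] := Hr _ (inr t t01).
  exact: cc NN.
have D t : 0 <= t <= 1 -> \forall s \near t, chart_dom i (c s) /\ is_derive s (1 : R) (fun u => chart i (c u)) (z' - z).
  move=> /N /nbhs_interior; apply: filterS => s Ns; split.
    by apply: chart_invD; exact: nbhs_singleton Ns.
  apply: der_near (der_segment z z' s); apply: filterS Ns => u Cu.
  by rewrite chartK.
have HC t : 0 <= t <= 1 -> C1_at c t.
  by move=> /D H; apply: (C1_at_chart H); exact: cst_continuous.
split; first exact: HC.
have [G DG E] := curve_length ler01 HC.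
exists (G 1 - G 0); last first.
  have := pw_curve ler01 HC; rewrite E /c scale0r addr0 scale1r subrKC.
  by [].
apply: le_trans (ler_norm _) _.
have := @mvt_scalar R G (speed c) 0 1 (K * `|z' - z|) ler01 DG.
rewrite subr0 mulr1; apply => t t01.
have [Ds Dd] := nbhs_singleton (D t t01); have vE := velocity_der Dd.
have Dd' : is_derive t (1 : R) (fun u => chart i (c u)) (velocity_in i c t) by rewrite vE.
rewrite ger0_norm ?speed_ge0// (speedE (HC t t01).1 Ds Dd') vE.
have [Ct Hw] := Hr _ (inr t t01).
by rewrite /c chartK//; exact: (Hw (z' - z)).2.
Qed.

Lemma pw_near x e : 0 < e -> \forall y \near x, exists l l' : R,
  [/\ l < e, l' < e, piecewise_C1 x y l & piecewise_C1 y x l'].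
Proof.
move=> e0; have Dx := chart_atP x; set i := chart_at x in Dx.
have [r [K [r0 K0 Cr H]]] := chart_segment (cdom_chart Dx).
have d0 : 0 < Num.min r (e / (K + 1)) by rewrite lt_min r0 divr_gt0// addr_gt0.
have N1 : \forall y \near x, chart_dom i y.
  by apply: open_nbhs_nbhs; split => //; exact: chart_dom_open.
have N2 : \forall y \near x, `|chart i y - chart i x| < Num.min r (e / (K + 1)).
  have NB : nbhs (chart i x) [set z | `|z - chart i x| < Num.min r (e / (K + 1))].
    by apply/nearN_P; exists (Num.min r (e / (K + 1))).
  exact: (chart_continuous Dx) NB.
apply: filterS2 N1 N2 => y Dy; rewrite lt_min => /andP[yr ye].
have xr : `|chart i x - chart i x| < r by rewrite subrr normr0.
have [_ [l lK P]] := H _ _ xr yr; have [_ [l' lK' P']] := H _ _ yr xr.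
rewrite !chart_invK// in P P'.
have small : K * `|chart i y - chart i x| < e.
  apply: (@le_lt_trans _ _ ((K + 1) * `|chart i y - chart i x|)).
    by rewrite ler_wpM2r// lerDl.
  by rewrite mulrC -ltr_pdivlMr// addr_gt0.
exists l, l'; split => //; first exact: le_lt_trans small.
by rewrite distrC in lK'; exact: le_lt_trans small.
Qed.

Lemma path_near (X : topologicalType) (g : R -> X) : {within `[0, 1], continuous g} ->
  forall t, 0 <= t <= 1 -> forall A, nbhs (g t) A -> exists2 d, 0 < d &
    forall s, 0 <= s <= 1 -> `|s - t| < d -> A (g s).
Proof.
move=> /subspace_continuousP H t t01 A NA.
have t01' : `[0, 1]%classic t by rewrite /= in_itv.
have := H t t01' A NA; rewrite /within /= => N.
have [d d0 Hd] := proj1 (nearN_P _ _) N; exists d => // s s01 sd.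
by apply: Hd => //; rewrite /= in_itv.
Qed.

(** Continuity induction along a continuous path: near each of its points the path is replaced by a
    segment in a chart. *)
Lemma pw_connected : simply_connected M -> forall x y, exists l : R, piecewise_C1 x y l.
Proof.
move=> [pc _] x y; have [g [cg g0 g1]] := pc x y.
suff H : forall t, 0 <= t -> t <= 1 -> exists l : R, piecewise_C1 x (g t) l.
  by rewrite -g1; exact: H.
apply: real_ind.
- by exists 0; rewrite g0; exact: Pw_nil.
- move=> t t0 t1 /(_ t t0 (lexx t))[l P].
  have t01 : 0 <= t <= 1 by rewrite t0 ltW.
  have [d d0 Hd] := path_near cg t01 (pw_near (g t) ltr01).
  exists d => // s ts sd s1.
  have s01 : 0 <= s <= 1 by rewrite s1 andbT (le_trans t0)// ltW.
  have st : `|s - t| < d by rewrite gtr0_norm ?subr_gt0// ltrBlDl.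
  have [l' [l'' [_ _ P' _]]] := Hd s s01 st.
  by exists (l + l'); exact: pw_cat P P'.
- move=> t t0 t1 H; have t01 : 0 <= t <= 1 by rewrite t1 ltW.
  have [d d0 Hd] := path_near cg t01 (pw_near (g t) ltr01).
  have [s [s0 st sd]] := left_point t0 d0.
  have s01 : 0 <= s <= 1 by rewrite s0 (le_trans (ltW st)).
  have [l' [l'' [_ _ _ P']]] := Hd s s01 sd.
  by have [l P] := H s s0 st; exists (l + l''); exact: pw_cat P P'.
Qed.

Lemma rdist_le x y l : piecewise_C1 x y l -> rdist x y <= l.
Proof. by move=> P; apply: ge_inf => //; exists 0 => u; exact: pw_ge0. Qed.

Lemma rdist_ge0 x y : 0 <= rdist x y.
Proof.
(* Without a connecting curve the infimum is that of the empty set, which is 0 by convention. *)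
rewrite /rdist; have [->|/set0P ne] := eqVneq [set l | piecewise_C1 x y l] set0; first by rewrite inf0.
by apply: lb_le_inf => // l; exact: pw_ge0.
Qed.

Hypothesis Msc : simply_connected M.

Lemma rdist_lt x y e : rdist x y < e -> exists2 l : R, l < e & piecewise_C1 x y l.
Proof.
move=> H; have hi : has_inf [set l | piecewise_C1 x y l].
  by split; [have [l P] := pw_connected Msc x y; exists l|exists 0 => u; exact: pw_ge0].
have e0 : 0 < e - rdist x y by rewrite subr_gt0.
by have [l P le] := inf_adherent e0 hi; exists l => //; rewrite addrC subrK in le.
Qed.

Lemma rdist_triangle x y z : rdist x z <= rdist x y + rdist y z.
Proof.
apply/ler_addgt0Pl => e e0; have e2 : 0 < e / 2 by rewrite divr_gt0.
have [|l1 H1 P1] := @rdist_lt x y (rdist x y + e / 2); first by rewrite ltrDl.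
have [|l2 H2 P2] := @rdist_lt y z (rdist y z + e / 2); first by rewrite ltrDl.
apply: le_trans (rdist_le (pw_cat P1 P2)) _; lra.
Qed.

(** By [pw_displacement] a short curve from [x] cannot leave a small coordinate ball. With
    [rdist_near] this matches the distance with the topology of the manifold. *)
Lemma rdist_small x (A : set M) : nbhs x A -> exists2 e, 0 < e & forall y, rdist x y < e -> A y.
Proof.
move=> NA; have Dx := chart_atP x; set i := chart_at x in Dx.
have [r [K [r0 K0 Hr]]] := sqn_equiv (cdom_chart Dx).
have NA' : nbhs (chart i x) (chart_inv i @^-1` A).
  by apply: (chart_inv_continuous (cdom_chart Dx)); rewrite chart_invK.
have [d d0 Hd] := proj1 (nearN_P _ _) NA'.
exists (Num.min r d / K); first by rewrite divr_gt0// lt_min r0.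
move=> y; rewrite ltr_pdivlMr// => yK.
have [l lK P] : exists2 l : R, l < Num.min r d / K & piecewise_C1 x y l.
  by apply: rdist_lt; rewrite ltr_pdivlMr.
have Hr' z : `|z - chart i x| < r -> cdom i z /\ forall w : 'rV[R]_n, `|w| <= K * Num.sqrt (sqn i z w).
  by move=> /Hr[Cz H]; split => // w; have [] := H w.
have [l0 H] := pw_displacement K0 Hr' P.
move: lK; rewrite ltr_pdivlMr// mulrC lt_min => /andP[lr ld].
have [||Dy By] := H 0 (lexx 0) Dx; rewrite ?subrr ?normr0 ?add0r//.
rewrite -(chart_invK Dy); apply: Hd; rewrite add0r in By; exact: le_lt_trans ld.
Qed.

Lemma rdist_near x e : 0 < e -> \forall y \near x, rdist x y < e /\ rdist y x < e.
Proof.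
move=> e0; apply: filterS (pw_near x e0) => y [l [l' [h h' P P']]].
by split; [exact: le_lt_trans (rdist_le P) _|exact: le_lt_trans (rdist_le P') _].
Qed.

End distance.

(** * Completeness and geodesics defined for all times *)

Section global_geodesics.
Context {R : realType} {n : nat} {M : riemannian_manifold R n}.
Implicit Types (a b s t u r e d K T L l : R) (p q x y : M) (c : R -> M) (i j : chart_index M).

Lemma near_affine a b t (A : set R) : (\forall s \near a * t + b, A s) ->
  \forall s \near t, A (a * s + b).
Proof.
move=> H; have [d d0 Hd] := proj1 (nearN_P _ _) H.
have a1 : 0 < `|a| + 1 by rewrite ltr_wpDl.
apply/nearN_P; exists (d / (`|a| + 1)); first by rewrite divr_gt0.
move=> y; rewrite ltr_pdivlMr// => yd; apply: Hd.
rewrite (_ : _ - _ = a * (y - t)); last by ring.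
by rewrite normrM; apply: le_lt_trans yd; rewrite mulrC ler_wpM2l// lerDl.
Qed.

Lemma speed_affine c a b t : {for a * t + b, continuous c} ->
  is_derive (a * t + b) (1 : R) (fun s => chart (chart_at (c (a * t + b))) (c s)) (velocity c (a * t + b)) ->
  speed (fun s => c (a * s + b)) t = `|a| * speed c (a * t + b).
Proof.
move=> cc D; have D' := der_affine D.
have vE := velocity_der (c := fun s => c (a * s + b)) D'.
rewrite /speed {1}/velocity vE /tnorm /inner linearZ /= -scalemxAl -scalemxAl -scalemxAr scalerA mxE.
by rewrite -expr2 sqrtrM ?sqr_ge0// sqrtr_sqr.
Qed.

Lemma C1_speed_affine c a b t : C1_at c (a * t + b) ->
  C1_at (fun s => c (a * s + b)) t /\ speed (fun s => c (a * s + b)) t = `|a| * speed c (a * t + b).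
Proof.
move=> H; have Di := chart_atP (c (a * t + b)); have [N cv] := C1_at_data H Di.
have N' := near_affine N.
split; last first.
  by have [_ cc D] := nbhs_singleton N; exact: speed_affine.
apply: (@C1_at_chart _ _ _ (chart_at (c (a * t + b))) _ (fun s => a *: velocity_in (chart_at (c (a * t + b))) c (a * s + b))).
  by apply: filterS N' => s [Ds _ D]; split => //; exact: (der_affine D).
apply: cvgZr; apply: (@continuous_comp _ _ _ (fun s => a * s + b)) => //.
by apply: (@lip_cont _ _ _ _ _ `|a|); exists 1 => // y _; rewrite -normrM (_ : _ - _ = a * (y - t))//; ring.
Qed.

Lemma pw_sym x y l : piecewise_C1 x y l -> piecewise_C1 y x l.
Proof.
elim=> [{}x|c a b {}y {}l ab /C1_onP HC _ IH]; first exact: Pw_nil.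
rewrite addrC; apply: pw_cat IH _.
pose o s := c (-1 * s + (a + b)).
have oin t : a <= t <= b -> a <= -1 * t + (a + b) <= b by move=> /andP[h1 h2]; apply/andP; split; lra.
have Ho t : a <= t <= b -> C1_at o t by move=> tab; exact: (C1_speed_affine (HC _ (oin t tab))).1.
have [G DG ->] := curve_length ab HC.
have cs t : a <= t <= b -> {for t, continuous (speed o)} by move=> /Ho; exact: speed_cont.
have D t : a <= t <= b -> is_derive t (1 : R) (fun s => - G (-1 * s + (a + b))) (speed o t).
  move=> tab; rewrite (C1_speed_affine (HC _ (oin t tab))).2 normrN normr1 mul1r.
  have D1 := der_affine (DG _ (oin t tab)).
  by apply: is_derive_eq (is_deriveN D1) _; rewrite scaleN1r opprK.
have := pw_curve ab Ho; rewrite (integral_antideriv ab cs D) /o.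
have -> : -1 * a + (a + b) = b by ring.
have -> : -1 * b + (a + b) = a by ring.
by rewrite opprK addrC.
Qed.

Lemma rdist_sym x y : rdist x y = rdist y x.
Proof.
by congr inf; apply/seteqP; split=> l /= P; exact: pw_sym.
Qed.

Lemma rdist_ageod c a b s t : (forall t, a <= t <= b -> ageod_at c t) ->
  a <= s <= b -> a <= t <= b -> rdist (c s) (c t) <= speed c a * `|s - t|.
Proof.
move=> G; wlog st : s t / s <= t.
  move=> H sab tab; have [/H|/ltW/H] := leP s t; first exact.
  by rewrite rdist_sym distrC; exact.
move=> /andP[as_ sb] /andP[at_ tb].
have Gst u : s <= u <= t -> ageod_at c u.
  by move=> /andP[su ut]; apply: G; rewrite (le_trans as_ su) (le_trans ut tb).
apply: le_trans (rdist_le (pw_ageod st Gst)) _.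
have -> : speed c a = speed c s.
  by apply: ageod_speed => // u /andP[au us]; apply: G; rewrite au (le_trans us).
by rewrite distrC ger0_norm// subr_ge0.
Qed.

Lemma ageod_eq_near c c' t : (\forall s \near t, c s = c' s) -> ageod_at c t -> ageod_at c' t.
Proof.
move=> N G; have Di := chart_atP (c t).
apply: (@ageod_inW _ _ _ (chart_at (c t))).
have H : \forall s \near t, nbhs s [set s | c s = c' s] /\ (chart_dom (chart_at (c t)) (c s) /\
    is_derive s (1 : R) (lift (chart_at (c t)) c) (spray (gram (chart_at (c t))) (lift (chart_at (c t)) c s))).
  exact: filterI (nbhs_interior N) (G _ Di).
apply: filterS H => s [Ns [Ds D]].
have lE u : nbhs u [set s | c s = c' s] -> lift (chart_at (c t)) c u = lift (chart_at (c t)) c' u.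
  move=> Nu; rewrite /lift (nbhs_singleton Nu); congr row_mx; apply/rowP => k; rewrite !mxE !derive1E.
  by apply: near_eq_derive; apply: filterS Nu => w /= E; rewrite /Defs.coord E.
split; first by rewrite -(nbhs_singleton Ns).
rewrite -(lE s Ns); apply: der_near D; apply: filterS (nbhs_interior Ns) => u; exact: lE.
Qed.

Lemma velocity_eq_near c c' t : (\forall s \near t, c s = c' s) -> velocity c t = velocity c' t.
Proof.
move=> N; rewrite /velocity (nbhs_singleton N); apply/rowP => k; rewrite !mxE !derive1E.
by apply: near_eq_derive; apply: filterS N => w /= E; rewrite /Defs.coord E.
Qed.

Definition starts c p (v : 'rV[R]_n) := c 0 = p /\ velocity c 0 = v.

Lemma starts_same c c' p v : starts c p v -> starts c' p v -> same_jet c c' 0.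
Proof. by move=> [cp cv] [cp' cv']; split; rewrite ?cp ?cv. Qed.

Lemma starts_near c c' p v : (\forall s \near (0 : R), c s = c' s) -> starts c p v -> starts c' p v.
Proof. by move=> N [h1 h2]; split; rewrite -?(velocity_eq_near N)// -(nbhs_singleton N). Qed.

Lemma glue_geod c c' t1 : ageod_at c t1 -> ageod_at c' t1 -> same_jet c c' t1 ->
  let g := fun u => if u <= t1 then c u else c' u in
  (forall t, t <= t1 -> ageod_at c t -> ageod_at g t /\ (t < t1 -> \forall u \near t, c u = g u)) /\
  (forall t, t1 < t -> ageod_at c' t -> ageod_at g t).
Proof.
move=> G1 G1' J g; have N := same_jet_near G1 G1' J.
have N1 : \forall u \near t1, c u = g u.
  by apply: filterS N => u [E _]; rewrite /g; case: ifP.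
have lt_near t : t < t1 -> \forall u \near t, c u = g u.
  move=> tt; apply/nearN_P; exists (t1 - t); first by rewrite subr_gt0.
  move=> u; rewrite ltr_norml => /andP[h1 h2]; rewrite /g ifT//; lra.
split=> [t|t t1t Gt].
  rewrite le_eqVlt => /predU1P[->|tt] Gt.
    by split=> [|]; [exact: ageod_eq_near G1|rewrite ltxx].
  by split=> [|_]; [exact: ageod_eq_near (lt_near t tt) Gt|exact: lt_near].
apply: ageod_eq_near Gt; apply/nearN_P; exists (t - t1); first by rewrite subr_gt0.
move=> u; rewrite ltr_norml => /andP[h1 h2]; rewrite /g ifF//; apply/negbTE; rewrite -ltNge; lra.
Qed.

Lemma geod_local_exists p v : exists c, starts c p v /\ ageod_at c 0.
Proof.
have Di := chart_atP p; set i := chart_at p in Di.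
have C0 : cdom i (lsubmx (row_mx (chart i p) v)) by rewrite row_mxKl; exact: cdom_chart.
have [T [r [L [Phi [A [T0 r0 L0 [H _ _ _]]]]]]] := geo_local C0.
have s0 : `|row_mx (chart i p) v - row_mx (chart i p) v| < r by rewrite subrr normr0.
have [P0 /(_ 0)] := H _ s0; rewrite normr0 => /(_ T0)[_ G E].
exists (fun t => chart_inv i (lsubmx (Phi t (row_mx (chart i p) v)))); split => //.
have c0 : chart_inv i (lsubmx (Phi 0 (row_mx (chart i p) v))) = p by rewrite P0 row_mxKl chart_invK.
split => //; rewrite /velocity c0 -/i.
by move: E; rewrite /lift P0 => /eq_row_mx[_].
Qed.

Hypothesis Msc : simply_connected M.
Hypothesis Mc : rcomplete M.

(** The speed is constant, so the geodesic is Lipschitz and completeness gives a limit point at [T].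
    Near [T] positions and velocities lie in a compact box of one chart. A cluster point of the lift
    provides a flow box of fixed duration, entered at a time [t1] so close to [T] that the flow
    passes beyond [T]. *)
Lemma geod_extend c T : 0 < T -> (forall t, 0 <= t -> t < T -> ageod_at c t) ->
  exists2 c', \forall u \near (0 : R), c u = c' u & forall t, 0 <= t <= T -> ageod_at c' t.
Proof.
move=> T0 G; set sg := speed c 0.
have sg0 : 0 <= sg by exact: speed_ge0.
have dc s t : 0 <= s -> s < T -> 0 <= t -> t < T -> rdist (c s) (c t) <= sg * `|s - t|.
  move=> s0 sT t0 tT; apply: (@rdist_ageod c 0 (Num.max s t)).
  - by move=> u /andP[u0 um]; apply: G => //; apply: le_lt_trans um _; rewrite gt_max sT.
  - by rewrite s0 le_max lexx.
  - by rewrite t0 le_max lexx orbT.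
pose tk k := T - T * 2^-1 ^+ k : R.
have tk0 k : 0 <= tk k.
  have h : 2^-1 ^+ k <= (1 : R) by rewrite exprn_ile1// invf_le1// ler1n.
  by rewrite /tk subr_ge0 ler_piMr// ltW.
have tkT k : tk k < T by rewrite ltrBlDr ltrDl mulr_gt0// exprn_gt0.
have tkn (k l : nat) : (k <= l)%N -> `|T - tk l| <= T * 2^-1 ^+ k.
  move=> kl; rewrite /tk opprB addrC subrK ger0_norm; last by rewrite mulr_ge0 ?exprn_ge0// ltW.
  by rewrite ler_pM2l// ler_wiXn2l// invf_le1// ler1n.
have [x xlim] : exists x, rdist (c (tk m)) x @[m --> \oo] --> (0 : R).
  apply: Mc => e e0; have [N HN] := half_pow_small (2 * (sg * T)) e0.
  exists N => k k' Nk Nl; apply: le_lt_trans (dc _ _ _ _ _ _) _ => //.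
  apply: le_lt_trans HN; rewrite -(subrKA T).
  apply: le_trans (ler_wpM2l sg0 (ler_normD _ _)) _; rewrite (distrC (tk k)).
  have := ler_wpM2l sg0 (lerD (tkn _ _ Nk) (tkn _ _ Nl)); lra.
have cT (A : set M) : nbhs x A -> exists2 d, 0 < d & forall t, 0 <= t -> T - d < t -> t < T -> A (c t).
  move=> NA; have [e e0 He] := rdist_small Msc NA.
  have e2 : 0 < e / 2 by rewrite divr_gt0.
  have sg1 : 0 < 2 * sg + 1 by rewrite ltr_wpDl// mulr_ge0.
  exists (e / 2 / (2 * sg + 1)); first by rewrite divr_gt0.
  move=> t t0 tl tT; apply: He.
  have [k1 Hk1] := half_pow_small T (divr_gt0 e2 sg1).
  have /cvgrPdist_lt/(_ _ e2)[k2 _ Hk2] := xlim.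
  have := Hk2 (maxn k1 k2) (leq_maxr _ _); rewrite /= sub0r normrN ger0_norm ?rdist_ge0// => H2.
  have H1 := tkn _ _ (leq_maxl k1 k2).
  apply: le_lt_trans (rdist_triangle Msc _ (c (tk (maxn k1 k2))) _) _.
  rewrite rdist_sym (splitr e); apply: ltr_leD => //.
  apply: le_trans (dc _ _ (tk0 _) (tkT _) t0 tT) _.
  have Q : 0 < e / 2 / (2 * sg + 1) by rewrite divr_gt0.
  apply: (@le_trans _ _ (sg * (2 * (e / 2 / (2 * sg + 1))))).
    apply: ler_wpM2l => //; rewrite -(subrKA T) (le_trans (ler_normD _ _))//.
    rewrite (distrC (tk _)) [2 * (e / _ / _)]mulr_natl mulr2n; apply: lerD; first exact: le_trans H1 (ltW Hk1).
    by rewrite ger0_norm; lra.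
  rewrite (_ : sg * _ = (2 * sg) * (e / 2 / (2 * sg + 1))); last by ring.
  rewrite mulrA ler_pdivrMr// mulrC ler_pM2l//; lra.
have Di := chart_atP x; set i := chart_at x in Di.
have [r [K [r0 K0 Hr]]] := sqn_equiv (cdom_chart Di).
have [d1 d10 Hd1] : exists2 d, 0 < d & forall t, 0 <= t -> T - d < t -> t < T ->
    chart_dom i (c t) /\ `|chart i (c t) - chart i x| < r / 2.
  apply: (cT [set y | chart_dom i y /\ `|chart i y - chart i x| < r / 2]).
  apply: filterI; first by apply: open_nbhs_nbhs; split => //; exact: chart_dom_open.
  have NB : nbhs (chart i x) [set z | `|z - chart i x| < r / 2].
    by apply/nearN_P; exists (r / 2) => //; rewrite divr_gt0.
  exact: (chart_continuous Di) NB.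
have vb t : 0 <= t -> T - d1 < t -> t < T -> `|velocity_in i c t| <= K * sg.
  move=> t0 td tT; have [Dt Bt] := Hd1 t t0 td tT.
  have -> : sg = speed c t.
    by apply: ageod_speed => // u /andP[u0 ut]; apply: G => //; exact: le_lt_trans tT.
  have Gt := G t t0 tT.
  have r2 : r / 2 < r by rewrite ltr_pdivrMr// ltr_pMr// ltr1n.
  by rewrite (speedE (ageod_cont Gt) Dt (ageod_der Gt Dt)); apply: ((Hr _ (lt_trans Bt r2)).2 _).1.
pose z0 := row_mx (chart i x) (0 : 'rV[R]_n); pose B := r / 2 + K * sg.
have KS : 0 <= K * sg by rewrite mulr_ge0// ltW.
have r20 : 0 < r / 2 by rewrite divr_gt0.
have B0 : 0 <= B by rewrite addr_ge0// ltW.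
pose box := [set s : 'rV[R]_(n + n) | forall k, (if fintype.split k is inl k' then `[chart i x 0 k' - r / 2, chart i x 0 k' + r / 2]%classic else `[- B, B]%classic) (s 0 k)].
have cbox : compact box.
  apply: (@rV_compact _ _ (fun k => if fintype.split k is inl k' then `[chart i x 0 k' - r / 2, chart i x 0 k' + r / 2]%classic else `[- B, B]%classic)) => k.
  by case: fintype.split => k'; exact: segment_compact.
have lbox t : 0 <= t -> T - d1 < t -> t < T -> box (lift i c t).
  move=> t0 td tT k; have [Dt Bt] := Hd1 t t0 td tT; have vt := vb t t0 td tT.
  rewrite /lift mxE; case: (fintype.split k) => k' /=; rewrite in_itv /=.
    have := le_lt_trans (rv_ge _ k') Bt; rewrite !mxE ltr_norml => /andP[h1 h2].
    by apply/andP; split; lra.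
  have := le_trans (rv_ge _ k') vt; rewrite ler_norml => /andP[h1 h2].
  by rewrite /B; apply/andP; split; lra.
pose F := (lift i c) @ (T^'-).
have FB : F box.
  have d0 : 0 < Num.min d1 T by rewrite lt_min d10.
  rewrite /F /= /fmap /= /at_left /within /=; apply/nearN_P; exists (Num.min d1 T) => // t.
  rewrite ltr_norml => /andP[h1 h2] tT; have : Num.min d1 T <= d1 /\ Num.min d1 T <= T by rewrite !ge_min !lexx orbT.
  by move=> [m1 m2]; apply: lbox => //; lra.
have [s0 [Bs0 Cs0]] := cbox F _ FB.
have C0 : cdom i (lsubmx s0).
  apply: (Hr _ _).1; apply: (@le_lt_trans _ _ (r / 2)); last by rewrite ltr_pdivrMr// ltr_pMr// ltr1n.
  apply: rv_le => [|k]; first exact: ltW.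
  have := Bs0 (lshift n k); rewrite (unsplitK (inl k)) /= in_itv /= => /andP[h1 h2].
  by rewrite !mxE ler_norml; apply/andP; split; lra.
have [T1 [r1 [L [Phi [A [T10 r10 L0 [H _ _ _]]]]]]] := geo_local C0.
pose dd := Num.min d1 (Num.min (T / 2) (T1 / 2)).
have dd0 : 0 < dd by rewrite !lt_min d10 !divr_gt0.
have [t1 [t1l t1T t1r]] : exists t1, [/\ T - dd < t1, t1 < T & `|lift i c t1 - s0| < r1].
  have N1 : nbhs s0 [set s | `|s - s0| < r1] by apply/nearN_P; exists r1.
  have F1 : F (lift i c @` [set t | T - dd < t /\ t < T]).
    rewrite /F /= /fmap /= /at_left /within /=; apply/nearN_P; exists dd => // t.
    rewrite ltr_norml => /andP[h1 h2] tT; exists t => //; split => //; lra.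
  by have [_ [[t [h1 h2] <-] h3]] := Cs0 _ _ F1 N1; exists t.
have [m1 [m2 m3]] : dd <= d1 /\ dd <= T / 2 /\ dd <= T1 / 2 by rewrite !ge_min !lexx !orbT.
have t10 : 0 < t1 by lra.
have [Dt1 _] := Hd1 t1 (ltW t10) (ltac:(lra)) t1T.
have [P0 HP] := H _ t1r.
pose g0 u := chart_inv i (lsubmx (Phi u (lift i c t1))).
pose g u := g0 (1 * u + (- t1)).
have Gg u : `|u - t1| < T1 -> ageod_at g u.
  by move=> uT; apply: ageod_affine; rewrite mul1r; have [] := HP _ uT.
have Gc1 := G t1 (ltW t10) t1T.
have z1 : `|t1 - t1| < T1 by rewrite subrr normr0.
have gt1 : g t1 = c t1 by rewrite /g /g0 mul1r subrr P0 /lift row_mxKl chart_invK.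
have J : same_jet c g t1.
  apply: (@same_lift _ _ _ i) => //; [exact: Gg|by rewrite gt1|].
  have z1' : `|0 : R| < T1 by rewrite normr0.
  have [_ G0 E0] := HP 0 z1'.
  rewrite {2}/lift gt1 /lift; congr row_mx.
  have E1 : velocity_in i g0 0 = velocity_in i c t1.
    by move: E0; rewrite -/g0 /lift P0 => /eq_row_mx[_].
  have Dg0 : chart_dom i (g0 0) by have := gt1; rewrite /g mul1r subrr => ->.
  have D0 := ageod_der (G0 : ageod_at g0 0) Dg0.
  rewrite -E1; apply/esym; apply: velocity_der.
  have -> : velocity_in i g0 0 = 1 *: velocity_in i g0 0 by rewrite scale1r.
  by apply: (der_affine (f := fun s => chart i (g0 s))); rewrite mul1r subrr.
have [Hl Hrr] := glue_geod Gc1 (Gg t1 z1) J.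
exists (fun u => if u <= t1 then c u else g u).
  by have [_ ] := Hl 0 (ltW t10) (G 0 (lexx 0) T0); exact.
move=> t /andP[t0 tT]; have [tt1|t1t] := leP t t1.
  by have [] := Hl t tt1 (G t t0 (le_lt_trans tt1 t1T)).
by apply: Hrr => //; apply: Gg; rewrite gtr0_norm; lra.
Qed.

Lemma geod_exists_upto p v T : 0 <= T ->
  exists c, starts c p v /\ forall t, 0 <= t <= T -> ageod_at c t.
Proof.
move=> T0; suff H : forall t, 0 <= t -> t <= T -> exists c, starts c p v /\ forall s, 0 <= s <= t -> ageod_at c s.
  exact: H.
apply: real_ind.
- have [c [sc G]] := geod_local_exists p v; exists c; split => // s.
  by rewrite -eq_le => /eqP <-.
- move=> t t0 tT /(_ t t0 (lexx t))[c [sc G]].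
  have [d d0 Hd] := proj1 (nearN_P _ _) (ageod_near (G t (ltac:(by rewrite t0 lexx)))).
  exists d => // s ts sd sT; exists c; split => // u /andP[u0 us].
  have [ut|tu] := leP u t; first by apply: G; rewrite u0.
  by apply: Hd; rewrite gtr0_norm ?subr_gt0//; lra.
- move=> t t0 tT H.
  have /choice[C HC] : forall s, exists c, 0 <= s -> s < t -> starts c p v /\ forall u, 0 <= u <= s -> ageod_at c u.
    move=> s; have [s0|?] := pselect (0 <= s /\ s < t).
      by have [c Hc] := H s s0.1 s0.2; exists c.
    by exists (fun=> p) => ? ?; exfalso; tauto.
  have same s s' u : 0 <= u -> u <= s -> u <= s' -> s < t -> s' < t -> C s u = C s' u.
    move=> u0 us us' st s't; have [S1 G1] := HC s (le_trans u0 us) st.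
    have [S2 G2] := HC s' (le_trans u0 us') s't.
    have [] := geo_unique (b := u) _ (starts_same S1 S2) u0 (lexx u) => // w w0 wu.
    by split; [apply: G1|apply: G2]; rewrite w0 (le_trans wu).
  (* At each time a solution existing beyond that time is used; near 0 it is one and the same
     solution, from which the initial velocity is read off. *)
  pose c u := if u <= t / 2 then C (t / 2) u else C ((u + t) / 2) u.
  have cE s u : 0 <= u -> u <= s -> s < t -> c u = C s u.
    move=> u0 us st; rewrite /c; case: ifP => h; apply: same => //; lra.
  have [|c' N0 G'] := @geod_extend c t t0.
    move=> u u0 ut; pose s := (u + t) / 2.
    have us : u < s by rewrite /s; lra.
    have st : s < t by rewrite /s; lra.
    have [S1 G1] := HC s (ltac:(lra)) st.
    move: u0; rewrite le_eqVlt => /predU1P[u0|u0].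
      rewrite -u0; have t20 : 0 < t / 2 by rewrite divr_gt0.
      have [S2 G2] := HC (t / 2) (ltW t20) (ltac:(lra)).
      apply: (@ageod_eq_near (C (t / 2))); last by apply: G2; rewrite lexx ltW.
      apply/nearN_P; exists (t / 2) => // w; rewrite subr0 ltr_norml => /andP[_ h].
      by rewrite /c ifT// ltW.
    apply: (@ageod_eq_near (C s)); last by apply: G1; rewrite !ltW.
    have m0 : 0 < Num.min u (s - u) by rewrite lt_min u0 subr_gt0.
    apply/nearN_P; exists (Num.min u (s - u)) => // w; rewrite lt_min !ltr_norml => /andP[/andP[h1 _] /andP[_ h2]].
    by apply/esym/cE => //; lra.
  exists c'; split => //; apply: starts_near N0 _.
  have t20 : 0 < t / 2 by rewrite divr_gt0.
  have [S2 _] := HC (t / 2) (ltW t20) (ltac:(lra)).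
  apply: starts_near S2; apply/nearN_P; exists (t / 2) => // w; rewrite subr0 ltr_norml => /andP[_ h].
  by rewrite /c ifT// ltW.
Qed.

Lemma geod_exists_fwd p v : exists c, starts c p v /\ forall t, 0 <= t -> ageod_at c t.
Proof.
have /choice[C HC] : forall T, exists c, 0 <= T -> starts c p v /\ forall t, 0 <= t <= T -> ageod_at c t.
  move=> T; have [T0|?] := pselect (0 <= T); last by exists (fun=> p).
  by have [c Hc] := geod_exists_upto p v T0; exists c.
have same s s' u : 0 <= u -> u <= s -> u <= s' -> C s u = C s' u.
  move=> u0 us us'; have [S1 G1] := HC s (le_trans u0 us).
  have [S2 G2] := HC s' (le_trans u0 us').
  have [] := geo_unique (b := u) _ (starts_same S1 S2) u0 (lexx u) => // w w0 wu.
  by split; [apply: G1|apply: G2]; rewrite w0 (le_trans wu).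
pose c u := if u <= 1 then C 1 u else C u u.
have N0 : \forall u \near (0 : R), C 1 u = c u.
  apply/nearN_P; exists 1 => // w; rewrite subr0 ltr_norml => /andP[_ h].
  by rewrite /c ifT// ltW.
have [S1 G1] := HC 1 ler01.
exists c; split; first exact: starts_near N0 S1.
move=> t; rewrite le_eqVlt => /predU1P[<-|t0].
  by apply: ageod_eq_near N0 _; apply: G1; rewrite lexx ler01.
have t1 : 0 <= t + 1 by rewrite addr_ge0// ltW.
have [S2 G2] := HC (t + 1) t1.
apply: (@ageod_eq_near (C (t + 1))); last by apply: G2; rewrite ltW//= lerDl.
have m0 : 0 < Num.min t 1 by rewrite lt_min t0 ltr01.
apply/nearN_P; exists (Num.min t 1) => // w; rewrite lt_min !ltr_norml => /andP[/andP[h1 _] /andP[_ h2]].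
rewrite /c; case: ifP => h; apply: same => //; lra.
Qed.

Lemma geod_exists p v : exists c, starts c p v /\ forall t, ageod_at c t.
Proof.
have [c [S G]] := geod_exists_fwd p v; have [c' [S' G']] := geod_exists_fwd p (- v).
pose o u := c' (-1 * u + 0).
have z0 : -1 * 0 + 0 = 0 :> R by ring.
have Go u : u <= 0 -> ageod_at o u by move=> u0; apply: ageod_affine; apply: G'; lra.
have So : starts o p v.
  split; first by rewrite /o z0; exact: S'.1.
  by rewrite velocity_affine z0 ?S'.2 ?scaleN1r ?opprK//; exact: G'.
have J : same_jet o c 0 := starts_same So S.
have [Hl Hr] := glue_geod (Go 0 (lexx 0)) (G 0 (lexx 0)) J.
have N0 : \forall u \near (0 : R), o u = (if u <= 0 then o u else c u).
  have := same_jet_near (Go 0 (lexx 0)) (G 0 (lexx 0)) J.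
  by apply: filterS => u [E _]; case: ifP.
exists (fun u => if u <= 0 then o u else c u); split; first exact: starts_near N0 So.
move=> t; have [t0|t0] := leP t 0; first by have [] := Hl t t0 (Go t t0).
by apply: Hr => //; apply: G; exact: ltW.
Qed.

End global_geodesics.

(** * The exponential map *)

Section variation.
Context {R : realType} {n : nat} {M : riemannian_manifold R n}.
Implicit Types (a b s t u r e d K T L l : R) (p q x y : M) (c : R -> M) (i j : chart_index M).

Lemma sdiff_fd (m k : nat) (f : 'rV[R]_m -> 'rV[R]_k) (z : 'rV[R]_m) A : sdiff f z A -> fd f z (fun h => h *m A).
Proof.
move=> H e e0; have [d d0 Hd] := H e e0; exists d => // w wd.
by apply: Hd => //; rewrite subrr normr0.
Qed.

Lemma sdiff_cont (m k : nat) (f : 'rV[R]_m -> 'rV[R]_k) (z : 'rV[R]_m) A : sdiff f z A -> {for z, continuous f}.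
Proof. by move=> /sdiff_fd /fd_lip H; apply: lip_cont (H (m%:R * `|A|) (fun h => mulmx_le h A)). Qed.

Lemma sdiff_der (m k : nat) (f : 'rV[R]_m -> 'rV[R]_k) A (c : R -> 'rV[R]_m) t v :
  sdiff f (c t) A -> is_derive t (1 : R) c v -> is_derive t (1 : R) (fun s => f (c s)) (v *m A).
Proof.
move=> /sdiff_fd H /der_fd Hc; apply/der_fd.
apply: fd_eq (fd_comp Hc H (C := `|v|) _ (fun h => mulmx_le h A) _) _ => [h|x y|h] /=.
- by rewrite normrZ mulrC.
- exact: mulmxBl.
- by rewrite scalemxAl.
Qed.

Lemma sdiff_near (m k : nat) (f g : 'rV[R]_m -> 'rV[R]_k) (z : 'rV[R]_m) A :
  (\forall w \near z, f w = g w) -> sdiff f z A -> sdiff g z A.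
Proof.
move=> N H e e0; have [d d0 Hd] := H e e0; have [d' d'0 Hd'] := proj1 (nearN_P _ _) N.
exists (Num.min d d'); first by rewrite lt_min d0.
move=> w w'; rewrite !lt_min => /andP[wd wd'] /andP[w'd w'd'].
by rewrite -!Hd'//; exact: Hd.
Qed.

Lemma sdiff_comp (m k l : nat) (f : 'rV[R]_m -> 'rV[R]_k) (g : 'rV[R]_k -> 'rV[R]_l) (z : 'rV[R]_m) A B :
  sdiff f z A -> sdiff g (f z) B -> sdiff (g \o f) z (A *m B).
Proof.
move=> Hf Hg e e0.
set CA := m%:R * `|A| + 1; have CA0 : 0 < CA by rewrite ltr_wpDl// mulr_ge0.
set CB := k%:R * `|B| + 1; have CB0 : 0 < CB by rewrite ltr_wpDl// mulr_ge0.
have e2 : 0 < e / 2 by rewrite divr_gt0.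
have [d1 d10 H1] := Hg _ (divr_gt0 e2 CA0).
have [d2 d20 H2] := Hf _ (divr_gt0 e2 CB0).
have [d3 d30 H3] := Hf _ ltr01.
exists (Num.min d2 (Num.min d3 (d1 / CA))); first by rewrite !lt_min d20 d30 divr_gt0.
have lip w w' : `|w - z| < d3 -> `|w' - z| < d3 -> `|f w - f w'| <= CA * `|w - w'|.
  move=> wd wd'; rewrite -(subrK ((w - w') *m A) (f w - f w')) (le_trans (ler_normD _ _))//.
  rewrite /CA mulrDl addrC; apply: lerD; first exact: mulmx_le.
  exact: H3.
have z3 : `|z - z| < d3 by rewrite subrr normr0.
move=> w w'; rewrite !lt_min => /and3P[wd2 wd3 wd1] /and3P[wd2' wd3' wd1'].
have i1 v : `|v - z| < d3 -> `|v - z| < d1 / CA -> `|f v - f z| < d1.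
  by move=> v3 v1; apply: le_lt_trans (lip _ _ v3 z3) _; rewrite mulrC -ltr_pdivlMr.
have K1 := H1 _ _ (i1 _ wd3 wd1) (i1 _ wd3' wd1'); have K2 := H2 _ _ wd2 wd2'.
have -> : (g \o f) w - (g \o f) w' - (w - w') *m (A *m B) =
  (g (f w) - g (f w') - (f w - f w') *m B) + (f w - f w' - (w - w') *m A) *m B.
  by rewrite [X in _ = _ + X]mulmxBl mulmxA addrA subrK.
apply: le_trans (ler_normD _ _) _; rewrite (splitr e) mulrDl; apply: lerD.
  apply: le_trans K1 _; rewrite -mulrA; apply: (@le_trans _ _ (e / 2 * (CA^-1 * (CA * `|w - w'|)))).
    by rewrite ler_pM2l// ler_pM2l ?invr_gt0//; exact: lip.
  by rewrite (mulrA CA^-1) mulVf ?mul1r// gt_eqF.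
apply: le_trans (mulmx_le _ _) _.
apply: (@le_trans _ _ (CB * (e / 2 / CB * `|w - w'|))).
  apply: ler_pM => //.
  by rewrite /CB lerDl.
by rewrite -mulrA mulrCA (mulrA CB) mulfV ?mul1r// gt_eqF.
Qed.

Lemma sdiff_lin (m k : nat) (A : 'M[R]_(m, k)) z : sdiff (fun w => w *m A) z A.
Proof.
move=> e e0; exists 1 => // w w' _ _.
by rewrite mulmxBl subrr normr0 mulr_ge0// ltW.
Qed.

Lemma sdiffD_cst (m k : nat) (f : 'rV[R]_m -> 'rV[R]_k) z A (b : 'rV[R]_k) : sdiff f z A -> sdiff (fun w => b + f w) z A.
Proof.
move=> H e /H[d d0 Hd]; exists d => // w w' h h'.
have -> : b + f w - (b + f w') = f w - f w' by rewrite opprD addrACA subrr add0r.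
exact: Hd.
Qed.

Lemma ck_sdiff (m k : nat) (U : set 'rV[R]_m) (F : 'rV[R]_m -> 'rV[R]_k) z : open U -> ckv 2 U F -> U z ->
  sdiff F z (jac F z).
Proof.
move=> oU cF Uz e e0; have [r [K [r0 K0 _ _ H]]] := near_quad oU cF Uz.
exists (Num.min r (e / (2 * K))); first by rewrite lt_min r0 divr_gt0// mulr_gt0.
move=> w w'; rewrite !lt_min => /andP[wr we] /andP[wr' we'].
have zz : `|z - z| < r by rewrite subrr normr0.
apply: le_trans (H _ _ _ zz wr wr') _; rewrite ler_wpM2r//.
have := ler_wpM2l (ltW K0) (ltW (ltrD we we')); move/le_trans; apply.
by rewrite le_eqVlt; apply/orP; left; apply/eqP; field; rewrite gt_eqF.
Qed.

Lemma geo_unique_back c c' a b : (forall t, a <= t -> t <= b -> ageod_at c t /\ ageod_at c' t) ->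
  same_jet c c' b -> forall t, a <= t -> t <= b -> c t = c' t.
Proof.
move=> G J t at_ tb; pose o (f : R -> M) s := f (-1 * s + 0).
have G' s : - b <= s -> s <= - a -> ageod_at (o c) s /\ ageod_at (o c') s.
  move=> h1 h2; have h3 : a <= -1 * s + 0 by lra.
  have h4 : -1 * s + 0 <= b by lra.
  by have [g g'] := G _ h3 h4; split; exact: ageod_affine.
have ab : a <= b by lra.
have [gb gb'] := G b ab (lexx b).
have bb : -1 * - b + 0 = b by ring.
have Jo : same_jet (o c) (o c') (- b) by apply: same_jet_affine; rewrite bb.
have h1 : - b <= - t by lra.
have h2 : - t <= - a by lra.
have [E _] := geo_unique G' Jo h1 h2.
by move: E; rewrite /o mulN1r opprK addr0.
Qed.

Lemma geo_unique_ball c c' t1 T : (forall t, `|t - t1| < T -> ageod_at c t /\ ageod_at c' t) ->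
  same_jet c c' t1 -> forall t, `|t - t1| < T -> c t = c' t.
Proof.
move=> G J t tT; have [t1t|tt1] := leP t1 t.
  have G1 s : t1 <= s -> s <= t -> ageod_at c s /\ ageod_at c' s.
    by move=> h h'; apply: G; apply: le_lt_trans tT; rewrite !ger0_norm; lra.
  by have [] := geo_unique G1 J t1t (lexx t).
have G1 s : t <= s -> s <= t1 -> ageod_at c s /\ ageod_at c' s.
  by move=> h h'; apply: G; apply: le_lt_trans tT; rewrite !ler0_norm; lra.
exact: (geo_unique_back G1 J (lexx t) (ltW tt1)).
Qed.

Definition geo p (v : 'rV[R]_n) : R -> M :=
  xget (fun=> p) [set c | starts c p v /\ forall t, ageod_at c t].

(* the derivative of the lifted tangent map is block triangular; only its
   smoothness matters here *)
Definition ttrans i j (s : 'rV[R]_(n + n)) : 'rV[R]_(n + n) :=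
  row_mx (trans (M := M) id i j (lsubmx s)) (rsubmx s *m jac (trans (M := M) id i j) (lsubmx s)).

Lemma ck_ttrans i j N : ckv N (sdom (tdom (M := M) id i j)) (ttrans i j).
Proof.
have [cid _ _] := @id_local _ _ M; have oT := @tdom_open _ _ M id i j cid.
have cl k : ck N (sdom (tdom (M := M) id i j)) (fun s : 'rV[R]_(n + n) => lsubmx s 0 k).
  have -> : (fun s : 'rV[R]_(n + n) => lsubmx s 0 k) = fun s : 'rV[R]_(n + n) => s 0 (lshift n k).
    by apply/funext => s; rewrite mxE.
  exact: ck_coord.
apply: split_ind => k.
  have -> : (fun s : 'rV[R]_(n + n) => ttrans i j s 0 (lshift n k)) = fun s : 'rV[R]_(n + n) => trans id i j (lsubmx s) 0 k.
    by apply/funext => s; rewrite /ttrans row_mxEl.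
  apply: (@ck_comp R N n (n + n) (sdom (tdom id i j)) (tdom id i j) (fun z => trans id i j z 0 k) (fun s : 'rV[R]_(n + n) => lsubmx s)) => //.
  exact: ck_trans id_local k.
have -> : (fun s : 'rV[R]_(n + n) => ttrans i j s 0 (rshift n k)) =
    fun s : 'rV[R]_(n + n) => \sum_a s 0 (rshift n a) * partial a (fun z => trans id i j z 0 k) (lsubmx s).
  by apply/funext => s; rewrite /ttrans row_mxEr mxE; apply: eq_bigr => a _; rewrite !mxE.
apply: (ck_sum xpredT) => a; apply: ckM; first exact: ck_coord.
apply: (@ck_comp R N n (n + n) (sdom (tdom id i j)) (tdom id i j) (partial a (fun z => trans id i j z 0 k)) (fun s : 'rV[R]_(n + n) => lsubmx s)) => //.
by apply: ck_partial => //; exact: ck_trans id_local k.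
Qed.

Lemma lift_ttrans i j c t : ageod_at c t -> chart_dom i (c t) -> chart_dom j (c t) ->
  lift j c t = ttrans i j (lift i c t).
Proof.
move=> G Di Dj; rewrite /ttrans /lift row_mxKl row_mxKr; congr row_mx.
  by rewrite /trans chart_invK.
exact: velocity_der (velocity_trans id_local (ageod_cont G) Di Dj (ageod_der G Di)).
Qed.

Hypothesis Msc : simply_connected M.
Hypothesis Mc : rcomplete M.

Lemma geoP p v : starts (geo p v) p v /\ forall t, ageod_at (geo p v) t.
Proof.
have [c Hc] := geod_exists Msc Mc p v.
exact: (@xgetPex _ (fun=> p) [set c | starts c p v /\ forall t, ageod_at c t] (ex_intro _ c Hc)).
Qed.

Lemma geo_ageod p v t : ageod_at (geo p v) t.
Proof. exact: (geoP p v).2. Qed.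

Lemma geo_eq c p v : starts c p v -> (forall t, ageod_at c t) -> c = geo p v.
Proof.
move=> S G; have [S' G'] := geoP p v; exact: geo_unique_all G G' (starts_same S S').
Qed.

Lemma geo0 p v : geo p v 0 = p.
Proof. exact: (geoP p v).1.1. Qed.

Lemma geo_velocity p v : velocity (geo p v) 0 = v.
Proof. exact: (geoP p v).1.2. Qed.

Lemma geo_scale p v a t : geo p (a *: v) t = geo p v (a * t).
Proof.
rewrite -(@geo_eq (fun t => geo p v (a * t + 0))) ?addr0//.
  split; first by rewrite mulr0 addr0 geo0.
  by rewrite velocity_affine ?mulr0 ?addr0 ?geo_velocity//; exact: geo_ageod.
by move=> s; apply: ageod_affine; exact: geo_ageod.
Qed.

Lemma lift_geo0 i p v : chart_dom i p ->
  lift i (geo p v) 0 = row_mx (chart i p) (v *m jac (trans id (chart_at p) i) (chart (chart_at p) p)).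
Proof.
move=> Di; rewrite /lift geo0; congr row_mx.
have Dp := chart_atP p; have G := ((geoP p v).2 0).
have Dp0 : chart_dom (chart_at p) (geo p v 0) by rewrite geo0.
have Di0 : chart_dom i (geo p v 0) by rewrite geo0.
have T := velocity_trans id_local (ageod_cont G) Dp0 Di0 (ageod_der G Dp0).
rewrite (velocity_der T) geo0; congr (_ *m _).
by have := geo_velocity p v; rewrite /velocity geo0.
Qed.

(** Strict differentiability at [v0] of the map from initial velocities to the state at time [t],
    read in the chart [i]; the first clause makes this reading meaningful around [v0]. *)
Definition good_in p (v0 : 'rV[R]_n) i t :=
  (\forall v \near v0, chart_dom i (geo p v t)) /\
  exists A, sdiff (fun v => lift i (geo p v) t) v0 A.

Lemma good_change p v0 i j t : good_in p v0 i t -> chart_dom j (geo p v0 t) -> good_in p v0 j t.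
Proof.
move=> [N [A HA]] Dj; have Di := nbhs_singleton N.
have cA := sdiff_cont HA.
have T0 : tdom id i j (chart i (geo p v0 t)) by exists (geo p v0 t).
have [cid _ _] := @id_local _ _ M; have oT := @tdom_open _ _ M id i j cid.
have S0 : sdom (tdom id i j) (lift i (geo p v0) t) by rewrite /sdom /= /lift row_mxKl.
have Nj : \forall v \near v0, chart_dom j (geo p v t).
  have NS : nbhs (lift i (geo p v0) t) (sdom (tdom id i j)).
    by apply: open_nbhs_nbhs; split => //; exact: sdom_open.
  apply: filterS2 N (cA _ NS) => v Dv; rewrite /sdom /= /lift row_mxKl => /tdomP[_].
  by rewrite chart_invK.
split => //; exists (A *m jac (ttrans i j) (lift i (geo p v0) t)).
have H := sdiff_comp HA (ck_sdiff (sdom_open oT) (ck_ttrans i j 2) S0).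
apply: sdiff_near H; apply: filterS2 N Nj => v Dv Djv.
by rewrite /= -(lift_ttrans ((geoP p v).2 t)).
Qed.

Lemma good0 p v0 i : chart_dom i p -> good_in p v0 i 0.
Proof.
move=> Di; split; first by apply: filterE => v; rewrite geo0.
exists (row_mx 0 (jac (trans id (chart_at p) i) (chart (chart_at p) p))).
apply: (@sdiff_near _ _ (fun v => row_mx (chart i p) 0 + v *m row_mx 0 (jac (trans id (chart_at p) i) (chart (chart_at p) p)))).
  by apply: filterE => v; rewrite lift_geo0// mul_mx_row mulmx0 add_row_mx addr0 add0r.
by apply: sdiffD_cst; exact: sdiff_lin.
Qed.

(* Around every time, the flow in one chart transports the strict derivative. *)
Lemma good_step p v0 i ts : chart_dom i (geo p v0 ts) -> exists2 d, 0 < d &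
  forall t1, `|t1 - ts| < d -> good_in p v0 i t1 -> exists (A1 : 'M[R]_(n, n + n)) (F : R -> 'M[R]_(n + n)),
  [/\ sdiff (fun v => lift i (geo p v) t1) v0 A1,
   forall t, `|t - ts| < d -> (\forall v \near v0, chart_dom i (geo p v t)) /\
      sdiff (fun v => lift i (geo p v) t) v0 (A1 *m F t) &
   forall t, `|t - ts| < d -> forall w : 'rV[R]_(n + n), is_derive t (1 : R) (fun t => w *m F t)
         (w *m F t *m jac (spray (gram i)) (lift i (geo p v0) t))].
Proof.
move=> Ds; set c0 := geo p v0; set s0 := lift i c0 ts.
have C0 : cdom i (lsubmx s0) by rewrite /s0 /lift row_mxKl; exact: cdom_chart.
have [T [r [L [Phi [A [T0 r0 L0 [H1 H2 H3 H4]]]]]]] := geo_local C0.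
have Gs := ((geoP p v0).2 ts).
have [_ Dl] := nbhs_singleton (Gs i Ds).
have [d1 d10 Hd1] : exists2 d, 0 < d & forall t, `|t - ts| < d -> `|lift i c0 t - s0| < r.
  have r2 : 0 < r / 2 by rewrite divr_gt0.
  have /contP/(_ _ r2)[d d0 Hd] := der_cont Dl; exists d => // t /Hd /le_lt_trans; apply.
  by rewrite ltr_pdivrMr// ltr_pMr// ltr1n.
exists (Num.min d1 (T / 2)); first by rewrite lt_min d10 divr_gt0.
move=> t1; rewrite lt_min => /andP[t1d t1T] [N1 [A1 HA1]].
have s1r := Hd1 _ t1d; set s1 := lift i c0 t1 in s1r.
have NB : \forall v \near v0, `|lift i (geo p v) t1 - s0| < r.
  have NN : nbhs s1 [set s | `|s - s0| < r].
    apply/nearN_P; exists (r - `|s1 - s0|); first by rewrite subr_gt0.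
    by move=> y yr /=; rewrite -(subrKA s1) (le_lt_trans (ler_normD _ _))// -ltrBrDr.
  exact: (sdiff_cont HA1) NN.
have tT t : `|t - ts| < T / 2 -> `|t - t1| < T.
  move=> h; rewrite -(subrKA ts) (le_lt_trans (ler_normD _ _))// (splitr T) ltrD// distrC.
  exact: t1T.
have flowE v : chart_dom i (geo p v t1) -> `|lift i (geo p v) t1 - s0| < r ->
   forall t, `|t - t1| < T -> chart_dom i (geo p v t) /\ lift i (geo p v) t = Phi (t - t1) (lift i (geo p v) t1).
  move=> Dv Bv; have [P0 HP] := H1 _ Bv; set sv := lift i (geo p v) t1 in P0 HP *.
  pose g0 u := chart_inv i (lsubmx (Phi u sv)).
  pose g u := g0 (1 * u + (- t1)).
  have G0 u : `|u| < T -> ageod_at g0 u by move=> /HP[].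
  have Gg u : `|u - t1| < T -> ageod_at g u by move=> uT; apply: ageod_affine; rewrite mul1r; exact: G0.
  have Dg0 u : `|u| < T -> chart_dom i (g0 u) by move=> /HP[Cu _ _]; exact: chart_invD.
  have lg u : `|u - t1| < T -> lift i g u = Phi (u - t1) sv.
    move=> uT; have [_ _ <-] := HP _ uT; rewrite /lift /g mul1r; congr row_mx.
    apply: velocity_der; have -> : velocity_in i g0 (u - t1) = 1 *: velocity_in i g0 (u - t1) by rewrite scale1r.
    apply: (der_affine (f := fun s => chart i (g0 s))); rewrite mul1r.
    by apply: ageod_der; [exact: G0|exact: Dg0].
  have z1 : `|t1 - t1| < T by rewrite subrr normr0.
  have Dg u : `|u - t1| < T -> chart_dom i (g u) by move=> uT; rewrite /g mul1r; exact: Dg0.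
  have J : same_jet (geo p v) g t1.
    apply: (@same_lift _ _ _ i); [exact: geo_ageod|exact: Gg|done|exact: Dg|].
    by rewrite lg// subrr P0.
  have E := geo_unique_ball (fun t h => conj ((geoP p v).2 t) (Gg t h)) J.
  move=> t ht; split; first by rewrite E//; exact: Dg.
  rewrite -lg// /lift E//; congr row_mx; apply: velocity_der.
  have := ageod_der (Gg t ht) (Dg t ht); apply: der_near.
  have : \forall u \near t, `|u - t1| < T.
    apply/nearN_P; exists (T - `|t - t1|); first by rewrite subr_gt0.
    by move=> y yr; rewrite -(subrKA t) (le_lt_trans (ler_normD _ _))// -ltrBrDr.
  by apply: filterS => u hu; rewrite E.
have Dv0 := nbhs_singleton N1.
exists A1, (fun t => A s1 (t - t1)); split => // t; rewrite lt_min => /andP[td tT2].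
  split.
    by apply: filterS2 N1 NB => v Dv Bv; have [] := flowE v Dv Bv t (tT _ tT2).
  apply: (@sdiff_near _ _ (Phi (t - t1) \o (fun v => lift i (geo p v) t1))).
    by apply: filterS2 N1 NB => v Dv Bv; have [_ ->] := flowE v Dv Bv t (tT _ tT2).
  by apply: sdiff_comp => //; apply: H4 => //; exact: tT.
move=> w; have [_ HD] := H3 _ s1r.
have := HD _ (tT _ tT2) w; rewrite -(flowE v0 Dv0 s1r t (tT _ tT2)).2.
have := @der_affine _ _ (fun t => w *m A s1 t) 1 (- t1) t (w *m A s1 (t - t1) *m jac (spray (gram i)) (lift i (geo p v0) t)).
rewrite mul1r scale1r => H /H.
by under [X in is_derive _ _ X _ -> _]eq_fun do rewrite mul1r.
Qed.

(** Continuity induction from time 0, forwards and backwards through the sign [sg]. Around every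
    time [good_step] gives an interval on which the property at one time implies it at all the
    others, so it serves both to continue and to close up. *)
Lemma good_all p v0 t i : chart_dom i (geo p v0 t) -> good_in p v0 i t.
Proof.
pose P s := forall j, chart_dom j (geo p v0 s) -> good_in p v0 j s.
suff H : forall sg : R, `|sg| = 1 -> forall s, 0 <= s -> s <= `|t| -> P (sg * s).
  move: i; change (P t); have [t0|t0] := leP 0 t.
    by have := H 1 (normr1 _) t t0; rewrite mul1r; apply; rewrite ger0_norm.
  have := H (-1) _ (- t); rewrite mulN1r opprK; apply; rewrite ?normrN ?normr1//; first lra.
  by rewrite ltr0_norm.
move=> sg sg1.
have sgN r d : `|sg * r - sg * d| = `|r - d| by rewrite -mulrBr normrM sg1 mul1r.
have step ts : exists2 d, 0 < d & forall s s', `|s - ts| < d -> `|s' - ts| < d -> P (sg * s) -> P (sg * s').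
  pose i0 := chart_at (geo p v0 (sg * ts)).
  have Di : chart_dom i0 (geo p v0 (sg * ts)) by exact: chart_atP.
  have [d d0 Hd] := good_step Di.
  have [d' d'0 Hd'] := proj1 (nearN_P _ _) (near_dom (ageod_cont ((geoP p v0).2 (sg * ts))) Di).
  exists (Num.min d d'); first by rewrite lt_min d0.
  move=> s s'; rewrite !lt_min => /andP[sd sd'] /andP[s'd s'd'] Ps j Dj.
  have [||A1 [F [_ H _]]] := Hd (sg * s); [by rewrite sgN|by apply: Ps; apply: Hd'; rewrite sgN|].
  apply: (@good_change _ _ i0) => //; have [|N S] := H (sg * s'); first by rewrite sgN.
  by split => //; exists (A1 *m F (sg * s')).
apply: real_ind.
- by rewrite mulr0 => j; rewrite geo0; exact: good0.
- move=> s s0 sT Hs; have [d d0 Hd] := step s; exists d => // s' ss' s'd _.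
  apply: (Hd s s'); [by rewrite subrr normr0|by rewrite gtr0_norm; lra|exact: Hs].
- move=> s s0 sT Hs; have [d d0 Hd] := step s.
  have [s' [h1 h2 h3]] := left_point s0 d0.
  by apply: (Hd s' s) => //; [rewrite subrr normr0|exact: Hs].
Qed.

End variation.

(** * Jacobi fields and the differential of the exponential map *)

Section jacobi.
Context {R : realType} {n : nat} {M : riemannian_manifold R n}.
Implicit Types (a b s t u r e d K T L l : R) (p q : M) (c : R -> M) (i j : chart_index M).

(** The derivative of [gam g x v w] in the base point [x], in the direction [xi]. *)
Definition dgam (g : 'rV[R]_n -> 'M[R]_n) (x xi v w : 'rV[R]_n) : 'rV[R]_n :=
  \row_k \sum_a \sum_b (\sum_c xi 0 c * partial c (chr g k a b) x) * v 0 a * w 0 b.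

Lemma der_cst (W : normedModType R) (y : W) t : is_derive t (1 : R) (fun _ : R => y) 0.
Proof.
apply/derP => e e0; exists 1 => // s _.
by rewrite scaler0 !subrr normr0 mulr_ge0// ltW.
Qed.

Lemma lsub_mul (m k l h : nat) (z : 'M[R]_(m, k)) (C : 'M[R]_(k, l + h)) : lsubmx (z *m C) = z *m lsubmx C.
Proof. by apply/matrixP => a b; rewrite !mxE; apply: eq_bigr => c _; rewrite mxE. Qed.

Lemma gamDr g (x v w w' : 'rV[R]_n) : gam g x v (w + w') = gam g x v w + gam g x v w'.
Proof.
apply/rowP => k; rewrite !mxE -big_split; apply: eq_bigr => a _ /=.
by rewrite -big_split; apply: eq_bigr => b _ /=; rewrite !mxE mulrDr.
Qed.

Lemma gamNl g (x v w : 'rV[R]_n) : gam g x (- v) w = - gam g x v w.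
Proof. by rewrite -[- v]scaleN1r -[w in LHS]scale1r gam_scale mulr1 scaleN1r. Qed.

Lemma chr_symm U g k (a b : 'I_n) (x : 'rV[R]_n) : metric_on U g -> U x -> chr g k a b x = chr g k b a x.
Proof.
move=> mg Ux; rewrite /chr; congr (_ * _); apply: eq_bigr => l _; congr (_ * _).
rewrite [X in X - _]addrC; congr (_ - _).
apply: (@partial_ext _ _ _ _ _ _ 0 U) => //; [exact: metric_open mg|exact: metric_ck mg _ _ _|].
by move=> z Uz; rewrite -{1}(metric_sym mg Uz) mxE.
Qed.

Lemma gam_symm U g (x v w : 'rV[R]_n) : metric_on U g -> U x -> gam g x v w = gam g x w v.
Proof.
move=> mg Ux; apply/rowP => k; rewrite !mxE exchange_big /=.
by apply: eq_bigr => a _; apply: eq_bigr => b _; rewrite (chr_symm k b a mg Ux) -mulrA -mulrA [v 0 b * _]mulrC.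
Qed.

Lemma dgam_symm U g (x xi v w : 'rV[R]_n) : metric_on U g -> U x -> dgam g x xi v w = dgam g x xi w v.
Proof.
move=> mg Ux; apply/rowP => k; rewrite !mxE exchange_big /=.
apply: eq_bigr => a _; apply: eq_bigr => b _.
have E : \sum_c xi 0 c * partial c (chr g k b a) x = \sum_c xi 0 c * partial c (chr g k a b) x.
  apply: eq_bigr => c _; apply: (congr1 (fun z => xi 0 c * z)).
  apply: (@partial_ext _ _ _ _ _ _ 0 U); [exact: metric_open mg|exact: ck_chr mg|exact: Ux|].
  by move=> z Uz; exact: (chr_symm k b a mg Uz).
rewrite [RHS]mulrAC; exact: (congr1 (fun z => z * v 0 b * w 0 a) E).
Qed.

Lemma der_gam U g (x v w : R -> 'rV[R]_n) t x' v' w' : metric_on U g -> U (x t) ->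
  is_derive t (1 : R) x x' -> is_derive t (1 : R) v v' -> is_derive t (1 : R) w w' ->
  is_derive t (1 : R) (fun s => gam g (x s) (v s) (w s))
    (dgam g (x t) x' (v t) (w t) + gam g (x t) v' (w t) + gam g (x t) (v t) w').
Proof.
move=> mg Ux Dx /der_rvP Dv /der_rvP Dw; apply/der_rvP => k.
have -> : (fun s => gam g (x s) (v s) (w s) 0 k) =
   fun s => \sum_a \sum_b chr g k a b (x s) * v s 0 a * w s 0 b by apply/funext => s; rewrite mxE.
have -> : (dgam g (x t) x' (v t) (w t) + gam g (x t) v' (w t) + gam g (x t) (v t) w') 0 k =
  \sum_a \sum_b ((\sum_c x' 0 c * partial c (chr g k a b) (x t)) * v t 0 a * w t 0 b
   + chr g k a b (x t) * v' 0 a * w t 0 b + chr g k a b (x t) * v t 0 a * w' 0 b).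
  rewrite !mxE -!big_split; apply: eq_bigr => a _ /=; rewrite -!big_split.
  by apply: eq_bigr => b _.
apply: der_sum => a; apply: der_sum => b.
have Dc := der_comp (ck_hg (ck_chr 1 k a b mg) Ux) Dx.
have E : dot x' (\row_c partial c (chr g k a b) (x t)) = \sum_c x' 0 c * partial c (chr g k a b) (x t).
  by apply: eq_bigr => c _; rewrite mxE.
rewrite E in Dc; move: Dc; set S := \sum_c _ => Dc.
have := is_deriveM (is_deriveM Dc (Dv a)) (Dw b); move/is_derive_eq; apply.
have -> : ((chr g k a b \o x) * (fun s => v s 0 a)) t = chr g k a b (x t) * v t 0 a by [].
clear E Dc; clearbody S; rewrite /GRing.scale /comp; move: (chr g k a b (x t)) => C0.
by rewrite /=; ring.
Qed.

Lemma jac_spray U g (x v xi eta : 'rV[R]_n) : metric_on U g -> U x ->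
  row_mx xi eta *m jac (spray g) (row_mx x v) =
  row_mx eta (- (dgam g x xi v v + gam g x eta v + gam g x v eta)).
Proof.
move=> mg Ux.
pose c s := row_mx x v + s *: row_mx xi eta.
have c0 : c 0 = row_mx x v by rewrite /c scale0r addr0.
have cd : is_derive (0 : R) (1 : R) c (row_mx xi eta).
  by have := der_segment (row_mx x v) (row_mx x v + row_mx xi eta) 0; rewrite addrAC subrr add0r.
have Uc : sdom U (c 0) by rewrite c0 /sdom /= row_mxKl.
have D1 := der_jac (ck_spray 1 mg) Uc cd; rewrite c0 in D1.
have Dl := der_lsubmx cd; have Dr := der_rsubmx cd; rewrite row_mxKl in Dl; rewrite row_mxKr in Dr.
have D2 := der_row_mx Dr (is_deriveN (der_gam (x := fun s => lsubmx (c s)) mg Uc Dl Dr Dr)).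
rewrite c0 row_mxKl row_mxKr in D2.
exact: derm_unique (proj2 (derm_row _ _ _) D1) (proj2 (derm_row _ _ _) D2).
Qed.

Hypothesis Msc : simply_connected M.
Hypothesis Mc : rcomplete M.

Section field.
Variables (p : M) (v0 w : 'rV[R]_n).
Local Notation c0 := (geo p v0).

(** The derivative at [s = 0] of the state at time [t] under the variation [v0 + s w] of the initial
    velocity. It solves the linearised spray equation; its position half [jfield] is the Jacobi
    field of the variation. *)
Definition vfield i t : 'rV[R]_(n + n) :=
  \row_k derive1 (fun s => lift i (geo p (v0 + s *: w)) t 0 k) 0.

Lemma vfield_sdiff i t A : sdiff (fun v => lift i (geo p v) t) v0 A ->
  is_derive (0 : R) (1 : R) (fun s => lift i (geo p (v0 + s *: w)) t) (w *m A) /\ vfield i t = w *m A.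
Proof.
move=> HA; have cd : is_derive (0 : R) (1 : R) (fun s => v0 + s *: w) w.
  by have := der_segment v0 (v0 + w) 0; rewrite addrAC subrr add0r.
have D : is_derive (0 : R) (1 : R) (fun s => lift i (geo p (v0 + s *: w)) t) (w *m A).
  apply: (sdiff_der (f := fun v => lift i (geo p v) t) (c := fun s => v0 + s *: w)) => //.
  by rewrite scale0r addr0.
split => //; apply/rowP => k; rewrite mxE; apply: derE.
exact: (proj1 (der_rvP _ _ _) D k).
Qed.

Lemma vfield_der i t : chart_dom i (c0 t) ->
  is_derive (0 : R) (1 : R) (fun s => lift i (geo p (v0 + s *: w)) t) (vfield i t).
Proof.
move=> D; have [_ [A HA]] := good_all Msc Mc D.
by have [h ->] := vfield_sdiff HA.
Qed.

Lemma vfield_ode i t : chart_dom i (c0 t) ->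
  is_derive t (1 : R) (vfield i) (vfield i t *m jac (spray (gram i)) (lift i c0 t)).
Proof.
move=> D; have [d d0 Hd] := good_step Msc Mc D.
have tt : `|t - t| < d by rewrite subrr normr0.
have [A1 [F [_ H1 H2]]] := Hd t tt (good_all Msc Mc D).
have E s : `|s - t| < d -> vfield i s = w *m A1 *m F s.
  by move=> /H1[_ /vfield_sdiff[_ ->]]; rewrite mulmxA.
rewrite (E t tt); have := H2 t tt (w *m A1); apply: der_near.
by apply/nearN_P; exists d => // s sd; rewrite E.
Qed.

Definition jfield i t := lsubmx (vfield i t).

Lemma jfield_along : field_along c0 jfield.
Proof.
move=> i j t Di Dj.
have Tt : tdom id i j (chart i (c0 t)) by exists (c0 t).
rewrite (fd_jacobian (fd_jac (ck_trans i j 1 id_local) Tt : fd (chart j \o chart_inv i) _ _)).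
have D1 := der_lsubmx (vfield_der Di); have D2 := der_lsubmx (vfield_der Dj).
have cE i' : (fun s => lsubmx (lift i' (geo p (v0 + s *: w)) t)) = fun s => chart i' (geo p (v0 + s *: w) t).
  by apply/funext => s; rewrite /lift row_mxKl.
rewrite cE in D1; rewrite cE in D2.
have g0 : geo p (v0 + 0 *: w) t = c0 t by rewrite scale0r addr0.
have Tt0 : tdom id i j (chart i (geo p (v0 + 0 *: w) t)) by rewrite g0.
have D3 := der_jac (ck_trans i j 1 id_local) Tt0 D1; rewrite g0 in D3.
have [N _] := good_all Msc Mc Di.
have N0 : \forall s \near (0 : R), chart_dom i (geo p (v0 + s *: w) t).
  have cd : is_derive (0 : R) (1 : R) (fun s => v0 + s *: w) w.
    by have := der_segment v0 (v0 + w) 0; rewrite addrAC subrr add0r.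
  have N' : nbhs (v0 + 0 *: w) [set v | chart_dom i (geo p v t)] by rewrite scale0r addr0.
  exact: (der_cont cd) N'.
have D4 : is_derive (0 : R) (1 : R) (fun s => chart j (geo p (v0 + s *: w) t)) (lsubmx (vfield i t) *m jac (trans id i j) (chart i (c0 t))).
  by apply: der_near D3; apply: filterS N0 => s Ds; rewrite /trans chart_invK.
exact: derm_unique (proj2 (derm_row _ _ _) D2) (proj2 (derm_row _ _ _) D4).
Qed.

Lemma jfield_der i t : chart_dom i (c0 t) ->
  is_derive t (1 : R) (jfield i) (rsubmx (vfield i t)).
Proof.
move=> D; have := der_lsubmx (vfield_ode D).
rewrite -[vfield i t in X in is_derive _ _ _ X -> _]hsubmxK /lift.
by rewrite (jac_spray _ _ _ (metric_chart i) (cdom_chart D)) row_mxKl.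
Qed.

Lemma covariant_jfield i t : chart_dom i (c0 t) ->
  covariant_derivative c0 jfield i t =
  rsubmx (vfield i t) + gam (gram i) (chart i (c0 t)) (velocity_in i c0 t) (jfield i t).
Proof.
move=> D; apply/rowP => k; rewrite [LHS]mxE [RHS]mxE; congr (_ + _); last by rewrite mxE.
by have /der_rvP/(_ k) := jfield_der D; exact: derE.
Qed.

Lemma covariant_jfield_der i t : chart_dom i (c0 t) ->
  let x := chart i (c0 t) in let v := velocity_in i c0 t in
  let V := jfield i t in let W := rsubmx (vfield i t) in let g := gam (gram i) x in
  is_derive t (1 : R) (covariant_derivative c0 jfield i)
    (- (dgam (gram i) x V v v + g W v + g v W) +
     (dgam (gram i) x v v V + g (- g v v) V + g v W)).
Proof.
move=> D x v V W g; have G := (geoP Msc Mc p v0).2 t.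
have [_ Dl] := nbhs_singleton (G i D); have [Dx Dv] := lift_der Dl.
apply: (@der_near _ _ (fun s => rsubmx (vfield i s) + gam (gram i) (chart i (c0 s)) (velocity_in i c0 s) (jfield i s))).
  by apply: filterS (near_dom (ageod_cont G) D) => s Ds; rewrite covariant_jfield.
apply: is_deriveD; last exact: der_gam (metric_chart i) (cdom_chart D) Dx Dv (jfield_der D).
have := der_rsubmx (vfield_ode D).
rewrite -[vfield i t in X in is_derive _ _ _ X -> _]hsubmxK /lift.
by rewrite (jac_spray _ _ _ (metric_chart i) (cdom_chart D)) row_mxKr.
Qed.

(** The components of [R(V, v) v], with the derivatives of the Christoffel symbols collected in
    [dgam]. *)
Lemma curvature_sum i (x V v : 'rV[R]_n) k :
  \sum_a \sum_b \sum_d curvature i k d a b x * V 0 a * v 0 b * v 0 d =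
  (dgam (gram i) x V v v - dgam (gram i) x v V v
    + gam (gram i) x V (gam (gram i) x v v) - gam (gram i) x v (gam (gram i) x V v)) 0 k.
Proof.
pose C (a b : 'I_n) := chr (gram i) k a b.
have E1 : dgam (gram i) x V v v 0 k = \sum_a \sum_b \sum_d partial a (C b d) x * V 0 a * v 0 b * v 0 d.
  rewrite mxE [RHS]exchange_big /=; apply: eq_bigr => b _; rewrite [RHS]exchange_big /=.
  by apply: eq_bigr => d _; rewrite !mulr_suml; apply: eq_bigr => a _; rewrite [V 0 a * _]mulrC.
have E2 : dgam (gram i) x v V v 0 k = \sum_a \sum_b \sum_d partial b (C a d) x * V 0 a * v 0 b * v 0 d.
  rewrite mxE; apply: eq_bigr => a _; rewrite [RHS]exchange_big /=; apply: eq_bigr => d _.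
  by rewrite !mulr_suml; apply: eq_bigr => b _; rewrite /C; ring.
have E3 : gam (gram i) x V (gam (gram i) x v v) 0 k =
  \sum_a \sum_b \sum_d (\sum_m C a m x * chr (gram i) m b d x) * V 0 a * v 0 b * v 0 d.
  rewrite mxE; apply: eq_bigr => a _; under eq_bigr => m _.
    rewrite mxE mulr_sumr; under eq_bigr => b _ do rewrite mulr_sumr. over.
  rewrite exchange_big /=; apply: eq_bigr => b _; rewrite exchange_big /=; apply: eq_bigr => d _.
  by rewrite !mulr_suml; apply: eq_bigr => m _; rewrite /C; ring.
have E4 : gam (gram i) x v (gam (gram i) x V v) 0 k =
  \sum_a \sum_b \sum_d (\sum_m C b m x * chr (gram i) m a d x) * V 0 a * v 0 b * v 0 d.
  rewrite [RHS]exchange_big /= mxE; apply: eq_bigr => b _; under [LHS]eq_bigr => m _.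
    rewrite mxE mulr_sumr; under eq_bigr => a _ do rewrite mulr_sumr. over.
  rewrite exchange_big /=; apply: eq_bigr => a _; rewrite exchange_big /=; apply: eq_bigr => d _.
  by rewrite !mulr_suml; apply: eq_bigr => m _; rewrite /C; ring.
have EE (P Q S T : 'rV[R]_n) : (P - Q + S - T) 0 k = P 0 k - Q 0 k + S 0 k - T 0 k by rewrite !mxE.
rewrite EE E1 E2 E3 E4.
rewrite -!sumrN -!big_split; apply: eq_bigr => a _ /=.
rewrite -!sumrN -!big_split; apply: eq_bigr => b _ /=.
rewrite -!sumrN -!big_split; apply: eq_bigr => d _ /=.
have E0 : curvature i k d a b x = partial a (C b d) x - partial b (C a d) x +
   (\sum_m C a m x * chr (gram i) m b d x - \sum_m C b m x * chr (gram i) m a d x).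
  by rewrite /curvature sumrB.
by rewrite E0 !mulrDl !mulNr !addrA.
Qed.

(** Expanding the two covariant derivatives turns the linearised geodesic equation into the Jacobi
    equation. After the symmetries of [gam] and [dgam] in their last two arguments, the terms cancel
    formally. *)
Lemma jfield_jacobi : jacobi_field c0 jfield.
Proof.
split.
- exact: jfield_along.
- move=> i t D k; have /der_rvP/(_ k) H := jfield_der D.
  exact: (ex_derive (is_derive := H)).
- move=> i t D k; have /der_rvP/(_ k) H := covariant_jfield_der D.
  exact: (ex_derive (is_derive := H)).
move=> i t D k; have H := covariant_jfield_der D.
rewrite curvature_sum [X in X + _]mxE (derE (proj1 (der_rvP _ _ _) H k)).
set x := chart i (c0 t); set v := velocity_in i c0 t; set V := jfield i t; set W := rsubmx (vfield i t).
have mi := metric_chart i; have Cx := cdom_chart D : cdom i x.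
have -> : \sum_a \sum_b christoffel i k a b x * v 0 a * covariant_derivative c0 jfield i t 0 b =
   gam (gram i) x v (covariant_derivative c0 jfield i t) 0 k by rewrite [RHS]mxE.
rewrite (covariant_jfield D) -/x -/v -/V -/W gamDr gamNl.
rewrite (gam_symm W v mi Cx) (dgam_symm v V v mi Cx) (gam_symm V v mi Cx) (gam_symm V (gam (gram i) x v v) mi Cx).
set P1 := dgam _ _ _ _ _; set P2 := dgam _ _ _ _ _; set P3 := gam _ _ v W; set P4 := gam _ _ (gam _ _ _ _) V.
set P5 := gam _ _ v (gam _ _ _ _).
move: P1 P2 P3 P4 P5 => P1 P2 P3 P4 P5.
rewrite !mxE; ring.
Qed.

End field.

Lemma geo_speed p v t : speed (geo p v) t = tnorm p v.
Proof.
have G := (geoP Msc Mc p v).2.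
have -> : speed (geo p v) t = speed (geo p v) 0.
  by have [t0|/ltW t0] := leP 0 t; [apply/esym|]; apply: ageod_speed.
by rewrite /speed (geo0 Msc Mc) (geo_velocity Msc Mc).
Qed.

Lemma geo_geodesic p v : tnorm p v = 1 -> geodesic (geo p v).
Proof.
by move=> v1; apply/geodesicP; split => [t|t]; [exact: (geoP Msc Mc p v).2|rewrite geo_speed].
Qed.

Hypothesis Mnc : no_conjugate_points M.

(** If the position half of the differential kills [w], the Jacobi field of the variation vanishes
    at times 0 and [t], hence identically. Its derivative at time 0 is [w]. *)
Lemma variation_injective p v0 (w : 'rV[R]_n) i t (A : 'M[R]_(n, n + n)) : tnorm p v0 = 1 -> t != 0 -> chart_dom i (geo p v0 t) ->
  sdiff (fun v => lift i (geo p v) t) v0 A -> w *m lsubmx A = 0 -> w = 0.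
Proof.
move=> v01 t0 Di HA wA.
have J := jfield_jacobi p v0 w.
have Vt : jfield p v0 w i t = 0.
  have [_ E] := vfield_sdiff w HA; by rewrite /jfield E lsub_mul.
have lift0 v : lift (chart_at p) (geo p v) 0 = row_mx (chart (chart_at p) p) v.
  rewrite /lift (geo0 Msc Mc); congr row_mx.
  by have := geo_velocity Msc Mc p v; rewrite /velocity (geo0 Msc Mc).
have V0 : vfield p v0 w (chart_at p) 0 = row_mx 0 w.
  have Dp : chart_dom (chart_at p) (geo p v0 0) by rewrite (geo0 Msc Mc); exact: chart_atP.
  have D1 := vfield_der w Dp.
  have D2 : is_derive (0 : R) (1 : R) (fun s => lift (chart_at p) (geo p (v0 + s *: w)) 0) (row_mx 0 w).
    have -> : (fun s => lift (chart_at p) (geo p (v0 + s *: w)) 0) =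
       fun s => row_mx (chart (chart_at p) p) (v0 + s *: w) by apply/funext => s; exact: lift0.
    have Dw : is_derive (0 : R) (1 : R) (fun s => v0 + s *: w) w.
      by have := der_segment v0 (v0 + w) 0; rewrite addrAC subrr add0r.
    exact: (der_row_mx (der_cst (chart (chart_at p) p) 0) Dw).
  exact: derm_unique (proj2 (derm_row _ _ _) D1) (proj2 (derm_row _ _ _) D2).
have c00 : geo p v0 0 = p by exact: geo0.
have Z : forall j u, chart_dom j (geo p v0 u) -> jfield p v0 w j u = 0.
  have Z1 : jfield p v0 w (chart_at (geo p v0 t)) t = 0.
    by rewrite (jfield_along w Di (chart_atP _)) Vt mul0mx.
  have Z0 : jfield p v0 w (chart_at (geo p v0 0)) 0 = 0.
    by rewrite c00 /jfield V0 row_mxKl.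
  by move=> j u; exact: (Mnc (geo_geodesic v01) J t0 Z1 Z0).
have Dp : chart_dom (chart_at p) (geo p v0 0) by rewrite c00; exact: chart_atP.
have D1 := jfield_der w Dp; rewrite V0 row_mxKr in D1.
have D2 : is_derive (0 : R) (1 : R) (jfield p v0 w (chart_at p)) 0.
  have Hc : is_derive (0 : R) (1 : R) (fun _ : R => (0 : 'rV[R]_n)) 0 by exact: der_cst.
  apply: der_near Hc; apply: filterS (near_dom (ageod_cont ((geoP Msc Mc p v0).2 0)) Dp) => u Du.
  by rewrite Z.
exact: derm_unique (proj2 (derm_row _ _ _) D1) (proj2 (derm_row _ _ _) D2).
Qed.

Definition ex p v : M := geo p v 1.

Lemma tnorm_ge0 p v : 0 <= tnorm p v.
Proof. exact: sqrtr_ge0. Qed.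

Lemma tnorm_scale p a v : tnorm p (a *: v) = `|a| * tnorm p v.
Proof.
rewrite /tnorm /inner linearZ /= -scalemxAl -scalemxAl -scalemxAr scalerA mxE.
by rewrite -expr2 sqrtrM ?sqr_ge0// sqrtr_sqr.
Qed.

Lemma tnorm_gt0 p v : v != 0 -> 0 < tnorm p v.
Proof.
move=> v0; rewrite sqrtr_gt0.
exact: (metric_pos (metric_chart (chart_at p)) (cdom_chart (chart_atP p)) v0).
Qed.

(** The absence of conjugate points is stated for unit speed, so [v0] is rescaled to a unit vector
    [u] and the previous lemma is applied at time [a = tnorm p v0]. At [v0 = 0] there is no such
    time; there the image of the line [s w] is the geodesic with initial velocity [w], and a
    vanishing derivative means [w = 0]. *)
Lemma ex_sdiff p v0 i : chart_dom i (ex p v0) ->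
  (\forall v \near v0, chart_dom i (ex p v)) /\
  exists2 D : 'M[R]_n, D \in unitmx & sdiff (fun v => chart i (ex p v)) v0 D.
Proof.
move=> Di; have [N [A HA]] := good_all Msc Mc (Di : chart_dom i (geo p v0 1)).
split => //; exists (lsubmx A); last first.
  have S : sdiff (fun s : 'rV[R]_(n + n) => lsubmx s : 'rV[R]_n) (lift i (geo p v0) 1) (lsubmx 1%:M).
    move=> e e0; exists 1 => // y z _ _; rewrite -lsub_mul mulmx1.
    have -> : lsubmx y - lsubmx z - lsubmx (y - z) = 0 by apply/rowP => k; rewrite !mxE subrr.
    by rewrite normr0 mulr_ge0// ltW.
  have := sdiff_comp HA S; rewrite -lsub_mul mulmx1; apply: sdiff_near.
  by apply: filterE => v /=; rewrite /lift row_mxKl.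
rewrite -row_free_unit -kermx_eq0; apply/eqP/row_matrixP => k; rewrite row0.
set w := row k _; have wA : w *m lsubmx A = 0 by rewrite /w -row_mul mulmx_ker row0.
have [v00|v0n] := eqVneq v0 0.
  have [_ E] := vfield_sdiff w HA.
  have D1 := der_lsubmx (vfield_der w Di).
  have E1 : lsubmx (vfield p v0 w i 1) = 0.
    by rewrite E lsub_mul.
  have cE : (fun s => lsubmx (lift i (geo p (v0 + s *: w)) 1)) = fun s => chart i (geo p w s).
    by apply/funext => s; rewrite /lift row_mxKl v00 add0r geo_scale// mulr1.
  rewrite cE E1 in D1.
  have Dp : chart_dom i p by move: Di; rewrite /ex v00 -(scale0r (0 : 'rV[R]_n)) geo_scale// mul0r geo0.
  have Dw : chart_dom i (geo p w 0) by rewrite geo0.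
  have G := (geoP Msc Mc p w).2 0.
  have D2 := ageod_der G Dw.
  have v0' := velocity_der D1.
  have D3 := velocity_trans id_local (ageod_cont G) Dw (chart_atP _) D2.
  by have := velocity_der D3; rewrite v0' mul0mx; have := geo_velocity Msc Mc p w; rewrite /velocity => ->.
pose a := tnorm p v0; have a0 : 0 < a by exact: tnorm_gt0.
pose u := a^-1 *: v0; have u1 : tnorm p u = 1.
  by rewrite tnorm_scale gtr0_norm ?invr_gt0// mulVf// gt_eqF.
have v0E : v0 = a *: u by rewrite /u scalerA mulfV ?scale1r// gt_eqF.
have Du : chart_dom i (geo p u a) by move: Di; rewrite /ex v0E geo_scale// mulr1.
have [_ [B HB]] := good_all Msc Mc Du.
apply: (variation_injective u1 _ Du HB); first by rewrite gt_eqF.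
have [DA EA] := vfield_sdiff w HA; have [DB EB] := vfield_sdiff (a^-1 *: w) HB.
have LA := der_lsubmx DA; have LB := der_lsubmx DB.
have cE : (fun s => lsubmx (lift i (geo p (u + s *: (a^-1 *: w))) a)) = (fun s => lsubmx (lift i (geo p (v0 + s *: w)) 1)).
  apply/funext => s; rewrite /lift !row_mxKl.
  have -> : v0 + s *: w = a *: (u + s *: (a^-1 *: w)).
    by rewrite scalerDr -v0E !scalerA mulrAC mulfV ?mul1r// gt_eqF.
  by rewrite geo_scale// mulr1.
rewrite cE in LB.
have := derm_unique (proj2 (derm_row _ _ _) LA) (proj2 (derm_row _ _ _) LB).
rewrite !lsub_mul wA -scalemxAl => /esym/eqP; rewrite scaler_eq0 invr_eq0 gt_eqF//=.
by move/eqP.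
Qed.

End jacobi.

(** * The Gauss lemma *)

Section gauss.
Context {R : realType} {n : nat} {M : riemannian_manifold R n}.
Implicit Types (a b s t r e d K T L l : R) (p q : M) (c : R -> M) (i j : chart_index M) (u h v w : 'rV[R]_n).
Hypothesis Msc : simply_connected M.
Hypothesis Mc : rcomplete M.

Lemma innerDl p u v w : inner p (u + v) w = inner p u w + inner p v w.
Proof. by rewrite /inner !mulmxDl mxE. Qed.
Lemma innerC p u v : inner p u v = inner p v u.
Proof.
have Cx := cdom_chart (chart_atP p).
rewrite /inner; transitivity (((v *m gram (chart_at p) (chart (chart_at p) p) *m u^T)^T) 0 0); last by rewrite mxE.
by rewrite !trmx_mul trmxK (gram_sym Cx) mulmxA.
Qed.
Lemma innerDr p u v w : inner p u (v + w) = inner p u v + inner p u w.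
Proof. by rewrite innerC innerDl !(innerC p u). Qed.
Lemma innerZl p a u v : inner p (a *: u) v = a * inner p u v.
Proof. by rewrite /inner -!scalemxAl mxE. Qed.
Lemma innerZr p a u v : inner p u (a *: v) = a * inner p u v.
Proof. by rewrite innerC innerZl innerC. Qed.
Lemma inner_ge0 p u : 0 <= inner p u u.
Proof. exact: (sqn_ge0 u (cdom_chart (chart_atP p))). Qed.
Lemma tnorm_sqr p u : tnorm p u ^+ 2 = inner p u u.
Proof. by rewrite sqr_sqrtr ?inner_ge0. Qed.

Lemma geo_sqn p v i t : chart_dom i (geo p v t) ->
  sqn i (chart i (geo p v t)) (velocity_in i (geo p v) t) = inner p v v.
Proof.
move=> D; have G := (geoP Msc Mc p v).2 t.
have := geo_speed Msc Mc p v t; rewrite (speedE (ageod_cont G) D (ageod_der G D)) => /(congr1 (fun z => z ^+ 2)).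
by rewrite tnorm_sqr sqr_sqrtr// sqn_ge0//; exact: cdom_chart.
Qed.

Definition pairing c (V : chart_index M -> R -> 'rV[R]_n) t : R :=
  (V (chart_at (c t)) t *m gram (chart_at (c t)) (chart (chart_at (c t)) (c t)) *m (velocity c t)^T) 0 0.

Lemma jac_transE i j z : tdom (M := M) id i j z -> 'J (chart j \o chart_inv i) z = jac (trans (M := M) id i j) z.
Proof. by move=> Tz; apply: (fd_jacobian (fd_jac (ck_trans i j 1 id_local) Tz : fd (chart j \o chart_inv i) _ _)). Qed.

Lemma pairing_in c V i t : field_along c V -> ageod_at c t -> chart_dom i (c t) ->
  pairing c V t = (V i t *m gram i (chart i (c t)) *m (velocity_in i c t)^T) 0 0.
Proof.
move=> FV G D; have Dk := chart_atP (c t); set k := chart_at (c t) in Dk *.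
have T : tdom id i k (chart i (c t)) by exists (c t).
rewrite /pairing -/k (FV i k t D Dk) (jac_transE T).
have := velocity_trans id_local (ageod_cont G) D Dk (ageod_der G D) => /velocity_der.
rewrite /velocity -/k => ->.
by rewrite (gram_trans id_local T) /trans chart_invK// trmx_mul !mulmxA.
Qed.

Lemma pairing_der p u h t : is_derive t (1 : R) (pairing (geo p u) (jfield p u h)) (inner p u h).
Proof.
have G := (geoP Msc Mc p u).2; have D := chart_atP (geo p u t); set i := chart_at _ in D.
have FV : field_along (geo p u) (jfield p u h) := @jfield_along R n M Msc Mc p u h.
apply: (@der_near _ _ (fun s => (jfield p u h i s *m gram i (chart i (geo p u s)) *m (velocity_in i (geo p u) s)^T) 0 0)).
  by apply: filterS (near_dom (ageod_cont (G t)) D) => s Ds; rewrite (pairing_in FV (G s) Ds).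
have [_ Dl] := nbhs_singleton (G t i D); have [Dx Dv] := lift_der Dl.
have mi := metric_chart i; have Cx := cdom_chart D.
have DV := jfield_der Msc Mc h D.
apply: is_derive_eq (first_variation mi Cx Dx Dv DV) _.
set W := rsubmx _; set V := jfield p u h i t; set x := chart i _; set v := velocity_in _ _ _.
(* both sides are half the s-derivative of the squared speed of geo p (u + s h) *)
have Dg := vfield_der Msc Mc h D.
have Dgl := der_lsubmx Dg; have Dgr := der_rsubmx Dg.
have cl : (fun s => lsubmx (lift i (geo p (u + s *: h)) t)) = fun s => chart i (geo p (u + s *: h) t).
  by apply/funext => s; rewrite /lift row_mxKl.
have cr : (fun s => rsubmx (lift i (geo p (u + s *: h)) t)) = fun s => velocity_in i (geo p (u + s *: h)) t.
  by apply/funext => s; rewrite /lift row_mxKr.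
rewrite cl in Dgl; rewrite cr in Dgr.
have u0 : u + 0 *: h = u by rewrite scale0r addr0.
have Cx0 : cdom i (chart i (geo p (u + 0 *: h) t)) by rewrite u0.
have H1 := derm_dmat (metric_ck mi 1) Cx0 Dgl.
have H2 := derm_mul (derm_mul (proj2 (derm_row _ _ _) Dgr) H1) (derm_tr (proj2 (derm_row _ _ _) Dgr)).
have {H2} := H2 0 0; rewrite !u0 -/x -/v -/W => H2.
have [N _] := good_all Msc Mc D.
have cd : is_derive (0 : R) (1 : R) (fun s => u + s *: h) h.
  by have := der_segment u (u + h) 0; rewrite addrAC subrr add0r.
have N0 : \forall s \near (0 : R), chart_dom i (geo p (u + s *: h) t).
  have N' : nbhs (u + 0 *: h) [set v | chart_dom i (geo p v t)] by rewrite u0.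
  exact: (der_cont cd) N'.
have H3 : is_derive (0 : R) (1 : R) (fun s => inner p (u + s *: h) (u + s *: h))
   (((W *m gram i x + v *m dmat (gram i) x V) *m v^T + v *m gram i x *m W^T) 0 0).
  by apply: der_near H2; apply: filterS N0 => s Ds; rewrite -(geo_sqn Ds).
have H4 : is_derive (0 : R) (1 : R) (fun s => inner p (u + s *: h) (u + s *: h)) (2 * inner p u h).
  have -> : (fun s => inner p (u + s *: h) (u + s *: h)) = fun s => inner p u u + (2 * inner p u h) * s + inner p h h * (s * s).
    by apply/funext => s; rewrite innerDl !innerDr !innerZl !innerZr (innerC p h u); ring.
  apply/derP => e e0; exists (e / (inner p h h + 1)).
    by rewrite divr_gt0// ltr_wpDl// inner_ge0.
  move=> s; rewrite subr0 ltr_pdivlMr ?ltr_wpDl ?inner_ge0// => se.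
  rewrite (_ : _ - _ - _ = inner p h h * s * s); last by rewrite /GRing.scale /=; ring.
  rewrite normrM ler_wpM2r// normrM (ger0_norm (inner_ge0 p h)).
  by apply: le_trans (ltW se); rewrite mulrC ler_wpM2l// lerDl.
have E := derE H3; rewrite (derE H4) in E.
have S : (v *m gram i x *m W^T) 0 0 = (W *m gram i x *m v^T) 0 0.
  transitivity (((W *m gram i x *m v^T)^T) 0 0); last by rewrite mxE.
  by rewrite !trmx_mul trmxK (gram_sym Cx) mulmxA.
move: E; rewrite mulmxDl.
have aE (A B : 'M[R]_1) : (A + B) 0 0 = A 0 0 + B 0 0 by rewrite mxE.
have zE (z : R) (A : 'M[R]_1) : (z *: A) 0 0 = z * A 0 0 by rewrite mxE.
rewrite !aE zE S.
set P := (W *m _ *m _) 0 0; set Q := (v *m _ *m _) 0 0.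
lra.
Qed.

(** The pairing of the Jacobi field of [h] with the velocity vanishes at time 0 and has the constant
    derivative [<u, h>]; it is read off at time 1. *)
Lemma gauss p u h i D : chart_dom i (ex p u) -> sdiff (fun v => chart i (ex p v)) u D ->
  ((h *m D) *m gram i (chart i (ex p u)) *m (velocity_in i (geo p u) 1)^T) 0 0 = inner p u h.
Proof.
move=> Di HD; have FV : field_along (geo p u) (jfield p u h) := @jfield_along R n M Msc Mc p u h.
have E : h *m D = jfield p u h i 1.
  have cd : is_derive (0 : R) (1 : R) (fun s => u + s *: h) h.
    by have := der_segment u (u + h) 0; rewrite addrAC subrr add0r.
  have HD0 : sdiff (fun v => chart i (ex p v)) (u + 0 *: h) D by rewrite scale0r addr0.
  have D1 := sdiff_der HD0 cd.
  have D2 := der_lsubmx (vfield_der Msc Mc h (Di : chart_dom i (geo p u 1))).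
  have cl : (fun s => lsubmx (lift i (geo p (u + s *: h)) 1)) = fun s => chart i (ex p (u + s *: h)).
    by apply/funext => s; rewrite /lift row_mxKl.
  rewrite cl in D2; exact: derm_unique (proj2 (derm_row _ _ _) D1) (proj2 (derm_row _ _ _) D2).
rewrite E -(pairing_in FV ((geoP Msc Mc p u).2 1) Di).
have P0 : pairing (geo p u) (jfield p u h) 0 = 0.
  have D0 := chart_atP (geo p u 0).
  suff V0 : jfield p u h (chart_at (geo p u 0)) 0 = 0 by rewrite /pairing V0 !mul0mx mxE.
  have D1 := der_lsubmx (vfield_der Msc Mc h D0); rewrite -/(jfield p u h _ 0) in D1.
  apply: derm_unique (proj2 (derm_row _ _ _) D1) (proj2 (derm_row _ _ _) _).
  have -> : (fun s => lsubmx (lift (chart_at (geo p u 0)) (geo p (u + s *: h)) 0)) = fun=> chart (chart_at (geo p u 0)) p.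
    by apply/funext => s; rewrite /lift row_mxKl (geo0 Msc Mc p (u + s *: h)).
  exact: der_cst.
pose P t := pairing (geo p u) (jfield p u h) t; set k := inner p u h.
have H t : is_derive t (1 : R) (fun s => P s - k * s) (k - k).
  apply: is_deriveB; first exact: pairing_der.
  by apply: is_derive_eq; rewrite /GRing.scale /= mulr1.
have := @mvt_scalar R (fun s => P s - k * s) (fun=> k - k) 0 1 0 ler01 (fun s _ => H s).
rewrite {2}/P P0 mulr0 mulr1 !subr0 subrr mul0r => E1.
have /E1 : forall s : R, 0 <= s <= 1 -> `|0 : R| <= 0 by move=> s _; rewrite normr0.
by rewrite normr_le0 subr_eq0 => /eqP.
Qed.

(** Cauchy-Schwarz in the Gauss lemma, with the velocity of constant norm [tnorm p u]: the radial
    component of [h] is at most the length of its image. *)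
Lemma gauss_le p u h i D : chart_dom i (ex p u) -> sdiff (fun v => chart i (ex p v)) u D ->
  `|inner p u h| <= tnorm p u * Num.sqrt (sqn i (chart i (ex p u)) (h *m D)).
Proof.
move=> Di HD; rewrite -(gauss h Di HD).
have Cx := cdom_chart Di; have := cauchy_schwarz (h *m D) (velocity_in i (geo p u) 1) Cx.
rewrite (geo_sqn (Di : chart_dom i (geo p u 1))) -tnorm_sqr.
set B := (_ *m _ *m _) 0 0 => H.
have := H; rewrite -(ler_sqrt _ (mulr_ge0 (sqn_ge0 _ Cx) (sqr_ge0 _))) sqrtr_sqr => /le_trans; apply.
by rewrite sqrtrM ?sqn_ge0// sqrtr_sqr ger0_norm ?tnorm_ge0// mulrC.
Qed.

End gauss.

(** * The inverse function theorem for strictly differentiable maps *)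

Section inverse_function.
Context {R : realType} {n : nat}.
Implicit Types (r e d K C : R).

Lemma sdiff_expand (f : 'rV[R]_n -> 'rV[R]_n) z D : D \in unitmx -> sdiff f z D ->
  exists r C, [/\ 0 < r, 0 < C & forall x y, `|x - z| < r -> `|y - z| < r ->
    `|x - y| <= C * `|f x - f y|].
Proof.
move=> Du HD; set C0 := n%:R * `|invmx D| + 1.
have C00 : 0 < C0 by rewrite ltr_wpDl// mulr_ge0.
have i2 : 0 < 2^-1 :> R by rewrite invr_gt0.
have [r r0 Hr] := HD (2^-1 / C0) (divr_gt0 i2 C00).
exists r, (2 * C0); split => //; first by rewrite mulr_gt0.
move=> x y xr yr; have H := Hr x y xr yr.
have wD : `|x - y| <= C0 * `|(x - y) *m D|.
  rewrite -{1}(mulmxK Du (x - y)); apply: le_trans (mulmx_le _ _) _.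
  by rewrite ler_wpM2r// /C0 lerDl.
have H2 : `|(x - y) *m D| <= `|f x - f y| + 2^-1 / C0 * `|x - y|.
  rewrite -[(x - y) *m D](subKr (f x - f y)) (le_trans (ler_normB _ _))//.
  by rewrite lerD2l.
have := le_trans wD (ler_wpM2l (ltW C00) H2).
have -> : C0 * (`|f x - f y| + 2^-1 / C0 * `|x - y|) = C0 * `|f x - f y| + 2^-1 * `|x - y|.
  by field; rewrite gt_eqF.
lra.
Qed.

(** Fixed point of the simplified Newton map [x + (y - f x) D^-1], which contracts by 1/2 near [z].
    The first step is at most [r / 4], so all iterates stay within [r / 2] of [z]. *)
Lemma local_surjection (f : 'rV[R]_n -> 'rV[R]_n) z D r1 : 0 < r1 -> D \in unitmx -> sdiff f z D ->
  exists2 d, 0 < d & forall y, `|y - f z| < d -> exists2 x, `|x - z| < r1 & f x = y.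
Proof.
move=> r10 Du HD; set C0 := n%:R * `|invmx D| + 1.
have C00 : 0 < C0 by rewrite ltr_wpDl// mulr_ge0.
have i2 : 0 < 2^-1 :> R by rewrite invr_gt0.
have [r2 r20 Hr] := HD _ (divr_gt0 i2 C00).
pose r := Num.min r1 r2; have r0 : 0 < r by rewrite lt_min r10.
exists (r / (4 * C0)); first by rewrite divr_gt0// mulr_gt0.
move=> y; rewrite ltr_pdivlMr ?mulr_gt0// => yd.
pose g x := x + (y - f x) *m invmx D.
have invC (w : 'rV[R]_n) : `|w *m invmx D| <= C0 * `|w|.
  by apply: le_trans (mulmx_le _ _) _; rewrite ler_wpM2r// /C0 lerDl.
have contr x x' : `|x - z| < r2 -> `|x' - z| < r2 -> `|g x - g x'| <= 2^-1 * `|x - x'|.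
  move=> xr xr'; have H := Hr x x' xr xr'.
  have -> : g x - g x' = - ((f x - f x' - (x - x') *m D) *m invmx D).
    rewrite (mulmxBl (f x - f x')) (mulmxK Du) /g !mulmxBl.
    by move: (y *m _) (f x *m _) (f x' *m _) => A1 A2 A3; apply/rowP => k; rewrite !mxE; ring.
  rewrite normrN; apply: le_trans (invC _) _; apply: le_trans (ler_wpM2l (ltW C00) H) _.
  by rewrite mulrA mulrCA mulfV ?gt_eqF// mulr1.
pose X k := iter k g z.
have M0 : `|g z - z| <= r / 4.
  rewrite /g addrAC subrr add0r; apply: le_trans (invC _) _; rewrite mulrC.
  by rewrite ler_pdivlMr// -mulrA [C0 * 4]mulrC ltW.
have r4 : 0 <= r / 4 by rewrite divr_ge0// ltW.
have HX k : `|X k - z| <= r / 2 * (1 - 2^-1 ^+ k) /\ `|X k.+1 - X k| <= r / 4 * 2^-1 ^+ k.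
  elim: k => [|k [IH1 IH2]]; first by rewrite /= subrr normr0 expr0 subrr mulr0 mulr1.
  have p0 : 0 <= 2^-1 ^+ k :> R by rewrite exprn_ge0// ltW.
  have B : `|X k.+1 - z| <= r / 2 * (1 - 2^-1 ^+ k.+1).
    rewrite -(subrKA (X k)) (le_trans (ler_normD _ _))// (le_trans (lerD IH2 IH1))//.
    by rewrite exprS le_eqVlt; apply/orP; left; apply/eqP; field.
  have inr m : `|X m - z| <= r / 2 * (1 - 2^-1 ^+ m) -> `|X m - z| < r2.
    move=> /le_lt_trans; apply; apply: (@le_lt_trans _ _ (r / 2)).
      by rewrite ler_piMr ?divr_ge0 ?ltW// gerBl exprn_ge0// ltW.
    apply: (@lt_le_trans _ _ r); first by rewrite ltr_pdivrMr// ltr_pMr// ltr1n.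
    by rewrite ge_min lexx orbT.
  split => //; apply: le_trans (contr _ _ (inr _ B) (inr _ IH1)) _.
  apply: le_trans (ler_wpM2l (ltW i2) IH2) _.
  by rewrite exprS mulrCA.
have [l Hl] := geo_cvg r4 (fun k => (HX k).2).
have lz : `|l - z| <= r / 2.
  by have := Hl 0%N; rewrite expr0 mulr1 /= distrC => h; lra.
have rr : r / 2 < r by rewrite ltr_pdivrMr// ltr_pMr// ltr1n.
have [rr1 rr2] : r <= r1 /\ r <= r2 by rewrite !ge_min !lexx orbT.
exists l; first by apply: le_lt_trans lz _; exact: lt_le_trans rr1.
have lr2 : `|l - z| < r2 by apply: le_lt_trans lz _; exact: lt_le_trans rr2.
have gl : g l = l.
  apply/eqP; rewrite -subr_eq0 -normr_le0; apply/ler_addgt0Pl => e e0; rewrite addr0.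
  have [k Hk] := half_pow_small (4 * (r / 4)) e0.
  have p0 : 0 <= 2^-1 ^+ k :> R by rewrite exprn_ge0// ltW.
  have Xr : `|X k - z| < r2.
    apply: le_lt_trans (HX k).1 _; apply: (@le_lt_trans _ _ (r / 2)).
      by rewrite ler_piMr ?divr_ge0 ?ltW// gerBl exprn_ge0// ltW.
    exact: lt_le_trans rr2.
  have h1 := contr _ _ lr2 Xr; rewrite distrC in h1.
  have h2 := Hl k; have h3 := Hl k.+1; rewrite exprS in h3.
  rewrite -(subrKA (X k.+1)); apply: le_trans (ler_normD _ _) _.
  have {h1} h1 : `|g l - X k.+1| <= 2^-1 * `|X k - l| by rewrite distrC [`|X k - l|]distrC.
  have := ltW Hk; lra.
have : (y - f l) *m invmx D = 0.
  by apply: (@addrI _ l); rewrite addr0; exact: gl.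
move=> /(congr1 (mulmx^~ D)); rewrite mulmxKV// mul0mx => /eqP; rewrite subr_eq0 => /eqP.
by [].
Qed.

End inverse_function.

(** * Lifting paths through the exponential map *)

Section lifting.
Context {R : realType} {V : normedModType R} {T : topologicalType}.
Variable E : V -> T.
Implicit Types (a b s t d : R) (u v w : V) (g : R -> V) (c : R -> T).

Lemma pair_contl (S U : topologicalType) (s : S) : continuous (fun t : U => (s, t)).
Proof.
move=> t A [[P Q] /= [NP NQ] PQ]; apply: filterS NQ => z Qz; apply: PQ.
by split => //; exact: nbhs_singleton.
Qed.

Lemma pair_contr (S U : topologicalType) (t : U) : continuous (fun s : S => (s, t)).
Proof.
move=> s A [[P Q] /= [NP NQ] PQ]; apply: filterS NP => z Pz; apply: PQ.
by split => //; exact: nbhs_singleton.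
Qed.

Definition locally_injective := forall u, exists2 d, 0 < d &
  forall v w, `|v - u| < d -> `|w - u| < d -> E v = E w -> v = w.

Definition section_on (W : set T) u (sg : T -> V) :=
  sg (E u) = u /\ forall y, W y -> E (sg y) = y /\ {for y, continuous sg}.

Definition local_sections := forall u, exists2 W : set T, open W & W (E u) /\ exists sg, section_on W u sg.

Lemma cont_glue (U : topologicalType) (f g : R -> U) t t1 : {for t, continuous f} -> {for t, continuous g} ->
  (t = t1 -> f t = g t) -> {for t, continuous (fun s => if s <= t1 then f s else g s)}.
Proof.
move=> cf cg fg; case: (ltgtP t t1) => tt.
- apply: (@cont_near _ _ f) => //.
  have : \forall s \near t, s < t1 by exact: lt_nbhsl.
  by apply: filterS => s /ltW ->.
- apply: (@cont_near _ _ g) => //.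
  have : \forall s \near t, t1 < s by exact: lt_nbhsr.
  by apply: filterS => s; rewrite ltNge => /negbTE ->.
- move=> A; rewrite /nbhs /= tt lexx -tt => NA.
  have NA' : nbhs (g t) A by rewrite -fg.
  have M1 : \forall s \near t, A (f s) := cf _ NA.
  have M2 : \forall s \near t, A (g s) := cg _ NA'.
  change (\forall s \near t, A (if s <= t then f s else g s)).
  by apply: filterS2 M1 M2 => s; case: ifP.
Qed.

Hypothesis Einj : locally_injective.

Lemma lift_eq_near (X : topologicalType) (g1 g2 : X -> V) (x : X) :
  {for x, continuous g1} -> {for x, continuous g2} -> g1 x = g2 x ->
  \forall y \near x, E (g1 y) = E (g2 y) -> g1 y = g2 y.
Proof.
move=> c1 c2 e; have [d d0 Hd] := Einj (g1 x).
have N1 : nbhs (g1 x) [set v | `|v - g1 x| < d] by apply/nearN_P; exists d.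
have N2 : nbhs (g2 x) [set v | `|v - g1 x| < d] by rewrite -e.
have M1 : \forall y \near x, `|g1 y - g1 x| < d := c1 _ N1.
have M2 : \forall y \near x, `|g2 y - g1 x| < d := c2 _ N2.
by apply: filterS2 M1 M2 => y h1 h2; exact: Hd.
Qed.

Lemma lift_unique_fwd g1 g2 a b :
  (forall t, a <= t -> t <= b -> [/\ {for t, continuous g1}, {for t, continuous g2} & E (g1 t) = E (g2 t)]) ->
  g1 a = g2 a -> forall t, a <= t -> t <= b -> g1 t = g2 t.
Proof.
move=> H ga; apply: real_ind => //.
- move=> t at_ tb Ht; have [c1 c2 _] := H t at_ (ltW tb).
  have [d d0 Hd] := proj1 (nearN_P _ _) (lift_eq_near c1 c2 (Ht t at_ (lexx t))).
  exists d => // s ts sd sb; have [] := H s (ltW (le_lt_trans at_ ts)) sb => _ _.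
  by apply: Hd; rewrite gtr0_norm; lra.
- move=> t at_ tb Ht; have [c1 c2 _] := H t (ltW at_) tb.
  apply/eqP; rewrite -subr_eq0 -normr_le0; apply/ler_addgt0Pl => e e0; rewrite addr0.
  have e2 : 0 < e / 2 by rewrite divr_gt0.
  have [d1 d10 H1] := proj1 (contP _ _) c1 _ e2; have [d2 d20 H2] := proj1 (contP _ _) c2 _ e2.
  have d0 : 0 < Num.min d1 d2 by rewrite lt_min d10.
  have [s [as_ st]] := left_point at_ d0; rewrite lt_min => /andP[sd1 sd2].
  rewrite -(subrKA (g1 s)) (le_trans (ler_normD _ _))// (splitr e) lerD//.
    by rewrite distrC; exact: H1.
  by rewrite (Ht s)//; exact: H2.
Qed.

Lemma lift_unique g1 g2 a b t0 : a <= t0 -> t0 <= b ->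
  (forall t, a <= t -> t <= b -> [/\ {for t, continuous g1}, {for t, continuous g2} & E (g1 t) = E (g2 t)]) ->
  g1 t0 = g2 t0 -> forall t, a <= t -> t <= b -> g1 t = g2 t.
Proof.
move=> at0 tb H gt t at_ tb'; have [tt|tt] := leP t0 t.
  by apply: (@lift_unique_fwd g1 g2 t0 b) => // s s1 s2; apply: H => //; lra.
have := @lift_unique_fwd (g1 \o -%R) (g2 \o -%R) (- t0) (- a) _ _ (- t).
rewrite /= !opprK; apply => //; [|lra..] => s s1 s2.
have [||c1 c2 e] := H (- s); [lra..|]; split => //; apply: continuous_comp => //; exact: opp_continuous.
Qed.

Hypothesis Esec : local_sections.

(* The set of times at which the lifts depend continuously on the parameter is open
   and closed, by the local sections of [E] along the lift of [s0]. *)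
Lemma lift_param (S : topologicalType) (G : S * R -> T) (g : S -> R -> V) (s0 : S) :
  continuous G -> (forall z : S, continuous (g z)) -> (forall (z : S) t, 0 <= t <= 1 -> E (g z t) = G (z, t)) ->
  {for s0, continuous (g^~ 0)} -> {for s0, continuous (g^~ 1)}.
Proof.
move=> cG cg Eg c0.
have cG1 (s : S) : continuous (fun t => G (s, t)).
  by move=> t; apply: (@continuous_comp _ _ _ (fun t => (s, t)) G); [exact: pair_contl|exact: cG].
have cG2 t : continuous (fun z => G (z, t)).
  by move=> z; apply: (@continuous_comp _ _ _ (fun z => (z, t)) G); [exact: pair_contr|exact: cG].
have step t : 0 <= t -> t <= 1 -> exists2 d, 0 < d & forall t1 t', 0 <= t1 <= 1 -> 0 <= t' <= 1 ->
    `|t1 - t| < d -> `|t' - t| < d -> {for s0, continuous (g^~ t1)} -> {for s0, continuous (g^~ t')}.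
  move=> t0 t1; have t01 : 0 <= t <= 1 by rewrite t0.
  have [W oW [Wt [sg [sgE sgW]]]] := Esec (g s0 t); rewrite Eg// in Wt sgE.
  have [[A B] /= [NA NB] AB] : nbhs (s0, t) (G @^-1` W).
    by apply: cG; exact: open_nbhs_nbhs.
  have N2 := lift_eq_near (cg s0 t) (continuous_comp (cG1 s0 t) (sgW _ Wt).2) (esym sgE).
  have [d1 d10 H1] := proj1 (nearN_P _ _) NB; have [d2 d20 H2] := proj1 (nearN_P _ _) N2.
  exists (Num.min d1 d2); first by rewrite lt_min d10.
  move=> t1' t' i1 i'; rewrite !lt_min => /andP[a1 a2] /andP[b1 b2] ct.
  have As0 := nbhs_singleton NA.
  have WG (s : S) r : A s -> `|r - t| < d1 -> W (G (s, r)) by move=> As /H1 Br; exact: AB.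
  have E1 : g s0 t1' = sg (G (s0, t1')).
    by apply: H2 => //=; rewrite Eg// (sgW _ (WG _ _ As0 a1)).1.
  have N3 := lift_eq_near ct (continuous_comp (cG2 t1' s0) (sgW _ (WG _ _ As0 a1)).2) E1.
  apply: (@cont_near _ _ (fun z : S => sg (G (z, t')))); last first.
    exact: (continuous_comp (cG2 t' s0) (sgW _ (WG _ _ As0 b1)).2).
  apply: filterS2 NA N3 => s As e3.
  have i1' := i1; move/andP: i1' => [i10 i11]; move/andP: (i') => [i'0 i'1].
  have e3' : g s t1' = sg (G (s, t1')) by apply: e3; rewrite /= Eg// (sgW _ (WG _ _ As a1)).1.
  have := @lift_unique (g s) (fun r => sg (G (s, r))) (Num.min t1' t') (Num.max t1' t') t1' _ _ _ e3' t'.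
  rewrite ge_min lexx le_max lexx ge_min lexx orbT le_max lexx orbT => -> //.
  move=> r; rewrite ge_min le_max => r1 r2.
  have r01 : 0 <= r <= 1 by apply/andP; split; [case/orP: r1|case/orP: r2]; lra.
  have rd : `|r - t| < d1.
    move: a1 b1; rewrite !ltr_norml => /andP[? ?] /andP[? ?].
    by apply/andP; split; [case/orP: r1|case/orP: r2]; lra.
  split; first exact: cg.
    exact: (continuous_comp (cG1 s r) (sgW _ (WG _ _ As rd)).2).
  by rewrite Eg// (sgW _ (WG _ _ As rd)).1.
suff H : forall t, 0 <= t -> t <= 1 -> {for s0, continuous (g^~ t)} by apply: H.
apply: real_ind => //.
- move=> t t0 t1 Ht; have [d d0 Hd] := step t t0 (ltW t1); exists d => // s ts sd s1.
  apply: (Hd t s); [by rewrite t0 ltW|by apply/andP; split; lra|by rewrite subrr normr0|by rewrite gtr0_norm; lra|exact: Ht].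
- move=> t t0 t1 Ht; have [d d0 Hd] := step t (ltW t0) t1.
  have [s [h1 h2 h3]] := left_point t0 d0.
  apply: (Hd s t); [by apply/andP; split; lra|by rewrite (ltW t0)|by []|by rewrite subrr normr0|exact: Ht].
Qed.

Definition lifts c a u t g := [/\ continuous g, g a = u & forall s, a <= s -> s <= t -> E (g s) = c s].

Lemma lifts_unique c a u t g g' : a <= t -> lifts c a u t g -> lifts c a u t g' -> forall s, a <= s -> s <= t -> g s = g' s.
Proof.
move=> at_ [cg ga Hg] [cg' ga' Hg']; apply: lift_unique_fwd => [s s1 s2|]; last by rewrite ga ga'.
by split; [exact: cg|exact: cg'|rewrite Hg// Hg'].
Qed.

Lemma lifts_extend c a u t1 t2 g (W : set T) sg : a <= t1 -> t1 <= t2 -> lifts c a u t1 g ->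
  (forall s, t1 <= s -> s <= t2 -> {for s, continuous c} /\ W (c s)) -> section_on W (g t1) sg ->
  exists2 g', lifts c a u t2 g' & forall s, s <= t1 -> g' s = g s.
Proof.
move=> at1 t12 [cg ga Hg] cW [sg1 sgW].
pose f s := sg (c (clamp1 ((t1 + t2) / 2) ((t2 - t1) / 2) s)).
have r0 : 0 <= (t2 - t1) / 2 by rewrite divr_ge0// subr_ge0.
have fE s : t1 <= s -> s <= t2 -> f s = sg (c s).
  by move=> h1 h2; rewrite /f clamp1_id// ler_norml; apply/andP; split; lra.
have Wc s : {for clamp1 ((t1 + t2) / 2) ((t2 - t1) / 2) s, continuous c} /\ W (c (clamp1 ((t1 + t2) / 2) ((t2 - t1) / 2) s)).
  by have := clamp1_in ((t1 + t2) / 2) s r0; rewrite ler_norml => /andP[h1 h2]; apply: cW; lra.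
have cf : continuous f.
  move=> s; have [cc Ws] := Wc s.
  apply: (@continuous_comp _ _ _ (fun s => c (clamp1 _ _ s)) sg); last exact: (sgW _ Ws).2.
  by apply: (@continuous_comp _ _ _ (clamp1 _ _) c); [exact: clamp1_cont|exact: cc].
have Et1 : E (g t1) = c t1 by exact: Hg.
exists (fun s => if s <= t1 then g s else f s) => [|s ->//]; split.
- move=> s; apply: cont_glue; [exact: cg|exact: cf|move=> ->].
  by rewrite fE// -Et1 sg1.
- by rewrite at1.
- move=> s as_ st; case: (leP s t1) => h; first exact: Hg.
  have h' := ltW h; rewrite fE//; exact: (sgW _ (cW _ h' st).2).1.
Qed.

(** The covering property in the form used here: every preimage of a point of [W], wherever it lies,
    has a section over the whole of the same [W]. *)
Definition uniform_sections := forall y0, exists2 W : set T, open W & W y0 /\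
  forall u, W (E u) -> exists sg, section_on W u sg.

Hypothesis Ecov : uniform_sections.

Lemma lift_path c u : continuous c -> E u = c 0 -> forall t, 0 <= t -> t <= 1 -> exists g, lifts c 0 u t g.
Proof.
move=> cc E0.
have step t : exists2 d, 0 < d & forall t1 t2, 0 <= t1 -> t1 <= t2 -> `|t1 - t| < d -> `|t2 - t| < d ->
    (exists g, lifts c 0 u t1 g) -> exists g, lifts c 0 u t2 g.
  have [W oW [Wt HW]] := Ecov (c t).
  have [d d0 Hd] := proj1 (nearN_P _ _) (cc t _ (open_nbhs_nbhs (conj oW Wt))).
  exists d => // t1 t2 t10 t12 d1 d2 [g Lg].
  have [cg g0 Hg] := Lg.
  have WE : W (E (g t1)) by rewrite Hg//; exact: Hd.
  have [sg Hs] := HW _ WE.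
  have [|g' L' _] := lifts_extend t10 t12 Lg _ Hs; last by exists g'.
  move=> s s1 s2; split; first exact: cc.
  apply: Hd; move: d1 d2; rewrite !ltr_norml => /andP[? ?] /andP[? ?]; apply/andP; split; lra.
apply: real_ind.
- exists (fun=> u); split => //; first by move=> t; exact: cst_continuous.
  by move=> s s0 s1; rewrite E0; congr c; apply/eqP; rewrite eq_le s0 s1.
- move=> t t0 t1 Ht; have [d d0 Hd] := step t; exists d => // s ts sd s1.
  apply: (Hd t s) => //; [exact: ltW|by rewrite subrr normr0|by rewrite gtr0_norm; lra|exact: Ht].
- move=> t t0 t1 Ht; have [d d0 Hd] := step t.
  have [s [h1 h2 h3]] := left_point t0 d0.
  by apply: (Hd s t) => //; [exact: ltW|by rewrite subrr normr0|exact: Ht].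
Qed.

(** The curves [t -> H (s, t)] are lifted from [u]. The end points of the lifts depend continuously
    on [s] and lie over one point, so they are constant. At [s = 0] the lift is the segment and ends
    at [v]; at [s = 1] it is constant and ends at [u]. *)
Lemma homotopy_injective u v (H : R * R -> T) : continuous H ->
  (forall t, 0 <= t <= 1 -> H (0, t) = E (u + t *: (v - u))) ->
  (forall t, 0 <= t <= 1 -> H (1, t) = E u) ->
  (forall s, H (s, 0) = E u /\ H (s, 1) = E u) -> u = v.
Proof.
move=> cH H0 H1 Hs.
have cH1 s : continuous (fun t => H (s, t)).
  by move=> t; apply: (@continuous_comp _ _ _ (fun t => (s, t)) H); [exact: pair_contl|exact: cH].
have ex_g (s : R) : exists g, lifts (fun t => H (s, t)) 0 u 1 g.
  by apply: lift_path; [exact: cH1|rewrite (Hs s).1|exact: ler01|].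
have [g Hg] := choice ex_g.
have cg1 : continuous (fun s => g s 1).
  move=> s; apply: (@lift_param R H g s) => //.
  - by move=> r; have [] := Hg r.
  - by move=> r t /andP[t0 t1]; have [_ _] := Hg r; apply.
  - have -> : g^~ 0 = fun=> u by apply/funext => r; have [_ ->] := Hg r.
    exact: cst_continuous.
have E1 : g 1 1 = u.
  apply: (lifts_unique ler01 (Hg 1) _ ler01 (lexx 1)); split => //.
    by move=> t; exact: cst_continuous.
  by move=> s s0 s1; rewrite H1// s0.
have E0 : g 0 1 = v.
  have := @lifts_unique (fun t => H (0, t)) 0 u 1 (g 0) (fun t => u + t *: (v - u)) ler01 (Hg 0) _ 1 ler01 (lexx 1).
  rewrite scale1r subrKC; apply; split.
  - move=> t; apply: cvgD; first exact: cvg_cst.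
    by apply: cvgZr_tmp.
  - by rewrite scale0r addr0.
  - by move=> s s0 s1; rewrite H0// s0.
rewrite -E1 -E0; apply: (@lift_unique_fwd (fun s => g s 1) (fun=> g 0 1) 0 1) => // s s0 s1.
split; [exact: cg1|exact: cst_continuous|].
have EE r : E (g r 1) = H (r, 1) by have [_ _] := Hg r; apply.
by rewrite !EE (Hs s).2 (Hs 0).2.
Qed.

End lifting.

(** * The exponential map is a bijective covering, and geodesics minimise *)

Section exponential.
Context {R : realType} {n : nat} {M : riemannian_manifold R n}.
Implicit Types (a b s t r e d K L l : R) (p q x y : M) (c : R -> M) (i j : chart_index M) (u v w h : 'rV[R]_n).
Hypothesis Msc : simply_connected M.
Hypothesis Mc : rcomplete M.
Hypothesis Mnc : no_conjugate_points M.

Lemma ex_continuous p : continuous (ex p).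
Proof.
move=> u; have Di := chart_atP (ex p u); set i := chart_at _ in Di.
have [N [D _ HD]] := ex_sdiff Msc Mc Mnc Di.
apply: (@cont_near _ _ (fun v => chart_inv i (chart i (ex p v)))).
  by apply: filterS N => v Dv; rewrite chart_invK.
apply: (@continuous_comp _ _ _ (fun v => chart i (ex p v)) (chart_inv i)); first exact: sdiff_cont HD.
by apply: chart_inv_continuous; exists (ex p u).
Qed.

Lemma ex_expand p u : let i := chart_at (ex p u) in exists r C, [/\ 0 < r, 0 < C,
  forall v, `|v - u| < r -> chart_dom i (ex p v) &
  forall v w, `|v - u| < r -> `|w - u| < r -> `|v - w| <= C * `|chart i (ex p v) - chart i (ex p w)|].
Proof.
move=> i; have Di : chart_dom i (ex p u) := chart_atP _.
have [N [D uD HD]] := ex_sdiff Msc Mc Mnc Di.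
have [r1 r10 H1] := proj1 (nearN_P _ _) N; have [r2 [C [r20 C0 H2]]] := sdiff_expand uD HD.
exists (Num.min r1 r2), C; split => //; first by rewrite lt_min r10.
  by move=> v; rewrite lt_min => /andP[/H1].
by move=> v w; rewrite !lt_min => /andP[_ h1] /andP[_ h2]; exact: H2.
Qed.

Lemma ex_injective_near p : locally_injective (ex p).
Proof.
move=> u; have [r [C [r0 C0 _ H]]] := ex_expand p u; exists r => // v w vr wr E.
by apply/eqP; have := H v w vr wr; rewrite E subrr normr0 mulr0 normr_le0 subr_eq0.
Qed.

Lemma chart_ball_open i (z0 : 'rV[R]_n) r : open [set y : M | chart_dom i y /\ `|chart i y - z0| < r].
Proof.
rewrite openE => y [Dy yr]; have N1 : nbhs y (chart_dom i) by apply: open_nbhs_nbhs; split; [exact: chart_dom_open|].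
have NB : nbhs (chart i y) [set z | `|z - z0| < r].
  apply/nearN_P; exists (r - `|chart i y - z0|); first by rewrite subr_gt0.
  by move=> z zr /=; rewrite -(subrKA (chart i y)) (le_lt_trans (ler_normD _ _))// -ltrBrDr.
have N2 : \forall x \near y, `|chart i x - z0| < r := chart_continuous Dy NB.
by apply: filterS2 N1 N2.
Qed.

Lemma ex_sections p : local_sections (ex p).
Proof.
move=> u; have [r [C [r0 C0 Dr H]]] := ex_expand p u; set i := chart_at (ex p u) in Dr H.
have Di : chart_dom i (ex p u) := chart_atP _.
have [_ [D uD HD]] := ex_sdiff Msc Mc Mnc Di.
have [d d0 Hd] := local_surjection r0 uD HD.
exists [set y | chart_dom i y /\ `|chart i y - chart i (ex p u)| < d]; first exact: chart_ball_open.
split; first by split => //; rewrite subrr normr0.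
pose sg y := xget 0 [set v | `|v - u| < r /\ ex p v = y].
have sgP y : chart_dom i y -> `|chart i y - chart i (ex p u)| < d -> `|sg y - u| < r /\ ex p (sg y) = y.
  move=> Dy yd; have [v vr E] := Hd _ yd; apply: (@xgetPex _ 0 [set v | `|v - u| < r /\ ex p v = y]).
  exists v; split => //; rewrite -(chart_invK Dy) -E chart_invK//; exact: Dr.
have uu : `|u - u| < r by rewrite subrr normr0.
exists sg; split.
  have [|h1 h2] := sgP _ Di; first by rewrite subrr normr0.
  apply/eqP; have := H _ _ h1 uu; rewrite h2 subrr normr0 mulr0.
  by rewrite normr_le0 subr_eq0.
move=> y [Dy yd]; have [h1 h2] := sgP y Dy yd; split => //.
move=> A /nearN_P[e e0 HA].
have NB : nbhs (chart i y) [set z | `|z - chart i y| < e / C].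
  by apply/nearN_P; exists (e / C) => //; rewrite divr_gt0.
have N1 : \forall x \near y, `|chart i x - chart i y| < e / C := chart_continuous Dy NB.
have N2 : \forall x \near y, chart_dom i x /\ `|chart i x - chart i (ex p u)| < d.
  by apply: open_nbhs_nbhs; split; [exact: chart_ball_open|].
change (\forall x \near y, A (sg x)); apply: filterS2 N1 N2 => x x1 [Dx xd]; apply: HA.
have [h3 h4] := sgP x Dx xd; apply: le_lt_trans (H _ _ h3 h1) _.
by rewrite h2 h4 mulrC -ltr_pdivlMr.
Qed.

(** Chain rule along an inverse branch. Continuity brings [g] into the region where [sdiff_expand]
    bounds its increments linearly by those of [x]; strict differentiability of [f] at [u] then
    yields the derivative. *)
Lemma lift_der_inv (f : 'rV[R]_n -> 'rV[R]_n) u D (g x : R -> 'rV[R]_n) t v : D \in unitmx -> sdiff f u D ->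
  g t = u -> {for t, continuous g} -> (\forall s \near t, f (g s) = x s) ->
  is_derive t (1 : R) x v -> is_derive t (1 : R) g (v *m invmx D).
Proof.
move=> uD HD gt cg fg Dx; have [r [C [r0 C0 HC]]] := sdiff_expand uD HD.
have [dg dg0 Hg] : exists2 d, 0 < d & forall s, `|s - t| < d -> `|g s - u| < r.
  have r2 : 0 < r / 2 by rewrite divr_gt0.
  have [d d0 Hd] := proj1 (contP _ _) cg _ r2; exists d => // s /Hd; rewrite gt => /le_lt_trans; apply.
  by rewrite ltr_pdivrMr// ltr_pMr// ltr1n.
have [df df0 Hf] := proj1 (nearN_P _ _) fg.
have [d1 d10 H1] := proj1 (derP _ _ _) Dx 1 ltr01.
have uu : `|u - u| < r by rewrite subrr normr0.
have tt : `|t - t| < df by rewrite subrr normr0.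
have gL s : `|s - t| < dg -> `|s - t| < df -> `|s - t| < d1 -> `|g s - u| <= C * (1 + `|v|) * `|s - t|.
  move=> h1 h2 h3; apply: le_trans (HC _ _ (Hg _ h1) uu) _; rewrite -mulrA ler_wpM2l ?(ltW C0)//.
  rewrite (Hf _ h2) -gt (Hf _ tt) mulrDl.
  rewrite -(subrK ((s - t) *: v) (x s - x t)) (le_trans (ler_normD _ _))// lerD//; first exact: H1.
  by rewrite normrZ mulrC.
set K := C * (1 + `|v|) in gL; have K0 : 0 < K by rewrite mulr_gt0// ltr_pwDl.
set C1 := n%:R * `|invmx D| + 1; have C10 : 0 < C1 by rewrite ltr_wpDl// mulr_ge0.
apply/derP => e e0.
have e1 : 0 < e / 2 / C1 by rewrite !divr_gt0.
have e2 : 0 < e / 2 / C1 / K by rewrite !divr_gt0.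
have [d2 d20 H2] := proj1 (derP _ _ _) Dx _ e1; have [d3 d30 H3] := HD _ e2.
exists (Num.min dg (Num.min df (Num.min d1 (Num.min d2 (d3 / K))))).
  by rewrite !lt_min dg0 df0 d10 d20 divr_gt0.
move=> s; rewrite !lt_min => /and5P[h1 h2 h3 h4 h5].
have gs := gL s h1 h2 h3.
have gd : `|g s - u| < d3 by apply: le_lt_trans gs _; rewrite mulrC -ltr_pdivlMr.
have ud : `|u - u| < d3 by rewrite subrr normr0.
have A1 := H2 s h4; have A2 := H3 _ _ gd ud.
rewrite (Hf _ h2) -{1}gt (Hf _ tt) in A2.
have -> : g s - g t - (s - t) *: (v *m invmx D) =
   (x s - x t - (s - t) *: v - (x s - x t - (g s - u) *m D)) *m invmx D.
  rewrite [X in _ = X]mulmxBl [X in _ = _ - X]mulmxBl (mulmxK uD) !mulmxBl -scalemxAl gt.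
  move: (x s *m _) (x t *m _) (v *m _) => B1 B2 B3.
  by apply/rowP => k; rewrite !mxE; ring.
apply: le_trans (mulmx_le _ _) _.
have B : `|x s - x t - (s - t) *: v - (x s - x t - (g s - u) *m D)| <= e / C1 * `|s - t|.
  apply: le_trans (ler_normB _ _) _.
  have -> : e / C1 * `|s - t| = e / 2 / C1 * `|s - t| + e / 2 / C1 * `|s - t| by field; rewrite gt_eqF.
  apply: lerD => //; apply: le_trans A2 _.
  have := ler_wpM2l (ltW e2) gs; move/le_trans; apply.
  by rewrite le_eqVlt; apply/orP; left; apply/eqP; field; rewrite !gt_eqF.
apply: (@le_trans _ _ (C1 * (e / C1 * `|s - t|))); last by rewrite mulrA mulrCA mulfV ?mulr1// gt_eqF.
by apply: ler_pM => //; rewrite /C1 lerDl.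
Qed.

Lemma tnorm_norm p : exists2 K, 0 < K & forall w, `|w| <= K * tnorm p w.
Proof.
have [r [K [r0 K0 H]]] := sqn_equiv (cdom_chart (chart_atP p)); exists K => // w.
have zz : `|chart (chart_at p) p - chart (chart_at p) p| < r by rewrite subrr normr0.
by have [_ Hw] := H _ zz; have [] := Hw w.
Qed.

(** The positive [e] makes the norm differentiable also where [g] passes through the origin; in
    [lift_length] it tends to 0 at the end. *)
Lemma sqrt_inner_der p (g : R -> 'rV[R]_n) t g' e : 0 < e -> is_derive t (1 : R) g g' ->
  is_derive t (1 : R) (fun s => Num.sqrt (e + inner p (g s) (g s))) (inner p (g t) g' / Num.sqrt (e + inner p (g t) (g t))).
Proof.
move=> e0 Dg; have DI : is_derive t (1 : R) (fun s => e + inner p (g s) (g s)) (2 * inner p (g t) g').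
  have Dg' := proj2 (derm_row _ _ _) Dg.
  have := derm_mul (derm_mul Dg' (derm_cst (gram (chart_at p) (chart (chart_at p) p)) t)) (derm_tr Dg') => /(_ 0 0) H.
  have := is_deriveD (der_cst e t) H; move/is_derive_eq; apply.
  rewrite add0r mulmx0 addr0 [LHS]mxE; rewrite -/(inner p g' (g t)) -/(inner p (g t) g') innerC.
  by ring.
have P0 : 0 < e + inner p (g t) (g t) by rewrite ltr_wpDr// inner_ge0.
have := is_derive1_comp (is_derive1_sqrt P0 : is_derive ((fun s => e + inner p (g s) (g s)) t) 1 Num.sqrt _) DI.
move/is_derive_eq; apply.
by field; rewrite gt_eqF// sqrtr_gt0.
Qed.

(* By the Gauss lemma |grad r| = 1, so the radius grows at most as fast as the length. *)
Lemma lift_length p c (G : R -> R) a b u g : a <= b -> (forall t, a <= t <= b -> C1_at c t) ->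
  (forall t, a <= t <= b -> is_derive t (1 : R) G (speed c t)) -> lifts (ex p) c a u b g ->
  tnorm p (g b) <= tnorm p u + (G b - G a).
Proof.
move=> ab C1c DG [cg ga Hg]; have [<-|neq] := eqVneq a b; first by rewrite ga subrr addr0.
have ab' : a < b by rewrite lt_neqAle neq.
apply/ler_addgt0Pl => e e0.
pose N s := Num.sqrt (e ^+ 2 + inner p (g s) (g s)).
have e20 : 0 < e ^+ 2 by rewrite exprn_gt0.
have tN s : tnorm p (g s) <= N s.
  by rewrite /tnorm /N ler_sqrt ?lerDr ?sqr_ge0// addr_ge0 ?sqr_ge0 ?inner_ge0.
have Nt s : N s <= e + tnorm p (g s).
  rewrite -(ler_pXn2r (n := 2)) ?nnegrE ?sqrtr_ge0 ?addr_ge0 ?tnorm_ge0 ?(ltW e0)//.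
  rewrite sqr_sqrtr ?addr_ge0 ?sqr_ge0 ?inner_ge0// sqrrD tnorm_sqr lerD2r lerDl.
  by rewrite mulrn_wge0// mulr_ge0 ?tnorm_ge0// ltW.
have DN t : a < t < b -> exists2 l, is_derive t (1 : R) N l & l <= speed c t.
  move=> /andP[ta tb]; have t_in : a <= t <= b by rewrite !ltW.
  have Et : ex p (g t) = c t by apply: Hg; exact: ltW.
  have D : chart_dom (chart_at (c t)) (c t) := chart_atP _; set i := chart_at _ in D.
  have De : chart_dom i (ex p (g t)) by rewrite Et.
  have [ND [D1 uD HD]] := ex_sdiff Msc Mc Mnc De.
  have [NC _] := C1_at_data (C1c t t_in) D; have [_ cc Dc] := nbhs_singleton NC.
  have Nin : \forall s \near t, a <= s <= b.
    have N1 : \forall s \near t, a < s by exact: lt_nbhsr.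
    have N2 : \forall s \near t, s < b by exact: lt_nbhsl.
    by apply: filterS2 N1 N2 => s h1 h2; rewrite !ltW.
  have Eg : \forall s \near t, chart i (ex p (g s)) = chart i (c s).
    by apply: filterS Nin => s /andP[h1 h2]; rewrite Hg.
  have Dg := lift_der_inv uD HD (erefl (g t)) (cg t) Eg Dc.
  exists (inner p (g t) (velocity_in i c t *m invmx D1) / N t); first exact: sqrt_inner_der.
  have N0 : 0 < N t by rewrite sqrtr_gt0 ltr_wpDr// inner_ge0.
  rewrite ler_pdivrMr//; apply: le_trans (ler_norm _) _.
  apply: le_trans (gauss_le Msc Mc _ De HD) _.
  rewrite mulmxKV// Et -(speedE cc D Dc) mulrC.
  by rewrite ler_wpM2l// speed_ge0.
have cN t : {for t, continuous N}.
  apply: (@continuous_comp _ _ _ (fun s => e ^+ 2 + inner p (g s) (g s)) Num.sqrt); last exact: sqrt_continuous.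
  apply: cvgD; first exact: cvg_cst.
  by apply: sqn_cont => //; [exact: cdom_chart (chart_atP p)|exact: cst_continuous|exact: cg].
pose dN t := xget 0 [set l | is_derive t (1 : R) N l /\ l <= speed c t].
have dNP t : a < t < b -> is_derive t (1 : R) N (dN t) /\ dN t <= speed c t.
  move=> /DN[l h1 h2]; apply: (@xgetPex _ 0 [set l | is_derive t (1 : R) N l /\ l <= speed c t]).
  by exists l.
have [t tin E] : exists2 t, t \in `]a, b[%R & (G b - N b) - (G a - N a) = (speed c t - dN t) * (b - a).
  apply: (@MVT _ (fun s => G s - N s) (fun s => speed c s - dN s)) => //.
    move=> t; rewrite in_itv /= => tab; apply: is_deriveB; last by have [] := dNP t tab.
    by apply: DG; case/andP: tab => /ltW -> /ltW ->.
  apply: continuous_in_subspaceT => t /set_mem; rewrite /= in_itv /= => tab.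
  by apply: cvgB; [exact: der_cont (DG t tab)|exact: cN].
have : 0 <= (G b - N b) - (G a - N a).
  rewrite E mulr_ge0 ?subr_ge0//.
  by have [_] := dNP t tin.
have := tN b; have := Nt a; rewrite ga; lra.
Qed.

(** At a limit time [t], the lifts over earlier times stay in a fixed ball by [lift_length], so
    their end points have a cluster point [w], which lies over [c t]. A section through [w] agrees
    with the lift at some time before [t], by local injectivity at [w], and continues it past
    [t]. *)
Lemma C1_lift p c a b u : a <= b -> (forall t, a <= t <= b -> C1_at c t) -> ex p u = c a ->
  exists g, lifts (ex p) c a u b g.
Proof.
move=> ab C1c Eu; have [G DG _] := curve_length ab C1c.
have cc t : a <= t <= b -> {for t, continuous c} by move=> /C1c[].
suff H : forall t, a <= t -> t <= b -> exists g, lifts (ex p) c a u t g by exact: H.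
apply: real_ind.
- exists (fun=> u); split => //; first by move=> t; exact: cst_continuous.
  by move=> s s0 s1; rewrite Eu; congr c; apply/eqP; rewrite eq_le s0 s1.
- move=> t at_ tb /(_ t at_ (lexx t)) [g Lg]; have [cg ga Hg] := Lg.
  have [W oW [Wt [sg Hs]]] := ex_sections p (g t).
  rewrite Hg// in Wt; have t_in : a <= t <= b by rewrite at_ ltW.
  have [d d0 Hd] := proj1 (nearN_P _ _) (cc t t_in _ (open_nbhs_nbhs (conj oW Wt))).
  exists d => // s ts sd sb.
  have [|g' L' _] := lifts_extend at_ (ltW ts) Lg _ Hs; last by exists g'.
  move=> r r1 r2; split; first by apply: cc; lra.
  by apply: Hd; rewrite ger0_norm; lra.
- move=> t at_ tb Ht.
  pose Lv s v := exists2 g, lifts (ex p) c a u s g & g s = v.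
  pose Lf s := xget 0 (Lv s).
  have LfP s : a <= s -> s < t -> Lv s (Lf s).
    by move=> h1 h2; have [g Lg] := Ht s h1 h2; apply: (@xgetPex _ 0 (Lv s)); exists (g s), g.
  have [K K0 HK] := tnorm_norm p.
  pose B := K * (tnorm p u + (G b - G a)).
  have LB s : a <= s -> s < t -> `|Lf s| <= B.
    move=> h1 h2; have [g Lg <-] := LfP s h1 h2; apply: le_trans (HK _) _.
    rewrite ler_pM2l//.
    have sb : s <= b by lra.
    have C1s r : a <= r <= s -> C1_at c r by move=> /andP[r1 r2]; apply: C1c; rewrite r1 (le_trans r2).
    have DGs r : a <= r <= s -> is_derive r (1 : R) G (speed c r) by move=> /andP[r1 r2]; apply: DG; rewrite r1 (le_trans r2).
    apply: le_trans (lift_length h1 C1s DGs Lg) _; rewrite lerD2l lerD2r.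
    exact: (nondecr_antideriv DG (fun r _ => speed_ge0 c r)).
  have cB : compact (closed_ball_ (fun v : 'rV[R]_n => `|v|) 0 B).
    apply: bounded_closed_compact; last exact: closed_closed_ball_.
    exists B; split; first exact: num_real.
    by move=> r Br v; rewrite /closed_ball_ /= sub0r normrN => /le_trans; apply; exact: ltW.
  have FB : (Lf @ t^'-) (closed_ball_ (fun v : 'rV[R]_n => `|v|) 0 B).
    have N1 : \forall s \near t, a < s by exact: lt_nbhsr.
    change (\forall s \near t^'-, `|0 - Lf s| <= B).
    by apply: filterS N1 => s as_ st; rewrite sub0r normrN; apply: LB => //; exact: ltW.
  have [w [_ clw]] := cB _ _ FB.
  have freq (A : set 'rV[R]_n) (Q : R -> Prop) : nbhs w A -> (\forall s \near t, Q s) ->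
      exists s, [/\ a <= s, s < t, A (Lf s) & Q s].
    move=> NA NQ; have FQ : (Lf @ t^'-) [set Lf s | s in [set s | a <= s /\ s < t /\ Q s]].
      have N1 : \forall s \near t, a < s by exact: lt_nbhsr.
      change (\forall s \near t^'-, [set Lf s | s in [set s | a <= s /\ s < t /\ Q s]] (Lf s)).
      by apply: filterS2 N1 NQ => s as_ Qs st; exists s => //; split; [exact: ltW|].
    by have [v [[s [h1 [h2 h3]] <-] Av]] := clw _ _ FQ NA; exists s.
  have t_in : a <= t <= b by rewrite (ltW at_).
  have Ew : ex p w = c t.
    apply: manifold_hausdorff => A1 A2 NA1 NA2.
    have [s [h1 h2 h3 h4]] := freq _ _ (ex_continuous NA1) (cc t t_in _ NA2).
    exists (c s); split; last exact: h4.
    have [g [_ _ Lg] Lgs] := LfP s h1 h2; rewrite -(Lg s h1 (lexx s)) Lgs; exact: h3.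
  have [W oW [Ww [sg [sgw sgW]]]] := ex_sections p w.
  have [d d0 Hd] := @ex_injective_near p w.
  have Nw : nbhs w [set v | `|v - w| < d] by apply/nearN_P; exists d.
  have Nc : \forall s \near t, W (c s) by apply: (cc t t_in); rewrite -Ew; exact: open_nbhs_nbhs.
  have [d' d'0 Hd'] := proj1 (nearN_P _ _) Nc.
  have cs : {for t, continuous (fun s => sg (c s))}.
    apply: (@continuous_comp _ _ _ c sg); first exact: cc.
    by rewrite -Ew; exact: (sgW _ Ww).2.
  have Ns : \forall s \near t, `|sg (c s) - w| < d.
    have NB : nbhs (sg (c t)) [set v | `|v - w| < d] by rewrite -Ew sgw.
    exact: cs NB.
  have Nd : \forall s \near t, `|s - t| < d' by apply/nearN_P; exists d'.
  have [s [h1 h2 h3 [h4 h5]]] := freq _ _ Nw (filterI Ns Nd).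
  have [g Lg Lgs] := LfP s h1 h2; have [_ _ Lg'] := Lg.
  have Es : ex p (Lf s) = c s by rewrite -Lgs; exact: Lg'.
  have Hs : section_on (ex p) W (g s) sg.
    split => //; rewrite Lgs Es; apply: Hd => //.
    by rewrite Es; exact: (sgW _ (Hd' _ h5)).1.
  have [|g' L' _] := lifts_extend h1 (ltW h2) Lg _ Hs; last by exists g'.
  move=> r r1 r2; split; first by apply: cc; lra.
  by apply: Hd'; move: h5; rewrite !ler0_norm; lra.
Qed.

(** Extends paths and homotopies given on the unit interval or square to the whole line or plane,
    where the lifting lemmas ask for continuity. *)
Lemma unit_clamp : exists cl : R -> R, [/\ continuous cl, forall t, 0 <= cl t <= 1 &
  forall t, 0 <= t <= 1 -> cl t = t].
Proof.
have i2 : 0 <= 2^-1 :> R by rewrite invr_ge0.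
exists (@clamp1 R 2^-1 2^-1); split.
- by move=> t; exact: clamp1_cont.
- move=> t; have := @clamp1_in R 2^-1 2^-1 t i2; rewrite ler_norml => /andP[h1 h2].
  by apply/andP; split; lra.
- by move=> t /andP[h1 h2]; apply: clamp1_id; rewrite ler_norml; apply/andP; split; lra.
Qed.

(** From a preimage [u] of a point of a coordinate ball, the chart segments issuing from [ex p u]
    are lifted by [C1_lift]. The end points of the lifts depend continuously on the target by
    [lift_param], and this dependence is the section. *)
Lemma ex_covering p : uniform_sections (ex p).
Proof.
move=> y0; pose i := chart_at y0; have D0 : chart_dom i y0 := chart_atP y0; pose z0 := chart i y0.
have [r [K [r0 K0 Hr HS]]] := chart_segment (cdom_chart D0).
have r2 : 0 <= r / 2 by rewrite divr_ge0// ltW.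
have rr : r / 2 < r by rewrite ltr_pdivrMr// ltr_pMr// ltr1n.
exists [set y | chart_dom i y /\ `|chart i y - z0| < r / 2]; first exact: chart_ball_open.
split; first by split => //; rewrite subrr normr0 divr_gt0.
move=> u [Du ur]; set xu := chart i (ex p u) in ur.
have xr : `|xu - z0| < r by apply: lt_trans rr.
pose z' z := clamp z0 (r / 2) z.
have z'r z : `|z' z - z0| < r by apply: le_lt_trans rr; exact: clamp_in.
have [cl [ccl cl01 clE]] := unit_clamp.
(* The clamps make [G] continuous on the whole product, as [lift_param] requires. *)
pose G (zt : 'rV[R]_n * R) := chart_inv (r := M) i (xu + cl zt.2 *: (z' zt.1 - xu)).
have cG : continuous G.
  move=> [z t]; apply: (@continuous_comp _ _ _ (fun zt : 'rV[R]_n * R => xu + cl zt.2 *: (z' zt.1 - xu)) (chart_inv i)).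
    apply: cvgD; first exact: cvg_cst.
    apply: cvgZ.
      apply: (@continuous_comp _ _ _ snd cl); first exact: cvg_snd.
      exact: ccl.
    apply: cvgB; last exact: cvg_cst.
    apply: (@continuous_comp _ _ _ fst z'); first exact: cvg_fst.
    apply: (@lip_cont _ _ _ _ _ 1); exists 1 => // y _.
    by rewrite mul1r clamp_lip.
  by apply: chart_inv_continuous; apply: Hr; exact: ball_segment.
have ex_g z : exists g, lifts (ex p) (fun t => chart_inv (r := M) i (xu + t *: (z' z - xu))) 0 u 1 g.
  have [C1s _] := HS _ _ xr (z'r z).
  have E0 : ex p u = chart_inv i (xu + 0 *: (z' z - xu)) by rewrite scale0r addr0 chart_invK.
  exact: C1_lift ler01 C1s E0.
have [g Hg] := choice ex_g.
have cg1 : continuous (fun z => g z 1).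
  move=> z; apply: (@lift_param _ _ _ (ex p) (@ex_injective_near p) (@ex_sections p) _ G g z cG) => //.
  - by move=> w; have [] := Hg w.
  - by move=> w t /[dup] /andP[h1 h2] h; have [_ _ ->//] := Hg w; rewrite /G /= clE.
  - have -> : g^~ 0 = fun=> u by apply/funext => w; have [_ ->] := Hg w.
    exact: cst_continuous.
have z'E z : `|z - z0| < r / 2 -> z' z = z by move=> h; apply: clamp_id; exact: ltW.
exists (fun y => g (chart i y) 1); split.
  have := lifts_unique (@ex_injective_near p) ler01 (Hg xu) _ ler01 (lexx 1); apply; split => //.
    by move=> t; exact: cst_continuous.
  by move=> t _ _; rewrite z'E// subrr scaler0 addr0 chart_invK.
move=> y [Dy yr]; split; last first.
  by apply: (@continuous_comp _ _ _ (chart i) (fun z => g z 1)); [exact: chart_continuous|exact: cg1].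
by have [_ _ ->//] := Hg (chart i y); rewrite scale1r subrKC z'E// chart_invK.
Qed.

(** The image of the segment from [u] to [v] is a loop; simple connectedness contracts it, and the
    contraction lifts. *)
Lemma ex_inj p u v : ex p u = ex p v -> u = v.
Proof.
move=> E; pose c t := ex p (u + t *: (v - u)).
have cc : continuous c.
  move=> t; apply: (@continuous_comp _ _ _ (fun t => u + t *: (v - u)) (ex p)); last exact: ex_continuous.
  exact: der_cont (der_segment u v t).
have c01 : c 0 = c 1 by rewrite /c scale0r addr0 scale1r subrKC.
have [H [cH H0 H1 Hs]] := Msc.2 c (continuous_subspaceT cc) c01.
have c0E : c 0 = ex p u by rewrite /c scale0r addr0.
have [cl [ccl cl01 clE]] := unit_clamp.
have cl0 : cl 0 = 0 by rewrite clE// lexx ler01.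
have cl1 : cl 1 = 1 by rewrite clE// lexx ler01.
pose H' (st : R * R) := H (cl st.1, cl st.2).
have cH' : continuous H'.
  move=> [s t] A NA; pose Q := `[0, 1]%classic `*` `[0, 1]%classic : set (R * R).
  have Qst : Q (cl s, cl t) by split; rewrite /= in_itv /=.
  have := (subspace_continuousP _ _).1 cH (cl s, cl t) Qst A NA.
  rewrite /within /= => N.
  have : nbhs (s, t) [set st | Q (cl st.1, cl st.2) -> A (H (cl st.1, cl st.2))].
    have N' : nbhs (cl s, cl t) [set z | Q z -> A (H z)] := N.
    have [[P1 P2] /= [NP1 NP2] PP] := N'.
    exists (cl @^-1` P1, cl @^-1` P2); first by split; apply: ccl.
    by move=> [s' t'] [h1 h2]; apply: PP.
  by apply: filterS => st; apply; split; rewrite /= in_itv /=.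
apply: (@homotopy_injective _ _ _ (ex p) (@ex_injective_near p) (@ex_sections p) (@ex_covering p) u v H' cH').
- by move=> t t01; rewrite /H' /= cl0 clE// H0.
- by move=> t t01; rewrite /H' /= cl1 clE// H1.
- by move=> s; rewrite /H' /= cl0 cl1; have [-> ->] := Hs _ (cl01 s).
Qed.

Lemma ex_pw p x y l : piecewise_C1 x y l -> forall u, ex p u = x ->
  exists2 v, ex p v = y & tnorm p v <= tnorm p u + l.
Proof.
elim=> [z u E|c a b z l' ab C1c _ IH u E]; first by exists u => //; rewrite addr0.
have C1c' := proj1 (C1_onP _ _ _) C1c.
have [g Lg] := C1_lift ab C1c' E; have [G DG ->] := curve_length ab C1c'.
have [v vE vl] := IH (g b) (let: And3 _ _ h := Lg in h b ab (lexx b)).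
by exists v => //; have := lift_length ab C1c' DG Lg; lra.
Qed.

Lemma ex0 p : ex p 0 = p.
Proof. by rewrite /ex -(scale0r (0 : 'rV[R]_n)) geo_scale// mul0r geo0. Qed.

Lemma tnorm0 p : tnorm p 0 = 0.
Proof. by rewrite /tnorm /inner !mul0mx mxE sqrtr0. Qed.

Lemma ex_surj p y : exists v, ex p v = y.
Proof.
by have [l /(@ex_pw p)/(_ 0 (ex0 p)) [v vE _]] := pw_connected Msc p y; exists v.
Qed.

(** The radial geodesic gives [<=]. A shorter curve would lift from the origin to a vector of
    smaller norm with the same image, against injectivity. *)
Lemma rdist_ex p v : rdist p (ex p v) = tnorm p v.
Proof.
apply/eqP; rewrite eq_le; apply/andP; split.
  have G t : 0 <= t <= 1 -> ageod_at (geo p v) t by move=> _; exact: (geoP Msc Mc p v).2.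
  have := @rdist_ageod _ _ _ (geo p v) 0 1 0 1 G; rewrite !lexx ler01 => /(_ isT isT).
  by rewrite geo0// (geo_speed Msc Mc) sub0r normrN normr1 mulr1.
rewrite leNgt; apply/negP => /(rdist_lt Msc) [l lt Hl].
have [w wE wl] := ex_pw Hl (ex0 p).
by move: wl lt; rewrite (ex_inj wE) tnorm0 add0r; lra.
Qed.

End exponential.

(** * Geodesic rays and visibility *)

Section geodesic_rays.
Context {R : realType} {n : nat} {M : riemannian_manifold R n}.
Implicit Types (a b s t r e d K L l : R) (p q x y : M) (c : R -> M) (i j : chart_index M) (u v w : 'rV[R]_n).
Implicit Types (xi eta : ideal_boundary M).
Hypothesis Msc : simply_connected M.
Hypothesis Mc : rcomplete M.
Hypothesis Mnc : no_conjugate_points M.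

Lemma geodesic_shift c s : geodesic c -> geodesic (fun t => c (t + s)).
Proof.
move=> /geodesicP[G S]; have E : (fun t => c (t + s)) = fun t => c (1 * t + s) by apply/funext => t; rewrite mul1r.
apply/geodesicP; rewrite E; split => t; first exact: ageod_affine.
have C := ageod_C1 (G (1 * t + s)).
by have [_ ->] := C1_speed_affine C; rewrite normr1 mul1r S.
Qed.

Lemma geodesic_start c : geodesic c -> tnorm (c 0) (velocity c 0) = 1 /\ c = geo (c 0) (velocity c 0).
Proof.
move=> /geodesicP[G S]; split; first by rewrite -(S 0).
by apply: geo_eq.
Qed.

Lemma geodesic_from c p : geodesic c -> c 0 = p -> exists2 v, tnorm p v = 1 & c = geo p v.
Proof. by move=> /geodesic_start[h1 h2] <-; exists (velocity c 0). Qed.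

Lemma geo_ex p v t : geo p v t = ex p (t *: v).
Proof. by rewrite /ex geo_scale// mulr1. Qed.

Lemma geodesic_rdist c s t : geodesic c -> rdist (c s) (c t) = `|t - s|.
Proof.
move=> /(geodesic_shift s) /geodesic_start; rewrite add0r; set v := velocity _ _ => -[v1 E].
have -> : c t = geo (c s) v (t - s) by rewrite -(congr1 (@^~ (t - s)) E) subrK.
by rewrite geo_ex rdist_ex// tnorm_scale v1 mulr1.
Qed.

Lemma rdist_refl p : rdist p p = 0.
Proof. by rewrite -{2}(ex0 Msc Mc p) rdist_ex// tnorm0. Qed.

Lemma rdist_gt0 p q : p <> q -> 0 < rdist p q.
Proof.
move=> pq; have [v E] := ex_surj Msc Mc Mnc p q; rewrite -E rdist_ex//.
by apply: tnorm_gt0; apply/eqP => v0; apply: pq; rewrite -E v0 ex0.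
Qed.

Lemma geodesic_to p q : p <> q -> exists2 v, tnorm p v = 1 & geo p v (rdist p q) = q.
Proof.
move=> pq; have d0 := rdist_gt0 pq; have [v E] := ex_surj Msc Mc Mnc p q.
have dE : rdist p q = tnorm p v by rewrite -E rdist_ex.
exists ((rdist p q)^-1 *: v); first by rewrite tnorm_scale gtr0_norm ?invr_gt0// dE mulVf// -dE gt_eqF.
by rewrite geo_ex scalerA mulfV ?gt_eqF// scale1r.
Qed.

Lemma geo_meet p u v s t : tnorm p u = 1 -> tnorm p v = 1 -> 0 < s -> 0 < t ->
  geo p u s = geo p v t -> s = t /\ u = v.
Proof.
move=> u1 v1 s0 t0; rewrite !geo_ex => /(ex_inj Msc Mc Mnc) E.
have st : s = t.
  by have := congr1 (tnorm p) E; rewrite !tnorm_scale u1 v1 !mulr1 !gtr0_norm.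
by split => //; move: E; rewrite st => /(congr1 (fun z => t^-1 *: z)); rewrite !scalerA mulVf ?gt_eqF// !scale1r.
Qed.

Lemma idealP xi c : sval xi c -> geodesic c /\
  forall c', sval xi c' <-> geodesic c' /\ asymptotic c c'.
Proof.
case: xi => A [c0 G0 E] /=; rewrite E => -[Gc [K HK]]; split; first exact: Gc.
move=> c'; split => -[Gc' [K' HK']]; (split; first exact: Gc').
  exists (K + K') => t t0; apply: le_trans (rdist_triangle Msc _ (c0 t) _) _.
  by rewrite lerD ?HK'// rdist_sym HK.
exists (K + K') => t t0; apply: le_trans (rdist_triangle Msc _ (c t) _) _.
by rewrite lerD ?HK' ?HK.
Qed.

Lemma ideal_inhabited xi : exists c, sval xi c.
Proof.
case: xi => A [c0 G0 E] /=; exists c0; rewrite E; split => //; exists 0 => t _.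
by rewrite rdist_refl.
Qed.

Lemma ideal_eq xi eta c : sval xi c -> sval eta c -> xi = eta.
Proof.
move=> /idealP[_ H1] /idealP[_ H2].
case: xi eta H1 H2 => A pA [B pB] /= H1 H2.
have AB : A = B by apply/seteqP; split => c'; [move=> /(proj1 (H1 _))/(proj2 (H2 _))|move=> /(proj1 (H2 _))/(proj2 (H1 _))].
by subst B; rewrite (Prop_irrelevance pA pB).
Qed.

Lemma inner_unit p u v : tnorm p u = 1 -> tnorm p v = 1 -> tnorm p (u - v) ^+ 2 = 2 - 2 * inner p u v.
Proof.
move=> u1 v1; have Iu : inner p u u = 1 by rewrite -tnorm_sqr u1 expr1n.
have Iv : inner p v v = 1 by rewrite -tnorm_sqr v1 expr1n.
rewrite tnorm_sqr -scaleN1r innerDl !innerDr !innerZl !innerZr Iu Iv (innerC p v u).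
by ring.
Qed.

Lemma tangle_unit p u v : tnorm p u = 1 -> tnorm p v = 1 ->
  0 <= tangle p u v <= pi /\ tnorm p (u - v) ^+ 2 = 2 - 2 * cos (tangle p u v).
Proof.
move=> u1 v1; have E := inner_unit u1 v1; have E0 := sqr_ge0 (tnorm p (u - v)).
have E' : tnorm p (u + v) ^+ 2 = 2 + 2 * inner p u v.
  have := @inner_unit p u (- v) u1; rewrite opprK -scaleN1r tnorm_scale normrN1 mul1r => /(_ v1) ->.
  by rewrite innerZr; ring.
have E0' := sqr_ge0 (tnorm p (u + v)).
have I : -1 <= inner p u v <= 1 by apply/andP; split; lra.
rewrite /tangle u1 v1 mulr1 divr1; have [-> ->] := acos_def I.
by [].
Qed.

Lemma tangle_refl p v : tnorm p v = 1 -> tangle p v v = 0.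
Proof. by move=> v1; rewrite /tangle v1 mulr1 divr1 -tnorm_sqr v1 expr1n acos1. Qed.

(** From here on a small angle is used as a small chord [tnorm p (u - v)], for which the triangle
    inequality is at hand; the two are tied by [|u - v|^2 = 2 - 2 cos]. *)
Lemma tangle_small p e : 0 < e -> exists2 d, 0 < d & forall u v, tnorm p u = 1 -> tnorm p v = 1 ->
  tangle p u v <= d -> tnorm p (u - v) <= e.
Proof.
move=> e0; have e20 : 0 < e ^+ 2 / 2 by rewrite divr_gt0// exprn_gt0.
have /(_ 0)/contP/(_ _ e20)[d' d'0 Hd'] := @continuous_cos R; rewrite cos0 in Hd'.
have pi0 := pi_gt0 R.
pose d := Num.min (d' / 2) pi; have d0 : 0 < d by rewrite lt_min divr_gt0.
exists d => // u v u1 v1; have [/andP[t0 tpi] E] := tangle_unit u1 v1 => td.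
have [dd' dpi] : d <= d' / 2 /\ d <= pi by rewrite !ge_min !lexx orbT.
have din : d \in `[0, pi] by rewrite in_itv /= ltW.
have tin : tangle p u v \in `[0, pi] by rewrite in_itv /= t0.
have C : cos d <= cos (tangle p u v).
  by rewrite leNgt (ltr_cos din tin) -leNgt.
have dd : `|d - 0| < d' by rewrite subr0 gtr0_norm//; lra.
have := Hd' d dd; rewrite ler_norml => /andP[h1 h2].
rewrite -(ler_pXn2r (n := 2)) ?nnegrE ?tnorm_ge0 ?(ltW e0)// E.
lra.
Qed.

Lemma direction_geo p (x : compactification M) v : ray p x = geo p v -> direction p x = v.
Proof.
move=> E; rewrite /direction E -[RHS](geo_velocity Msc Mc p v) /velocity geo0//.
Qed.

Lemma ray_geo p v t : tnorm p v = 1 -> 0 < t -> ray p (inl (geo p v t)) = geo p v.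
Proof.
move=> v1 t0; set A := [set c | [/\ geodesic c, c 0 = p & goes_to c (inl (geo p v t))]].
have Av : A (geo p v) by split; [exact: geo_geodesic|exact: geo0|exists t].
have [G0 c0 [s s0 E]] : A (ray p (inl (geo p v t))) by exact: (@xgetPex _ (fun=> p) A (ex_intro _ _ Av)).
have [u u1 Eu] := geodesic_from G0 c0; rewrite Eu in E *.
by have [_ ->] := geo_meet u1 v1 s0 t0 E.
Qed.

Lemma ray_inl p y : y <> p -> let v := direction p (inl y) in
  [/\ tnorm p v = 1, ray p (inl y) = geo p v & geo p v (rdist p y) = y].
Proof.
move=> /nesym yp; have [u u1 E] := geodesic_to yp; have d0 := rdist_gt0 yp.
have Er := ray_geo u1 d0; rewrite E in Er.
by rewrite (direction_geo Er).
Qed.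

Hypothesis Mvis : visibility M.

(** The points at time [t] of the two rays are joined by a segment of length at most [K], which
    stays at distance at least [t - K] from [p]. For large [t] visibility makes the angle at [p]
    arbitrarily small, but this angle does not depend on [t]. *)
Lemma asymptotic_eq p c c' : geodesic c -> geodesic c' -> c 0 = p -> c' 0 = p -> asymptotic c c' -> c = c'.
Proof.
move=> Gc Gc' c0 c'0 [K HK].
have [u u1 Eu] := geodesic_from Gc c0; have [v v1 Ev] := geodesic_from Gc' c'0.
apply: contrapT => neq; have uv : tnorm p (u - v) != 0.
  apply/eqP => uv0; apply: neq; rewrite Eu Ev; congr geo; apply/eqP; rewrite -subr_eq0.
  by apply: contraT => /(@tnorm_gt0 _ _ _ p); rewrite uv0 ltxx.
have uv0 : 0 < tnorm p (u - v) / 2 by rewrite divr_gt0// lt_neqAle eq_sym uv tnorm_ge0.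
have [d d0 Hd] := tangle_small p uv0; have [r r0 Hr] := Mvis p d0.
pose t := `|K| + r + 1; have t0 : 0 < t by rewrite ltr_wpDl// addr_ge0// ltW.
have Kt : K <= `|K| := ler_norm K.
have nE : geo p u t <> geo p v t by move=> /(geo_meet u1 v1 t0 t0)[_ E]; apply: neq; rewrite Eu Ev E.
have [w w1 Ew] := geodesic_to nE; set l := rdist _ _ in Ew.
have lK : l <= K by have := HK t (ltW t0); rewrite Eu Ev.
have l0 : 0 < l := rdist_gt0 nE.
have G := geo_geodesic Msc Mc w1.
have ptu : rdist p (geo p u t) = t.
  have := geodesic_rdist 0 t (geo_geodesic Msc Mc u1).
  by rewrite (geo0 Msc Mc p u) subr0 gtr0_norm.
have A : angle p (inl (geo p u t)) (inl (geo p v t)) <= d.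
  apply: (Hr (geo (geo p u t) w) 0%:E l%:E) => //.
  - move=> s /andP[s0 sl]; rewrite !lee_fin in s0 sl.
    have := rdist_triangle Msc p (geo (geo p u t) w s) (geo p u t); rewrite ptu.
    have -> : rdist (geo (geo p u t) w s) (geo p u t) = s.
      by rewrite -{2}(geo0 Msc Mc (geo p u t) w) geodesic_rdist// sub0r normrN ger0_norm.
    by rewrite /t; lra.
  - by rewrite /= geo0.
  - by rewrite /= Ew.
have : tnorm p (u - v) <= tnorm p (u - v) / 2.
  by apply: Hd => //; move: A; rewrite /angle !(direction_geo (ray_geo _ t0)).
by have := uv0; lra.
Qed.

(** Existence of the ray comes from visibility. If there were none, [ray] would be its constant
    default, with direction 0, and the quotient inside [acos] would be 0: every angle with [xi]
    would be [pi / 2]. Far along a geodesic of the class [xi], visibility bounds this angle by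
    [pi / 4]. *)
Lemma ray_inr p xi : let v := direction p (inr xi) in
  [/\ tnorm p v = 1, ray p (inr xi) = geo p v, sval xi (geo p v) &
      forall c, geodesic c -> c 0 = p -> sval xi c -> c = geo p v].
Proof.
set A := [set c | [/\ geodesic c, c 0 = p & goes_to c (inr xi : compactification M)]].
have [[c0 Ac0]|nA] := pselect (exists c, A c).
  have [G c00 S] : A (ray p (inr xi)) by exact: (@xgetPex _ (fun=> p) A (ex_intro _ _ Ac0)).
  have [u u1 Eu] := geodesic_from G c00; rewrite (direction_geo Eu) /=; split => //.
    by rewrite -Eu.
  rewrite -Eu => c Gc c0' Sc; apply: (asymptotic_eq Gc G c0' c00).
  by have [_ H] := idealP Sc; have [] := proj1 (H _) S.
have Er : ray p (inr xi) = fun=> p.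
  by apply: xgetPN => c Ac; apply: nA; exists c.
have D0 : direction p (inr xi) = 0.
  by apply/rowP => k; rewrite /direction Er !mxE derive1_cst.
have [c Sc] := ideal_inhabited xi; have [Gc _] := idealP Sc.
have pi0 := pi_gt0 R; have pi4 : 0 < pi / 4 :> R by rewrite divr_gt0.
have [r r0 Hr] := Mvis p pi4.
pose t := rdist p (c 0) + r.
have t0 : 0 <= t by rewrite addr_ge0 ?rdist_ge0// ltW.
have : angle p (inl (c t)) (inr xi) <= pi / 4.
  apply: (Hr c t%:E +oo%E) => //; first exact: ltry.
    move=> s /andP[st _]; rewrite lee_fin in st.
    have := rdist_triangle Msc (c 0) p (c s); rewrite geodesic_rdist// subr0 ger0_norm; last by lra.
    by rewrite (rdist_sym (c 0) p) /t in st *; lra.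
  by exists xi.
rewrite /angle /tangle D0 tnorm0 mulr0 invr0 mulr0 acos0; lra.
Qed.

(** Visibility in terms of chords. Points at distance at least [r > 0] differ from [p], so their
    directions are unit vectors and [tangle_small] applies. *)
Lemma vis_chord p e : 0 < e -> exists2 r, 0 < r & forall c, geodesic c ->
  (forall s t, s <= t -> (forall u : R, s <= u <= t -> r <= rdist p (c u)) ->
     tnorm p (direction p (inl (c s)) - direction p (inl (c t))) <= e) /\
  (forall s xi, sval xi c -> (forall u : R, s <= u -> r <= rdist p (c u)) ->
     tnorm p (direction p (inl (c s)) - direction p (inr xi)) <= e).
Proof.
move=> e0; have [d d0 Hd] := tangle_small p e0; have [r r0 Hr] := Mvis p d0.
have np y : r <= rdist p y -> tnorm p (direction p (inl y)) = 1.
  by move=> ry; apply: (let: And3 h _ _ := @ray_inl p y _ in h) => yp; move: ry; rewrite yp rdist_refl leNgt r0.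
exists r => // c Gc; split.
  move=> s t; rewrite le_eqVlt => /orP[/eqP <- _|st H]; first by rewrite subrr tnorm0 ltW.
  apply: Hd; [by apply/np/H; rewrite lexx ltW|by apply/np/H; rewrite lexx ltW|].
  by apply: (Hr c s%:E t%:E) => // u; rewrite !lee_fin; exact: H.
move=> s xi Sc H; apply: Hd; [by apply/np/H|by have [] := ray_inr p xi|].
apply: (Hr c s%:E +oo%E) => //; first exact: ltry.
  by move=> u /andP[su _]; apply: H; rewrite lee_fin in su.
by exists xi.
Qed.

End geodesic_rays.

(** * Isometries and shadows *)

Section isometries.
Context {R : realType} {n : nat} {M : riemannian_manifold R n}.
Implicit Types (a b s t r e d K L l : R) (p q x y : M) (c : R -> M) (i j : chart_index M) (u v w : 'rV[R]_n).
Implicit Types (xi eta : ideal_boundary M) (f g : M -> M).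
Local Notation X := (borel_compactification M).
Hypothesis Msc : simply_connected M.
Hypothesis Mc : rcomplete M.
Hypothesis Mnc : no_conjugate_points M.

Lemma C1_isom f c t : local_isom f -> C1_at c t -> C1_at (f \o c) t /\ speed (f \o c) t = speed c t.
Proof.
move=> If Cc; have D : chart_dom (chart_at (c t)) (c t) := chart_atP _; set i := chart_at _ in D.
have Dj : chart_dom (chart_at (f (c t))) (f (c t)) := chart_atP _; set j := chart_at _ in Dj.
have [N cv] := C1_at_data Cc D; have [_ cc Dc] := nbhs_singleton N.
have [cf _ _] := If; split; last by apply: speed_isom => //; exists i.
have cfc : {for t, continuous (f \o c)} by apply: continuous_comp => //; exact: cf.
have Tt : tdom f i j (chart i (c t)) by exists (c t).
apply: (@C1_at_chart _ _ _ j _ (fun s => velocity_in i c s *m jac (trans f i j) (chart i (c s)))).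
  have N2 : \forall s \near t, chart_dom j (f (c s)) := near_dom cfc Dj.
  apply: filterS2 N N2 => s [Ds cs Dcs] Djs; split => //.
  exact: velocity_trans.
apply/cont_rvP => k; apply: (@cont_mulmx R R 1 n n (velocity_in i c) (fun s => jac (trans f i j) (chart i (c s)))).
  by move=> i0 l; rewrite ord1; exact: (proj1 (cont_rvP _ _) cv).
move=> a b; apply: (@continuous_comp _ _ _ (fun s => chart i (c s)) (fun z => jac (trans f i j) z a b)).
  exact: cont_coord.
have -> : (fun z => jac (trans f i j) z a b) = partial a (fun z => trans f i j z 0 b).
  by apply/funext => z; rewrite mxE.
apply: (@ck_cont _ 0 _ (tdom f i j)) => //.
by apply: ck_partial; [exact: tdom_open|exact: (ck_trans i j 1 If)].
Qed.

Lemma pw_isom f x y l : local_isom f -> piecewise_C1 x y l -> piecewise_C1 (f x) (f y) l.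
Proof.
move=> If; elim=> [z|c a b z l' ab /(proj1 (C1_onP _ _ _)) C1c _ IH]; first exact: Pw_nil.
have -> : Rintegral (@lebesgue_measure R) `[a, b] (speed c) = Rintegral (@lebesgue_measure R) `[a, b] (speed (f \o c)).
  apply: eq_Rintegral => t /set_mem; rewrite /= in_itv /= => tab.
  by have [_ E] := C1_isom If (C1c t tab); exact: (esym E).
apply: (@Pw_cons _ _ _ (f \o c)) => //.
by apply/C1_onP => t tab; have [] := C1_isom If (C1c t tab).
Qed.

Lemma rdist_local_isom f x y : local_isom f -> rdist (f x) (f y) <= rdist x y.
Proof.
move=> If; rewrite leNgt; apply/negP => /(rdist_lt Msc)[l ll /(pw_isom If)/rdist_le].
by rewrite leNgt ll.
Qed.

Lemma geodesic_isom f c : local_isom f -> geodesic c -> geodesic (f \o c).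
Proof.
move=> If /geodesicP[G S]; apply/geodesicP; split => t; first exact: ageod_isom.
by have [_ ->] := C1_isom If (ageod_C1 (G t)).
Qed.

Definition iso_pair f g := [/\ local_isom f, local_isom g, cancel f g & cancel g f].

Lemma iso_pair_sym f g : iso_pair f g -> iso_pair g f.
Proof. by case. Qed.

Lemma rdist_isom f g x y : iso_pair f g -> rdist (f x) (f y) = rdist x y.
Proof.
move=> [If Ig fg gf]; apply/eqP; rewrite eq_le rdist_local_isom//=.
by rewrite -{1}(fg x) -{1}(fg y) rdist_local_isom.
Qed.

Lemma asymptotic_isom f g c c' : iso_pair f g -> asymptotic c c' -> asymptotic (f \o c) (f \o c').
Proof. by move=> I [K HK]; exists K => t t0; rewrite /= (rdist_isom _ _ I); exact: HK. Qed.

Lemma ideal_isom f g xi : iso_pair f g -> exists eta, forall c, sval xi c -> sval eta (f \o c).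
Proof.
move=> I; have [If _ _ _] := I; have [c0 S0] := ideal_inhabited Msc Mc Mnc xi.
have [G0 H0] := idealP Msc S0.
pose A := [set c' | geodesic c' /\ asymptotic (f \o c0) c'].
have pA : exists2 c, geodesic c & A = [set c' | geodesic c' /\ asymptotic c c'].
  by exists (f \o c0); [exact: geodesic_isom|].
exists (exist _ A pA) => c /H0[Gc Ac]; split; first exact: geodesic_isom.
exact: asymptotic_isom I Ac.
Qed.

Lemma ideal_isom_eq f g xi eta c c' : iso_pair f g -> sval xi c -> sval eta (f \o c) -> sval xi c' -> sval eta (f \o c').
Proof.
move=> I S S' S1; have [eta' H] := ideal_isom xi I.
by rewrite (ideal_eq Msc S' (H _ S)); exact: H.
Qed.

Hypothesis Mvis : visibility M.

Lemma ray_inr_eq p xi c : sval xi c -> c 0 = p -> ray p (inr xi) = c.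
Proof.
move=> S c0; have [_ -> _ H] := ray_inr Msc Mc Mnc Mvis p xi.
by rewrite (H c)//; have [] := idealP Msc S.
Qed.

Lemma ray_isom f g x xi eta c : iso_pair f g -> sval xi c -> sval eta (f \o c) ->
  ray (f x) (inr eta) = f \o ray x (inr xi).
Proof.
move=> I S S'; have [_ E Sr _] := ray_inr Msc Mc Mnc Mvis x xi.
apply: ray_inr_eq; first by rewrite E; exact: ideal_isom_eq I S S' Sr.
by rewrite /= E geo0.
Qed.

Lemma shadowP x p r xi : shadow x (rball p r) (inr xi) <-> exists2 t, 0 < t & rdist p (ray x (inr xi) t) < r.
Proof.
split => [[z [xi' [zr zx S [xiE]]]] | [t t0 tr]].
  subst xi'; have [v1 E Ez] := ray_inl Msc Mc Mnc zx; move: S; rewrite E => S.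
  have -> : ray x (inr xi) = geo x (direction x (inl z)) by apply: ray_inr_eq => //; exact: geo0.
  by exists (rdist x z); [exact: rdist_gt0 (nesym zx)|rewrite Ez].
have [v1 E S _] := ray_inr Msc Mc Mnc Mvis x xi; rewrite E in tr.
exists (geo x (direction x (inr xi)) t), xi; split => //; last by rewrite ray_geo.
move=> E0; have := geodesic_rdist Msc Mc Mnc 0 t (geo_geodesic Msc Mc v1).
by rewrite E0 geo0// rdist_refl// subr0 gtr0_norm// => /eqP; rewrite lt_eqF.
Qed.

Lemma shadow_ideal x A : shadow x A `<=` ideal_points M.
Proof. by move=> y [z [xi [_ _ _ ->]]]; exists xi. Qed.

Lemma translate_shadow f g x p r : iso_pair f g ->
  translate f (shadow x (rball p r)) = shadow (f x) (rball (f p) r).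
Proof.
move=> I; have [_ _ fg gf] := I; apply/seteqP; split => y.
  move=> [z Sz]; have [xi _ zE] := shadow_ideal Sz; rewrite -zE in Sz *.
  case: y => // eta [c S S']; apply/shadowP; move/shadowP: Sz => [t t0 tr].
  by exists t => //; rewrite (ray_isom x I S S') /= (rdist_isom _ _ I).
move=> Sy; have [eta _ yE] := shadow_ideal Sy; rewrite -yE in Sy *.
have [xi Hxi] := ideal_isom eta (iso_pair_sym I).
have [c Sc] := ideal_inhabited Msc Mc Mnc eta; have Sgc := Hxi _ Sc.
have Sfgc : sval eta (f \o (g \o c)) by rewrite (_ : f \o _ = c)//; apply/funext => t /=; rewrite gf.
exists (inr xi); last by exists (g \o c).
apply/shadowP; move/shadowP: Sy => [t t0 tr]; exists t => //.
by move: tr; rewrite (ray_isom x I Sgc Sfgc) /= (rdist_isom _ _ I).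
Qed.

(** The function under the limit is nonincreasing and bounded below, by the triangle inequality; so
    the limit exists and lies below each of its values. *)
Lemma busemann_le xi p x t : busemann xi p x <= rdist p (ray x (inr xi) t) - t.
Proof.
have [v1 E _ _] := ray_inr Msc Mc Mnc Mvis x xi.
have G := geo_geodesic Msc Mc v1; rewrite /busemann E; set c := geo _ _ in G *.
pose g t := rdist p (c t) - t.
have gN s t' : s <= t' -> g t' <= g s.
  move=> st; have := rdist_triangle Msc p (c s) (c t'); rewrite (geodesic_rdist Msc Mc Mnc _ _ G) ger0_norm ?subr_ge0//.
  by rewrite /g; lra.
have gB s : - rdist p (c 0) <= g s.
  have := rdist_triangle Msc (c 0) p (c s); rewrite (geodesic_rdist Msc Mc Mnc _ _ G) subr0 (rdist_sym (c 0) p) /g.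
  by have := ler_norm s; lra.
have hi : has_inf (range g).
  by split; [exists (g 0), 0|exists (- rdist p (c 0)) => _ [s _ <-]].
have cg : g s @[s --> +oo] --> inf (range g).
  apply/cvgrPdist_le => e e0; have [_ [s0 _ <-] Hs0] := inf_adherent e0 hi.
  have N : \forall s \near +oo, s0 <= s by apply: nbhs_pinfty_ge; exact: num_real.
  apply: filterS N => s s0s; have h1 := gN _ _ s0s.
  have h2 : inf (range g) <= g s by apply: ge_inf; [exact: hi.2|exists s].
  by rewrite ler0_norm; lra.
apply: limr_le; first by apply/cvg_ex; exists (inf (range g)).
have N : \forall s \near +oo, t <= s by apply: nbhs_pinfty_ge; exact: num_real.
by apply: filterS N => s; exact: gN.
Qed.

Lemma cone_subbase_open (A : set (compactification M)) : cone_subbase A -> open A.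
Proof.
move=> cA; exists [set A]; last by rewrite bigcup_set1.
move=> _ ->; exists (finmap.fset1 A); first by move=> B; rewrite finmap.in_fset1 inE => /eqP ->.
by rewrite set_fset1 bigcap_set1.
Qed.

Lemma cone_open p v e r : tnorm p v = 1 -> 0 < e -> 0 < r -> open (truncated_cone p v e r).
Proof.
move=> v1 e0 r0; apply: cone_subbase_open; right; exists p, v, e, r; split => //.
by rewrite -tnorm_sqr v1 expr1n.
Qed.

Lemma borel_open (A : set (compactification M)) : open A -> measurable (A : set X).
Proof. by move=> oA; exact: sub_sigma_algebra. Qed.

Lemma ideal_measurable : measurable (ideal_points M : set X).
Proof.
have -> : (ideal_points M : set X) = ~` (inl @` setT).
  apply/seteqP; split => [_ [xi _ <-] [y _] //|[y|xi] H]; first by exfalso; apply: H; exists y.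
  by exists xi.
apply: measurableC; apply: borel_open; apply: cone_subbase_open; left.
by exists setT => //; exact: openT.
Qed.

Lemma half_bound (t K d : R) : 0 < t -> 0 < K -> 0 < d -> t * (K * (d / (t * K) / 2)) < d.
Proof.
move=> t0 K0 d0; have -> : t * (K * (d / (t * K) / 2)) = d / 2 by field; rewrite !gt_eqF.
lra.
Qed.

(** [O] is the union of the cones whose boundary points all lie in the shadow. It covers the shadow:
    if the ray to [xi] is in the open ball at time [t], continuity of [ex x] puts there all rays
    with nearby directions. The truncation radius 1 is arbitrary, boundary points being beyond every
    radius. *)
Lemma shadow_measurable x p r : measurable (shadow x (rball p r) : set X).
Proof.
pose O := \bigcup_(ve in [set ve : 'rV[R]_n * R | [/\ tnorm x ve.1 = 1, 0 < ve.2 &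
   forall xi, truncated_cone x ve.1 ve.2 1 (inr xi) -> shadow x (rball p r) (inr xi)]]) truncated_cone x ve.1 ve.2 1.
have -> : (shadow x (rball p r) : set X) = ideal_points M `&` O; last first.
  apply: measurableI; first exact: ideal_measurable.
  by apply: borel_open; apply: bigcup_open => -[v e] [/= v1 e0 _]; exact: cone_open.
apply/seteqP; split => [y Sy|_ [[xi _ <-] [[v e] [/= v1 e0 H] Hc]]]; last exact: H.
split; first exact: shadow_ideal Sy.
have [xi _ yE] := shadow_ideal Sy; rewrite -yE in Sy *; move/shadowP: (Sy) => [t t0 tr].
have [v1 E _ _] := ray_inr Msc Mc Mnc Mvis x xi; set v := direction _ _ in v1 E; rewrite E geo_ex// in tr.
have e0 : 0 < r - rdist p (ex x (t *: v)) by rewrite subr_gt0.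
have N0 := rdist_near (ex x (t *: v)) e0.
have N1 := ex_continuous Msc Mc Mnc N0.
have [d d0 Hd] := proj1 (nearN_P _ _) N1.
have [K K0 HK] := tnorm_norm x.
have dK : 0 < d / (t * K) by rewrite divr_gt0// mulr_gt0.
have dK2 : 0 < d / (t * K) / 2 by rewrite divr_gt0.
have [e1 e10 He1] := tangle_small x dK2.
exists (v, e1); last first.
  split => //=; rewrite -/v.
  by rewrite tangle_refl.
split => //= xi' [/= Hc _]; have [v1' E' _ _] := ray_inr Msc Mc Mnc Mvis x xi'; set v' := direction _ _ in v1' E' Hc.
apply/shadowP; exists t; first exact: t0.
rewrite E' (geo_ex Msc Mc x v' t).
have vv : tnorm x (v' - v) <= d / (t * K) / 2 by apply: He1 => //; exact: ltW.
have nn : `|t *: v' - t *: v| < d.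
  rewrite -scalerBr normrZ gtr0_norm//; apply: (@le_lt_trans _ _ (t * (K * (d / (t * K) / 2)))).
    rewrite ler_pM2l//; apply: le_trans (HK _) _; by rewrite ler_pM2l.
  exact: half_bound.
have [h _] := Hd _ nn.
apply: le_lt_trans (rdist_triangle Msc _ (ex x (t *: v)) _) _.
by rewrite addrC -ltrBrDr.
Qed.

End isometries.

(** * Consequences of visibility for shadows, Busemann functions and group elements *)

Section visibility_geometry.
Context {R : realType} {n : nat} {M : riemannian_manifold R n}.
Implicit Types (a b s t r e d K D : R) (p q x y z : M) (c : R -> M) (u v w : 'rV[R]_n).
Implicit Types (xi eta : ideal_boundary M) (f g : M -> M).
Hypothesis Msc : simply_connected M.
Hypothesis Mc : rcomplete M.
Hypothesis Mnc : no_conjugate_points M.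
Hypothesis Mvis : visibility M.

Lemma tnorm_triangle p u v : tnorm p (u + v) <= tnorm p u + tnorm p v.
Proof.
have I : inner p u v <= tnorm p u * tnorm p v.
  have := cauchy_schwarz u v (cdom_chart (chart_atP p)).
  change (inner p u v ^+ 2 <= inner p u u * inner p v v -> inner p u v <= tnorm p u * tnorm p v).
  rewrite -!tnorm_sqr -exprMn => H; apply: le_trans (ler_norm _) _.
  by rewrite -(ler_pXn2r (n := 2)) ?nnegrE ?mulr_ge0 ?tnorm_ge0// real_normK ?num_real.
rewrite -(ler_pXn2r (n := 2)) ?nnegrE ?addr_ge0 ?tnorm_ge0// sqrrD !tnorm_sqr.
rewrite innerDl !innerDr (innerC p v u) mulr2n; lra.
Qed.

Lemma chordC p u v : tnorm p (u - v) = tnorm p (v - u).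
Proof. by rewrite -opprB -scaleN1r tnorm_scale normrN1 mul1r. Qed.

Lemma chord_triangle p v u w : tnorm p (u - w) <= tnorm p (u - v) + tnorm p (v - w).
Proof. by rewrite -(subrKA v) tnorm_triangle. Qed.

Lemma chord_gt0 p u v : u != v -> 0 < tnorm p (u - v).
Proof. by rewrite -subr_eq0; exact: tnorm_gt0. Qed.

Lemma direction_inj p xi eta : direction p (inr xi) = direction p (inr eta) -> xi = eta.
Proof.
have [_ _ S1 _] := ray_inr Msc Mc Mnc Mvis p xi; have [_ _ S2 _] := ray_inr Msc Mc Mnc Mvis p eta.
by move=> E; rewrite -E in S2; exact: (ideal_eq Msc S1 S2).
Qed.

Lemma ray_data p xi : let c := ray p (inr xi) in [/\ geodesic c, c 0 = p & sval xi c].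
Proof.
have [v1 E S _] := ray_inr Msc Mc Mnc Mvis p xi; rewrite E /=; split => //.
  exact: geo_geodesic.
exact: geo0.
Qed.

Lemma vis_pass p e : 0 < e -> exists2 r, 0 < r & forall c, geodesic c ->
  (forall s t, s <= t -> e < tnorm p (direction p (inl (c s)) - direction p (inl (c t))) ->
     exists2 t', s <= t' <= t & rdist p (c t') < r) /\
  (forall s xi, sval xi c -> e < tnorm p (direction p (inl (c s)) - direction p (inr xi)) ->
     exists2 t', s <= t' & rdist p (c t') < r).
Proof.
move=> e0; have [r r0 Hr] := vis_chord Msc Mc Mnc Mvis p e0; exists r => // c Gc; have [H1 H2] := Hr c Gc.
split=> [s t st|s xi S] He; apply: contrapT => N; move: He; rewrite ltNge => /negP; apply.
  apply: H1 => // t' st'; rewrite leNgt; apply/negP => h; by apply: N; exists t'.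
by apply: H2 => // t' st'; rewrite leNgt; apply/negP => h; apply: N; exists t'.
Qed.

(** A ray from [x] that misses the ball stays at distance at least [r] from [p] at positive times,
    hence also at its start by letting the time tend to 0. Visibility then bounds the angle at [p]
    between its two ends. *)
Lemma shadow_far p e : 0 < e -> exists2 r, 0 < r & forall x xi, ~ shadow x (rball p r) (inr xi) ->
  tnorm p (direction p (inr xi) - direction p (inl x)) <= e.
Proof.
move=> e0; have [r r0 Hr] := vis_chord Msc Mc Mnc Mvis p e0; exists r => // x xi nS.
have [Gc c0 S] := ray_data x xi; set c := ray x _ in Gc c0 S.
have far t : 0 < t -> r <= rdist p (c t).
  move=> t0; rewrite leNgt; apply/negP => h; apply: nS.
  by apply/(shadowP Msc Mc Mnc Mvis); exists t.
have [_ H] := Hr c Gc; rewrite chordC -{1}c0; apply: H => // t; rewrite le_eqVlt => /orP[/eqP <-|]; last exact: far.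
apply/ler_addgt0Pl => d d0; apply: le_trans (far d d0) _.
apply: le_trans (rdist_triangle Msc p (c 0) (c d)) _.
by rewrite (geodesic_rdist Msc Mc Mnc _ _ Gc) subr0 gtr0_norm// addrC.
Qed.

(** Since [x] and [xi] are seen from [p] under a large angle, the ray from [x] to [xi] comes within
    [r] of [p] at some time [t]. Then [t > d(p, x) - r], and the Busemann function is at most
    [d(p, c t) - t]. *)
Lemma busemann_pass p e xi : 0 < e -> exists2 r, 0 < r & forall x,
  e < tnorm p (direction p (inl x) - direction p (inr xi)) ->
  busemann xi p x < 2 * r - rdist p x.
Proof.
move=> e0; have [r r0 Hr] := vis_pass p e0; exists r => // x.
have [Gc c0 S] := ray_data x xi; have [_ H] := Hr _ Gc.
rewrite -{1}c0 => /(H _ _ S)[t t0 tr].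
apply: le_lt_trans (busemann_le Msc Mc Mnc Mvis xi p x t) _.
have := rdist_triangle Msc p (ray x (inr xi) t) x.
have := geodesic_rdist Msc Mc Mnc t 0 Gc; rewrite c0 => ->.
by rewrite sub0r normrN ger0_norm//; lra.
Qed.

(* An isometry fixing [xi] that moves [q] deep into the direction [w1] maps the
   complement of a neighbourhood of [xi] close to the direction [w1]: otherwise the
   geodesic from [f y] to [xi], which passes near [f q], would come back to [q] both
   before and after. *)
Lemma pingpong q xi w1 e0 e1 : let w0 := direction q (inr xi) in
  0 < e0 -> 0 < e1 -> e1 <= tnorm q (w1 - w0) ->
  exists D, forall f g, iso_pair f g -> (exists2 c, sval xi c & sval xi (f \o c)) ->
    tnorm q (direction q (inl (f q)) - w1) < e1 / 2 -> D < rdist q (f q) ->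
    forall y, y = q \/ e0 <= tnorm q (direction q (inl y) - w0) ->
      tnorm q (direction q (inl (f y)) - w1) < e1.
Proof.
move=> w0 e00 e10 e1w.
have ar1 (W A B F Z e : R) : e <= W -> A < e / 2 -> F <= e / 8 -> W <= A + B -> B <= F + Z -> 0 < e -> e / 8 < Z by lra.
have ar2 (Y A B F Z e : R) : Y <= e / 8 -> A < e / 2 -> F <= e / 8 -> B <= Y + Z -> Z <= F + A -> 0 < e -> B < e by lra.
have ar3 (d1 d2 t0 t1 t2 dz df fz r r' : R) : d1 < r' -> d2 < r' -> t2 - t1 <= d1 + d2 -> t0 <= t2 ->
  dz <= d1 + (t0 - t1) -> df <= dz + fz -> fz < r -> r + 3 * r' < df -> False by lra.
have e02 : 0 < e0 / 2 by rewrite divr_gt0.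
have e18 : 0 < e1 / 8 by rewrite divr_gt0.
have [r r0 Hr] := vis_pass q e02; have [r' r'0 Hr'] := vis_pass q e18.
(* If the geodesic were within [r'] of [q] at times [t1 <= t0 <= t2], then [t2 - t1 < 2 r'], so the
   point [z] at time [t0] would be within [3 r'] of [q], and [f q], which is within [r] of [z],
   within [r + 3 r']. *)
exists (r + 3 * r') => f g I [c1 S1 S1'] fw fD y Hy.
have [Gc c0 S] := ray_data y xi; set c := ray y _ in Gc c0 S.
have [t0 t00 t0r] : exists2 t, 0 <= t & rdist q (c t) < r.
  case: Hy => [yq|Hy]; first by exists 0 => //; rewrite c0 yq rdist_refl.
  have [_ H] := Hr c Gc; apply: (H 0 xi S); rewrite c0.
  by apply: lt_le_trans Hy; rewrite ltr_pdivrMr// ltr_pMr// ltr1n.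
have Sf : sval xi (f \o c) := ideal_isom_eq Msc Mc Mnc I S1 S1' S.
have If : local_isom f by case: I.
have GC := geodesic_isom If Gc.
set z := f (c t0); have fz : rdist (f q) z < r by rewrite /z (rdist_isom Msc _ _ I).
have qz := rdist_triangle Msc q z (f q); rewrite (rdist_sym z) in qz.
have fqz : tnorm q (direction q (inl (f q)) - direction q (inl z)) <= e1 / 8.
  have [->|/eqP nz] := eqVneq (f q) z; first by rewrite subrr tnorm0 ltW.
  have [v v1 Ev] := geodesic_to Msc Mc Mnc nz; have Gv := geo_geodesic Msc Mc v1.
  have [H _] := Hr' _ Gv; rewrite leNgt; apply/negP.
  have := H 0 _ (rdist_ge0 (f q) z); rewrite Ev geo0// => /[apply] -[s /andP[s0 sl] sr].
  have := rdist_triangle Msc q (geo (f q) v s) (f q).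
  have := geodesic_rdist Msc Mc Mnc s 0 Gv; rewrite geo0// => ->.
  by rewrite sub0r normrN ger0_norm//; lra.
have [H1 H2] := Hr' _ GC.
have yz : tnorm q (direction q (inl (f y)) - direction q (inl z)) <= e1 / 8.
  rewrite leNgt; apply/negP => h.
  have := H1 0 t0 t00; rewrite /= c0 => /(_ h)[t1 /andP[t10 t1t] t1r].
  have zw : e1 / 8 < tnorm q (direction q (inl z) - w0).
    have K1 := chord_triangle q (direction q (inl (f q))) w1 w0; rewrite (chordC q w1 (direction q _)) in K1.
    have K2 := chord_triangle q (direction q (inl z)) (direction q (inl (f q))) w0.
    exact: ar1 e1w fw fqz K1 K2 e10.
  have [t2 t20 t2r] := H2 t0 xi Sf zw.
  have G12 := geodesic_rdist Msc Mc Mnc t1 t2 GC; have G10 := geodesic_rdist Msc Mc Mnc t1 t0 GC.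
  have t12 : t1 <= t2 := le_trans t1t t20.
  rewrite ger0_norm ?subr_ge0// in G12; rewrite ger0_norm ?subr_ge0// in G10.
  have K1 := rdist_triangle Msc ((f \o c) t1) q ((f \o c) t2).
  rewrite (rdist_sym _ q) G12 in K1; have K2 := rdist_triangle Msc q ((f \o c) t1) z.
  rewrite [rdist ((f \o c) t1) z]G10 in K2.
  exact: ar3 t1r t2r K1 t20 K2 qz fz fD.
have K1 := chord_triangle q (direction q (inl z)) (direction q (inl (f y))) w1.
have K2 := chord_triangle q (direction q (inl (f q))) (direction q (inl z)) w1.
rewrite (chordC q (direction q (inl z)) (direction q (inl (f q)))) in K2.
exact: ar2 yz fw fqz K1 K2 e10.
Qed.

Lemma limit_set_near (Gamma : set (M -> M)) q eta e D : limit_set Gamma q (inr eta) -> 0 < e ->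
  exists2 f, Gamma f & tnorm q (direction q (inl (f q)) - direction q (inr eta)) < e /\ D < rdist q (f q).
Proof.
move=> [cl _] e0; have [v1 _ _ _] := ray_inr Msc Mc Mnc Mvis q eta.
have e2 : 0 < e / 2 by rewrite divr_gt0.
have [d d0 Hd] := tangle_small q e2.
(* A truncated cone of the subbase has a positive radius, while [D] is arbitrary. *)
pose D' := Num.max D 1; have D'0 : 0 < D' by rewrite lt_max ltr01 orbT.
have DD' : D <= D' by rewrite le_max lexx.
have N : nbhs (inr eta : compactification M) (truncated_cone q (direction q (inr eta)) d D').
  apply: open_nbhs_nbhs; split; first exact: cone_open.
  by split => //; rewrite tangle_refl.
have [_ [[f Gf <-] [/= h1 h2]]] := cl _ N; exists f => //; split; last exact: le_lt_trans h2.
have fq : f q <> q by move=> E; move: h2; rewrite E rdist_refl// => h2; lra.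
have [u1 _ _] := ray_inl Msc Mc Mnc fq.
by apply: le_lt_trans (Hd _ _ u1 v1 (ltW h1)) _; rewrite ltr_pdivrMr// ltr_pMr// ltr1n.
Qed.

Lemma limit_set_two (Gamma : set (M -> M)) q xi : non_elementary Gamma q ->
  exists eta1 eta2, [/\ limit_set Gamma q (inr eta1), limit_set Gamma q (inr eta2), eta1 <> xi, eta2 <> xi & eta1 <> eta2].
Proof.
move=> inf.
have pick (A : set (compactification M)) : finite_set A -> exists2 eta, limit_set Gamma q (inr eta) & ~ A (inr eta).
  move=> finA; have [y [Ly nA]] : (limit_set Gamma q `\` A) !=set0.
    apply: contrapT => /forallNP ne; apply: inf; apply: sub_finite_set finA => y Ly.
    by apply: contrapT => nA; exact: (ne y).
  by have [_ [eta _ yE]] := Ly; rewrite -yE in Ly nA; exists eta.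
have [eta1 L1 n1] := pick [set inr xi] (finite_set1 _).
have [eta2 L2 n2] := pick [set inr xi; inr eta1] (finite_set2 _ _).
exists eta1, eta2; split => // E; [apply: n1|apply: n2; left|apply: n2; right]; by rewrite E.
Qed.

End visibility_geometry.

(** * Conformal densities *)

Section boundary_measures.
Context {R : realType} {n : nat} {M : riemannian_manifold R n}.
Implicit Types (a b s t r e d K D : R) (p q x y z : M) (c : R -> M) (u v w : 'rV[R]_n).
Implicit Types (xi eta : ideal_boundary M) (f g : M -> M).
Local Notation X := (borel_compactification M).
Hypothesis Msc : simply_connected M.
Hypothesis Mc : rcomplete M.
Hypothesis Mnc : no_conjugate_points M.
Hypothesis Mvis : visibility M.

(** The other boundary points are covered by open cones that avoid [xi]: around the direction of
    [eta], take as aperture the angle between [eta] and [xi], which the strict inequality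
    excludes. *)
Lemma ideal_point_measurable xi : measurable ([set inr xi] : set X).
Proof.
pose p : M := point; pose w := direction p (inr xi).
pose O := \bigcup_(ve in [set ve : 'rV[R]_n * R | [/\ tnorm p ve.1 = 1, 0 < ve.2 &
   ~ truncated_cone p ve.1 ve.2 1 (inr xi)]]) truncated_cone p ve.1 ve.2 1.
have w1 : tnorm p w = 1 by have [] := ray_inr Msc Mc Mnc Mvis p xi.
have -> : ([set inr xi] : set X) = ideal_points M `\` O; last first.
  apply: measurableD; first exact: ideal_measurable.
  by apply: borel_open; apply: bigcup_open => -[v e] [/= v1 e0 _]; exact: cone_open.
apply/seteqP; split => [_ ->|_ [[eta _ <-] nO]].
  by split; [exists xi|move=> [[v e] [/= _ _ H] /H]].
apply: contrapT => ne; apply: nO; set v := direction p (inr eta).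
have v1 : tnorm p v = 1 by have [] := ray_inr Msc Mc Mnc Mvis p eta.
have [/andP[t0 _] E] := tangle_unit w1 v1.
exists (v, tangle p w v); last first.
  split => //=; rewrite -/v (tangle_refl v1) lt_neqAle t0 andbT; apply/eqP => tE.
  apply: ne; congr inr; apply: (direction_inj Msc Mc Mnc Mvis (p := p)); apply/eqP; rewrite eq_sym -subr_eq0.
  apply: contraT => /(@tnorm_gt0 _ _ _ p); rewrite -/w -/v => h.
  by move: E; rewrite -tE cos0 mulr1 subrr => /eqP; rewrite sqrf_eq0 gt_eqF.
split => //=; last by move=> [/=]; rewrite ltxx.
rewrite lt_neqAle t0 andbT; apply/eqP => tE.
apply: ne; congr inr; apply: (direction_inj Msc Mc Mnc Mvis (p := p)); apply/eqP; rewrite eq_sym -subr_eq0.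
apply: contraT => /(@tnorm_gt0 _ _ _ p); rewrite -/w -/v => h.
by move: E; rewrite -tE cos0 mulr1 subrr => /eqP; rewrite sqrf_eq0 gt_eqF.
Qed.

Section radon_nikodym.
Variables (mu nu : {finite_measure set X -> \bar R}) (F : ideal_boundary M -> R).
Hypothesis dom : mu `<< nu.
Hypothesis RN : {ae nu, forall z : X, forall xi, z = inr xi ->
  Radon_Nikodym (charge_of_finite_measure mu) nu z = (F xi)%:E}.

(** The density is integrated over [A] minus the null set on which its formula may fail; removing
    that set leaves [nu A] unchanged. *)
Lemma density_ge (A : set X) b : measurable A -> A `<=` ideal_points M -> 0 <= b ->
  (forall xi, A (inr xi) -> b <= F xi) -> (b%:E * nu A <= mu A)%E.
Proof.
move=> mA Ai b0 Fb; have [N [mN N0 HN]] := RN.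
have mAN : measurable (A `\` N) by exact: measurableD.
have E : (nu A = nu (A `\` N))%E.
  apply/eqP; rewrite eq_le; apply/andP; split; last by apply: le_measure; rewrite ?inE//; exact: subDsetl.
  have -> : nu A = nu (A `\` N `|` A `&` N) by rewrite setUC setUIDK.
  have mI : measurable (A `&` N) by exact: measurableI.
  have I0 : nu (A `&` N) = 0%E by apply/eqP; rewrite -measure_le0 -N0; apply: le_measure; rewrite ?inE//; exact: subIsetr.
  have I0' : (nu (A `&` N) <= 0)%E by rewrite I0.
  apply: (@le_trans _ _ (nu (A `\` N) + nu (A `&` N))%E); first exact: measureU2.
  by rewrite I0 adde0.
apply: (@le_trans _ _ (mu (A `\` N))); last by apply: le_measure; rewrite ?inE//; exact: subDsetl.
have -> : mu (A `\` N) = charge_of_finite_measure mu (A `\` N) by [].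
rewrite (@Radon_Nikodym_integral _ _ _ (charge_of_finite_measure mu) nu (A `\` N) dom mAN) E.
rewrite -(integral_cst nu mAN).
have mRN := measurable_int nu (@Radon_Nikodym_integrable _ _ _ (charge_of_finite_measure mu) nu dom).
apply: ge0_le_integral => //.
  exact: measurable_funS mRN.
move=> z [Az Nz]; have [xi _ zE] := Ai _ Az; rewrite /cst /=.
have H : forall xi', z = inr xi' -> Radon_Nikodym (charge_of_finite_measure mu) nu z = (F xi')%:E.
  by apply: contrapT => h; apply: Nz; apply: HN.
by rewrite (H xi (esym zE)) lee_fin; apply: Fb; rewrite zE.
Qed.

(** A point of positive mass lies outside the exceptional null set, so at such a point the almost
    everywhere formula holds. *)
Lemma density_atom xi : (0 < nu [set inr xi])%E -> mu [set inr xi] = ((F xi)%:E * nu [set inr xi])%E.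
Proof.
move=> n0; have mA := ideal_point_measurable xi; have [N [mN N0 HN]] := RN.
have -> : mu [set inr xi] = charge_of_finite_measure mu [set inr xi] by [].
rewrite (@Radon_Nikodym_integral _ _ _ (charge_of_finite_measure mu) nu _ dom mA).
rewrite -(integral_cst nu mA); apply: eq_integral => z /set_mem ->; rewrite /cst.
suff H : forall xi', inr xi = inr xi' :> X -> Radon_Nikodym (charge_of_finite_measure mu) nu (inr xi) = (F xi')%:E by exact: H.
apply: contrapT => h; move: n0; rewrite ltNge => /negP; apply; rewrite -N0.
by apply: le_measure; rewrite ?inE// => _ ->; exact: HN.
Qed.

End radon_nikodym.

Import HBNNSimple.

(** [nu] is a bare set function, as [orbit_measure] is, so the definition of the integral is
    unfolded: the negative part contributes 0, and the simple function 1 bounds the positive part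
    from below. *)
Lemma integral_one (nu : set X -> \bar R) : nu set0 = 0%E -> (nu setT <= \int[nu]_z 1%:E)%E.
Proof.
move=> n0; rewrite /integral.
have -> : (fun _ : X => 1%:E : \bar R) \_ setT = fun _ : X => 1%:E by rewrite patch_setT.
rewrite [X in (_ - X)%E](_ : _ = 0%E); last first.
  rewrite (_ : [set _ | _ in _] = [set 0%E]) ?ereal_sup1//.
  have nul (h : {nnsfun X >-> R}) : (forall x : X, ((h x)%:E <= (fun _ : X => 1%:E : \bar R)^\- x)%E) -> sintegral nu h = 0%E.
    move=> H; apply: fsbig1 => y _; have [->|y0] := eqVneq y 0; first by rewrite mul0e.
    rewrite (_ : h @^-1` [set y] = set0) ?n0 ?mule0//; apply/seteqP; split => // z /= hz.
    have := H z; rewrite hz funenegE => hy; have h0 : 0 <= h z by [].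
    move: y0; rewrite -hz eq_le h0 andbT hz => /negP; apply.
    by move: hy; rewrite -EFinN -EFin_max lee_fin max_r.
  apply/seteqP; split => [_ [h H <-]|_ ->]; first exact: nul.
  have H0 (x : X) : ((nnsfun0 x : R)%:E <= (fun _ : X => 1%:E : \bar R)^\- x)%E by rewrite funeneg_ge0.
  by exists nnsfun0 => //; exact: nul.
rewrite sube0; apply: ereal_sup_ubound; exists (cst_nnsfun X 1%:nng).
  by move=> x /=; rewrite funeposE le_max lexx.
rewrite /sintegral -(@fsbig_widen _ _ _ _ [set 1 : R]) ?fsbig_set1//.
  rewrite mul1e; congr nu; apply/seteqP; by split.
move=> y [_ /= y1]; rewrite (_ : cst_nnsfun X 1%:nng @^-1` [set y] = set0) ?n0 ?mule0//.
by apply/seteqP; split => // z /= e; apply: y1.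
Qed.

End boundary_measures.

(** * Measures of shadows *)

Section conformal.
Context {R : realType} {n : nat} {M : riemannian_manifold R n}.
Implicit Types (a b s t r e d K D : R) (p x y z : M) (c : R -> M) (u v w : 'rV[R]_n).
Implicit Types (xi eta : ideal_boundary M) (f g : M -> M).
Local Notation X := (borel_compactification M).
Hypothesis Msc : simply_connected M.
Hypothesis Mc : rcomplete M.
Hypothesis Mnc : no_conjugate_points M.
Hypothesis Mvis : visibility M.
Variables (Gamma : set (M -> M)) (q : M) (delta : R) (mu : M -> {finite_measure set X -> \bar R}).
Hypothesis delta0 : 0 <= delta.
Hypothesis CD : conformal_density Gamma q delta mu.
Hypothesis DG : discrete_isometry_group Gamma.

Lemma group_pair f : Gamma f -> exists2 g, Gamma g & iso_pair f g.
Proof.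
move=> Gf; have [iso _ _ inv _] := DG; have [g Gg [fg gf]] := inv f Gf.
by exists g => //; split => //; apply: isometry_local; exact: iso.
Qed.

(** On the shadow the ray from [x] is in the ball at a time [t > d(x, p) - r], so
    [beta_xi(p, x) <= r - t <= 2 r - d(x, p)], which bounds the density from below. *)
Lemma shadow_measure_le p x r :
  ((expR (- delta * (2 * r - rdist x p)))%:E * mu x (shadow x (rball p r)) <= mu p (shadow x (rball p r)))%E.
Proof.
have [_ _ H _] := CD; have [dom RN] := H p x.
apply: (density_ge dom RN); [exact: shadow_measurable|exact: shadow_ideal|exact: expR_ge0|].
move=> xi /(shadowP Msc Mc Mnc Mvis)[t t0 tr].
rewrite ler_expR !mulNr lerN2 ler_wpM2l//.
apply: le_trans (busemann_le Msc Mc Mnc Mvis xi p x t) _.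
have [G c0 _] := ray_data Msc Mc Mnc Mvis x xi.
have := geodesic_rdist Msc Mc Mnc 0 t G; rewrite c0 subr0 gtr0_norm// => E.
have := rdist_triangle Msc x (ray x (inr xi) t) p; rewrite E (rdist_sym (ray x (inr xi) t) p).
by lra.
Qed.

(** Here the densities are exchanged, and [beta_xi(x, p) <= d(x, p)], the bound of the Busemann
    limit by its value at time 0, is enough. *)
Lemma shadow_measure_ge p x r :
  ((expR (- delta * rdist x p))%:E * mu p (shadow x (rball p r)) <= mu x (shadow x (rball p r)))%E.
Proof.
have [_ _ H _] := CD; have [dom RN] := H x p.
apply: (density_ge dom RN); [exact: shadow_measurable|exact: shadow_ideal|exact: expR_ge0|].
move=> xi _; rewrite ler_expR !mulNr lerN2 ler_wpM2l//.
have := busemann_le Msc Mc Mnc Mvis xi x p 0.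
by have [_ -> _] := ray_data Msc Mc Mnc Mvis p xi; rewrite subr0.
Qed.

Lemma shadow_translate p f g r : Gamma f -> iso_pair f g ->
  mu p (shadow p (rball (f p) r)) = mu (g p) (shadow (g p) (rball p r)).
Proof.
move=> Gf I; have [_ _ _ H] := CD; have [_ _ _ gf] := I.
rewrite -(H (g p) f _ Gf); [|exact: shadow_measurable|exact: shadow_ideal].
by rewrite (translate_shadow Msc Mc Mnc Mvis (g p) p r I) gf.
Qed.

Lemma shadow_mono x p r r' : r <= r' -> shadow x (rball p r) `<=` shadow x (rball p r').
Proof.
move=> rr y [z [xi [zr zx S yE]]]; exists z, xi; split => //.
exact: lt_le_trans zr rr.
Qed.

Lemma exp2_le (k l : nat) : (k <= l)%N -> 2^-1 ^+ l <= 2^-1 ^+ k :> R.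
Proof.
move=> kl; have h0 : 0 <= 2^-1 :> R by rewrite invr_ge0.
have h1 : 2^-1 <= 1 :> R by rewrite invf_le1// ler1n.
exact: ler_wiXn2l.
Qed.

Lemma null_small (m : {finite_measure set X -> \bar R}) (A : set X) : measurable A ->
  (forall k : nat, (m A <= (2^-1 ^+ k)%:E)%E) -> m A = 0%E.
Proof.
move=> mA H; have fA : m A \is a fin_num by exact: fin_num_measure.
apply/eqP; rewrite -measure_le0 leNgt; apply/negP => h.
have h' : 0 < fine (m A) by apply: fine_gt0; rewrite h ltey_eq fA.
have [k] := half_pow_small 1 h'; rewrite mul1r ltNge => /negP; apply.
by rewrite -lee_fin fineK.
Qed.

(* If shadows of large balls around [p] can have small measure, the complements of
   the shadows are small caps carrying almost all the mass; their centres converge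
   and the mass concentrates at one point. *)
Lemma shadow_dichotomy p : (0 < mu p setT)%E ->
  (exists2 r, 0 < r & exists2 a, 0 < a & forall x, (a%:E <= mu p (shadow x (rball p r)))%E) \/
  exists xi, (mu p).-negligible (~` [set inr xi]).
Proof.
move=> mass; set P := (X in X \/ _); have [hP|nP] := pselect P; [by left|right].
have i2 : 0 < 2^-1 :> R by rewrite invr_gt0.
have bad (k : nat) : exists xr : M * R, (mu p (shadow xr.1 (rball p xr.2)) < (2^-1 ^+ k)%:E)%E /\
    forall xi, ~ shadow xr.1 (rball p xr.2) (inr xi) ->
      tnorm p (direction p (inr xi) - direction p (inl xr.1)) <= 2^-1 ^+ k.
  have ek : 0 < 2^-1 ^+ k :> R by exact: exprn_gt0.
  have [r r0 Hr] := shadow_far Msc Mc Mnc Mvis p ek.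
  apply: contrapT => nx; apply: nP; exists r => //; exists (2^-1 ^+ k) => // x.
  rewrite leNgt; apply/negP => h; apply: nx; exists (x, r); split => //= xi; exact: Hr.
have [xr Hxr] := choice bad.
pose S k : set X := shadow (xr k).1 (rball p (xr k).2).
pose w k := direction p (inl (xr k).1).
have mS k : measurable (S k) by exact: shadow_measurable.
have Sk k : (mu p (S k) <= (2^-1 ^+ k)%:E)%E by exact: ltW (Hxr k).1.
have fT : mu p setT \is a fin_num by exact: fin_num_measure.
have m0 : 0 < fine (mu p setT) by apply: fine_gt0; rewrite mass ltey_eq fT.
(* From index [K] on, two of the shadows cannot exhaust the mass. Their complements therefore share
   a boundary point, which is close to both centres [w k] and [w l]. *)
have [K HK] := half_pow_small 2 m0.
have ideal0 : mu p (~` ideal_points M) = 0%E by have [-> _] := CD.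
have mI : measurable (~` ideal_points M : set X) by apply: measurableC; exact: ideal_measurable.
have close k l : (K <= k)%N -> (K <= l)%N -> tnorm p (w k - w l) <= 2^-1 ^+ k + 2^-1 ^+ l.
  move=> Kk Kl; have [xi [nk nl]] : exists xi, ~ S k (inr xi) /\ ~ S l (inr xi).
    apply: contrapT => nx; have cov : setT `<=` (S k `|` S l) `|` ~` ideal_points M.
      move=> z _; have [[xi _ <-]|nz] := pselect (ideal_points M z); last by right.
      by left; apply: contrapT => /not_orP[h1 h2]; apply: nx; exists xi.
    have h : (mu p setT <= (2^-1 ^+ k)%:E + (2^-1 ^+ l)%:E)%E.
      apply: (@le_trans _ _ (mu p ((S k `|` S l) `|` ~` ideal_points M))).
        by apply: le_measure; rewrite ?inE//; apply: measurableU => //; exact: measurableU.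
      apply: (@le_trans _ _ (mu p (S k `|` S l) + mu p (~` ideal_points M))%E).
        by apply: measureU2 => //; exact: measurableU.
      rewrite ideal0 adde0; apply: (@le_trans _ _ (mu p (S k) + mu p (S l))%E); first exact: measureU2.
      exact: leeD (Sk k) (Sk l).
    move: h; rewrite -(fineK fT) -EFinD lee_fin.
    have := exp2_le Kk; have := exp2_le Kl; lra.
  have [_ Hk] := Hxr k; have [_ Hl] := Hxr l.
  apply: le_trans (chord_triangle p (direction p (inr xi)) _ _) _.
  by rewrite chordC lerD; [|exact: Hk|exact: Hl].
have [C C0 HC] := tnorm_norm p.
have p0 (k : nat) : 0 < 2^-1 ^+ k :> R by exact: exprn_gt0.
have C20 : 0 <= 2 * C by rewrite mulr_ge0// ltW.
have step k : `|w (K + k.+1)%N - w (K + k)%N| <= 2 * C * 2^-1 ^+ k.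
  apply: le_trans (HC _) _; rewrite (mulrC 2) -mulrA ler_pM2l//.
  apply: le_trans (close _ _ (leq_addr _ _) (leq_addr _ _)) _.
  have h1 := @exp2_le k (K + k.+1) (leq_trans (leqnSn k) (leq_addl _ _)).
  have h2 := @exp2_le k (K + k) (leq_addl _ _).
  have -> : 2 * 2^-1 ^+ k = 2^-1 ^+ k + 2^-1 ^+ k :> R by ring.
  exact: lerD h1 h2.
have [l Hl] := geo_cvg (u := fun k => w (K + k)%N) C20 step.
(* A boundary point outside infinitely many of the shadows is close to their centres, hence has
   direction [l]. *)
have eventually_in xi : direction p (inr xi) <> l -> exists j, forall k, S (K + (j + k))%N (inr xi).
  move=> /eqP; rewrite -subr_eq0 -normr_gt0 => dl.
  have [j Hj] := half_pow_small (5 * C) dl; exists j => k; apply: contrapT => nS.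
  have h1 := HC (direction p (inr xi) - w (K + (j + k))%N).
  have h2 := (Hxr (K + (j + k))%N).2 xi nS; rewrite -/(w _) in h2.
  have h3 := Hl (j + k)%N; have h4 := @exp2_le j (j + k) (leq_addr _ _).
  have h5 := @exp2_le j (K + (j + k)) (leq_trans (leq_addr k j) (leq_addl K _)).
  have h6 : `|direction p (inr xi) - l| <= `|direction p (inr xi) - w (K + (j + k))%N| + `|w (K + (j + k))%N - l|.
    by rewrite -(subrKA (w (K + (j + k))%N)) ler_normD.
  have h7 := ler_wpM2l (ltW C0) (le_trans h2 h5).
  have h8 := ler_wpM2l (mulr_ge0 (ler0n _ 2) C20) h4.
  move: Hj; rewrite ltNge => /negP; apply.
  apply: le_trans h6 _; apply: le_trans (lerD (le_trans h1 h7) (le_trans h3 h8)) _.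
  by rewrite le_eqVlt; apply/orP; left; apply/eqP; ring.
(* The points lying in all shadows from index [K + j] on; the measures of these shadows tend to
   0. *)
pose N j : set X := \bigcap_k S (K + (j + k))%N.
have negN j : (mu p).-negligible (N j).
  have mN : measurable (N j) by apply: bigcapT_measurable => k; exact: mS.
  apply/negligibleP => //; apply: null_small => // k.
  apply: (@le_trans _ _ (mu p (S (K + (j + k))%N))).
    by apply: le_measure; rewrite ?inE// => z; apply.
  apply: le_trans (Sk _) _; rewrite lee_fin; apply: exp2_le.
  by rewrite addnA leq_addl.
pose Z : set X := ~` ideal_points M `|` \bigcup_j N j.
have negZ : (mu p).-negligible Z.
  by apply: negligibleU; [exact/negligibleP|exact: negligible_bigcup].
have in_Z xi : direction p (inr xi) <> l -> Z (inr xi).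
  by move=> /eventually_in[j Hj]; right; exists j => // k _; exact: Hj.
(* [Z] is null and the mass is positive, so some boundary point escapes [Z]. Its direction has to be
   [l], and directions determine boundary points. *)
have [xi0 nZ] : exists xi, ~ Z (inr xi).
  apply: contrapT => nx; have [A [mA A0 ZA]] := negZ.
  move: mass; rewrite ltNge => /negP; apply; rewrite -A0; apply: le_measure; rewrite ?inE//.
  move=> z _; apply: ZA; have [[xi _ <-]|nz] := pselect (ideal_points M z); last by left.
  by apply: contrapT => h; apply: nx; exists xi.
exists xi0; apply: negligibleS negZ => z zxi; have [[xi _ zE]|nz] := pselect (ideal_points M z); last by left.
rewrite -zE in zxi *; apply: (in_Z xi) => dxi; apply: nZ; apply: contrapT => nZ0.
have d0 : direction p (inr xi0) = l by apply: contrapT => /in_Z.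
by apply: zxi; rewrite /=; congr inr; apply: (direction_inj Msc Mc Mnc Mvis (p := p)); rewrite dxi d0.
Qed.

End conformal.

(** * The Patterson-Sullivan measure *)

Section sums.
Context {R : realType} {T : choiceType}.
Implicit Types (A B F : set T) (t : T -> R) (phi : T -> T).

Lemma esum_ge1 A t x : (forall y, 0 <= t y) -> A x -> ((t x)%:E <= \esum_(y in A) (t y)%:E)%E.
Proof.
move=> t0 Ax; apply: esum_ge; exists [set x]; last by rewrite fsbig_set1.
by split => // y ->.
Qed.

Lemma esum_subset A B t : (forall y, 0 <= t y) -> A `<=` B ->
  (\esum_(y in A) (t y)%:E <= \esum_(y in B) (t y)%:E)%E.
Proof.
move=> t0 AB; rewrite (esumID A B) => [|y _]; last by rewrite lee_fin.
rewrite (_ : B `&` A = A); last by apply/seteqP; split => [y []|y Ay] //; split => //; exact: AB.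
by rewrite leeDl// esum_ge0// => y _; rewrite lee_fin.
Qed.

(* The two disjoint copies of [F] inside [F] carry at least [2 * th] times the sum. *)
Lemma two_copies F t phi1 phi2 th x0 : (forall x, 0 <= t x) -> set_inj F phi1 -> set_inj F phi2 ->
  (forall x, F x -> F (phi1 x)) -> (forall x, F x -> F (phi2 x)) ->
  (forall x y, F x -> F y -> phi1 x <> phi2 y) ->
  (forall x, th * t x <= t (phi1 x)) -> (forall x, th * t x <= t (phi2 x)) -> 1 < 2 * th ->
  F x0 -> 0 < t x0 -> (\esum_(y in F) (t y)%:E < +oo)%E -> False.
Proof.
move=> t0 i1 i2 F1 F2 dis h1 h2 th1 Fx0 tx0 fin.
have t0' y : (0 <= (t y)%:E)%E by rewrite lee_fin.
set S := (\esum_(y in F) (t y)%:E)%E in fin.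
pose u x := (2 * th - 1) * t x; have u0 x : 0 <= u x by rewrite mulr_ge0// subr_ge0 ltW.
have K : (S + \esum_(y in F) (u y)%:E <= S)%E.
  apply: (@le_trans _ _ (\esum_(y in phi1 @` F) (t y)%:E + \esum_(y in phi2 @` F) (t y)%:E)%E).
    rewrite !esum_image//; rewrite -!esumD//; last by move=> y _; rewrite lee_fin.
    by apply: le_esum => y Fy; rewrite -!EFinD lee_fin /u; have := h1 y; have := h2 y; lra.
  rewrite [leRHS](esumID (phi1 @` F)) => [|y _]; last by rewrite lee_fin.
  apply: leeD; apply: esum_subset => // y [x Fx <-].
    by split; [exact: F1|exists x].
  by split; [exact: F2|move=> [z Fz]; exact: dis].
have fS : S \is a fin_num by rewrite ge0_fin_numE// esum_ge0.
have : ((u x0)%:E <= 0)%E.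
  apply: le_trans (esum_ge1 u0 Fx0) _.
  by rewrite -(leeD2lE _ _ fS) adde0.
by rewrite lee_fin leNgt mulr_gt0// subr_gt0.
Qed.

End sums.

(** * Positivity of the total mass *)

Section patterson_measure.
Context {R : realType} {n : nat} {M : riemannian_manifold R n}.
Implicit Types (a b s t r e d K D : R) (p x y z : M) (c : R -> M) (u v w : 'rV[R]_n).
Implicit Types (xi eta : ideal_boundary M) (f g : M -> M).
Local Notation X := (borel_compactification M).
Variables (Gamma : set (M -> M)) (q : M) (h : R -> R) (mu : M -> {finite_measure set X -> \bar R}).
Local Notation delta := (fine (critical_exponent Gamma q q)).

Lemma critical_exponent_ge0 : (0 <= critical_exponent Gamma q q)%E.
Proof. by apply: le_ereal_inf_tmp => _ [s [s0 _] <-]; rewrite lee_fin. Qed.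

Hypothesis fin : (critical_exponent Gamma q q < +oo)%E.

Lemma critical_exponentE : critical_exponent Gamma q q = delta%:E.
Proof. by rewrite fineK// ge0_fin_numE// critical_exponent_ge0. Qed.

Lemma weighted_poincare_lt (k : R -> R) s x y : (forall t, 0 <= t -> 0 <= k t) ->
  (weighted_exponent k Gamma x y < s%:E)%E -> (weighted_poincare k Gamma s x y < +oo)%E.
Proof.
move=> k0 /ereal_inf_lt[_ [s0 [_ fin0] <-]]; rewrite lte_fin => ss; apply: le_lt_trans fin0.
apply: le_esum => f _; rewrite lee_fin ler_wpM2l ?k0 ?rdist_ge0// ler_expR !mulNr lerN2.
by rewrite ler_wpM2r ?rdist_ge0// ltW.
Qed.

Hypothesis Ph : patterson_function Gamma q h.
Hypothesis PS : patterson_sullivan Gamma q h mu.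

(** If the series vanished at one [s], every term would, so [h] would vanish at all orbit distances
    and the series would be 0 at the critical exponent, where it diverges. *)
Lemma weighted_poincare_gt0 s : (0 < weighted_poincare h Gamma s q q)%E.
Proof.
have [h0 _ _ hd _] := Ph; have [_ D] := hd q q.
have t0 s' f : 0 <= h (rdist q (f q)) * expR (- s' * rdist q (f q)).
  by rewrite mulr_ge0 ?expR_ge0// h0 ?rdist_ge0.
rewrite lt_neqAle eq_sym esum_ge0 ?andbT; last by move=> f _; rewrite lee_fin.
apply/eqP => E; move: D; rewrite /weighted_poincare esum1// => f Gf.
have := @esum_ge1 R _ Gamma _ f (t0 s) Gf; rewrite -/(weighted_poincare h Gamma s q q) E lee_fin => le0.
have : h (rdist q (f q)) * expR (- s * rdist q (f q)) == 0 by rewrite eq_le le0 t0.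
by rewrite mulf_eq0 [X in _ || X]gt_eqF ?expR_gt0// orbF => /eqP ->; rewrite mul0r.
Qed.

Lemma orbit_measure_total s : delta < s -> orbit_measure h Gamma s q q setT = 1%E.
Proof.
move=> ds; have [h0 _ _ hd _] := Ph; have [D _] := hd q q.
have P1 : (weighted_poincare h Gamma s q q < +oo)%E.
  by apply: weighted_poincare_lt => //; rewrite D critical_exponentE lte_fin.
have P0 := weighted_poincare_gt0 s.
rewrite /orbit_measure (_ : (\esum_(f in Gamma) _)%E = weighted_poincare h Gamma s q q); last first.
  by apply: eq_esum => f _; rewrite diracT mule1.
have fP : weighted_poincare h Gamma s q q \is a fin_num by rewrite ge0_fin_numE// ltW.
rewrite -[X in (_ * X)%E](fineK fP) -EFinM mulVf// gt_eqF// fine_gt0// P0 P1//.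
Qed.

Lemma orbit_measure0 s : orbit_measure h Gamma s q q set0 = 0%E.
Proof. by rewrite /orbit_measure esum1 ?mule0// => f _; rewrite dirac0 mule0. Qed.

(** The measures seen from [q] itself are normalised to total mass 1; testing the weak limit on the
    constant 1 gives [mu q] mass at least 1. *)
Lemma patterson_mass : (0 < mu q setT)%E.
Proof.
have [_ [s [_ ds _ lim_s]]] := PS.
have C := lim_s q (fun=> 1) (@cst_continuous _ _ _).
apply: (@lt_le_trans _ _ 1%E) => //.
have -> : mu q setT = (\int[mu q]_z 1%:E)%E by rewrite (integral_cst (mu q) measurableT 1%:E) mul1e.
rewrite -(cvg_lim _ C)//; apply: lime_ge; first by apply/cvg_ex; exists (\int[mu q]_z 1%:E)%E.
apply: filterE => k; have := integral_one (orbit_measure0 (s k)).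
by rewrite (orbit_measure_total (ds k)).
Qed.

Lemma conformal_mass p : (0 < mu p setT)%E.
Proof.
have [[_ _ H _] _] := PS; have [dom _] := H q p.
rewrite lt_neqAle measure_ge0 andbT; apply/eqP => E.
have N : (mu p).-null_set setT by apply/measure0_null_setP.
by have := patterson_mass; rewrite (dom _ N setT)// ltxx.
Qed.

End patterson_measure.

(** * No point of the boundary carries all the mass; the shadow lemma *)

Section shadow_lemma.
Context {R : realType} {n : nat} {M : riemannian_manifold R n}.
Implicit Types (a b s t r e d K D : R) (p x y z : M) (c : R -> M) (u v w : 'rV[R]_n).
Implicit Types (xi eta : ideal_boundary M) (f g : M -> M).
Local Notation X := (borel_compactification M).
Hypothesis Msc : simply_connected M.
Hypothesis Mc : rcomplete M.
Hypothesis Mnc : no_conjugate_points M.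
Hypothesis Mvis : visibility M.
Variables (Gamma : set (M -> M)) (q : M) (mu : M -> {finite_measure set X -> \bar R}).
Local Notation delta := (fine (critical_exponent Gamma q q)).
Hypothesis fin : (critical_exponent Gamma q q < +oo)%E.
Hypothesis DG : discrete_isometry_group Gamma.
Hypothesis NE : non_elementary Gamma q.

Lemma half_min3 a b d : 0 < a -> 0 < b -> 0 < d ->
  exists2 e, 0 < e & [/\ 2 * e <= a, 2 * e <= b & 2 * e <= d].
Proof.
move=> a0 b0 d0; exists (Num.min a (Num.min b d) / 2); first by rewrite divr_gt0// !lt_min a0 b0.
by rewrite mulrCA mulfV// mulr1; split; rewrite !ge_min lexx ?orbT.
Qed.

Definition fixes f xi := exists2 c, sval xi c & sval xi (f \o c).

Lemma fixed_point_exponent xi : (forall f, Gamma f -> fixes f xi) -> 0 < delta.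
Proof.
move=> fixed.
have le2 (e z : R) : 0 < e -> 2 * e <= z -> e <= z by lra.
have ar (e A B C : R) : A < e -> 2 * e <= B -> B <= A + C -> e <= C by lra.
have ar2 (e A B C : R) : A < e -> B < e -> 2 * e <= C -> C <= A + B -> False by lra.
have ar3 (x y : R) : x < 2^-1 -> 1 - x <= y -> 1 < 2 * y by lra.
have ar4 (x : R) : 0 <= x -> x < 2^-1 * (2 * (x + 1)) by lra.
rewrite lt_neqAle fine_ge0 ?critical_exponent_ge0// andbT; apply/eqP => d0.
have [eta1 [eta2 [L1 L2 n1 n2 n12]]] := limit_set_two xi NE.
pose w0 := direction q (inr xi); pose w1 := direction q (inr eta1); pose w2 := direction q (inr eta2).
have inj eta eta' : eta <> eta' -> 0 < tnorm q (direction q (inr eta) - direction q (inr eta')).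
  by move=> ne; apply: chord_gt0; apply/eqP => /(direction_inj Msc Mc Mnc Mvis).
have c1 : 0 < tnorm q (w1 - w0) := inj _ _ n1; have c2 : 0 < tnorm q (w2 - w0) := inj _ _ n2.
have c12 : 0 < tnorm q (w1 - w2) := inj _ _ n12.
(* With [e] at most half of each mutual distance, the chord balls of radius [e] about [w1] and [w2]
   are disjoint, and points in them are at distance at least [e] from [w0]. *)
have [e e0 [e1 e2 e12]] := half_min3 c1 c2 c12.
have [D1 H1] := @pingpong _ _ _ Msc Mc Mnc Mvis q xi w1 e e e0 e0 (le2 _ _ e0 e1).
have [D2 H2] := @pingpong _ _ _ Msc Mc Mnc Mvis q xi w2 e e e0 e0 (le2 _ _ e0 e2).
have eh : 0 < e / 2 by rewrite divr_gt0.
have [a Ga [a1 a2]] := limit_set_near Msc Mc Mnc Mvis D1 L1 eh.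
have [b Gb [b1 b2]] := limit_set_near Msc Mc Mnc Mvis D2 L2 eh.
have [a' _ Ia] := group_pair DG Ga; have [b' _ Ib] := group_pair DG Gb.
have Ha := H1 _ _ Ia (fixed _ Ga) a1 a2; have Hb := H2 _ _ Ib (fixed _ Gb) b1 b2.
pose F := [set f | Gamma f /\ (f q = q \/ e <= tnorm q (direction q (inl (f q)) - w0))].
have [_ Gid Gcomp _ _] := DG.
have Fa f : F f -> F (a \o f).
  move=> [Gf Hf]; split; first exact: Gcomp.
  right; have h1 := Ha _ Hf; have h2 := chord_triangle q (direction q (inl (a (f q)))) w1 w0.
  by rewrite chordC in h1; exact: ar h1 e1 h2.
have Fb f : F f -> F (b \o f).
  move=> [Gf Hf]; split; first exact: Gcomp.
  right; have h1 := Hb _ Hf; have h2 := chord_triangle q (direction q (inl (b (f q)))) w2 w0.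
  by rewrite chordC in h1; exact: ar h1 e2 h2.
pose L := Num.max (rdist q (a q)) (rdist q (b q)).
have L0 : 0 <= L by rewrite le_max rdist_ge0.
(* With this [s], [s L < 1/2]. Composition with [a] or [b] lengthens orbit distances by at most [L],
   so each copy of the series keeps at least the fraction [e^(- s L) >= 1 - s L > 1/2]. *)
pose s := (2 * (L + 1))^-1; have s0 : 0 < s by rewrite invr_gt0 mulr_gt0// ltr_wpDl.
have sL : s * L < 2^-1.
  by rewrite /s mulrC ltr_pdivrMr ?mulr_gt0 ?ltr_wpDl//; exact: ar4.
pose t f := expR (- s * rdist q (f q)).
have t0 f : 0 <= t f by exact: expR_ge0.
have shrink k k' f : iso_pair k k' -> rdist q (k q) <= L -> expR (- s * L) * t f <= t (k \o f).
  move=> I kL; rewrite -expRD ler_expR -mulrDr !mulNr lerN2 ler_pM2l//.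
  apply: le_trans (rdist_triangle Msc q (k q) (k (f q))) _.
  by rewrite (rdist_isom Msc _ _ I) lerD2r.
have inj_iso k k' : iso_pair k k' -> set_inj F (fun f => k \o f).
  move=> [_ _ kk' _] f f' _ _ E; apply/funext => z; apply: (can_inj kk').
  exact: (congr1 (@^~ z) E).
have fin_sum : (\esum_(f in F) (t f)%:E < +oo)%E.
  apply: (@le_lt_trans _ _ (\esum_(f in Gamma) (t f)%:E)%E); first by apply: esum_subset => // f [].
  rewrite (_ : (\esum_(f in Gamma) _)%E = weighted_poincare (fun=> 1) Gamma s q q).
    apply: weighted_poincare_lt => //.
    by have := critical_exponentE fin; rewrite -d0 /critical_exponent => ->; rewrite lte_fin.
  by apply: eq_esum => f _; rewrite mul1r.
have dis f f' : F f -> F f' -> a \o f <> b \o f'.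
  move=> [_ Hf] [_ Hf'] E; have h1 := Ha _ Hf; have h2 := Hb _ Hf'.
  have E' : a (f q) = b (f' q) := congr1 (@^~ q) E.
  rewrite E' chordC in h1; have h3 := chord_triangle q (direction q (inl (b (f' q)))) w1 w2.
  exact: ar2 h1 h2 e12 h3.
have Sa f : expR (- s * L) * t f <= t (a \o f) by apply: shrink Ia _; rewrite le_max lexx.
have Sb f : expR (- s * L) * t f <= t (b \o f) by apply: shrink Ib _; rewrite le_max lexx orbT.
have th : 1 < 2 * expR (- s * L) by apply: (ar3 _ _ sL); have := expR_ge1Dx (- s * L); rewrite mulNr.
have Fid : F idfun by split; [exact: Gid|left].
exact: (two_copies t0 (inj_iso _ _ Ia) (inj_iso _ _ Ib) Fa Fb dis Sa Sb th Fid (expR_gt0 _) fin_sum).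
Qed.

Hypothesis CD : conformal_density Gamma q delta mu.
Hypothesis mass : forall x, (0 < mu x setT)%E.

Lemma conformal_null p x (A : set X) : (mu p).-negligible A -> (mu x).-negligible A.
Proof.
move=> [B [mB B0 AB]]; exists B; split => //; have [_ _ H _] := CD; have [dom _] := H x p.
by apply: (dom B _ B) => //; exact/measure0_null_setP.
Qed.

Section atom.
Variables (p : M) (xi : ideal_boundary M).
Hypothesis conc : (mu p).-negligible (~` [set inr xi]).

Let msing eta : measurable ([set inr eta] : set X).
Proof. exact: ideal_point_measurable. Qed.

Let off_atom x : mu x (~` [set inr xi]) = 0%E.
Proof. by apply/negligibleP; [exact: measurableC|exact: conformal_null conc]. Qed.

Lemma atom_gt0 x : (0 < mu x [set inr xi])%E.
Proof.
apply: lt_le_trans (mass x) _; rewrite -(setUv [set inr xi]).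
apply: (@le_trans _ _ (mu x [set inr xi] + mu x (~` [set inr xi]))%E); last by rewrite off_atom adde0.
by apply: measureU2 => //; exact: measurableC.
Qed.

Let translate_point f eta : (forall c, sval xi c -> sval eta (f \o c)) ->
  translate f [set inr xi] = [set inr eta].
Proof.
move=> H; have [c0 S0] := ideal_inhabited Msc Mc Mnc xi.
apply/seteqP; split => [[y|eta'] [_ -> // [c S S']] | _ ->] /=.
  by congr inr; exact: ideal_eq Msc _ _ _ S' (H _ S).
by exists (inr xi) => //; exists c0 => //; exact: H.
Qed.

(** Equivariance carries the atom at [xi] to a point of positive mass for [mu (f p)]; but all these
    measures have the same null sets, hence are concentrated at [xi]. *)
Lemma atom_fixed f : Gamma f -> fixes f xi.
Proof.
move=> Gf; have [g _ I] := group_pair DG Gf; have [eta H] := ideal_isom Msc Mc Mnc xi I.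
have [c0 S0] := ideal_inhabited Msc Mc Mnc xi; exists c0 => //.
suff <- : eta = xi by exact: H.
apply: contrapT => ne; have [_ _ _ K] := CD.
have := atom_gt0 p; rewrite -(K p f _ Gf (msing xi)); last by move=> _ ->; exists xi.
rewrite (translate_point H).
rewrite ltNge => /negP; apply; rewrite -(off_atom (f p)); apply: le_measure; rewrite ?inE//.
  exact: measurableC.
by move=> _ -> [E]; apply: ne.
Qed.

(** By equivariance [mu (f q)] and [mu q] give [xi] the same positive mass, while the density at the
    atom relates the two by the factor [e^(- delta beta_xi(q, f q))]. *)
Lemma atom_busemann f : Gamma f -> delta * busemann xi q (f q) = 0.
Proof.
move=> Gf; have [c S S'] := atom_fixed Gf; have [_ _ H K] := CD.
have [g _ I] := group_pair DG Gf.
have Hf c' : sval xi c' -> sval xi (f \o c') by exact: ideal_isom_eq I S S'.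
have T : translate f [set inr xi] = [set inr xi] by exact: translate_point.
have E : mu (f q) [set inr xi] = mu q [set inr xi].
  by rewrite -{1}T (K q f _ Gf (msing xi))// => _ ->; exists xi.
have [dom RN] := H q (f q).
have := density_atom Msc Mc Mnc Mvis dom RN (atom_gt0 (f q)); rewrite E.
have fA : mu q [set inr xi] \is a fin_num by exact: fin_num_measure.
rewrite -(fineK fA) -EFinM => -[] Eq; have A0 : 0 < fine (mu q [set inr xi]).
  by apply: fine_gt0; rewrite atom_gt0 ltey_eq fA.
have : expR (- delta * busemann xi q (f q)) = 1.
  by apply: (mulIf (lt0r_neq0 A0)); rewrite mul1r -Eq.
by rewrite -expR0 => /expR_inj; rewrite mulNr => /eqP; rewrite oppr_eq0 => /eqP.
Qed.

Lemma no_atom : False.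
Proof.
have d0 := fixed_point_exponent atom_fixed.
have [eta [_ [L _ ne _ _]]] := limit_set_two xi NE.
pose e := tnorm q (direction q (inr eta) - direction q (inr xi)) / 2.
have e0 : 0 < e.
  by rewrite divr_gt0//; apply: chord_gt0; apply/eqP => /(direction_inj Msc Mc Mnc Mvis).
have [r r0 Hr] := busemann_pass Msc Mc Mnc Mvis q xi e0.
(* Beyond distance [2 r] the bound [2 r - d(q, f q)] of [busemann_pass] is negative, so the Busemann
   function cannot vanish. *)
have [f Gf [f1 f2]] := limit_set_near Msc Mc Mnc Mvis (2 * r) L e0.
have far : e < tnorm q (direction q (inl (f q)) - direction q (inr xi)).
  have ar (A B C : R) : A < B / 2 -> B <= A + C -> B / 2 < C by lra.
  have K := chord_triangle q (direction q (inl (f q))) (direction q (inr eta)) (direction q (inr xi)).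
  rewrite (chordC q (direction q (inr eta)) (direction q (inl (f q)))) in K.
  exact: ar f1 K.
have := Hr _ far; have /eqP := atom_busemann Gf; rewrite mulf_eq0 gt_eqF//= => /eqP ->.
by rewrite subr_gt0 ltNge (ltW f2).
Qed.

End atom.

End shadow_lemma.

Theorem theorem4p4 (R : realType) (n : nat) (M : riemannian_manifold R n)
    (Gamma : set (M -> M)) (q : M) (h : R -> R)
    (mu : M -> {finite_measure set (borel_compactification M) -> \bar R}) :
  rcomplete M -> simply_connected M -> no_conjugate_points M -> visibility M ->
  discrete_isometry_group Gamma -> non_elementary Gamma q ->
  (critical_exponent Gamma q q < +oo)%E ->
  patterson_function Gamma q h ->
  patterson_sullivan Gamma q h mu ->
  forall p : M, exists2 R0 : R, 0 < R0 &
    forall r : R, R0 <= r -> exists2 C : R, 1 < C &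
      forall alpha : M -> M, Gamma alpha ->
        C^-1 <= fine (mu p (shadow p (rball (alpha p) r))) /
                expR (- fine (critical_exponent Gamma q q) * rdist p (alpha p))
             <= C.
Proof.
move=> Mc Msc Mnc Mvis DG NE fin Ph PS p; set delta := fine _.
have delta0 : 0 <= delta by rewrite fine_ge0 ?critical_exponent_ge0.
have [CD _] := PS; have mass := conformal_mass fin Ph PS.
have [[R0 R00 [a a0 Ha]]|[xi neg]] := shadow_dichotomy Msc Mc Mnc Mvis CD (mass p); last first.
  by case: (no_atom Msc Mc Mnc Mvis fin DG NE CD mass neg).
(* Shadows grow with the radius, so the lower bound [a] found at [R0] persists for every
   [r >= R0]. *)
exists R0 => // r R0r.
(* [a^-1] serves the lower bound, [e^(2 delta r)] times the total mass the upper one, and the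
   summand 1 makes [C] exceed 1. *)
pose m := fine (mu p setT); pose C := a^-1 + expR (2 * delta * r) * m + 1.
have m0 : 0 <= m by exact: fine_ge0.
have fT : mu p setT \is a fin_num by exact: fin_num_measure.
have C1 : 0 <= expR (2 * delta * r) * m by rewrite mulr_ge0// expR_ge0.
have ai : 0 < a^-1 by rewrite invr_gt0.
have C1' : 1 < C by rewrite /C; lra.
exists C => // f Gf; have [g Gg I] := group_pair DG Gf; have [_ _ fg gf] := I.
rewrite (shadow_translate Msc Mc Mnc Mvis CD p r Gf I); set x := g p; set S := shadow x _.
have mS : measurable (S : set (borel_compactification M)) by exact: shadow_measurable.
have fS y : mu y S \is a fin_num by exact: fin_num_measure.
have dE : rdist p (f p) = rdist x p.
  by rewrite -(rdist_isom Msc x p I) /x gf.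
rewrite dE; set d := rdist x p; set E := expR _; have E0 : 0 < E by exact: expR_gt0.
have up := shadow_measure_le Msc Mc Mnc Mvis delta0 CD p x r; rewrite -/S -/d in up.
have low := shadow_measure_ge Msc Mc Mnc Mvis delta0 CD p x r; rewrite -/S -/d -/E in low.
have low' : a <= fine (mu p S).
  rewrite -lee_fin (fineK (fS p)); apply: le_trans (Ha x) _; apply: le_measure; rewrite ?inE//.
    exact: shadow_measurable.
  exact: shadow_mono.
have up' : fine (mu p S) <= m.
  by apply: fine_le => //; apply: le_measure; rewrite ?inE.
rewrite -(fineK (fS x)) -(fineK (fS p)) -EFinM lee_fin in up.
rewrite -(fineK (fS x)) -(fineK (fS p)) -EFinM lee_fin in low.
apply/andP; split.
  rewrite ler_pdivlMr//; apply: le_trans low; rewrite mulrC ler_pM2l//.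
  apply: le_trans low'; rewrite -[leRHS]invrK lef_pV2 ?posrE//; last by lra.
  by rewrite /C; lra.
rewrite ler_pdivrMr//.
have E2 : expR (- delta * (2 * r - d)) * expR (2 * delta * r) = E^-1.
  by rewrite -expRD /E -expRN; congr expR; ring.
have : fine (mu x S) * E^-1 <= m * expR (2 * delta * r).
  rewrite -E2 mulrA ler_pM2r ?expR_gt0// mulrC.
  exact: le_trans up up'.
rewrite ler_pdivrMr// => /le_trans; apply; rewrite ler_pM2r//.
by rewrite /C [m * _]mulrC; lra.
Qed.
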